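(* There is a nonempty open interval $(a_1,a_2)\subset(0,1)$ with the following property: for each $\lambda\in(a_1,a_2)$ there exist real numbers $\lambda_1,\lambda_2$ with $1<\lambda_1<\lambda_2$ and a rectangular torus $\mathbb{T}^2$ such that the map $$X(p)=\operatorname{Re}\int_{p_0}^{p}(\phi_1,\phi_2,\phi_3),$$ considered as a map into $\mathbb{T}^2\times\mathbb{R}$, is single-valued on $R$, where $R$ and $(\phi_1,\phi_2,\phi_3)$ are defined from $\lambda,\lambda_1,\lambda_2$ as in the context.
   Context: For real numbers $0<\lambda<1<\lambda_1<\lambda_2$ put $$g_1(z)=(z-\lambda)(z+1)(z-\lambda_1)(z+\lambda_2),\qquad g_2(z)=(z+\lambda)(z-1)(z+\lambda_1)(z-\lambda_2),$$ $$\alpha=\lambda+\lambda_1-\lambda_2-\lambda\lambda_1+\lambda\lambda_2+\lambda_1\lambda_2,\qquad a=\sqrt{\frac{\alpha-\sqrt{\alpha^2-4\lambda\lambda_1\lambda_2}}{2}}$$ (it is known that $\alpha^2-4\lambda\lambda_1\lambda_2>0$ and $\lambda<a<1$). Let $\overline{R}=\{(z,w)\in(\mathbb{C}\cup\{\infty\})^2 : g_2(z)w^2=g_1(z)\}$, a compact Riemann surface of genus $3$, and $$R=\overline{R}\setminus\{(a,i),(-a,i),(a,-i),(-a,-i)\},\qquad G=w,\qquad dh=\frac{dz}{z^2-a^2},$$ $$(\phi_1,\phi_2,\phi_3)=\left(\frac12\left(\frac1G-G\right)dh,\ \frac i2\left(\frac1G+G\right)dh,\ dh\right),$$ and let $p_0\in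 R$ be a base point. A rectangular torus is a quotient $\mathbb{T}^2=\mathbb{R}^2/\Lambda$ with $\Lambda$ a lattice generated by two orthogonal nonzero vectors; $\mathbb{T}^2\times\mathbb{R}$ is the quotient of $\mathbb{R}^3=\mathbb{R}^2\times\mathbb{R}$ by $\Lambda$ acting by translations on the first two coordinates. Single-valuedness means that the value of the integral modulo $\Lambda\times\{0\}$ does not depend on the path in $R$ from $p_0$ to $p$. *)

(* Defs.v *)
From Stdlib Require Import Reals ZArith.
From Coquelicot Require Import Coquelicot.

Open Scope R_scope.

Inductive sphere : Type :=
| Fin (z : C)
| Infty.

(* Coordinate z on the sphere minus Infty; the value at Infty is junk. *)
Definition affine (p : sphere) : C :=
  match p with Fin z => z | Infty => RtoC 0 end.

(* The involution z |-> 1/z, so that [affine (recip p)] is the coordinate 1/z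
   on the sphere minus Fin 0. *)
Definition recip (p : sphere) : sphere :=
  match p with
  | Fin z => match Ceq_dec z (RtoC 0) with
             | left _ => Infty
             | right _ => Fin (/ z)%C
             end
  | Infty => Fin (RtoC 0)
  end.

(* Below, l, l1, l2 stand for lambda, lambda_1, lambda_2. *)

Definition g1 (l l1 l2 : R) (z : C) : C :=
  ((z - l) * (z + 1) * (z - l1) * (z + l2))%C.

Definition g2 (l l1 l2 : R) (z : C) : C :=
  ((z + l) * (z - 1) * (z + l1) * (z - l2))%C.

Definition alpha (l l1 l2 : R) : R :=
  l + l1 - l2 - l * l1 + l * l2 + l1 * l2.

Definition a_end (l l1 l2 : R) : R :=
  sqrt ((alpha l l1 l2 - sqrt (alpha l l1 l2 ^ 2 - 4 * l * l1 * l2)) / 2).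

(* The equation g2(z) w^2 = g1(z) on the product of two spheres.  It has
   bidegree (4, 2); bihomogenizing and using that g1 and g2 are monic of
   degree 4, it reads w^2 = 1 at z = oo, g2(z) = 0 at w = oo, and it has no
   solution at (oo, oo). *)
Definition Rbar_surf (l l1 l2 : R) (p : sphere * sphere) : Prop :=
  match p with
  | (Fin z, Fin w) => (g2 l l1 l2 z * (w * w) = g1 l l1 l2 z)%C
  | (Fin z, Infty) => g2 l l1 l2 z = RtoC 0
  | (Infty, Fin w) => (w * w)%C = RtoC 1
  | (Infty, Infty) => False
  end.

Definition R_surf (l l1 l2 : R) (p : sphere * sphere) : Prop :=
  let a := RtoC (a_end l l1 l2) in
  Rbar_surf l l1 l2 p /\
  p <> (Fin a, Fin Ci) /\
  p <> (Fin (- a)%C, Fin Ci) /\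
  p <> (Fin a, Fin (- Ci)%C) /\
  p <> (Fin (- a)%C, Fin (- Ci)%C).

Definition C1_at (f : R -> C) (t : R) : Prop :=
  exists f' : R -> C,
    locally t (fun s => is_derive (V := C_R_NormedModule) f s (f' s)) /\
    continuous (U := C_UniformSpace) f' t.

Definition sphere_C1_at (f : R -> sphere) (t : R) : Prop :=
  (locally t (fun s => f s <> Infty) /\ C1_at (fun s => affine (f s)) t) \/
  (locally t (fun s => f s <> Fin (RtoC 0)) /\
   C1_at (fun s => affine (recip (f s))) t).

(* C^1 on the closed interval [s, t], in the sense of being there the
   restriction of a map that is C^1 on a neighbourhood of [s, t].  The surface
   is an embedded submanifold of the product of two spheres, so that for paths
   lying in it this is C^1 regularity with respect to its complex charts. *)
Definition C1_on (gamma : R -> sphere * sphere) (s t : R) : Prop :=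
  exists delta : R -> sphere * sphere,
    forall x, s <= x <= t ->
      delta x = gamma x /\
      sphere_C1_at (fun y => fst (delta y)) x /\
      sphere_C1_at (fun y => snd (delta y)) x.

Inductive piecewise_C1 (gamma : R -> sphere * sphere) : R -> R -> Prop :=
| pwC1_piece s t : s <= t -> C1_on gamma s t -> piecewise_C1 gamma s t
| pwC1_concat s t u : piecewise_C1 gamma s t -> piecewise_C1 gamma t u ->
    piecewise_C1 gamma s u.

Definition is_path (S : sphere * sphere -> Prop) (p q : sphere * sphere)
    (gamma : R -> sphere * sphere) : Prop :=
  piecewise_C1 gamma 0 1 /\
  (forall t, 0 <= t <= 1 -> S (gamma t)) /\
  gamma 0 = p /\ gamma 1 = q.

(* For a 1-form phi, [pb_phi gamma t] is phi evaluated at the tangent vector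
   gamma'(t), i.e. gamma^* phi = (pb_phi gamma t) dt. *)

Definition velocity (f : R -> C) (t : R) : C :=
  (Derive (fun s => fst (f s)) t, Derive (fun s => snd (f s)) t).

(* At z = oo one uses u = 1/z: dz / (z^2 - a^2) = - du / (1 - a^2 u^2), which
   is - du at u = 0. *)
Definition pb_dh (l l1 l2 : R) (gamma : R -> sphere * sphere) (t : R) : C :=
  let a := RtoC (a_end l l1 l2) in
  match fst (gamma t) with
  | Fin z => (velocity (fun s => affine (fst (gamma s))) t / (z * z - a * a))%C
  | Infty => (- velocity (fun s => affine (recip (fst (gamma s)))) t)%C
  end.

(* At w = oo (where z is a simple root of g2) one uses the local coordinate
   v = 1/w.  Differentiating g2(z) = g1(z) v^2 gives
   w dz = dz / v = 2 g1(z) / (g2'(z) - v^2 g1'(z)) dv,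
   which is 2 g1(z) / g2'(z) dv at v = 0. *)
Definition pb_Gdh (l l1 l2 : R) (gamma : R -> sphere * sphere) (t : R) : C :=
  let a := RtoC (a_end l l1 l2) in
  match gamma t with
  | (Fin z, Infty) =>
      (2 * g1 l l1 l2 z / C_derive (g2 l l1 l2) z
       * velocity (fun s => affine (recip (snd (gamma s)))) t
       / (z * z - a * a))%C
  | (_, w) => (affine w * pb_dh l l1 l2 gamma t)%C
  end.

(* At w = 0 (where z is a simple root of g1) w is a local coordinate, and
   g2(z) w^2 = g1(z) gives dz / w = 2 g2(z) / (g1'(z) - w^2 g2'(z)) dw,
   which is 2 g2(z) / g1'(z) dw at w = 0.  Elsewhere dh is multiplied by
   1/w = affine (recip w), which is 0 at w = oo. *)
Definition pb_dh_over_G (l l1 l2 : R) (gamma : R -> sphere * sphere) (t : R)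
    : C :=
  let a := RtoC (a_end l l1 l2) in
  match gamma t, recip (snd (gamma t)) with
  | (Fin z, _), Infty =>
      (2 * g2 l l1 l2 z / C_derive (g1 l l1 l2) z
       * velocity (fun s => affine (snd (gamma s))) t
       / (z * z - a * a))%C
  | _, v => (affine v * pb_dh l l1 l2 gamma t)%C
  end.

Definition pb_phi1 (l l1 l2 : R) (gamma : R -> sphere * sphere) (t : R) : C :=
  (/ 2 * (pb_dh_over_G l l1 l2 gamma t - pb_Gdh l l1 l2 gamma t))%C.

Definition pb_phi2 (l l1 l2 : R) (gamma : R -> sphere * sphere) (t : R) : C :=
  (Ci / 2 * (pb_dh_over_G l l1 l2 gamma t + pb_Gdh l l1 l2 gamma t))%C.

Definition pb_phi3 (l l1 l2 : R) (gamma : R -> sphere * sphere) (t : R) : C :=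
  pb_dh l l1 l2 gamma t.

Definition CRInt (f : R -> C) (s t : R) : C :=
  RInt (V := C_R_CompleteNormedModule) f s t.

(* The value of X obtained by integrating along gamma. *)
Definition X_along (l l1 l2 : R) (gamma : R -> sphere * sphere) : R * R * R :=
  (Re (CRInt (pb_phi1 l l1 l2 gamma) 0 1),
   Re (CRInt (pb_phi2 l l1 l2 gamma) 0 1),
   Re (CRInt (pb_phi3 l l1 l2 gamma) 0 1)).

Definition rectangular_lattice (Lambda : R * R -> Prop) : Prop :=
  exists u v : R * R,
    u <> (0, 0) /\ v <> (0, 0) /\
    fst u * fst v + snd u * snd v = 0 /\
    forall x : R * R,
      Lambda x <->
      exists m n : Z,
        x = (IZR m * fst u + IZR n * fst v, IZR m * snd u + IZR n * snd v).

(* Equality of the images in (R^2 / Lambda) x R. *)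
Definition eq_mod (Lambda : R * R -> Prop) (x y : R * R * R) : Prop :=
  let '(x1, x2, x3) := x in
  let '(y1, y2, y3) := y in
  Lambda (x1 - y1, x2 - y2) /\ x3 = y3.

Definition X_single_valued (l l1 l2 : R) (Lambda : R * R -> Prop)
    (p0 : sphere * sphere) : Prop :=
  forall (p : sphere * sphere) (gamma delta : R -> sphere * sphere),
    R_surf l l1 l2 p ->
    is_path (R_surf l l1 l2) p0 p gamma ->
    is_path (R_surf l l1 l2) p0 p delta ->
    eq_mod Lambda (X_along l l1 l2 gamma) (X_along l l1 l2 delta).

(* Main.v *)
(* Put u = (z^2 + a^2) / (z^2 - a^2) and V = 2 a z / (z^2 - a^2), so that V^2 = u^2 - 1.  A
   rescaling Y of g2(z) w / (z^2 - a^2)^2 satisfies Y^2 = - Q4(u), where Q4 is the monic quartic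
   with roots p0 < -1 < 1 < p1 < p2 < p3, the images of lambda, lambda_2, lambda_1 and 1.  The choice
   of a makes phi_1 = mu1 (u - c) du / Y and phi_2 = mu2 (u - beta) du / Y6 with
   Y6^2 = (u^2 - 1) Q4(u), while Re int dh is a multiple of ln |u + V|.  Hence, up to the sign of the
   square root, Re int phi_1 and Re int phi_2 are harmonic functions X of u on the upper half plane,
   and exp (i om (X - x0)) becomes a function on the whole curve, inverted by the exchange of the two
   sheets and reflected across the real axis, as soon as om (X - x0) takes values in pi Z on the real
   intervals where Y is real.  X is constant on each of these intervals, so single-valuedness is one
   equality of boundary values for phi_2 and one rational ratio of periods for phi_1.

   The roots are parametrized as p0 = - cosh (m - h), p1 = cosh (n - h), p2 = cosh (n + h),
   p3 = cosh (m + h), where cosh m = Theta cosh h and Theta = (1 + lambda) / (1 - lambda), so that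
   0 < h < n are free.  The equality for phi_2 reads J(h, n) = 0, where J is strictly decreasing in n,
   positive for n near h and negative for n near m; its zero psi(h) is therefore unique and continuous.
   Along n = psi(h) the two periods of phi_1 are mu1 P and mu1 P' with P' > 0.  When h is very small P
   is negative, and when h is large P > - P' / k for any prescribed k, so by the intermediate value
   theorem k P + P' vanishes for a suitable integer k and some h. *)

Require Import Defs.
From Stdlib Require Import Reals Lra Psatz List Ranalysis5 ClassicalEpsilon.
From Coquelicot Require Import Coquelicot.
Open Scope R_scope.

(** * Continuity rules *)

(** The splitting into two curves over the u-line comes from g1(-z) = g2(z): the involution (z, w)
    -> (-z, 1/w) fixes u, Y and phi_1, while (z, w) -> (-z, -1/w) fixes u, Y6 and phi_2. So phi_1
    lives on an elliptic curve and phi_2 on a curve of genus two. The parameters h, n, m linearize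
    the relation g1(a) + g2(a) = 0. The ratios (a - l)/(a + l), (l1 - a)/(l1 + a), (1 - a)/(1 + a),
    (l2 - a)/(l2 + a) are exp of -(m - h), -(n + h), -(m + h), -(n - h), and the relation equates
    the product of the first two with that of the last two. The paths to be compared are arbitrary
    piecewise C^1 paths. Instead of a homology basis, the proof uses a unit complex function E,
    defined on the whole curve, with dE = i om Re(phi) E: the integral along any path is then
    determined by its ends modulo 2 PI / om. The work lies where E is glued, at branch points and
    across the real axis. There E is controlled by first-order expansions, uniform near each point,
    of boundary values of a primitive constructed in the open upper half plane only. *)

Lemma continuous_Rplus {T : UniformSpace} (f g : T -> R) x :
  continuous f x -> continuous g x -> continuous (fun t => f t + g t) x.
Proof. intros Hf Hg. exact (continuous_plus f g x Hf Hg). Qed.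

Lemma continuous_Ropp {T : UniformSpace} (f : T -> R) x :
  continuous f x -> continuous (fun t => - f t) x.
Proof. intros Hf. exact (continuous_opp f x Hf). Qed.

Lemma continuous_Rminus {T : UniformSpace} (f g : T -> R) x :
  continuous f x -> continuous g x -> continuous (fun t => f t - g t) x.
Proof. intros Hf Hg. exact (continuous_minus f g x Hf Hg). Qed.

Lemma continuous_Rmult {T : UniformSpace} (f g : T -> R) x :
  continuous f x -> continuous g x -> continuous (fun t => f t * g t) x.
Proof. intros Hf Hg. exact (continuous_mult f g x Hf Hg). Qed.

Lemma continuous_comp_R {T : UniformSpace} (g : R -> R) (f : T -> R) x :
  continuous g (f x) -> continuous f x -> continuous (fun t => g (f t)) x.
Proof. intros Hg Hf. exact (continuous_comp f g x Hf Hg). Qed.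

Lemma continuous_Rinv' {T : UniformSpace} (f : T -> R) x :
  continuous f x -> f x <> 0 -> continuous (fun t => / f t) x.
Proof.
  intros Hf H0. apply (continuous_comp_R Rinv f x); [|exact Hf].
  now apply continuous_Rinv.
Qed.

Lemma continuous_Rdiv {T : UniformSpace} (f g : T -> R) x :
  continuous f x -> continuous g x -> g x <> 0 ->
  continuous (fun t => f t / g t) x.
Proof. intros. apply continuous_Rmult; [|apply continuous_Rinv']; auto. Qed.

Lemma continuous_Rsqrt {T : UniformSpace} (f : T -> R) x :
  continuous f x -> continuous (fun t => sqrt (f t)) x.
Proof. intros Hf. apply (continuous_comp_R sqrt f x); [apply continuous_sqrt|exact Hf]. Qed.

(** Continuity is taken componentwise, so that every rule reduces to a rule for real functions. The
    domain may be the line, or the plane seen as the product [R2]. *)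
Definition ccont {T : UniformSpace} (f : T -> C) (x : T) : Prop :=
  continuous (fun t => Re (f t)) x /\ continuous (fun t => Im (f t)) x.

Notation R2 := (prod_UniformSpace R_UniformSpace R_UniformSpace).

Section ccont_rules.
Context {T : UniformSpace}.
Implicit Types (f g : T -> C) (x : T).

Lemma ccont_const (c : C) x : ccont (fun _ => c) x.
Proof. split; apply continuous_const. Qed.

Lemma ccont_plus f g x : ccont f x -> ccont g x -> ccont (fun t => (f t + g t)%C) x.
Proof. intros [] []; split; simpl; apply continuous_Rplus; auto. Qed.

Lemma ccont_opp f x : ccont f x -> ccont (fun t => (- f t)%C) x.
Proof. intros []; split; simpl; apply continuous_Ropp; auto. Qed.

Lemma ccont_minus f g x : ccont f x -> ccont g x -> ccont (fun t => (f t - g t)%C) x.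
Proof. intros; apply ccont_plus, ccont_opp; auto. Qed.

Lemma ccont_mult f g x : ccont f x -> ccont g x -> ccont (fun t => (f t * g t)%C) x.
Proof.
  intros [] []; split; simpl;
    [apply continuous_Rminus|apply continuous_Rplus]; apply continuous_Rmult; auto.
Qed.

Lemma Cnorm2_neq0 (z : C) : z <> RtoC 0 -> fst z ^ 2 + snd z ^ 2 <> 0.
Proof.
  intros H E. apply H. destruct z as [a b]; simpl in E.
  unfold RtoC; f_equal; nra.
Qed.

Lemma ccont_inv f x : ccont f x -> f x <> RtoC 0 -> ccont (fun t => (/ f t)%C) x.
Proof.
  intros [H1 H2] H.
  assert (HN : continuous (fun t => Re (f t) * Re (f t) + Im (f t) * Im (f t)) x)
    by (apply continuous_Rplus; apply continuous_Rmult; assumption).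
  assert (H0 : Re (f x) * Re (f x) + Im (f x) * Im (f x) <> 0).
  { intros E. apply (Cnorm2_neq0 _ H). unfold Re, Im in E. lra. }
  split.
  - apply (continuous_ext (fun t => Re (f t) / (Re (f t) * Re (f t) + Im (f t) * Im (f t)))).
    { intros t. unfold Cinv, Re, Im; simpl. unfold Rdiv; repeat f_equal; ring. }
    apply continuous_Rdiv; assumption.
  - apply (continuous_ext (fun t => (- Im (f t)) / (Re (f t) * Re (f t) + Im (f t) * Im (f t)))).
    { intros t. unfold Cinv, Re, Im; simpl. unfold Rdiv; repeat f_equal; ring. }
    apply continuous_Rdiv; [apply continuous_Ropp| |]; assumption.
Qed.

Lemma ccont_div f g x : ccont f x -> ccont g x -> g x <> RtoC 0 ->
  ccont (fun t => (f t / g t)%C) x.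
Proof. intros; apply ccont_mult; [|apply ccont_inv]; auto. Qed.

Lemma ccont_pair (f1 f2 : T -> R) x :
  continuous f1 x -> continuous f2 x -> ccont (fun t => (f1 t, f2 t)) x.
Proof. split; auto. Qed.

Lemma ccont_Cmod f x : ccont f x -> continuous (fun t => Cmod (f t)) x.
Proof.
  intros [H1 H2]. apply continuous_Rsqrt.
  apply continuous_Rplus; simpl; apply continuous_Rmult; auto;
   apply continuous_Rmult; auto; apply continuous_const.
Qed.

Lemma ccont_ext_loc f g x : locally x (fun t => g t = f t) -> ccont f x -> ccont g x.
Proof.
  intros HL [H1 H2].
  split;
    [apply (continuous_ext_loc _ (fun t => Re (f t)))
    |apply (continuous_ext_loc _ (fun t => Im (f t)))]; auto;
    (eapply filter_imp; [|exact HL]); cbv beta; intros t ->; reflexivity.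
Qed.

Lemma ccont_eps f x : ccont f x ->
  forall eps, 0 < eps -> locally x (fun t => Cmod (f t - f x)%C < eps).
Proof.
  intros H eps He.
  assert (H' : continuous (fun t => Cmod (f t - f x)%C) x).
  { apply ccont_Cmod, ccont_minus; auto using ccont_const. }
  assert (H0 : Cmod (f x - f x)%C = 0).
  { replace (f x - f x)%C with (RtoC 0) by ring. apply Cmod_0. }
  generalize (proj1 (filterlim_locally _ _) H' (mkposreal eps He)); intros HL.
  refine (filter_imp _ _ _ HL); intros t Ht.
  rewrite H0 in Ht. unfold ball in Ht; simpl in Ht; unfold AbsRing_ball in Ht.
  unfold abs, minus, plus, opp in Ht; simpl in Ht.
  generalize (Cmod_ge_0 (f t - f x)%C); intro.
  rewrite Ropp_0, Rplus_0_r, Rabs_pos_eq in Ht; auto.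
Qed.

Lemma ccont_of_eps f x :
  (forall eps, 0 < eps -> locally x (fun t => Cmod (f t - f x)%C < eps)) -> ccont f x.
Proof.
  intros H; split; apply filterlim_locally; intros eps;
    refine (filter_imp _ _ _ (H eps (cond_pos eps))); intros t Ht;
    unfold ball; simpl; unfold AbsRing_ball, abs, minus, plus, opp; simpl;
    (eapply Rle_lt_trans; [|exact Ht]);
    generalize (Rmax_Cmod (f t - f x)%C); intros HM; simpl in HM.
  - eapply Rle_trans; [apply Rmax_l|exact HM].
  - eapply Rle_trans; [apply Rmax_r|exact HM].
Qed.

Lemma ccont_neq0 f x : ccont f x -> f x <> RtoC 0 -> locally x (fun t => f t <> RtoC 0).
Proof.
  intros H H0. assert (Hp : 0 < Cmod (f x)) by now apply Cmod_gt_0.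
  refine (filter_imp _ _ _ (ccont_eps f x H _ Hp)); intros t Ht E.
  rewrite E in Ht. replace (RtoC 0 - f x)%C with (- f x)%C in Ht by ring.
  rewrite Cmod_opp in Ht. lra.
Qed.
End ccont_rules.

Lemma ccont_comp {T : UniformSpace} (g : C -> C) (f : T -> C) (x : T) :
  ccont (T := R2) g (f x) -> ccont f x -> ccont (fun t => g (f t)) x.
Proof.
  intros Hg Hf. apply ccont_of_eps; intros eps He.
  destruct (ccont_eps (T := R2) g (f x) Hg eps He) as [d Hd].
  refine (filter_imp _ _ _ (ccont_eps f x Hf d (cond_pos d))); intros t Ht.
  apply Hd. generalize (Rmax_Cmod (f t - f x)%C); intros HM; simpl in HM.
  split; simpl; unfold ball; simpl; unfold AbsRing_ball, abs, minus, plus, opp; simpl;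
   (eapply Rle_lt_trans; [|exact Ht]); (eapply Rle_trans; [|exact HM]);
   [apply Rmax_l|apply Rmax_r].
Qed.

Lemma locally_C (u : C) (P : C -> Prop) :
  locally (T := R2) u P <-> exists d, 0 < d /\ forall v, Cmod (v - u)%C < d -> P v.
Proof.
  split.
  - intros [d Hd]. exists d; split; [apply cond_pos|]. intros v Hv. apply Hd.
    generalize (Rmax_Cmod (v - u)%C); intros HM; simpl in HM.
    split; simpl; unfold ball; simpl; unfold AbsRing_ball, abs, minus, plus, opp; simpl;
     (eapply Rle_lt_trans; [|exact Hv]); (eapply Rle_trans; [|exact HM]);
     [apply Rmax_l|apply Rmax_r].
  - intros (d & Hd & H).
    assert (Hd2 : 0 < d / 2) by lra. exists (mkposreal _ Hd2).
    intros v [H1 H2]. apply H.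
    unfold ball in H1, H2; simpl in H1, H2; unfold AbsRing_ball, abs, minus, plus, opp in H1, H2;
      simpl in H1, H2.
    eapply Rle_lt_trans; [apply Cmod_2Rmax|]. simpl.
    assert (Hs : sqrt 2 < 2).
    { replace 2 with (sqrt (2*2)) at 2 by (apply sqrt_square; lra). apply sqrt_lt_1; lra. }
    set (M := Rmax _ _).
    assert (Hm : M < d / 2) by (apply Rmax_lub_lt; [exact H1|exact H2]).
    assert (H3 : 0 <= M) by (eapply Rle_trans; [apply Rabs_pos|apply Rmax_l]).
    clearbody M. nra.
Qed.

Lemma locally_C_intro (u : C) (P : C -> Prop) d :
  0 < d -> (forall v, Cmod (v - u)%C < d -> P v) -> locally (T := R2) u P.
Proof. intros Hd H. apply (proj2 (locally_C u P)). now exists d. Qed.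

Lemma locally_C_elim (u : C) (P : C -> Prop) : locally (T := R2) u P ->
  exists d, 0 < d /\ forall v, Cmod (v - u)%C < d -> P v.
Proof. exact (proj1 (locally_C u P)). Qed.

Lemma locally_R (t : R) (P : R -> Prop) :
  locally t P <-> exists d, 0 < d /\ forall y, Rabs (y - t) < d -> P y.
Proof.
  split.
  - intros [d Hd]. exists d; split; [apply cond_pos|exact Hd].
  - intros (d & Hd & H). exists (mkposreal d Hd). exact H.
Qed.

Lemma ccont_id u : ccont (T := R2) (fun v : C => v) u.
Proof. split; [apply continuous_fst|apply continuous_snd]. Qed.

Lemma ccont_C_eps (f : C -> C) u : ccont (T := R2) f u ->
  forall eps, 0 < eps -> exists d, 0 < d /\
    forall v, Cmod (v - u)%C < d -> Cmod (f v - f u)%C < eps.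
Proof. intros H eps He. apply locally_C, (ccont_eps (T := R2)); auto. Qed.

(** * Complex derivatives, along curves and in the plane *)

Definition cder (g : R -> C) (t : R) (l : C) : Prop :=
  is_derive (fun s => Re (g s)) t (Re l) /\ is_derive (fun s => Im (g s)) t (Im l).

(* Caratheodory's form of complex differentiability. *)
Definition cdiff (f : C -> C) (u l : C) : Prop :=
  exists phi : C -> C, ccont (T := R2) phi u /\ phi u = l /\
    locally (T := R2) u (fun v : C => f v = (f u + phi v * (v - u))%C).

Lemma is_derive_eps (f : R -> R) x l :
  is_derive f x l <->
  forall eps, 0 < eps -> exists d, 0 < d /\ forall y, Rabs (y - x) < d ->
    Rabs (f y - f x - l * (y - x)) <= eps * Rabs (y - x).
Proof.
  rewrite is_derive_Reals. split.
  - intros H eps He. destruct (H eps He) as [d Hd].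
    exists d; split; [apply cond_pos|]. intros y Hy.
    destruct (Req_dec y x) as [->|Hne].
    { replace (f x - f x - l * (x - x)) with 0 by ring.
      rewrite Rminus_diag, Rabs_R0. lra. }
    specialize (Hd (y - x) ltac:(lra) Hy).
    replace (x + (y - x)) with y in Hd by ring.
    replace (f y - f x - l * (y - x)) with (((f y - f x) / (y - x) - l) * (y - x))
      by (field; lra).
    rewrite Rabs_mult. apply Rmult_le_compat_r; [apply Rabs_pos|lra].
  - intros H eps He. destruct (H (eps / 2) ltac:(lra)) as (d & Hd & Hy).
    exists (mkposreal d Hd). intros h Hh0 Hh. specialize (Hy (x + h)).
    replace (x + h - x) with h in Hy by ring. specialize (Hy Hh).
    replace ((f (x + h) - f x) / h - l) with ((f (x + h) - f x - l * h) / h) by (field; auto).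
    unfold Rdiv. rewrite Rabs_mult, Rabs_inv.
    assert (0 < Rabs h) by now apply Rabs_pos_lt.
    apply Rle_lt_trans with (eps / 2 * Rabs h * / Rabs h).
    { apply Rmult_le_compat_r; [left; now apply Rinv_0_lt_compat|exact Hy]. }
    replace (eps / 2 * Rabs h * / Rabs h) with (eps / 2) by (field; lra). lra.
Qed.

Lemma Cmod_le_abs (z : C) : Cmod z <= Rabs (Re z) + Rabs (Im z).
Proof.
  replace z with (RtoC (Re z) + (0, Im z))%C at 1
    by (destruct z; unfold Re, Im, RtoC, Cplus; simpl; f_equal; ring).
  eapply Rle_trans; [apply Cmod_triangle|]. rewrite Cmod_R.
  apply Rplus_le_compat_l. unfold Cmod; simpl.
  replace (0 * (0 * 1) + Im z * (Im z * 1)) with (Rsqr (Im z)) by (unfold Rsqr; ring).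
  rewrite sqrt_Rsqr_abs. lra.
Qed.

Lemma im_le_Cmod (z : C) : Rabs (Im z) <= Cmod z.
Proof. eapply Rle_trans; [apply Rmax_r|apply Rmax_Cmod]. Qed.

Lemma cder_eps (g : R -> C) t l :
  cder g t l <->
  forall eps, 0 < eps -> exists d, 0 < d /\ forall y, Rabs (y - t) < d ->
    Cmod (g y - g t - l * RtoC (y - t))%C <= eps * Rabs (y - t).
Proof.
  unfold cder. rewrite !is_derive_eps. split.
  - intros [H1 H2] eps He.
    destruct (H1 (eps / 2) ltac:(lra)) as (d1 & Hd1 & K1).
    destruct (H2 (eps / 2) ltac:(lra)) as (d2 & Hd2 & K2).
    exists (Rmin d1 d2); split; [now apply Rmin_pos|]. intros y Hy.
    specialize (K1 y (Rlt_le_trans _ _ _ Hy (Rmin_l _ _))).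
    specialize (K2 y (Rlt_le_trans _ _ _ Hy (Rmin_r _ _))).
    eapply Rle_trans; [apply Cmod_le_abs|].
    replace (Re (g y - g t - l * RtoC (y - t))%C) with (Re (g y) - Re (g t) - Re l * (y - t))
      by (unfold Re, Im; simpl; ring).
    replace (Im (g y - g t - l * RtoC (y - t))%C) with (Im (g y) - Im (g t) - Im l * (y - t))
      by (unfold Re, Im; simpl; ring).
    lra.
  - intros H; split; intros eps He; destruct (H eps He) as (d & Hd & K);
      exists d; (split; [exact Hd|]); intros y Hy; specialize (K y Hy);
      (eapply Rle_trans; [|exact K]).
    + replace (Re (g y) - Re (g t) - Re l * (y - t)) with (Re (g y - g t - l * RtoC (y - t))%C)
        by (unfold Re, Im; simpl; ring). apply re_le_Cmod.
    + replace (Im (g y) - Im (g t) - Im l * (y - t)) with (Im (g y - g t - l * RtoC (y - t))%C)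
        by (unfold Re, Im; simpl; ring). apply im_le_Cmod.
Qed.

Lemma is_derive_eq (f : R -> R) (x l l' : R) : is_derive f x l -> l = l' -> is_derive f x l'.
Proof. now intros H <-. Qed.

Lemma is_derive_Rmult (f g : R -> R) (x df dg : R) :
  is_derive f x df -> is_derive g x dg ->
  is_derive (fun t => f t * g t) x (df * g x + f x * dg).
Proof. intros Hf Hg. exact (is_derive_mult f g x df dg Hf Hg Rmult_comm). Qed.

Lemma is_derive_Rplus (f g : R -> R) (x df dg : R) :
  is_derive f x df -> is_derive g x dg -> is_derive (fun t => f t + g t) x (df + dg).
Proof. intros Hf Hg. exact (is_derive_plus f g x df dg Hf Hg). Qed.

Lemma is_derive_Rminus (f g : R -> R) (x df dg : R) :
  is_derive f x df -> is_derive g x dg -> is_derive (fun t => f t - g t) x (df - dg).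
Proof. intros Hf Hg. exact (is_derive_minus f g x df dg Hf Hg). Qed.

Lemma is_derive_Ropp (f : R -> R) (x df : R) :
  is_derive f x df -> is_derive (fun t => - f t) x (- df).
Proof. intros Hf. exact (is_derive_opp f x df Hf). Qed.

Lemma cder_const (c : C) t : cder (fun _ => c) t (RtoC 0).
Proof. split; simpl; apply (is_derive_const (V := R_NormedModule)). Qed.

Lemma cder_plus f g t df dg :
  cder f t df -> cder g t dg -> cder (fun s => (f s + g s)%C) t (df + dg)%C.
Proof. intros [] []; split; simpl; apply is_derive_Rplus; assumption. Qed.

Lemma cder_opp f t df : cder f t df -> cder (fun s => (- f s)%C) t (- df)%C.
Proof. intros []; split; simpl; apply is_derive_Ropp; assumption. Qed.

Lemma cder_minus f g t df dg :
  cder f t df -> cder g t dg -> cder (fun s => (f s - g s)%C) t (df - dg)%C.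
Proof. intros; apply cder_plus, cder_opp; assumption. Qed.

Lemma cder_mult f g t df dg :
  cder f t df -> cder g t dg ->
  cder (fun s => (f s * g s)%C) t (df * g t + f t * dg)%C.
Proof.
  intros [H1 H2] [H3 H4]; split.
  - refine (is_derive_eq _ _ _ _ (is_derive_Rminus _ _ _ _ _
      (is_derive_Rmult _ _ _ _ _ H1 H3) (is_derive_Rmult _ _ _ _ _ H2 H4)) _).
    unfold Re, Im; simpl; ring.
  - refine (is_derive_eq _ _ _ _ (is_derive_Rplus _ _ _ _ _
      (is_derive_Rmult _ _ _ _ _ H1 H4) (is_derive_Rmult _ _ _ _ _ H2 H3)) _).
    unfold Re, Im; simpl; ring.
Qed.

Lemma cder_eq f t l l' : cder f t l -> l = l' -> cder f t l'.
Proof. now intros H <-. Qed.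

Lemma cder_ext_loc f g t l : locally t (fun s => f s = g s) -> cder f t l -> cder g t l.
Proof.
  intros HL [H1 H2]; split; eapply is_derive_ext_loc;
    [|exact H1| |exact H2]; (eapply filter_imp; [|exact HL]); cbv beta; intros s ->; reflexivity.
Qed.

Lemma cder_cont f t l : cder f t l -> ccont f t.
Proof.
  intros [H1 H2]; split.
  - apply (ex_derive_continuous (fun s => Re (f s)) t). eexists; exact H1.
  - apply (ex_derive_continuous (fun s => Im (f s)) t). eexists; exact H2.
Qed.

Lemma cder_unique f t l l' : cder f t l -> cder f t l' -> l = l'.
Proof.
  intros [H1 H2] [H3 H4].
  apply is_derive_unique in H1, H2, H3, H4.
  destruct l, l'; unfold Re, Im in *; simpl in *; congruence.
Qed.

Lemma locally_C_forall (u : C) (P : C -> Prop) : (forall v, P v) -> locally (T := R2) u P.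
Proof. intros H. apply filter_forall. exact H. Qed.

Lemma locally_C_imp (u : C) (P Q : C -> Prop) :
  (forall v, P v -> Q v) -> locally (T := R2) u P -> locally (T := R2) u Q.
Proof. intros H. apply filter_imp. exact H. Qed.

Lemma locally_C_imp2 (u : C) (P Q S : C -> Prop) :
  (forall v, P v -> Q v -> S v) ->
  locally (T := R2) u P -> locally (T := R2) u Q -> locally (T := R2) u S.
Proof.
  intros H HP HQ. generalize (filter_and _ _ HP HQ). apply filter_imp. intros v []; auto.
Qed.

Lemma cdiff_eq f u l l' : cdiff f u l -> l = l' -> cdiff f u l'.
Proof. now intros H <-. Qed.

Lemma cdiff_const (c u : C) : cdiff (fun _ => c) u (RtoC 0).
Proof.
  exists (fun _ => RtoC 0). split; [apply ccont_const|]. split; [reflexivity|].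
  apply locally_C_forall. intros v. ring.
Qed.

Lemma cdiff_id (u : C) : cdiff (fun v => v) u (RtoC 1).
Proof.
  exists (fun _ => RtoC 1). split; [apply ccont_const|]. split; [reflexivity|].
  apply locally_C_forall. intros v. ring.
Qed.

Lemma cdiff_cont f u l : cdiff f u l -> ccont (T := R2) f u.
Proof.
  intros (phi & H1 & H2 & H3).
  refine (ccont_ext_loc (T := R2) (fun v : C => (f u + phi v * (v - u))%C) f u H3 _).
  apply ccont_plus; [apply ccont_const|].
  apply ccont_mult; [exact H1|]. apply ccont_minus; [apply ccont_id|apply ccont_const].
Qed.

Lemma cdiff_plus f g u df dg :
  cdiff f u df -> cdiff g u dg -> cdiff (fun v => (f v + g v)%C) u (df + dg)%C.
Proof.
  intros (p & P1 & P2 & P3) (q & Q1 & Q2 & Q3).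
  exists (fun v => p v + q v)%C. split; [now apply ccont_plus|]. split; [congruence|].
  refine (locally_C_imp2 _ _ _ _ _ P3 Q3). intros v -> ->. ring.
Qed.

Lemma cdiff_mult f g u df dg :
  cdiff f u df -> cdiff g u dg -> cdiff (fun v => (f v * g v)%C) u (df * g u + f u * dg)%C.
Proof.
  intros Hf Hg. generalize (cdiff_cont _ _ _ Hg). intros Cg.
  destruct Hf as (p & P1 & P2 & P3). destruct Hg as (q & Q1 & Q2 & Q3).
  exists (fun v => p v * g v + f u * q v)%C. split.
  { apply ccont_plus; apply ccont_mult; auto. apply ccont_const. }
  split; [congruence|].
  refine (locally_C_imp2 _ _ _ _ _ P3 Q3). intros v -> E. rewrite E. ring.
Qed.

Lemma cdiff_inv f u df :
  cdiff f u df -> f u <> RtoC 0 -> cdiff (fun v => (/ f v)%C) u (- df / (f u * f u))%C.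
Proof.
  intros Hf H0. generalize (cdiff_cont _ _ _ Hf). intros Cf.
  destruct Hf as (p & P1 & P2 & P3).
  exists (fun v => - p v / (f v * f u))%C. split.
  { apply ccont_div; [now apply ccont_opp| |].
    - apply ccont_mult; [exact Cf|apply ccont_const].
    - now apply Cmult_neq_0. }
  split; [now rewrite P2|].
  refine (locally_C_imp2 _ _ _ _ _ P3 (ccont_neq0 (T := R2) f u Cf H0)).
  intros v E Hv. assert (E' : (p v * (v - u) = f v - f u)%C) by (rewrite E; ring).
  transitivity (/ f u + - (p v * (v - u)) / (f v * f u))%C; [|field; auto].
  rewrite E'. field; auto.
Qed.

(** Caratheodory's form gives f (g s) = f (g t) + phi (g s) * (g s - g t) near t: a continuous
    factor times a differentiable one that vanishes at t, so phi itself is not differentiated. *)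
Lemma cdiff_cder (f : C -> C) (g : R -> C) t l dg :
  cdiff f (g t) l -> cder g t dg -> cder (fun s => f (g s)) t (l * dg)%C.
Proof.
  intros (phi & H1 & H2 & H3) Hg.
  assert (K : cder (fun s => (f (g t) + phi (g s) * (g s - g t))%C) t (l * dg)%C).
  { assert (Hc : ccont (fun s => phi (g s)) t)
      by (apply ccont_comp; [exact H1|exact (cder_cont _ _ _ Hg)]).
    rewrite cder_eps in Hg |- *. intros eps He.
    set (B := Cmod dg + 1).
    assert (HB : 0 < B) by (generalize (Cmod_ge_0 dg); unfold B; lra).
    set (A := Cmod l + 1).
    assert (HA : 0 < A) by (generalize (Cmod_ge_0 l); unfold A; lra).
    assert (He1 : 0 < eps / (2 * A)) by (apply Rdiv_lt_0_compat; lra).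
    assert (He2 : 0 < eps / (2 * B)) by (apply Rdiv_lt_0_compat; lra).
    destruct (Hg (eps / (2 * A)) He1) as (d1 & Hd1 & K1).
    destruct (Hg 1 Rlt_0_1) as (d2 & Hd2 & K2).
    destruct (proj1 (locally_R _ _) (ccont_eps _ _ Hc _ He2)) as (d3 & Hd3 & K3).
    exists (Rmin d1 (Rmin d2 d3)). split; [repeat apply Rmin_pos; auto|].
    intros y Hy.
    assert (Y1 : Rabs (y - t) < d1) by (eapply Rlt_le_trans; [exact Hy|apply Rmin_l]).
    assert (Y2 : Rabs (y - t) < d2)
      by (eapply Rlt_le_trans; [exact Hy|eapply Rle_trans; [apply Rmin_r|apply Rmin_l]]).
    assert (Y3 : Rabs (y - t) < d3)
      by (eapply Rlt_le_trans; [exact Hy|eapply Rle_trans; [apply Rmin_r|apply Rmin_r]]).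
    specialize (K1 y Y1). specialize (K2 y Y2). specialize (K3 y Y3). rewrite H2 in K3.
    set (a := Rabs (y - t)) in *.
    assert (Ha : 0 <= a) by apply Rabs_pos.
    assert (K4 : Cmod (g y - g t)%C <= B * a).
    { replace (g y - g t)%C with ((g y - g t - dg * RtoC (y - t)) + dg * RtoC (y - t))%C by ring.
      eapply Rle_trans; [apply Cmod_triangle|]. rewrite Cmod_mult, Cmod_R. fold a. unfold B. lra. }
    replace (f (g t) + phi (g y) * (g y - g t) - (f (g t) + phi (g t) * (g t - g t))
             - l * dg * RtoC (y - t))%C
      with ((phi (g y) - l) * (g y - g t) + l * (g y - g t - dg * RtoC (y - t)))%C by ring.
    eapply Rle_trans; [apply Cmod_triangle|]. rewrite !Cmod_mult.
    apply Rle_trans with (eps / (2 * B) * (B * a) + A * (eps / (2 * A) * a)).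
    - apply Rplus_le_compat.
      + apply Rmult_le_compat; try apply Cmod_ge_0; [left; exact K3|exact K4].
      + apply Rmult_le_compat; try apply Cmod_ge_0; [unfold A; lra|exact K1].
    - right. field. lra. }
  refine (cder_ext_loc _ _ _ _ _ K).
  destruct (proj1 (locally_C _ _) H3) as (d & Hd & Kd).
  generalize (ccont_eps _ _ (cder_cont _ _ _ Hg) d Hd). apply filter_imp.
  intros s Hs. symmetry. now apply Kd.
Qed.

Lemma cder_inv f t df :
  cder f t df -> f t <> RtoC 0 -> cder (fun s => (/ f s)%C) t (- df / (f t * f t))%C.
Proof.
  intros Hf H0.
  refine (cder_eq _ _ _ _ (cdiff_cder (fun v => (/ v)%C) f t _ df
    (cdiff_inv (fun v => v) (f t) _ (cdiff_id (f t)) H0) Hf) _).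
  field; auto.
Qed.

(** * Square roots on the closed upper half plane *)

Lemma Cmod_sqr (z : C) : Cmod z * Cmod z = Re z * Re z + Im z * Im z.
Proof.
  generalize (Cmod2_alt z). simpl. lra.
Qed.

Lemma Ceq_ext (a b : C) : Re a = Re b -> Im a = Im b -> a = b.
Proof. destruct a, b; unfold Re, Im; simpl; congruence. Qed.

(* On the closed upper half plane this is the square root lying in the closed first
   quadrant; below the real axis it is the root of the conjugate. *)
Definition hsqrt (u : C) : C :=
  (sqrt ((Cmod u + Re u) / 2), sqrt ((Cmod u - Re u) / 2)).

Lemma hsqrt_cont u : ccont (T := R2) hsqrt u.
Proof.
  destruct (ccont_id u) as [H1 H2].
  generalize (ccont_Cmod _ _ (ccont_id u)); intros H3.
  apply (ccont_pair (T := R2)); apply (continuous_Rsqrt (T := R2));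
   apply (continuous_Rmult (T := R2)); try apply continuous_const;
   [apply (continuous_Rplus (T := R2))|apply (continuous_Rminus (T := R2))]; assumption.
Qed.

Lemma Cmod_Re_bounds (u : C) : 0 <= (Cmod u + Re u) / 2 /\ 0 <= (Cmod u - Re u) / 2.
Proof. destruct (proj1 (Rabs_le_between _ _) (re_le_Cmod u)). lra. Qed.

Lemma hsqrt_sqr_gen (u : C) : (hsqrt u * hsqrt u)%C = (Re u, Rabs (Im u)).
Proof.
  destruct (Cmod_Re_bounds u) as [H1 H2]. unfold hsqrt.
  assert (H3 : sqrt ((Cmod u + Re u) / 2) * sqrt ((Cmod u - Re u) / 2) = Rabs (Im u) / 2).
  { rewrite <- sqrt_mult by assumption.
    replace ((Cmod u + Re u) / 2 * ((Cmod u - Re u) / 2)) with (Rsqr (Im u / 2)).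
    2: { unfold Rsqr. generalize (Cmod_sqr u). nra. }
    rewrite sqrt_Rsqr_abs. unfold Rdiv. rewrite Rabs_mult, (Rabs_pos_eq (/ 2)) by lra.
    reflexivity. }
  generalize (sqrt_sqrt _ H1) (sqrt_sqrt _ H2). revert H3.
  generalize (sqrt ((Cmod u + Re u) / 2)) (sqrt ((Cmod u - Re u) / 2)).
  intros a b H3 H4 H5. unfold Cmult; simpl. f_equal; lra.
Qed.

Lemma hsqrt_sqr (u : C) : 0 <= Im u -> (hsqrt u * hsqrt u)%C = u.
Proof.
  intros H. rewrite hsqrt_sqr_gen, Rabs_pos_eq by exact H.
  now destruct u.
Qed.

Lemma Cmod_hsqrt (u : C) : Cmod (hsqrt u) * Cmod (hsqrt u) = Cmod u.
Proof.
  rewrite <- Cmod_mult, hsqrt_sqr_gen. unfold Cmod; simpl. f_equal.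
  generalize (Rsqr_abs (Im u)). unfold Rsqr, Re, Im. lra.
Qed.

Lemma hsqrt_neq0 (u : C) : u <> RtoC 0 -> hsqrt u <> RtoC 0.
Proof.
  intros H E. apply H. apply Cmod_eq_0. rewrite <- Cmod_hsqrt, E, Cmod_0. ring.
Qed.

Lemma hsqrt_nonneg u : 0 <= Re (hsqrt u) /\ 0 <= Im (hsqrt u).
Proof. split; apply sqrt_pos. Qed.

Lemma hsqrt_pos u : 0 < Im u -> 0 < Re (hsqrt u) /\ 0 < Im (hsqrt u).
Proof.
  intros H.
  assert (H1 : Rabs (Re u) < Cmod u).
  { apply Rsqr_incrst_0; try apply Rabs_pos; try apply Cmod_ge_0.
    rewrite <- Rsqr_abs. unfold Rsqr. rewrite Cmod_sqr. nra. }
  apply Rabs_def2 in H1. split; apply sqrt_lt_R0; lra.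
Qed.

Lemma hsqrt_of_sqr (s : C) : 0 <= Re s -> 0 <= Im s -> hsqrt (s * s)%C = s.
Proof.
  intros H1 H2.
  assert (E : Cmod (s * s)%C = Re s * Re s + Im s * Im s) by (rewrite Cmod_mult; apply Cmod_sqr).
  apply Ceq_ext; unfold hsqrt; rewrite E; unfold Re, Im in *; simpl.
  - replace ((fst s * fst s + snd s * snd s + (fst s * fst s - snd s * snd s)) / 2)
      with (fst s * fst s) by field. now apply sqrt_square.
  - replace ((fst s * fst s + snd s * snd s - (fst s * fst s - snd s * snd s)) / 2)
      with (snd s * snd s) by field. now apply sqrt_square.
Qed.

Lemma hsqrt_Rpos x : 0 <= x -> hsqrt (RtoC x) = RtoC (sqrt x).
Proof.
  intros H. unfold hsqrt. rewrite Cmod_R, Rabs_pos_eq by exact H.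
  unfold RtoC, Re; simpl. f_equal; [f_equal; field|].
  replace ((x - x) / 2) with 0 by field. apply sqrt_0.
Qed.

Lemma hsqrt_Rneg x : x <= 0 -> hsqrt (RtoC x) = (Ci * RtoC (sqrt (- x)))%C.
Proof.
  intros H. unfold hsqrt. rewrite Cmod_R, Rabs_left1 by exact H.
  unfold RtoC, Re, Cmult; simpl. f_equal.
  - replace ((- x + x) / 2) with 0 by field. rewrite sqrt_0. ring.
  - replace ((- x - x) / 2) with (- x) by field. ring.
Qed.

(** The slope is 1 / (hsqrt v + hsqrt u), from the difference of two squares. It stays finite
    because both roots have nonnegative real part and that of [hsqrt u] is positive. *)
Lemma cdiff_hsqrt u : 0 < Im u -> cdiff hsqrt u (/ (hsqrt u + hsqrt u))%C.
Proof.
  intros Hu. destruct (hsqrt_pos u Hu) as [P1 P2].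
  exists (fun v => / (hsqrt v + hsqrt u))%C.
  assert (N : forall v, (hsqrt v + hsqrt u)%C <> RtoC 0).
  { intros v E. apply (f_equal Re) in E. destruct (hsqrt_nonneg v) as [Q1 _].
    unfold Re in *; simpl in *. lra. }
  split.
  - apply ccont_inv; [|apply N].
    apply ccont_plus; [apply hsqrt_cont|apply ccont_const].
  - split; [reflexivity|].
    apply (locally_C_intro u _ (Im u) Hu). intros v Hv.
    assert (Hv0 : 0 <= Im v).
    { generalize (Rle_lt_trans _ _ _ (im_le_Cmod (v - u)%C) Hv). intros K.
      apply Rabs_def2 in K. unfold Im in *; simpl in *. lra. }
    transitivity (hsqrt u + / (hsqrt v + hsqrt u)
                  * (hsqrt v * hsqrt v - hsqrt u * hsqrt u))%C; [field; apply N|].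
    rewrite !hsqrt_sqr by lra. reflexivity.
Qed.

Section HalfPlaneRoot.
Context (iota : C) (Hiota : iota <> RtoC 0).

(** A branch, continuous up to the real axis, of the square root of iota^2 times the product of the
    u - p over the upper half plane. The constant iota fixes the sign of the polynomial: it is [Ci]
    for the first form and 1 for the second. *)
Fixpoint YU (ps : list R) (u : C) : C :=
  match ps with
  | nil => iota
  | p :: l => (hsqrt (u - RtoC p) * YU l u)%C
  end.

Lemma YU_cont ps u : ccont (T := R2) (YU ps) u.
Proof.
  induction ps as [|p l IH]; [apply ccont_const|].
  apply (ccont_mult (T := R2)); [|exact IH].
  refine (ccont_comp (T := R2) hsqrt (fun u : C => (u - RtoC p)%C) u (hsqrt_cont _) _).
  apply ccont_minus; [apply ccont_id|apply ccont_const].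
Qed.

Lemma Im_minus_R (u : C) (p : R) : Im (u - RtoC p)%C = Im u.
Proof. unfold Im; simpl; ring. Qed.

Lemma YU_neq0 ps (u : C) : (forall p, In p ps -> u <> RtoC p) -> YU ps u <> RtoC 0.
Proof.
  induction ps as [|p l IH]; intros H; [exact Hiota|].
  simpl. apply Cmult_neq_0.
  - apply hsqrt_neq0. intros E. apply (H p (or_introl eq_refl)).
    rewrite <- (Cplus_0_r (RtoC p)), <- E. ring.
  - apply IH. intros q Hq. apply H. now right.
Qed.

Lemma YU_cdiff ps : exists D : C -> C, forall u, 0 < Im u ->
  cdiff (YU ps) u (D u) /\ ccont (T := R2) D u.
Proof.
  induction ps as [|p l [D IH]].
  - exists (fun _ => RtoC 0). intros u _. split; [apply cdiff_const|apply ccont_const].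
  - exists (fun u => / (hsqrt (u - RtoC p) + hsqrt (u - RtoC p)) * YU l u
                     + hsqrt (u - RtoC p) * D u)%C.
    intros u Hu. destruct (IH u Hu) as [I1 I2].
    assert (Hp : 0 < Im (u - RtoC p)%C) by now rewrite Im_minus_R.
    assert (Cs : ccont (T := R2) (fun u : C => hsqrt (u - RtoC p)%C) u).
    { refine (ccont_comp (T := R2) hsqrt (fun u : C => (u - RtoC p)%C) u (hsqrt_cont _) _).
      apply ccont_minus; [apply ccont_id|apply ccont_const]. }
    split.
    + refine (cdiff_mult (fun u : C => hsqrt (u - RtoC p)%C) (YU l) u _ _ _ I1).
      destruct (cdiff_hsqrt _ Hp) as (phi & F1 & F2 & F3).
      exists (fun v => phi (v - RtoC p)%C). split; [|split].
      * refine (ccont_comp (T := R2) phi (fun u : C => (u - RtoC p)%C) u F1 _).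
        apply ccont_minus; [apply ccont_id|apply ccont_const].
      * exact F2.
      * destruct (locally_C_elim _ _ F3) as (d & Hd & F3'). clear F3. rename F3' into F3. apply (locally_C_intro u _ d Hd).
        intros v Hv. rewrite F3.
        { f_equal. f_equal. ring. }
        replace (v - RtoC p - (u - RtoC p))%C with (v - u)%C by ring. exact Hv.
    + apply ccont_plus; apply ccont_mult; auto.
      * apply ccont_inv; [now apply ccont_plus|].
        destruct (hsqrt_pos _ Hp) as [P1 _]. intros E. apply (f_equal Re) in E.
        unfold Re in *; simpl in *. lra.
      * apply YU_cont.
Qed.

End HalfPlaneRoot.

(** * Real parts of primitives on the upper half plane *)

Lemma cdiff_is_derive_x (f : C -> C) x y l :
  cdiff f (x, y) l ->
  is_derive (fun t => Re (f (t, y))) x (Re l) /\ is_derive (fun t => Im (f (t, y))) x (Im l).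
Proof.
  intros H.
  assert (K : cder (fun t => (t, y)) x (RtoC 1)).
  { split; simpl; [apply (is_derive_id (K := R_AbsRing))|apply (is_derive_const (V := R_NormedModule))]. }
  destruct (cdiff_cder f (fun t => (t, y)) x l _ H K) as [H1 H2].
  rewrite Cmult_1_r in H1, H2. auto.
Qed.

Lemma cdiff_is_derive_y (f : C -> C) x y l :
  cdiff f (x, y) l ->
  is_derive (fun t => Re (f (x, t))) y (- Im l) /\ is_derive (fun t => Im (f (x, t))) y (Re l).
Proof.
  intros H.
  assert (K : cder (fun t => (x, t)) y Ci).
  { split; simpl; [apply (is_derive_const (V := R_NormedModule))|apply (is_derive_id (K := R_AbsRing))]. }
  destruct (cdiff_cder f (fun t => (x, t)) y l _ H K) as [H1 H2].
  split; eapply is_derive_eq; [exact H1| |exact H2|]; destruct l; unfold Re, Im; simpl; ring.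
Qed.

Lemma ccont_slice_x (f : C -> C) x y : ccont (T := R2) f (x, y) ->
  ccont (fun t : R => f (t, y)) x.
Proof.
  intros H. apply (ccont_comp f (fun t : R => (t, y) : C) x H).
  apply ccont_pair; [apply continuous_id|apply continuous_const].
Qed.

Lemma ccont_slice_y (f : C -> C) x y : ccont (T := R2) f (x, y) ->
  ccont (fun t : R => f (x, t)) y.
Proof.
  intros H. apply (ccont_comp f (fun t : R => (x, t) : C) y H).
  apply ccont_pair; [apply continuous_const|apply continuous_id].
Qed.

Lemma locally_pos y : 0 < y -> locally y (fun t => 0 < t).
Proof. intros H. apply (open_gt 0 y H). Qed.

Lemma Rmin_pos_1 y t : 0 < y -> Rmin 1 y <= t <= Rmax 1 y -> 0 < t.
Proof. intros H [H1 _]. eapply Rlt_le_trans; [|exact H1]. apply Rmin_pos; lra. Qed.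

Section Primitive.
Context (f D : C -> C).
Context (HD : forall u, 0 < Im u -> cdiff f u (D u) /\ ccont (T := R2) D u).

(** The real part of the integral of f from i to x + i y, taken horizontally at height 1 and then
    vertically. The path never touches the real axis, where the forms have singularities. *)
Definition hp_primitive (x y : R) : R :=
  RInt (fun t => Re (f (t, 1))) 0 x - RInt (fun t => Im (f (x, t))) 1 y.

Lemma HDc u : 0 < Im u -> ccont (T := R2) f u.
Proof. intros H. exact (cdiff_cont _ _ _ (proj1 (HD u H))). Qed.

Lemma ex_RInt_vertical x y : 0 < y -> ex_RInt (fun t => Im (f (x, t))) 1 y.
Proof.
  intros H. apply (ex_RInt_continuous (V := R_CompleteNormedModule)). intros t Ht.
  apply (ccont_slice_y f x t). apply HDc. exact (Rmin_pos_1 y t H Ht).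
Qed.

Lemma hp_primitive_dy x y : 0 < y ->
  is_derive (fun t => hp_primitive x t) y (- Im (f (x, y))).
Proof.
  intros Hy. unfold hp_primitive.
  apply (is_derive_eq _ _ (0 - Im (f (x, y)))); [|ring].
  apply is_derive_Rminus; [apply (is_derive_const (V := R_NormedModule))|].
  apply (is_derive_RInt (fun t => Im (f (x, t)))
           (fun y => RInt (fun t => Im (f (x, t))) 1 y) 1 y).
  - refine (filter_imp _ _ _ (locally_pos y Hy)). intros t Ht.
    apply (RInt_correct (V := R_CompleteNormedModule)). now apply ex_RInt_vertical.
  - apply (ccont_slice_y f x y). now apply HDc.
Qed.

(** The vertical integral is differentiated under the integral sign. By the Cauchy-Riemann equations
    the x-derivative of Im f is minus the y-derivative of Re f, so it integrates to end terms, one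
    of which cancels the derivative of the horizontal part. *)
Lemma hp_primitive_dx x y : 0 < y ->
  is_derive (fun t => hp_primitive t y) x (Re (f (x, y))).
Proof.
  intros Hy. unfold hp_primitive.
  assert (E : RInt (fun t => Im (D (x, t))) 1 y = Re (f (x, 1)) - Re (f (x, y))).
  { apply is_RInt_unique.
    replace (Re (f (x, 1)) - Re (f (x, y)))
      with (minus (- Re (f (x, y))) (- Re (f (x, 1))))
      by (unfold minus, plus, opp; simpl; ring).
    apply (is_RInt_derive (V := R_CompleteNormedModule) (fun t => - Re (f (x, t)))).
    - intros t Ht. apply (is_derive_eq _ _ (- - Im (D (x, t)))); [|ring].
      apply is_derive_Ropp. apply cdiff_is_derive_y, HD. exact (Rmin_pos_1 y t Hy Ht).
    - intros t Ht. apply (ccont_slice_y D x t). apply HD. exact (Rmin_pos_1 y t Hy Ht). }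
  apply (is_derive_eq _ _ (Re (f (x, 1)) - RInt (fun t => Im (D (x, t))) 1 y)); [|rewrite E; ring].
  apply is_derive_Rminus.
  - apply (is_derive_RInt (fun t => Re (f (t, 1)))
             (fun x => RInt (fun t => Re (f (t, 1))) 0 x) 0 x).
    + apply filter_forall. intros z. apply (RInt_correct (V := R_CompleteNormedModule)).
      apply (ex_RInt_continuous (V := R_CompleteNormedModule)). intros t _.
      apply (ccont_slice_x f t 1). apply HDc. simpl; lra.
    + apply (ccont_slice_x f x 1). apply HDc. simpl; lra.
  - assert (K := is_derive_RInt_param (fun x t => Im (f (x, t))) 1 y x).
    assert (E2 : RInt (fun t => Derive (fun u => Im (f (u, t))) x) 1 y
                 = RInt (fun t => Im (D (x, t))) 1 y).
    { apply RInt_ext. intros t Ht. apply is_derive_unique.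
      apply (cdiff_is_derive_x f x t), HD. apply (Rmin_pos_1 y t Hy). lra. }
    simpl in K. rewrite E2 in K. apply K.
    + apply filter_forall. intros z t Ht. exists (Im (D (z, t))).
      apply (cdiff_is_derive_x f z t), HD. exact (Rmin_pos_1 y t Hy Ht).
    + intros t Ht. assert (Ht0 := Rmin_pos_1 y t Hy Ht).
      apply (continuity_2d_pt_ext_loc (fun u v => Im (D (u, v)))).
      * exists (mkposreal t Ht0). intros u v _ Hv. simpl in Hv. symmetry. apply is_derive_unique.
        apply (cdiff_is_derive_x f u v), HD. simpl. apply Rabs_def2 in Hv. lra.
      * apply continuity_2d_pt_filterlim.
        destruct (proj2 (HD (x, t) Ht0)) as [_ Q].
        refine (filterlim_ext _ _ _ Q). intros [? ?]. reflexivity.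
    + apply filter_forall. intros z. now apply ex_RInt_vertical.
Qed.

Lemma hp_primitive_path (g : R -> C) t dg : 0 < Im (g t) -> cder g t dg ->
  is_derive (fun s => hp_primitive (Re (g s)) (Im (g s))) t (Re (f (g t) * dg)%C).
Proof.
  intros Hg [H1 H2].
  set (x := Re (g t)) in *. set (y := Im (g t)) in *.
  assert (Egt : g t = (x, y)) by (unfold x, y; now destruct (g t)).
  assert (K : filterdiff (fun u : R * R => hp_primitive (fst u) (snd u)) (locally (x, y))
     (fun u : R * R => plus (scal (fst u) (Re (f (x, y)))) (scal (snd u) (- Im (f (x, y)))))).
  { apply (is_derive_filterdiff hp_primitive x y (fun x y => Re (f (x, y)))).
    - assert (L : locally (T := R2) (x, y) (fun u : C => 0 < Im u)).
      { apply (locally_C_intro _ _ y Hg). intros v Hv.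
        generalize (Rle_lt_trans _ _ _ (im_le_Cmod _) Hv). intros K. apply Rabs_def2 in K.
        unfold Im in *; simpl in *. lra. }
      refine (filter_imp _ _ _ L). intros [a b] Hab. simpl. now apply hp_primitive_dx.
    - now apply hp_primitive_dy.
    - destruct (HDc (x, y) Hg) as [Q _].
      refine (continuous_ext _ _ _ _ Q). intros [? ?]. reflexivity. }
  apply (filterdiff_differentiable_pt_lim hp_primitive x y) in K.
  apply is_derive_Reals in H1. apply is_derive_Reals in H2.
  generalize (derivable_pt_lim_comp_2d _ _ _ _ _ _ _ _ K H1 H2). intros K'.
  apply is_derive_Reals in K'.
  refine (is_derive_eq _ _ _ _ K' _).
  rewrite Egt. unfold Re, Im; simpl. ring.
Qed.

End Primitive.

(** * Boundary values *)

Lemma ccont_real_lim {T : UniformSpace} (F : T -> R) x :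
  continuous F x <-> forall eps, 0 < eps -> locally x (fun t => Rabs (F t - F x) < eps).
Proof.
  split.
  - intros H eps He. exact (proj1 (filterlim_locally _ _) H (mkposreal eps He)).
  - intros H. apply filterlim_locally. intros eps. exact (H eps (cond_pos eps)).
Qed.

Lemma MVT_01 (F dF : R -> R) :
  (forall r, 0 <= r <= 1 -> is_derive F r (dF r)) ->
  exists r, 0 <= r <= 1 /\ F 1 - F 0 = dF r.
Proof.
  intros H.
  destruct (MVT_cor2 F dF 0 1 Rlt_0_1) as (c & E & Hc).
  { intros c Hc. apply is_derive_Reals. now apply H. }
  exists c. split; [lra|]. rewrite E. ring.
Qed.

Definition seg (u v : C) (r : R) : C := (v + RtoC r * (u - v))%C.

Lemma cder_seg u v r : cder (seg u v) r (u - v)%C.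
Proof.
  unfold seg.
  assert (K : cder (fun r => RtoC r) r (RtoC 1)).
  { split; simpl; [apply (is_derive_id (K := R_AbsRing))|apply (is_derive_const (V := R_NormedModule))]. }
  refine (cder_eq _ _ _ _ (cder_plus _ _ _ _ _ (cder_const v r)
    (cder_mult _ _ _ _ _ K (cder_const (u - v)%C r))) _).
  ring.
Qed.

Lemma seg_Cmod_lt u v w r d : 0 <= r <= 1 ->
  Cmod (u - w)%C < d -> Cmod (v - w)%C < d -> Cmod (seg u v r - w)%C < d.
Proof.
  intros Hr Hu Hv.
  replace (seg u v r - w)%C with (RtoC (1 - r) * (v - w) + RtoC r * (u - w))%C
    by (unfold seg; rewrite RtoC_minus; ring).
  eapply Rle_lt_trans; [apply Cmod_triangle|].
  rewrite !Cmod_mult, !Cmod_R, !Rabs_pos_eq by lra.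
  set (m := Rmax (Cmod (v - w)%C) (Cmod (u - w)%C)).
  assert (Hm : m < d) by now apply Rmax_lub_lt.
  assert (H1 := Rmult_le_compat_l (1 - r) _ m ltac:(lra) (Rmax_l _ (Cmod (u - w)%C))).
  assert (H2 := Rmult_le_compat_l r _ m ltac:(lra) (Rmax_r (Cmod (v - w)%C) _)).
  lra.
Qed.

(* A coordinate [S] of the upper half plane near [u0], with inverse [I] and convex image
   [Q], in which the differential of [X] is [Re (g ds)]. *)
Lemma chart_estimate (X : C -> R) (S I g : C -> C) (Q : C -> Prop) (u0 : C) :
  (forall u, 0 < Im u -> Q (S u) /\ I (S u) = u) ->
  (forall u v r, Q u -> Q v -> 0 <= r <= 1 -> Q (seg u v r)) ->
  (forall (s : R -> C) r ds, Q (s r) -> cder s r ds ->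
     is_derive (fun t => X (I (s t))) r (Re (g (s r) * ds)%C)) ->
  ccont (T := R2) g (S u0) -> ccont (T := R2) S u0 ->
  forall eps, 0 < eps -> exists d, 0 < d /\
    forall u v, 0 < Im u -> 0 < Im v -> Cmod (u - u0)%C < d -> Cmod (v - u0)%C < d ->
      Rabs (X u - X v - Re (g (S u0) * (S u - S v))%C) <= eps * Cmod (S u - S v)%C.
Proof.
  intros HQ Hc HX Hg HS eps He.
  destruct (ccont_C_eps g _ Hg eps He) as (d1 & Hd1 & K1).
  destruct (ccont_C_eps S _ HS d1 Hd1) as (d & Hd & K2).
  exists d. split; [exact Hd|]. intros u v Hu Hv Du Dv.
  destruct (HQ u Hu) as [Qu Iu]. destruct (HQ v Hv) as [Qv Iv].
  (* The linear part at [S u0] is subtracted before the mean value theorem is applied, so that the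
     remainder is bounded by the oscillation of g near [S u0]. *)
  assert (HM : forall r, 0 <= r <= 1 -> is_derive
    (fun r => X (I (seg (S u) (S v) r)) - r * Re (g (S u0) * (S u - S v))%C) r
    (Re (g (seg (S u) (S v) r) * (S u - S v))%C - Re (g (S u0) * (S u - S v))%C)).
  { intros r Hr. apply is_derive_Rminus.
    - apply HX; [now apply Hc|apply cder_seg].
    - apply (is_derive_eq _ _ (1 * Re (g (S u0) * (S u - S v))%C + r * 0)); [|ring].
      apply is_derive_Rmult; [apply (is_derive_id (K := R_AbsRing))
        |apply (is_derive_const (V := R_NormedModule))]. }
  destruct (MVT_01 _ _ HM) as (r & Hr & E).
  assert (E1 : seg (S u) (S v) 1 = S u) by (unfold seg; ring).
  assert (E0 : seg (S u) (S v) 0 = S v) by (unfold seg; ring).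
  rewrite E1, E0, Iu, Iv in E.
  replace (X u - X v - Re (g (S u0) * (S u - S v))%C)
    with (Re ((g (seg (S u) (S v) r) - g (S u0)) * (S u - S v))%C).
  2: { unfold Re in *; simpl in *. lra. }
  eapply Rle_trans; [apply re_le_Cmod|]. rewrite Cmod_mult.
  apply Rmult_le_compat_r; [apply Cmod_ge_0|].
  left. apply K1. apply seg_Cmod_lt; auto.
Qed.

Definition raise (u : C) (k : nat) : C := (Re u, Im u + / (INR k + 1)).

Lemma inv_INR_pos k : 0 < / (INR k + 1).
Proof. apply Rinv_0_lt_compat. generalize (pos_INR k). lra. Qed.

Lemma up_pos u k : 0 <= Im u -> 0 < Im (raise u k).
Proof. intros H. unfold raise. simpl. generalize (inv_INR_pos k). lra. Qed.

Lemma up_lim u d : 0 < d -> eventually (fun k => Cmod (raise u k - u)%C < d).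
Proof.
  intros Hd.
  destruct (archimed_cor1 d Hd) as (N & HN & HN0).
  exists N. intros k Hk.
  replace (raise u k - u)%C with (0, / (INR k + 1)).
  2: { unfold raise. apply Ceq_ext; unfold Re, Im; simpl; ring. }
  eapply Rle_lt_trans; [apply Cmod_le_abs|]. simpl.
  rewrite Rabs_R0, Rplus_0_l, Rabs_pos_eq by (left; apply inv_INR_pos).
  apply Rlt_trans with (/ INR N); [|exact HN].
  apply Rinv_lt_contravar.
  - apply Rmult_lt_0_compat; [now apply lt_0_INR|generalize (pos_INR k); lra].
  - generalize (le_INR _ _ Hk). lra.
Qed.

Lemma is_lim_seq_up (S : C -> C) (F : C -> R) u :
  continuous (T := R2) F u -> is_lim_seq (fun k => F (raise u k)) (F u).
Proof.
  intros H. apply is_lim_seq_spec. intros eps.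
  destruct (locally_C_elim _ _ (proj1 (ccont_real_lim (T := R2) F u) H eps (cond_pos eps)))
    as (d & Hd & K).
  refine (filter_imp _ _ _ (up_lim u d Hd)). intros k Hk. now apply K.
Qed.

Section Boundary.
Context (X : C -> R).

(** A two-point estimate for points of the open half plane close to u0. It does not mention a value
    of X at u0, which is what allows u0 to lie on the real axis. S is the identity at a regular
    point and the square root of u - p at a branch point. *)
Definition chart_at (u0 : C) (S : C -> C) (kap : C) : Prop :=
  (forall u, ccont (T := R2) S u) /\
  forall eps, 0 < eps -> exists d, 0 < d /\
    forall u v, 0 < Im u -> 0 < Im v -> Cmod (u - u0)%C < d -> Cmod (v - u0)%C < d ->
      Rabs (X u - X v - Re (kap * (S u - S v))%C) <= eps * Cmod (S u - S v)%C.

(* The boundary value, taken along the vertical line through [u]. *)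
Definition XH (u : C) : R := real (Lim_seq (fun k => X (raise u k))).

(** S is continuous at u, so the values of S along the vertical sequence are Cauchy; the two-point
    estimate carries this over to X. *)
Lemma XH_lim u S kap : 0 <= Im u -> chart_at u S kap ->
  is_lim_seq (fun k => X (raise u k)) (XH u).
Proof.
  intros Hu [HS H].
  assert (HC : ex_finite_lim_seq (fun k => X (raise u k))).
  { apply ex_lim_seq_cauchy_corr. intros eps.
    destruct (H 1 Rlt_0_1) as (d & Hd & K).
    set (M := Cmod kap + 1).
    assert (HM : 0 < M) by (generalize (Cmod_ge_0 kap); unfold M; lra).
    assert (He : 0 < eps / (2 * M)) by (apply Rdiv_lt_0_compat; [apply cond_pos|lra]).
    destruct (ccont_C_eps S u (HS u) _ He) as (d2 & Hd2 & K2).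
    destruct (filter_and _ _ (up_lim u d Hd) (up_lim u d2 Hd2)) as [N HN].
    exists N. intros n m Hn Hm.
    destruct (HN n Hn) as [A1 A2]. destruct (HN m Hm) as [B1 B2].
    specialize (K _ _ (up_pos u n Hu) (up_pos u m Hu) A1 B1).
    apply K2 in A2. apply K2 in B2.
    set (s := (S (raise u n) - S (raise u m))%C) in *.
    assert (Hs : Cmod s < eps / M).
    { replace s with ((S (raise u n) - S u) + - (S (raise u m) - S u))%C by (unfold s; ring).
      eapply Rle_lt_trans; [apply Cmod_triangle|]. rewrite Cmod_opp.
      replace (eps / M) with (eps / (2 * M) + eps / (2 * M)) by (field; lra). lra. }
    generalize (re_le_Cmod (kap * s)%C). rewrite Cmod_mult. intros K3.
    assert (K4 : M * Cmod s < eps).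
    { replace (pos eps) with (M * (eps / M)) by (field; lra). now apply Rmult_lt_compat_l. }
    replace (X (raise u n) - X (raise u m)) with
      ((X (raise u n) - X (raise u m) - Re (kap * s)%C) + Re (kap * s)%C) by ring.
    eapply Rle_lt_trans; [apply Rabs_triang|]. unfold M in K4. lra. }
  unfold XH. destruct HC as [l Hl]. rewrite (is_lim_seq_unique _ _ Hl). exact Hl.
Qed.

(** Both points are raised by the same amount and the weak inequality passes to the limit. A chart
    at every point of the closed half plane guarantees that the limits defining the boundary values
    exist. *)
Lemma XH_expansion u0 S kap :
  0 <= Im u0 -> chart_at u0 S kap ->
  (forall u, 0 <= Im u -> exists S' k', chart_at u S' k') ->
  forall eps, 0 < eps -> exists d, 0 < d /\
    forall u, 0 <= Im u -> Cmod (u - u0)%C < d ->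
      Rabs (XH u - XH u0 - Re (kap * (S u - S u0))%C) <= eps * Cmod (S u - S u0)%C.
Proof.
  intros H0 Hc Hall eps He.
  destruct Hc as [HS H]. destruct (H eps He) as (d & Hd & K).
  exists d. split; [exact Hd|]. intros u Hu Hdu.
  destruct (Hall u Hu) as (S' & k' & Hc').
  assert (L1 := XH_lim u S' k' Hu Hc').
  assert (L2 := XH_lim u0 S kap H0 (conj HS H)).
  destruct (HS u) as [C1 C2]. destruct (HS u0) as [C3 C4].
  assert (M : forall (F : C -> R) w, continuous (T := R2) F w ->
    is_lim_seq (fun k => F (raise w k)) (F w)) by (intros; now apply is_lim_seq_up).
  assert (LS : is_lim_seq (fun k => eps * Cmod (S (raise u k) - S (raise u0 k))%C
      - Rabs (X (raise u k) - X (raise u0 k) - Re (kap * (S (raise u k) - S (raise u0 k)))%C))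
      (eps * Cmod (S u - S u0)%C - Rabs (XH u - XH u0 - Re (kap * (S u - S u0))%C))).
  { assert (R1 := M (fun w => Re (S w)) u C1). assert (R2' := M (fun w => Im (S w)) u C2).
    assert (R3 := M (fun w => Re (S w)) u0 C3). assert (R4 := M (fun w => Im (S w)) u0 C4).
    cbv beta in R1, R2', R3, R4.
    assert (Da := is_lim_seq_minus' _ _ _ _ R1 R3).
    assert (Db := is_lim_seq_minus' _ _ _ _ R2' R4).
    apply is_lim_seq_minus'.
    - apply (is_lim_seq_scal_l _ eps (Finite _)).
      unfold Cmod. simpl.
      apply (is_lim_seq_continuous sqrt (fun k => _) _).
      + apply continuity_pt_filterlim, continuous_sqrt.
      + apply is_lim_seq_plus'; apply is_lim_seq_mult'; try assumption;
          apply is_lim_seq_mult'; try assumption; apply is_lim_seq_const.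
    - apply (is_lim_seq_abs _ (Finite _)).
      apply is_lim_seq_minus'; [now apply is_lim_seq_minus'|].
      simpl. apply is_lim_seq_minus'; apply (is_lim_seq_scal_l _ _ (Finite _)); assumption. }
  assert (G : Rbar_le 0 (Finite (eps * Cmod (S u - S u0)%C
      - Rabs (XH u - XH u0 - Re (kap * (S u - S u0))%C)))).
  { refine (is_lim_seq_le_loc (fun _ => 0) _ 0 _ _ (is_lim_seq_const 0) LS).
    assert (Hd' : 0 < d - Cmod (u - u0)%C) by lra.
    generalize (filter_and _ _ (up_lim u _ Hd') (up_lim u0 _ Hd)). apply filter_imp.
    intros k [A B].
    specialize (K _ _ (up_pos u k Hu) (up_pos u0 k H0)).
    apply Rle_minus_r. rewrite Rplus_0_l. apply K; [|exact B].
    replace (raise u k - u0)%C with ((raise u k - u) + (u - u0))%C by ring.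
    eapply Rle_lt_trans; [apply Cmod_triangle|]. lra. }
  unfold Rbar_le in G. lra.
Qed.

End Boundary.

(** * Hyperelliptic integrals *)

Lemma YU_split iota l1 p l2 u :
  YU iota (l1 ++ p :: l2) u = (hsqrt (u - RtoC p) * YU iota (l1 ++ l2) u)%C.
Proof.
  induction l1 as [|q l1 IH]; [reflexivity|]. simpl. rewrite IH. ring.
Qed.

Fixpoint Qp (ps : list R) (u : C) : C :=
  match ps with nil => RtoC 1 | p :: l => ((u - RtoC p) * Qp l u)%C end.

Fixpoint Qd (ps : list R) (u : C) : C :=
  match ps with nil => RtoC 0 | p :: l => (Qp l u + (u - RtoC p) * Qd l u)%C end.

Lemma Qp_split l1 p l2 u : Qp (l1 ++ p :: l2) u = ((u - RtoC p) * Qp (l1 ++ l2) u)%C.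
Proof. induction l1 as [|q l1 IH]; [reflexivity|]. simpl. rewrite IH. ring. Qed.

Lemma Qd_split l1 p l2 : Qd (l1 ++ p :: l2) (RtoC p) = Qp (l1 ++ l2) (RtoC p).
Proof.
  assert (H : forall l1 u, Qd (l1 ++ p :: l2) u = (Qp (l1 ++ l2) u + (u - RtoC p) * Qd (l1 ++ l2) u)%C).
  { clear l1. induction l1 as [|q l1 IH]; intros u; [reflexivity|].
    simpl. rewrite IH, Qp_split. ring. }
  rewrite H. ring.
Qed.

Lemma YU_sqr iota ps u : 0 <= Im u -> (YU iota ps u * YU iota ps u = iota * iota * Qp ps u)%C.
Proof.
  intros H. induction ps as [|p l IH]; [simpl; ring|]. simpl.
  transitivity ((hsqrt (u - RtoC p) * hsqrt (u - RtoC p)) * (YU iota l u * YU iota l u))%C; [ring|].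
  rewrite IH, hsqrt_sqr by (now rewrite Im_minus_R). ring.
Qed.

Section Hyperelliptic.
Context (iota : C) (Hiota : iota <> RtoC 0) (ps : list R) (Hps : NoDup ps) (mu c : R).

Definition numer (u : C) : C := (RtoC mu * (u - RtoC c))%C.
Definition fU (u : C) : C := (numer u / YU iota ps u)%C.
Definition XU (u : C) : R := hp_primitive fU (Re u) (Im u).

Lemma numer_cont u : ccont (T := R2) numer u.
Proof. apply ccont_mult; [apply ccont_const|apply ccont_minus; [apply ccont_id|apply ccont_const]]. Qed.

Lemma upper_not_real (u : C) (p : R) : 0 < Im u -> u <> RtoC p.
Proof. intros H E. rewrite E in H. simpl in H. lra. Qed.

Lemma fU_diff : exists D : C -> C, forall u, 0 < Im u ->
  cdiff fU u (D u) /\ ccont (T := R2) D u.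
Proof.
  destruct (YU_cdiff iota ps) as [D HD].
  exists (fun u => RtoC mu * / YU iota ps u + numer u * (- D u / (YU iota ps u * YU iota ps u)))%C.
  intros u Hu. destruct (HD u Hu) as [H1 H2].
  assert (H0 : YU iota ps u <> RtoC 0)
    by (apply YU_neq0; [exact Hiota|]; intros p _; now apply upper_not_real).
  split.
  - refine (cdiff_mult numer (fun u => / YU iota ps u)%C u (RtoC mu) _ _ (cdiff_inv _ u _ H1 H0)).
    refine (cdiff_eq _ _ _ _ (cdiff_mult _ _ u _ _ (cdiff_const (RtoC mu) u)
      (cdiff_plus _ _ u _ _ (cdiff_id u) (cdiff_const (- RtoC c)%C u))) _).
    ring.
  - apply ccont_plus; apply ccont_mult; try apply numer_cont; try apply ccont_const.
    + apply ccont_inv; [apply YU_cont|exact H0].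
    + apply ccont_div; [now apply ccont_opp| |now apply Cmult_neq_0].
      apply ccont_mult; apply YU_cont.
Qed.

Lemma XU_path (g : R -> C) t dg : 0 < Im (g t) -> cder g t dg ->
  is_derive (fun s => XU (g s)) t (Re (fU (g t) * dg)%C).
Proof.
  intros H K. destruct fU_diff as [D HD]. exact (hp_primitive_path fU D HD g t dg H K).
Qed.

Lemma chart_regular u0 : 0 <= Im u0 -> (forall p, In p ps -> u0 <> RtoC p) ->
  chart_at XU u0 (fun u => u) (fU u0).
Proof.
  intros H0 Hn. split; [apply ccont_id|].
  apply (chart_estimate XU (fun u => u) (fun u => u) fU (fun u => 0 < Im u)).
  - auto.
  - intros u v r Hu Hv Hr. unfold seg, Im in *; simpl in *.
    destruct (Req_dec r 0) as [->|Hr0]; [lra|].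
    assert (0 < r * snd u) by (apply Rmult_lt_0_compat; lra).
    assert (0 <= (1 - r) * snd v) by (apply Rmult_le_pos; lra). lra.
  - intros s r ds Hs Hds. now apply XU_path.
  - apply ccont_div; [apply numer_cont|apply YU_cont|now apply YU_neq0].
  - apply ccont_id.
Qed.

(** In s = sqrt (u - p) one has du = 2 s ds, and s cancels the factor of [YU] that vanishes at p;
    the remaining coefficient is continuous at s = 0. The upper half plane becomes the open first
    quadrant, which is convex as the mean value argument requires. *)
Lemma chart_branch l1 p l2 : ps = l1 ++ p :: l2 ->
  chart_at XU (RtoC p) (fun u => hsqrt (u - RtoC p)%C)
    (2 * numer (RtoC p) / YU iota (l1 ++ l2) (RtoC p))%C.
Proof.
  intros Eps.
  assert (Hno : forall q, In q (l1 ++ l2) -> RtoC p <> RtoC q).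
  { intros q Hq E. apply RtoC_inj in E. subst q. rewrite Eps in Hps.
    now apply (NoDup_remove_2 _ _ _ Hps). }
  assert (HS : forall u, ccont (T := R2) (fun u : C => hsqrt (u - RtoC p)%C) u).
  { intros u. refine (ccont_comp (T := R2) hsqrt (fun u : C => (u - RtoC p)%C) u (hsqrt_cont _) _).
    apply ccont_minus; [apply ccont_id|apply ccont_const]. }
  assert (S0 : hsqrt (RtoC p - RtoC p)%C = RtoC 0).
  { replace (RtoC p - RtoC p)%C with (RtoC 0) by ring. rewrite hsqrt_Rpos by lra. now rewrite sqrt_0. }
  split; [exact HS|].
  set (I := fun s : C => (RtoC p + s * s)%C).
  set (g := fun s : C => (2 * numer (I s) / YU iota (l1 ++ l2) (I s))%C).
  assert (I0 : I (RtoC 0) = RtoC p) by (unfold I; ring).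
  replace (2 * numer (RtoC p) / YU iota (l1 ++ l2) (RtoC p))%C
    with (g (hsqrt (RtoC p - RtoC p)%C)) by (unfold g; now rewrite S0, I0).
  assert (HI : forall s, ccont (T := R2) I s).
  { intros s. apply ccont_plus; [apply ccont_const|]. apply ccont_mult; apply ccont_id. }
  apply (chart_estimate XU (fun u => hsqrt (u - RtoC p)%C) I g (fun s => 0 < Re s /\ 0 < Im s)).
  - intros u Hu. assert (Hp : 0 < Im (u - RtoC p)%C) by now rewrite Im_minus_R.
    split; [now apply hsqrt_pos|]. unfold I. rewrite hsqrt_sqr by lra. ring.
  - intros u v r [Hu1 Hu2] [Hv1 Hv2] Hr. unfold seg, Re, Im in *; simpl in *.
    destruct (Req_dec r 0) as [->|Hr0]; [lra|].
    assert (0 < r * snd u) by (apply Rmult_lt_0_compat; lra).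
    assert (0 <= (1 - r) * snd v) by (apply Rmult_le_pos; lra).
    assert (0 < r * fst u) by (apply Rmult_lt_0_compat; lra).
    assert (0 <= (1 - r) * fst v) by (apply Rmult_le_pos; lra). lra.
  - intros s r ds [Hs1 Hs2] Hds.
    assert (HIm : 0 < Im (I (s r))).
    { unfold I, Re, Im in *; simpl in *.
      assert (0 < fst (s r) * snd (s r)) by (apply Rmult_lt_0_compat; lra). lra. }
    assert (Hd : cder (fun t => I (s t)) r (2 * s r * ds)%C).
    { refine (cder_eq _ _ _ _ (cder_plus _ _ _ _ _ (cder_const (RtoC p) r) (cder_mult _ _ _ _ _ Hds Hds)) _).
      ring. }
    refine (is_derive_eq _ _ _ _ (XU_path _ r _ HIm Hd) _). f_equal.
    unfold fU, g. rewrite Eps, YU_split.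
    replace (I (s r) - RtoC p)%C with (s r * s r)%C by (unfold I; ring).
    rewrite hsqrt_of_sqr by lra.
    field. split.
    + apply YU_neq0; [exact Hiota|]. intros q _. now apply upper_not_real.
    + intros E. rewrite E in Hs1. simpl in Hs1. lra.
  - rewrite S0. apply ccont_div.
    + apply ccont_mult; [apply ccont_const|].
      apply (ccont_comp (T := R2)); [apply numer_cont|apply HI].
    + apply (ccont_comp (T := R2)); [apply YU_cont|apply HI].
    + rewrite I0. now apply YU_neq0.
  - apply HS.
Qed.

Lemma branch_dec u : {p | In p ps /\ u = RtoC p} + {forall p, In p ps -> u <> RtoC p}.
Proof.
  induction ps as [|q l IH]; [right; intros p []|].
  destruct (Ceq_dec u (RtoC q)) as [E|E].
  - left. exists q. split; [now left|exact E].
  - destruct IH as [(p & H1 & H2)|H].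
    + now inversion Hps.
    + left. exists p. split; [now right|exact H2].
    + right. intros p [<-|Hp]; auto.
Qed.

Lemma chart_exists u : 0 <= Im u -> exists S k, chart_at XU u S k.
Proof.
  intros Hu. destruct (branch_dec u) as [(p & Hp & ->)|Hn].
  - apply in_split in Hp. destruct Hp as (l1 & l2 & E).
    eexists; eexists; exact (chart_branch l1 p l2 E).
  - eexists; eexists; exact (chart_regular u Hu Hn).
Qed.

Definition XB (u : C) : R := XH XU u.

Lemma XB_regular u0 : 0 <= Im u0 -> (forall p, In p ps -> u0 <> RtoC p) ->
  forall eps, 0 < eps -> exists d, 0 < d /\
    forall u, 0 <= Im u -> Cmod (u - u0)%C < d ->
      Rabs (XB u - XB u0 - Re (fU u0 * (u - u0))%C) <= eps * Cmod (u - u0)%C.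
Proof.
  intros H0 Hn. exact (XH_expansion XU u0 (fun u => u) _ H0 (chart_regular u0 H0 Hn) chart_exists).
Qed.

Lemma XB_branch l1 p l2 : ps = l1 ++ p :: l2 ->
  forall eps, 0 < eps -> exists d, 0 < d /\
    forall u, 0 <= Im u -> Cmod (u - RtoC p)%C < d ->
      Rabs (XB u - XB (RtoC p)
            - Re (2 * numer (RtoC p) / YU iota (l1 ++ l2) (RtoC p) * hsqrt (u - RtoC p))%C)
      <= eps * Cmod (hsqrt (u - RtoC p)%C).
Proof.
  intros E eps He.
  destruct (XH_expansion XU (RtoC p) _ _ ltac:(simpl; lra) (chart_branch l1 p l2 E) chart_exists eps He)
    as (d & Hd & K).
  exists d. split; [exact Hd|]. intros u Hu Hdu. specialize (K u Hu Hdu). cbv beta in K.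
  assert (S0 : hsqrt (RtoC p - RtoC p)%C = RtoC 0).
  { replace (RtoC p - RtoC p)%C with (RtoC 0) by ring. rewrite hsqrt_Rpos by lra. now rewrite sqrt_0. }
  rewrite S0 in K.
  replace (hsqrt (u - RtoC p) - RtoC 0)%C with (hsqrt (u - RtoC p)) in K by ring.
  exact K.
Qed.

Definition Xreal (x : R) : R := XB (RtoC x).

Lemma Xreal_derive x : ~ In x ps -> is_derive Xreal x (Re (fU (RtoC x))).
Proof.
  intros Hx. apply is_derive_eps. intros eps He.
  destruct (XB_regular (RtoC x) ltac:(simpl; lra)
    ltac:(intros p Hp E; apply RtoC_inj in E; now subst) eps He) as (d & Hd & K).
  exists d. split; [exact Hd|]. intros y Hy.
  specialize (K (RtoC y) ltac:(simpl; lra)).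
  rewrite <- RtoC_minus, Cmod_R in K. specialize (K Hy).
  unfold Xreal.
  replace (Re (fU (RtoC x)) * (y - x)) with (Re (fU (RtoC x) * RtoC (y - x))%C)
    by (unfold Re; simpl; ring).
  exact K.
Qed.

Lemma Xreal_cont x : continuous Xreal x.
Proof.
  destruct (in_dec Req_EM_T x ps) as [Hp|Hn].
  - apply in_split in Hp. destruct Hp as (l1 & l2 & E).
    apply (ccont_real_lim (T := R_UniformSpace)). intros eps He.
    set (k := (2 * numer (RtoC x) / YU iota (l1 ++ l2) (RtoC x))%C).
    destruct (XB_branch l1 x l2 E 1 Rlt_0_1) as (d & Hd & K). fold k in K.
    set (M := Cmod k + 1).
    assert (HM : 0 < M) by (generalize (Cmod_ge_0 k); unfold M; lra).
    apply locally_R. exists (Rmin d ((eps / M) * (eps / M))).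
    assert (HeM : 0 < eps / M) by (apply Rdiv_lt_0_compat; lra).
    split; [apply Rmin_pos; [exact Hd|now apply Rmult_lt_0_compat]|].
    intros y Hy. specialize (K (RtoC y) ltac:(simpl; lra)).
    set (s := hsqrt (RtoC y - RtoC x)%C) in *.
    assert (Es : Cmod s * Cmod s = Rabs (y - x))
      by (unfold s; rewrite Cmod_hsqrt, <- RtoC_minus, Cmod_R; reflexivity).
    rewrite <- RtoC_minus, Cmod_R in K.
    specialize (K (Rlt_le_trans _ _ _ Hy (Rmin_l _ _))).
    assert (Hs : Cmod s < eps / M).
    { apply Rsqr_incrst_0; [|apply Cmod_ge_0|lra]. unfold Rsqr. rewrite Es.
      eapply Rlt_le_trans; [exact Hy|apply Rmin_r]. }
    generalize (re_le_Cmod (k * s)%C). rewrite Cmod_mult. intros K3.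
    assert (K4 : M * Cmod s < eps).
    { replace eps with (M * (eps / M)) by (field; lra). now apply Rmult_lt_compat_l. }
    unfold Xreal.
    replace (XB (RtoC y) - XB (RtoC x)) with
      ((XB (RtoC y) - XB (RtoC x) - Re (k * s)%C) + Re (k * s)%C) by ring.
    eapply Rle_lt_trans; [apply Rabs_triang|]. unfold M in K4. lra.
  - apply (ex_derive_continuous (V := R_NormedModule)). eexists. now apply Xreal_derive.
Qed.

End Hyperelliptic.

(** * Circle-valued lifts to the curve *)

Definition cis (x : R) : C := (cos x, sin x).

Lemma cis_plus x y : cis (x + y) = (cis x * cis y)%C.
Proof. unfold cis, Cmult; simpl. rewrite cos_plus, sin_plus. f_equal; ring. Qed.

Lemma cis_0 : cis 0 = RtoC 1.
Proof. unfold cis. now rewrite cos_0, sin_0. Qed.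

Lemma Cmod_cis x : Cmod (cis x) = 1.
Proof.
  unfold Cmod, cis; simpl. transitivity (sqrt 1); [f_equal|apply sqrt_1].
  generalize (sin2_cos2 x). unfold Rsqr. lra.
Qed.

Lemma cis_opp_inv x : (cis x * cis (- x))%C = RtoC 1.
Proof. rewrite <- cis_plus. replace (x + - x) with 0 by ring. apply cis_0. Qed.

Lemma sin_kPI_Z (k : Z) : sin (IZR k * PI) = 0.
Proof. apply sin_eq_0_1. now exists k. Qed.

Lemma cis_kPI (k : Z) : cis (- (IZR k * PI)) = cis (IZR k * PI).
Proof. unfold cis. rewrite cos_neg, sin_neg, sin_kPI_Z. f_equal. ring. Qed.

Lemma cis_cder (g : R -> R) t dg :
  is_derive g t dg -> cder (fun s => cis (g s)) t (Ci * RtoC dg * cis (g t))%C.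
Proof.
  intros H. split; simpl.
  - apply (is_derive_eq _ _ (dg * (- sin (g t)))); [|ring].
    apply (is_derive_comp cos g t); [apply is_derive_cos|exact H].
  - apply (is_derive_eq _ _ (dg * cos (g t))); [|ring].
    apply (is_derive_comp sin g t); [apply is_derive_sin|exact H].
Qed.

Lemma cis_approx eps : 0 < eps -> exists d, 0 < d /\ forall x, Rabs x < d ->
  Cmod (cis x - 1 - Ci * RtoC x)%C <= eps * Rabs x.
Proof.
  intros He.
  assert (K := cis_cder (fun s => s) 0 1 (is_derive_id (K := R_AbsRing) 0)).
  destruct (proj1 (cder_eps _ _ _) K eps He) as (d & Hd & H).
  exists d. split; [exact Hd|]. intros x Hx. specialize (H x).
  rewrite Rminus_0_r in H. specialize (H Hx). cbv beta in H. rewrite cis_0 in H.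
  replace (Ci * RtoC x)%C with (Ci * RtoC 1 * RtoC 1 * RtoC x)%C by ring. exact H.
Qed.

Lemma Cconj_mult a b : Cconj (a * b) = (Cconj a * Cconj b)%C.
Proof. apply Ceq_ext; unfold Re, Im; simpl; ring. Qed.

Lemma Cconj_plus a b : Cconj (a + b) = (Cconj a + Cconj b)%C.
Proof. apply Ceq_ext; unfold Re, Im; simpl; ring. Qed.

Lemma Cconj_minus a b : Cconj (a - b) = (Cconj a - Cconj b)%C.
Proof. apply Ceq_ext; unfold Re, Im; simpl; ring. Qed.

Lemma Cconj_inv a : Cconj (/ a) = (/ Cconj a)%C.
Proof.
  unfold Cinv, Cconj; simpl.
  f_equal; unfold Rdiv; [f_equal|rewrite Ropp_mult_distr_l; f_equal]; f_equal; ring.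
Qed.

Lemma Cconj_R x : Cconj (RtoC x) = RtoC x.
Proof. apply Ceq_ext; unfold Re, Im; simpl; ring. Qed.

Lemma Cconj_conj' a : Cconj (Cconj a) = a.
Proof. apply Ceq_ext; unfold Re, Im; simpl; ring. Qed.

Lemma Cconj_eq0 a : Cconj a = RtoC 0 -> a = RtoC 0.
Proof. intros H. rewrite <- (Cconj_conj' a), H. apply Cconj_R. Qed.

Lemma Qp_conj ps u : Qp ps (Cconj u) = Cconj (Qp ps u).
Proof.
  induction ps as [|p l IH]; simpl; [now rewrite Cconj_R|].
  rewrite IH, Cconj_mult, Cconj_minus, Cconj_R. reflexivity.
Qed.

Lemma Qd_conj ps u : Qd ps (Cconj u) = Cconj (Qd ps u).
Proof.
  induction ps as [|p l IH]; simpl; [now rewrite Cconj_R|].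
  rewrite IH, Qp_conj, Cconj_plus, Cconj_mult, Cconj_minus, Cconj_R. reflexivity.
Qed.

Lemma Csqr_eq (a b : C) : (a * a = b * b)%C -> a = b \/ a = (- b)%C.
Proof.
  intros H. destruct (Ceq_dec (a - b)%C (RtoC 0)) as [E|E].
  - left. rewrite <- (Cplus_0_r b), <- E. ring.
  - right. destruct (Ceq_dec (a + b)%C (RtoC 0)) as [E'|E'].
    + transitivity ((a + b) - b)%C; [ring|]. rewrite E'. ring.
    + exfalso. apply (Cmult_neq_0 _ _ E E').
      transitivity (a * a - b * b)%C; [ring|]. rewrite H. ring.
Qed.

Section Lift.
Context (iota : C) (Hiota : iota <> RtoC 0) (ps : list R) (Hps : NoDup ps) (mu c : R).
Context (eta : R) (Heta : (iota * iota)%C = RtoC eta).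
Context (om x0 : R).
Context (Hper : forall x, eta * Re (Qp ps (RtoC x)) <= 0 ->
  exists k : Z, om * (Xreal iota ps mu c x - x0) = IZR k * PI).

Notation Y_U := (YU iota ps).
Notation X_B := (XB iota ps mu c).
Notation num := (numer mu c).

Definition curve (u Y : C) : Prop := (Y * Y)%C = (RtoC eta * Qp ps u)%C.

Definition theta (u : C) : R := om * (X_B u - x0).

Definition lift_up (u Y : C) : C :=
  if Ceq_dec Y (Y_U u) then cis (theta u) else cis (- theta u).

(* The circle-valued function [exp (i om (X - x0))] on the curve; the integral changes sign
   with the sheet, and complex conjugation carries the lower half plane to the upper one. *)
Definition lift (u Y : C) : C :=
  if Rle_dec 0 (Im u) then lift_up u Y else lift_up (Cconj u) (Cconj Y).

Lemma curve_conj u Y : curve u Y -> curve (Cconj u) (Cconj Y).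
Proof.
  unfold curve. intros H. rewrite <- Cconj_mult, H, Cconj_mult, Cconj_R, Qp_conj. reflexivity.
Qed.

Lemma curve_YU u Y : 0 <= Im u -> curve u Y -> Y = Y_U u \/ Y = (- Y_U u)%C.
Proof.
  intros Hu H. apply Csqr_eq. rewrite YU_sqr, Heta by exact Hu. exact H.
Qed.

Lemma Qp_R_real (l : list R) x : Im (Qp l (RtoC x)) = 0.
Proof.
  induction l as [|p l IH]; [reflexivity|].
  unfold Im, Re in *; simpl in *. rewrite IH. ring.
Qed.

Lemma root_of_YU u : 0 <= Im u -> Y_U u = RtoC 0 -> exists p, In p ps /\ u = RtoC p.
Proof.
  intros Hu H. destruct (branch_dec ps Hps u) as [(p & H1 & H2)|Hn].
  - now exists p.
  - exfalso. now apply (YU_neq0 iota Hiota ps u Hn).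
Qed.

Lemma theta_real x : eta * Re (Qp ps (RtoC x)) <= 0 -> cis (- theta (RtoC x)) = cis (theta (RtoC x)).
Proof.
  intros H. destruct (Hper x H) as [k Hk]. unfold theta. fold (Xreal iota ps mu c x).
  rewrite Hk. apply cis_kPI.
Qed.

Lemma theta_branch u : 0 <= Im u -> Y_U u = RtoC 0 -> cis (- theta u) = cis (theta u).
Proof.
  intros Hu H. destruct (root_of_YU u Hu H) as (p & Hp & ->).
  apply theta_real.
  assert (E : (RtoC eta * Qp ps (RtoC p))%C = RtoC 0)
    by (rewrite <- Heta, <- YU_sqr by exact Hu; rewrite H; ring).
  apply (f_equal Re) in E. unfold Re in *; simpl in *. lra.
Qed.

Lemma lift_upper u : 0 <= Im u -> lift u (Y_U u) = cis (theta u).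
Proof.
  intros Hu. unfold lift, lift_up. destruct (Rle_dec 0 (Im u)); [|contradiction].
  destruct (Ceq_dec (Y_U u) (Y_U u)); [reflexivity|congruence].
Qed.

Lemma lift_upper_opp u : 0 <= Im u -> lift u (- Y_U u)%C = cis (- theta u).
Proof.
  intros Hu. unfold lift, lift_up. destruct (Rle_dec 0 (Im u)); [|contradiction].
  destruct (Ceq_dec (- Y_U u)%C (Y_U u)) as [E|E]; [|reflexivity].
  symmetry. apply theta_branch; [exact Hu|].
  assert (E2 : (2 * Y_U u)%C = RtoC 0) by (transitivity (Y_U u - - Y_U u)%C; [ring|rewrite E; ring]).
  destruct (Ceq_dec (Y_U u) (RtoC 0)) as [|N]; [assumption|].
  exfalso. refine (Cmult_neq_0 _ _ _ N E2). intros K. apply RtoC_inj in K. lra.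
Qed.

(** The critical case is u real. Where eta Q(u) < 0 the value Y is imaginary, so conjugation fixes u
    and exchanges the sheets, and the lift is consistent only if cis theta = cis (- theta), that is,
    if theta lies in PI Z; this is what [Hper] provides. Where eta Q(u) > 0 the value Y is real and
    conjugation fixes the point. *)
Lemma lift_conj u Y : curve u Y -> lift (Cconj u) (Cconj Y) = lift u Y.
Proof.
  intros H.
  destruct (Rtotal_order (Im u) 0) as [Hl|[H0|Hg]].
  - unfold lift. destruct (Rle_dec 0 (Im u)); [lra|].
    destruct (Rle_dec 0 (Im (Cconj u))) as [|N]; [reflexivity|].
    exfalso. apply N. unfold Im in *; simpl; lra.
  - assert (Eu : u = RtoC (Re u)) by (apply Ceq_ext; unfold Re, Im in *; simpl; auto).
    assert (Ec : Cconj u = u) by (rewrite Eu; apply Cconj_R).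
    rewrite Ec.
    destruct (Ceq_dec (Cconj Y) Y) as [E|E]; [now rewrite E|].
    assert (Hs : cis (- theta u) = cis (theta u)).
    { rewrite Eu. apply theta_real. rewrite <- Eu.
      assert (HY := H). unfold curve in HY. rewrite Eu in HY.
      assert (Q0 := Qp_R_real ps (Re u)). rewrite <- Eu in HY, Q0.
      assert (H1 := f_equal Re HY). assert (H2 := f_equal Im HY).
      assert (HI : snd Y <> 0).
      { intros Z. apply E. apply Ceq_ext; unfold Re, Im; simpl; [reflexivity|rewrite Z; ring]. }
      unfold Re, Im in *; simpl in *. rewrite Q0 in *.
      assert (fst Y = 0).
      { assert (fst Y * snd Y = 0) by lra. destruct (Rmult_integral _ _ H3); [assumption|contradiction]. }
      nra. }
    assert (Hall : forall Z, curve u Z -> lift u Z = cis (theta u)).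
    { intros Z HZ. destruct (curve_YU u Z ltac:(lra) HZ) as [->| ->].
      - apply lift_upper. lra.
      - rewrite lift_upper_opp by lra. exact Hs. }
    rewrite !Hall; auto. rewrite <- Ec. now apply curve_conj.
  - unfold lift. destruct (Rle_dec 0 (Im u)); [|lra].
    destruct (Rle_dec 0 (Im (Cconj u))) as [N|].
    { exfalso. unfold Im in *; simpl in N; lra. }
    now rewrite !Cconj_conj'.
Qed.

Lemma Cmod_lift u Y : Cmod (lift u Y) = 1.
Proof.
  unfold lift, lift_up. destruct (Rle_dec 0 (Im u)), (Ceq_dec _ _); apply Cmod_cis.
Qed.

(** The form num du / Y at (u0, Y0), applied to the increment of a local coordinate. At a branch
    point this coordinate is Y, and 2 Y dY = eta Q'(u) du gives num du / Y = 2 num dY / (eta Q'). *)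
Definition lin (u0 Y0 u Y : C) : C :=
  if Ceq_dec Y0 (RtoC 0) then (2 * num u0 / (RtoC eta * Qd ps u0) * Y)%C
  else (num u0 / Y0 * (u - u0))%C.

Lemma lin_conj u0 Y0 u Y :
  lin (Cconj u0) (Cconj Y0) (Cconj u) (Cconj Y) = Cconj (lin u0 Y0 u Y).
Proof.
  assert (En : num (Cconj u0) = Cconj (num u0))
    by (unfold numer; rewrite Cconj_mult, Cconj_minus, !Cconj_R; reflexivity).
  unfold lin. destruct (Ceq_dec Y0 (RtoC 0)) as [E|E].
  - destruct (Ceq_dec (Cconj Y0) (RtoC 0)) as [_|N];
      [|exfalso; apply N; rewrite E; apply Cconj_R].
    unfold Cdiv. rewrite En, Qd_conj, !Cconj_mult, Cconj_inv, !Cconj_mult, !Cconj_R. reflexivity.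
  - destruct (Ceq_dec (Cconj Y0) (RtoC 0)) as [N|_]; [exfalso; apply E; now apply Cconj_eq0|].
    unfold Cdiv. rewrite En, !Cconj_mult, Cconj_inv, Cconj_minus. reflexivity.
Qed.

(** The increment is expressed as a factor [cis (om * r)] with r real, so no branch of the logarithm
    has to be chosen. P serves to restrict the points to one side of the real axis. *)
Definition first_order (u0 Y0 : C) (P : C -> Prop) : Prop :=
  forall eps, 0 < eps -> exists d, 0 < d /\
    forall u Y, P u -> curve u Y -> Cmod (u - u0)%C < d -> Cmod (Y - Y0)%C < d ->
      exists r, lift u Y = (lift u0 Y0 * cis (om * r))%C /\
        Rabs (r - Re (lin u0 Y0 u Y)) <= eps * (Cmod (u - u0)%C + Cmod (Y - Y0)%C).

Lemma eps_weaken a eps m n : a <= eps * m -> 0 < eps -> 0 <= n -> a <= eps * (m + n).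
Proof. intros. assert (0 <= eps * n) by (apply Rmult_le_pos; lra). lra. Qed.

(** A point on the opposite sheet would make 2 Y0 a sum of two terms smaller than |Y0| / 2, so the
    sheet is locally constant away from Y = 0. *)
Lemma sheet_regular u0 Y0 : 0 <= Im u0 -> curve u0 Y0 -> Y0 <> RtoC 0 ->
  exists sg : R, (sg = 1 \/ sg = -1) /\ Y0 = (RtoC sg * Y_U u0)%C /\
    exists d, 0 < d /\ forall u Y, 0 <= Im u -> curve u Y ->
      Cmod (u - u0)%C < d -> Cmod (Y - Y0)%C < d -> Y = (RtoC sg * Y_U u)%C.
Proof.
  intros H0 Hc HY.
  assert (K : exists sg : R, (sg = 1 \/ sg = -1) /\ Y0 = (RtoC sg * Y_U u0)%C).
  { destruct (curve_YU u0 Y0 H0 Hc) as [E|E]; [exists 1|exists (-1)]; (split; [tauto|]);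
      rewrite E; apply Ceq_ext; unfold Re, Im; simpl; ring. }
  destruct K as (sg & Hsg & E). exists sg. split; [exact Hsg|]. split; [exact E|].
  assert (Hp : 0 < Cmod Y0 / 2) by (assert (0 < Cmod Y0) by (now apply Cmod_gt_0); lra).
  destruct (ccont_C_eps Y_U u0 (YU_cont iota ps u0) _ Hp) as (d & Hd & K).
  exists (Rmin d (Cmod Y0 / 2)). split; [now apply Rmin_pos|].
  intros u Y Hu HuY D1 D2.
  specialize (K u (Rlt_le_trans _ _ _ D1 (Rmin_l _ _))).
  assert (D3 := Rlt_le_trans _ _ _ D2 (Rmin_r _ _)).
  assert (Hs : Cmod (RtoC sg) = 1).
  { rewrite Cmod_R. destruct Hsg as [-> | ->]; [rewrite Rabs_pos_eq|rewrite Rabs_left]; lra. }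
  assert (Habs : Y = (- (RtoC sg * Y_U u))%C -> False).
  { intros E'. assert (E2 : (2 * Y0 = - (Y - Y0) - RtoC sg * (Y_U u - Y_U u0))%C)
      by (rewrite E', E; ring).
    assert (E3 : Cmod (2 * Y0)%C = 2 * Cmod Y0) by (rewrite Cmod_mult, Cmod_R, Rabs_pos_eq; lra).
    rewrite E2 in E3. unfold Cminus at 1 in E3.
    generalize (Cmod_triangle (- (Y - Y0))%C (- (RtoC sg * (Y_U u - Y_U u0)))%C).
    rewrite !Cmod_opp, Cmod_mult, Hs. lra. }
  destruct (curve_YU u Y Hu HuY) as [E'|E']; destruct Hsg as [-> | ->].
  - rewrite E'. ring.
  - exfalso. apply Habs. rewrite E'. apply Ceq_ext; unfold Re, Im; simpl; ring.
  - exfalso. apply Habs. rewrite E'. ring.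
  - rewrite E'. apply Ceq_ext; unfold Re, Im; simpl; ring.
Qed.

Lemma lift_sheet sg u : (sg = 1 \/ sg = -1) -> 0 <= Im u ->
  lift u (RtoC sg * Y_U u)%C = cis (sg * theta u).
Proof.
  intros [-> | ->] Hu.
  - rewrite Rmult_1_l, Cmult_1_l. now apply lift_upper.
  - replace (RtoC (-1) * Y_U u)%C with (- Y_U u)%C by (apply Ceq_ext; unfold Re, Im; simpl; ring).
    replace (-1 * theta u) with (- theta u) by ring. now apply lift_upper_opp.
Qed.

Lemma first_order_regular u0 Y0 : 0 <= Im u0 -> curve u0 Y0 -> Y0 <> RtoC 0 ->
  first_order u0 Y0 (fun u => 0 <= Im u).
Proof.
  intros H0 Hc HY eps He.
  destruct (sheet_regular u0 Y0 H0 Hc HY) as (sg & Hsg & E0 & d1 & Hd1 & K1).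
  assert (HYU : Y_U u0 <> RtoC 0) by (intros E; apply HY; rewrite E0, E; ring).
  assert (Hn : forall p, In p ps -> u0 <> RtoC p).
  { intros p Hp ->. apply HYU. apply in_split in Hp. destruct Hp as (l1 & l2 & ->).
    rewrite YU_split. replace (RtoC p - RtoC p)%C with (RtoC 0) by ring.
    rewrite hsqrt_Rpos, sqrt_0 by lra. ring. }
  destruct (XB_regular iota Hiota ps Hps mu c u0 H0 Hn eps He) as (d2 & Hd2 & K2).
  exists (Rmin d1 d2). split; [now apply Rmin_pos|].
  intros u Y Hu HuY D1 D2.
  assert (EY := K1 u Y Hu HuY (Rlt_le_trans _ _ _ D1 (Rmin_l _ _)) (Rlt_le_trans _ _ _ D2 (Rmin_l _ _))).
  specialize (K2 u Hu (Rlt_le_trans _ _ _ D1 (Rmin_r _ _))).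
  exists (sg * (X_B u - X_B u0)). split.
  - rewrite E0, EY, !lift_sheet, <- cis_plus by assumption. f_equal. unfold theta. ring.
  - apply eps_weaken; [|exact He|apply Cmod_ge_0]. eapply Rle_trans; [|exact K2].
    unfold lin. destruct (Ceq_dec Y0 (RtoC 0)) as [|_]; [contradiction|].
    assert (Hss : sg * sg = 1) by (destruct Hsg as [-> | ->]; ring).
    assert (E : (num u0 / Y0 * (u - u0))%C = (RtoC sg * (fU iota ps mu c u0 * (u - u0)))%C).
    { unfold fU. rewrite E0.
      assert (Hs0 : RtoC sg <> RtoC 0) by (intros Z; apply RtoC_inj in Z; lra).
      assert (HsC : (RtoC sg * RtoC sg)%C = RtoC 1) by (rewrite <- RtoC_mult, Hss; reflexivity).
      transitivity (RtoC sg * RtoC sg * (num u0 / (RtoC sg * Y_U u0) * (u - u0)))%C.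
      { rewrite HsC. ring. }
      field. auto. }
    rewrite E.
    replace (sg * (X_B u - X_B u0) - Re (RtoC sg * (fU iota ps mu c u0 * (u - u0)))%C)
      with (sg * (X_B u - X_B u0 - Re (fU iota ps mu c u0 * (u - u0))%C))
      by (unfold Re; simpl; ring).
    rewrite Rabs_mult.
    replace (Rabs sg) with 1 by (destruct Hsg as [-> | ->]; [rewrite Rabs_pos_eq|rewrite Rabs_left]; lra).
    lra.
Qed.

(** The boundary expansion is in s = sqrt (u - p), whereas [lin] is in Y = sg * s * O(u), O being
    the product of the other factors. Replacing O(u) by O(p) costs a term o(s), and |s| is
    comparable with |Y| because O(p) is not 0. *)
Lemma first_order_branch u0 : 0 <= Im u0 -> curve u0 (RtoC 0) ->
  first_order u0 (RtoC 0) (fun u => 0 <= Im u).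
Proof.
  intros H0 Hc eps He.
  assert (HYU : Y_U u0 = RtoC 0).
  { destruct (curve_YU u0 _ H0 Hc) as [E|E]; [now symmetry|].
    transitivity (- - Y_U u0)%C; [ring|]. rewrite <- E. ring. }
  destruct (root_of_YU u0 H0 HYU) as (p & Hp & Eu0).
  destruct (in_split _ _ Hp) as (l1 & l2 & Eps).
  set (O := YU iota (l1 ++ l2)).
  assert (HO : O (RtoC p) <> RtoC 0).
  { apply YU_neq0; [exact Hiota|]. intros q Hq E. apply RtoC_inj in E. subst q.
    rewrite Eps in Hps. now apply (NoDup_remove_2 _ _ _ Hps). }
  assert (EQd : (RtoC eta * Qd ps u0)%C = (O (RtoC p) * O (RtoC p))%C).
  { rewrite Eu0, Eps, Qd_split. unfold O. rewrite YU_sqr by (simpl; lra). now rewrite Heta. }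
  set (k := (2 * num (RtoC p))%C).
  set (B := Cmod (O (RtoC p))). assert (HB : 0 < B) by now apply Cmod_gt_0.
  set (A := Cmod k + 1). assert (HA : 0 < A) by (generalize (Cmod_ge_0 k); unfold A; lra).
  set (e1 := eps * B / 4). assert (He1 : 0 < e1) by (unfold e1; assert (0 < eps * B) by (now apply Rmult_lt_0_compat); lra).
  destruct (XB_branch iota Hiota ps Hps mu c l1 p l2 Eps e1 He1) as (d2 & Hd2 & K2).
  fold O in K2. fold k in K2.
  (* The first bound keeps |O(u)| above B / 2, so that |s| B / 2 <= |Y|; the second makes the
     correction w at most e1 |s|. *)
  set (e2 := Rmin (B / 2) (e1 * (B * B) / A)).
  assert (He2 : 0 < e2).
  { apply Rmin_pos; [lra|]. apply Rdiv_lt_0_compat; [|lra].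
    apply Rmult_lt_0_compat; [exact He1|]. now apply Rmult_lt_0_compat. }
  destruct (ccont_C_eps O (RtoC p) (YU_cont iota (l1 ++ l2) (RtoC p)) _ He2) as (d3 & Hd3 & K3).
  exists (Rmin d2 d3). split; [now apply Rmin_pos|].
  intros u Y Hu HuY D1 D2. rewrite Eu0 in D1.
  specialize (K2 u Hu (Rlt_le_trans _ _ _ D1 (Rmin_l _ _))).
  specialize (K3 u (Rlt_le_trans _ _ _ D1 (Rmin_r _ _))).
  assert (Ksg : exists sg : R, (sg = 1 \/ sg = -1) /\ Y = (RtoC sg * Y_U u)%C).
  { destruct (curve_YU u Y Hu HuY) as [E|E]; [exists 1|exists (-1)]; (split; [tauto|]);
      rewrite E; apply Ceq_ext; unfold Re, Im; simpl; ring. }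
  destruct Ksg as (sg & Hsg & EY).
  assert (Habs : Rabs sg = 1)
    by (destruct Hsg as [-> | ->]; [rewrite Rabs_pos_eq|rewrite Rabs_left]; lra).
  set (s := hsqrt (u - RtoC p)) in *.
  assert (EYU : Y_U u = (s * O u)%C) by (rewrite Eps; apply YU_split).
  exists (sg * (X_B u - X_B u0)). split.
  - assert (E0 : lift u0 (RtoC 0) = cis (sg * theta u0)).
    { rewrite <- lift_sheet by assumption. f_equal. rewrite HYU. ring. }
    rewrite E0, EY, lift_sheet, <- cis_plus by assumption. f_equal. unfold theta. ring.
  - unfold lin. destruct (Ceq_dec (RtoC 0) (RtoC 0)) as [_|N]; [|congruence].
    rewrite EQd, EY, EYU. rewrite Eu0 at 1 2. fold k.
    set (z := (k / O (RtoC p) * s)%C) in *.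
    set (w := (k / (O (RtoC p) * O (RtoC p)) * s * (O u - O (RtoC p)))%C).
    replace (k / (O (RtoC p) * O (RtoC p)) * (RtoC sg * (s * O u)))%C with (RtoC sg * (z + w))%C
      by (unfold z, w; field; exact HO).
    replace (sg * (X_B u - X_B (RtoC p)) - Re (RtoC sg * (z + w))%C)
      with (sg * ((X_B u - X_B (RtoC p) - Re z) - Re w)) by (unfold Re; simpl; ring).
    rewrite Rabs_mult, Habs, Rmult_1_l.
    assert (Hw : Cmod w <= e1 * Cmod s).
    { unfold w. rewrite !Cmod_mult, Cmod_div, Cmod_mult by now apply Cmult_neq_0. fold B.
      assert (K4 : Cmod (O u - O (RtoC p))%C <= e1 * (B * B) / A)
        by (left; eapply Rlt_le_trans; [exact K3|apply Rmin_r]).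
      apply Rle_trans with (A / (B * B) * Cmod s * (e1 * (B * B) / A)).
      - apply Rmult_le_compat; try apply Cmod_ge_0; [|  |exact K4].
        + apply Rmult_le_pos; [|apply Cmod_ge_0]. apply Rmult_le_pos; [apply Cmod_ge_0|].
          left. apply Rinv_0_lt_compat. now apply Rmult_lt_0_compat.
        + apply Rmult_le_compat_r; [apply Cmod_ge_0|]. apply Rmult_le_compat_r.
          * left. apply Rinv_0_lt_compat. now apply Rmult_lt_0_compat.
          * unfold A; lra.
      - right. field. lra. }
    assert (Hs : Cmod s * (B / 2) <= Cmod (RtoC sg * (s * O u) - RtoC 0)%C).
    { replace (RtoC sg * (s * O u) - RtoC 0)%C with (RtoC sg * (s * O u))%C by ring.
      rewrite !Cmod_mult, Cmod_R, Habs, Rmult_1_l.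
      apply Rmult_le_compat_l; [apply Cmod_ge_0|].
      assert (K5 : Cmod (O u - O (RtoC p))%C < B / 2) by (eapply Rlt_le_trans; [exact K3|apply Rmin_l]).
      generalize (Cmod_triangle (O u) (- (O u - O (RtoC p)))%C). rewrite Cmod_opp.
      replace (O u + - (O u - O (RtoC p)))%C with (O (RtoC p)) by ring. fold B. lra. }
    generalize (re_le_Cmod w). intros Hw'.
    apply Rle_trans with (2 * e1 * Cmod s).
    { unfold Rminus. eapply Rle_trans; [apply Rabs_triang|]. rewrite Rabs_Ropp.
      unfold Rminus in K2. lra. }
    rewrite Rplus_comm. apply eps_weaken; [|exact He|apply Cmod_ge_0].
    apply Rle_trans with (eps * (Cmod s * (B / 2))); [unfold e1; lra|].
    apply Rmult_le_compat_l; [lra|exact Hs].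
Qed.

Lemma first_order_upper u0 Y0 : 0 <= Im u0 -> curve u0 Y0 ->
  first_order u0 Y0 (fun u => 0 <= Im u).
Proof.
  intros H0 Hc. destruct (Ceq_dec Y0 (RtoC 0)) as [->|H].
  - now apply first_order_branch.
  - now apply first_order_regular.
Qed.

Lemma first_order_conj u0 Y0 (P : C -> Prop) : curve u0 Y0 ->
  first_order (Cconj u0) (Cconj Y0) P -> first_order u0 Y0 (fun u => P (Cconj u)).
Proof.
  intros Hc H eps He. destruct (H eps He) as (d & Hd & K).
  exists d. split; [exact Hd|]. intros u Y HP HuY D1 D2.
  assert (M : forall a b, Cmod (Cconj a - Cconj b)%C = Cmod (a - b)%C)
    by (intros; now rewrite <- Cconj_minus, Cmod_conj).
  specialize (K (Cconj u) (Cconj Y) HP (curve_conj _ _ HuY)). rewrite !M in K.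
  destruct (K D1 D2) as (r & E & Hr). exists r.
  rewrite !lift_conj, lin_conj in * by assumption. split; [exact E|exact Hr].
Qed.

(** At a real u0 there is one expansion from each side. They share the same linear term, since [lin]
    commutes with conjugation and only its real part enters, and the same value of the lift at the
    centre, by [lift_conj]. *)
Lemma first_order_all u0 Y0 : curve u0 Y0 -> first_order u0 Y0 (fun _ => True).
Proof.
  intros Hc eps He.
  assert (Cc := curve_conj _ _ Hc).
  assert (near : forall (d : R) (u : C), Cmod (u - u0)%C < d -> Rabs (Im u - Im u0) < d).
  { intros d u Hu. eapply Rle_lt_trans; [apply (im_le_Cmod (u - u0)%C)|exact Hu]. }
  destruct (Rtotal_order (Im u0) 0) as [Hl|[H0|Hg]].
  - assert (Hl' : 0 <= Im (Cconj u0)) by (unfold Im in *; simpl; lra).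
    destruct (first_order_conj _ _ _ Hc (first_order_upper _ _ Hl' Cc) eps He) as (d & Hd & K).
    exists (Rmin d (- Im u0)). split; [apply Rmin_pos; lra|]. intros u Y _ HuY D1 D2.
    apply K; auto.
    + assert (N := near _ _ (Rlt_le_trans _ _ _ D1 (Rmin_r _ _))). apply Rabs_def2 in N.
      unfold Im in *; simpl; lra.
    + exact (Rlt_le_trans _ _ _ D1 (Rmin_l _ _)).
    + exact (Rlt_le_trans _ _ _ D2 (Rmin_l _ _)).
  - assert (Hl' : 0 <= Im (Cconj u0)) by (unfold Im in *; simpl; lra).
    destruct (first_order_conj _ _ _ Hc (first_order_upper _ _ Hl' Cc) eps He) as (d & Hd & K).
    destruct (first_order_upper u0 Y0 ltac:(lra) Hc eps He) as (d' & Hd' & K').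
    exists (Rmin d d'). split; [now apply Rmin_pos|]. intros u Y _ HuY D1 D2.
    destruct (Rle_dec 0 (Im u)) as [Hu|Hu].
    + apply K'; auto; eapply Rlt_le_trans; eauto; apply Rmin_r.
    + apply K; auto; [unfold Im in *; simpl; lra| |]; eapply Rlt_le_trans; eauto; apply Rmin_l.
  - destruct (first_order_upper u0 Y0 ltac:(lra) Hc eps He) as (d & Hd & K).
    exists (Rmin d (Im u0)). split; [apply Rmin_pos; lra|]. intros u Y _ HuY D1 D2.
    apply K; auto.
    + assert (N := near _ _ (Rlt_le_trans _ _ _ D1 (Rmin_r _ _))). apply Rabs_def2 in N. lra.
    + exact (Rlt_le_trans _ _ _ D1 (Rmin_l _ _)).
    + exact (Rlt_le_trans _ _ _ D2 (Rmin_l _ _)).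
Qed.

End Lift.

(** * Simple roots, and the derivative of the lift along a path *)

Lemma Qp_root ps u : Qp ps u = RtoC 0 -> exists p, In p ps /\ u = RtoC p.
Proof.
  induction ps as [|p l IH]; simpl; intros H.
  - exfalso. apply RtoC_inj in H. lra.
  - destruct (Ceq_dec (u - RtoC p)%C (RtoC 0)) as [E|E].
    + exists p. split; [now left|]. rewrite <- (Cplus_0_r (RtoC p)), <- E. ring.
    + destruct (Ceq_dec (Qp l u) (RtoC 0)) as [E'|E'].
      * destruct (IH E') as (q & Hq & ->). exists q. split; [now right|reflexivity].
      * exfalso. exact (Cmult_neq_0 _ _ E E' H).
Qed.

Lemma Qd_neq0 ps u : NoDup ps -> Qp ps u = RtoC 0 -> Qd ps u <> RtoC 0.
Proof.
  intros Hps H. destruct (Qp_root ps u H) as (p & Hp & ->).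
  apply in_split in Hp. destruct Hp as (l1 & l2 & ->).
  rewrite Qd_split. intros E. destruct (Qp_root _ _ E) as (q & Hq & Eq).
  apply RtoC_inj in Eq. subst q. now apply (NoDup_remove_2 _ _ _ Hps).
Qed.

Section LiftPath.
Context (iota : C) (Hiota : iota <> RtoC 0) (ps : list R) (Hps : NoDup ps) (mu c : R).
Context (eta : R) (Heta : (iota * iota)%C = RtoC eta).
Context (om x0 : R).
Context (Hper : forall x, eta * Re (Qp ps (RtoC x)) <= 0 ->
  exists k : Z, om * (Xreal iota ps mu c x - x0) = IZR k * PI).

Notation lft := (lift iota ps mu c om x0).
Notation num := (numer mu c).
Notation crv := (curve ps eta).
Notation ln0 := (lin ps mu c eta).

Lemma lin_bound u0 Y0 : exists M, 0 < M /\ forall u Y,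
  Cmod (ln0 u0 Y0 u Y) <= M * (Cmod (u - u0)%C + Cmod (Y - Y0)%C).
Proof.
  unfold lin. destruct (Ceq_dec Y0 (RtoC 0)) as [->|H].
  - set (k := (2 * num u0 / (RtoC eta * Qd ps u0))%C).
    exists (Cmod k + 1). split; [generalize (Cmod_ge_0 k); lra|]. intros u Y.
    replace (Y - RtoC 0)%C with Y by ring. rewrite Cmod_mult.
    generalize (Cmod_ge_0 k) (Cmod_ge_0 Y) (Cmod_ge_0 (u - u0)%C). intros.
    assert (0 <= Cmod k * Cmod (u - u0)%C) by now apply Rmult_le_pos. lra.
  - set (k := (num u0 / Y0)%C).
    exists (Cmod k + 1). split; [generalize (Cmod_ge_0 k); lra|]. intros u Y.
    rewrite Cmod_mult.
    generalize (Cmod_ge_0 k) (Cmod_ge_0 (Y - Y0)%C) (Cmod_ge_0 (u - u0)%C). intros.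
    assert (0 <= Cmod k * Cmod (Y - Y0)%C) by now apply Rmult_le_pos. lra.
Qed.

Lemma cder_Lipschitz g t l : cder g t l -> exists B d, 0 < B /\ 0 < d /\
  forall y, Rabs (y - t) < d -> Cmod (g y - g t)%C <= B * Rabs (y - t).
Proof.
  intros H. destruct (proj1 (cder_eps _ _ _) H 1 Rlt_0_1) as (d & Hd & K).
  exists (Cmod l + 1), d. split; [generalize (Cmod_ge_0 l); lra|]. split; [exact Hd|].
  intros y Hy. specialize (K y Hy).
  replace (g y - g t)%C with ((g y - g t - l * RtoC (y - t)) + l * RtoC (y - t))%C by ring.
  eapply Rle_trans; [apply Cmod_triangle|]. rewrite Cmod_mult, Cmod_R. lra.
Qed.

(** The two conditions on pb say that it is the pull-back of num du / Y, read in the coordinate u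
    or, at a branch point, in the coordinate Y. They are multiplied out so as to be exactly what the
    charts of the surface supply. *)
Lemma lift_path (u Y : R -> C) t du dY pb :
  cder u t du -> cder Y t dY -> locally t (fun s => crv (u s) (Y s)) ->
  (Y t <> RtoC 0 -> (pb * Y t)%C = (num (u t) * du)%C) ->
  (Y t = RtoC 0 -> (pb * (RtoC eta * Qd ps (u t)))%C = (2 * num (u t) * dY)%C) ->
  cder (fun s => lft (u s) (Y s)) t (Ci * RtoC (om * Re pb) * lft (u t) (Y t))%C.
Proof.
  intros Hu HY Hc P1 P2.
  assert (Hct : crv (u t) (Y t)) by exact (locally_singleton _ _ Hc).
  assert (He0 : RtoC eta <> RtoC 0) by (rewrite <- Heta; now apply Cmult_neq_0).
  assert (HL : forall eps, 0 < eps -> exists d, 0 < d /\ forall y, Rabs (y - t) < d ->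
     Cmod (ln0 (u t) (Y t) (u y) (Y y) - pb * RtoC (y - t))%C <= eps * Rabs (y - t)).
  { unfold lin. destruct (Ceq_dec (Y t) (RtoC 0)) as [E|E].
    - assert (HQ : Qd ps (u t) <> RtoC 0).
      { apply Qd_neq0; [exact Hps|].
        unfold curve in Hct. rewrite E in Hct.
        destruct (Ceq_dec (Qp ps (u t)) (RtoC 0)) as [|N]; [assumption|].
        exfalso. apply (Cmult_neq_0 _ _ He0 N). rewrite <- Hct. ring. }
      set (k := (2 * num (u t) / (RtoC eta * Qd ps (u t)))%C).
      assert (K : cder (fun y => k * Y y)%C t (k * dY)%C).
      { refine (cder_eq _ _ _ _ (cder_mult _ _ _ _ _ (cder_const k t) HY) _). ring. }
      intros eps He. destruct (proj1 (cder_eps _ _ _) K eps He) as (d & Hd & Kd).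
      exists d. split; [exact Hd|]. intros y Hy. specialize (Kd y Hy). cbv beta in Kd.
      rewrite E in Kd.
      replace (k * Y y - k * RtoC 0 - k * dY * RtoC (y - t))%C
        with (k * Y y - pb * RtoC (y - t))%C in Kd; [exact Kd|].
      replace (k * dY)%C with pb; [ring|].
      assert (Hne : (RtoC eta * Qd ps (u t))%C <> RtoC 0) by now apply Cmult_neq_0.
      transitivity (pb * (RtoC eta * Qd ps (u t)) / (RtoC eta * Qd ps (u t)))%C; [field; auto|].
      rewrite (P2 E). unfold k. field. auto.
    - set (k := (num (u t) / Y t)%C).
      assert (K : cder (fun y => k * u y)%C t (k * du)%C).
      { refine (cder_eq _ _ _ _ (cder_mult _ _ _ _ _ (cder_const k t) Hu) _). ring. }
      intros eps He. destruct (proj1 (cder_eps _ _ _) K eps He) as (d & Hd & Kd).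
      exists d. split; [exact Hd|]. intros y Hy. specialize (Kd y Hy). cbv beta in Kd.
      replace (k * u y - k * u t - k * du * RtoC (y - t))%C
        with (k * (u y - u t) - pb * RtoC (y - t))%C in Kd; [exact Kd|].
      replace (k * du)%C with pb; [ring|].
      transitivity (pb * Y t / Y t)%C; [field; auto|].
      rewrite (P1 E). unfold k. field. auto. }
  destruct (cder_Lipschitz _ _ _ Hu) as (B1 & d1 & HB1 & Hd1 & L1).
  destruct (cder_Lipschitz _ _ _ HY) as (B2 & d2 & HB2 & Hd2 & L2).
  destruct (proj1 (locally_R _ _) Hc) as (d3 & Hd3 & L3).
  set (B := B1 + B2).
  set (W := Rabs om + 1). assert (HW : 0 < W) by (generalize (Rabs_pos om); unfold W; lra).
  set (V := Cmod pb + 1 + B). assert (HV : 0 < V) by (generalize (Cmod_ge_0 pb); unfold V, B; lra).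
  apply cder_eps. intros eps He.
  (* Three thirds of eps: the linearization of the form along the path, the remainder of the
     first-order expansion, and the second-order remainder of [cis]. The minima with 1 below give
     the crude bound |r| <= V a. *)
  assert (Ha : 0 < eps / (3 * W)) by (apply Rdiv_lt_0_compat; lra).
  assert (Hb : 0 < eps / (3 * W * B)) by (apply Rdiv_lt_0_compat; [lra|]; apply Rmult_lt_0_compat; unfold B; lra).
  assert (Hcc : 0 < eps / (3 * W * V)) by (apply Rdiv_lt_0_compat; [lra|]; apply Rmult_lt_0_compat; lra).
  destruct (HL _ (Rmin_pos _ _ Ha Rlt_0_1)) as (d4 & Hd4 & L4).
  destruct (first_order_all iota Hiota ps Hps mu c eta Heta om x0 Hper _ _ Hct _ (Rmin_pos _ _ Hb Rlt_0_1))
    as (d5 & Hd5 & L5).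
  destruct (cis_approx _ Hcc) as (d6 & Hd6 & L6).
  set (B5 := d5 / (B + 1)).
  assert (HB : 0 < B) by (unfold B; lra).
  assert (HB5 : 0 < B5) by (apply Rdiv_lt_0_compat; lra).
  assert (HB6 : 0 < d6 / (W * V)) by (apply Rdiv_lt_0_compat; [lra|]; now apply Rmult_lt_0_compat).
  set (d := Rmin (Rmin (Rmin d1 d2) (Rmin d3 d4)) (Rmin B5 (d6 / (W * V)))).
  exists d. split; [unfold d; repeat apply Rmin_pos; auto|].
  intros y Hy.
  assert (M1 : d <= d1 /\ d <= d2 /\ d <= d3 /\ d <= d4 /\ d <= B5 /\ d <= d6 / (W * V)).
  { unfold d.
    generalize (Rmin_l (Rmin (Rmin d1 d2) (Rmin d3 d4)) (Rmin B5 (d6 / (W * V))))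
      (Rmin_r (Rmin (Rmin d1 d2) (Rmin d3 d4)) (Rmin B5 (d6 / (W * V))))
      (Rmin_l (Rmin d1 d2) (Rmin d3 d4)) (Rmin_r (Rmin d1 d2) (Rmin d3 d4))
      (Rmin_l d1 d2) (Rmin_r d1 d2) (Rmin_l d3 d4) (Rmin_r d3 d4)
      (Rmin_l B5 (d6 / (W * V))) (Rmin_r B5 (d6 / (W * V))).
    intros. repeat split; lra. }
  destruct M1 as (M1 & M2 & M3 & M4 & M5 & M6).
  set (a := Rabs (y - t)) in *. assert (Ha0 : 0 <= a) by apply Rabs_pos.
  specialize (L1 y ltac:(unfold a in *; lra)). specialize (L2 y ltac:(unfold a in *; lra)).
  specialize (L3 y ltac:(unfold a in *; lra)). specialize (L4 y ltac:(unfold a in *; lra)).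
  fold a in L1, L2, L4.
  assert (HaB : (B + 1) * a < d5).
  { replace d5 with ((B + 1) * B5) by (unfold B5; field; lra). apply Rmult_lt_compat_l; lra. }
  assert (0 <= B1 * a /\ 0 <= B2 * a) as [? ?] by (split; apply Rmult_le_pos; lra).
  destruct (L5 (u y) (Y y) I L3) as (r & Er & Hr).
  { unfold B in HaB. lra. }
  { unfold B in HaB. lra. }
  assert (HS : Cmod (u y - u t)%C + Cmod (Y y - Y t)%C <= B * a) by (unfold B; lra).
  set (rho := Re pb * (y - t)).
  assert (Hr1 : Rabs (r - rho) <= Rmin (eps / (3 * W * B)) 1 * (B * a) + Rmin (eps / (3 * W)) 1 * a).
  { replace (r - rho) with ((r - Re (ln0 (u t) (Y t) (u y) (Y y)))
      + Re (ln0 (u t) (Y t) (u y) (Y y) - pb * RtoC (y - t))%C)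
      by (unfold rho, Re; simpl; ring).
    eapply Rle_trans; [apply Rabs_triang|]. apply Rplus_le_compat.
    - eapply Rle_trans; [exact Hr|]. apply Rmult_le_compat_l; [|exact HS].
      left. apply Rmin_pos; [assumption|lra].
    - eapply Rle_trans; [apply re_le_Cmod|exact L4]. }
  assert (Hr2 : Rabs (r - rho) <= 2 * eps / (3 * W) * a).
  { eapply Rle_trans; [exact Hr1|].
    replace (2 * eps / (3 * W) * a) with (eps / (3 * W * B) * (B * a) + eps / (3 * W) * a) by (field; lra).
    apply Rplus_le_compat; apply Rmult_le_compat_r; auto using Rmin_l.
    apply Rmult_le_pos; lra. }
  assert (Hrho : Rabs rho <= Cmod pb * a).
  { unfold rho. rewrite Rabs_mult. apply Rmult_le_compat_r; [exact Ha0|apply re_le_Cmod]. }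
  assert (Hr3 : Rabs r <= V * a).
  { replace r with ((r - rho) + rho) by ring. eapply Rle_trans; [apply Rabs_triang|].
    assert (Rmin (eps / (3 * W * B)) 1 * (B * a) <= 1 * (B * a))
      by (apply Rmult_le_compat_r; [apply Rmult_le_pos; lra|apply Rmin_r]).
    assert (Rmin (eps / (3 * W)) 1 * a <= 1 * a) by (apply Rmult_le_compat_r; [lra|apply Rmin_r]).
    unfold V. lra. }
  assert (Hom : Rabs (om * r) <= W * (V * a)).
  { rewrite Rabs_mult. apply Rmult_le_compat; try apply Rabs_pos; [unfold W; lra|exact Hr3]. }
  assert (Hlt : Rabs (om * r) < d6).
  { eapply Rle_lt_trans; [exact Hom|].
    replace d6 with (W * V * (d6 / (W * V))) by (field; lra).
    rewrite <- Rmult_assoc. apply Rmult_lt_compat_l; [now apply Rmult_lt_0_compat|lra]. }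
  specialize (L6 _ Hlt).
  rewrite Er.
  replace (lft (u t) (Y t) * cis (om * r) - lft (u t) (Y t)
      - Ci * RtoC (om * Re pb) * lft (u t) (Y t) * RtoC (y - t))%C
    with (lft (u t) (Y t) * ((cis (om * r) - 1 - Ci * RtoC (om * r))
           + Ci * RtoC (om * (r - rho))))%C.
  2: { unfold rho. rewrite !RtoC_mult, !RtoC_minus, !RtoC_mult, RtoC_minus. ring. }
  rewrite Cmod_mult, Cmod_lift, Rmult_1_l.
  eapply Rle_trans; [apply Cmod_triangle|].
  rewrite (Cmod_mult Ci), Cmod_Ci, Rmult_1_l, Cmod_R, Rabs_mult.
  apply Rle_trans with (eps / (3 * W * V) * (W * (V * a)) + W * (2 * eps / (3 * W) * a)).
  - apply Rplus_le_compat.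
    + eapply Rle_trans; [exact L6|]. apply Rmult_le_compat_l; [lra|exact Hom].
    + apply Rmult_le_compat; try apply Rabs_pos; [unfold W; lra|exact Hr2].
  - right. field. lra.
Qed.

Lemma lift_continuous u0 Y0 : crv u0 Y0 -> forall eps, 0 < eps -> exists d, 0 < d /\
  forall u Y, crv u Y -> Cmod (u - u0)%C < d -> Cmod (Y - Y0)%C < d ->
    Cmod (lft u Y - lft u0 Y0)%C < eps.
Proof.
  intros Hc eps He.
  destruct (first_order_all iota Hiota ps Hps mu c eta Heta om x0 Hper _ _ Hc 1 Rlt_0_1) as (d & Hd & K).
  destruct (lin_bound u0 Y0) as (M & HM & L).
  destruct (cis_approx 1 Rlt_0_1) as (d6 & Hd6 & L6).
  set (W := Rabs om + 1). assert (HW : 0 < W) by (generalize (Rabs_pos om); unfold W; lra).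
  set (m := Rmin d6 (eps / 2)). assert (Hm : 0 < m) by (apply Rmin_pos; lra).
  set (e := m / (W * (M + 1) * 2)).
  assert (HWM : 0 < W * (M + 1)) by (apply Rmult_lt_0_compat; lra).
  assert (He' : 0 < e) by (apply Rdiv_lt_0_compat; lra).
  exists (Rmin d e). split; [now apply Rmin_pos|]. intros u Y HuY D1 D2.
  assert (D3 := Rlt_le_trans _ _ _ D1 (Rmin_r _ _)). assert (D4 := Rlt_le_trans _ _ _ D2 (Rmin_r _ _)).
  destruct (K u Y I HuY (Rlt_le_trans _ _ _ D1 (Rmin_l _ _)) (Rlt_le_trans _ _ _ D2 (Rmin_l _ _)))
    as (r & Er & Hr).
  specialize (L u Y).
  generalize (re_le_Cmod (ln0 u0 Y0 u Y)). intros L'.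
  assert (Hr2 : Rabs r < (M + 1) * (2 * e)).
  { replace r with ((r - Re (ln0 u0 Y0 u Y)) + Re (ln0 u0 Y0 u Y)) by ring.
    eapply Rle_lt_trans; [apply Rabs_triang|].
    set (q := Cmod (u - u0)%C + Cmod (Y - Y0)%C) in *.
    apply Rle_lt_trans with ((M + 1) * q); [lra|]. apply Rmult_lt_compat_l; unfold q; lra. }
  assert (Ho : Rabs (om * r) < m).
  { rewrite Rabs_mult.
    replace m with (W * ((M + 1) * (2 * e))) by (unfold e; field; lra).
    apply Rle_lt_trans with (W * Rabs r).
    - apply Rmult_le_compat_r; [apply Rabs_pos|unfold W; lra].
    - now apply Rmult_lt_compat_l. }
  rewrite Er. replace (lft u0 Y0 * cis (om * r) - lft u0 Y0)%C
    with (lft u0 Y0 * ((cis (om * r) - 1 - Ci * RtoC (om * r)) + Ci * RtoC (om * r)))%C by ring.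
  rewrite Cmod_mult, Cmod_lift, Rmult_1_l.
  eapply Rle_lt_trans; [apply Cmod_triangle|].
  rewrite (Cmod_mult Ci), Cmod_Ci, Rmult_1_l, Cmod_R.
  specialize (L6 (om * r) (Rlt_le_trans _ _ _ Ho (Rmin_l _ _))).
  assert (Rabs (om * r) < eps / 2) by (eapply Rlt_le_trans; [exact Ho|apply Rmin_r]). lra.
Qed.

End LiftPath.

(** * Integration along the pieces of a path *)

Definition within_cont (s t : R) (F : R -> R) (x : R) : Prop :=
  forall eps, 0 < eps -> exists d, 0 < d /\
    forall y, s <= y <= t -> Rabs (y - x) < d -> Rabs (F y - F x) < eps.

(** Freezing the argument outside [s, t] turns continuity relative to [s, t] into two-sided
    continuity, the form in which the mean value theorem is available. *)
Definition clamp (s t x : R) : R := Rmax s (Rmin x t).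

Lemma clamp_in s t x : s <= t -> s <= clamp s t x <= t.
Proof.
  intros H. unfold clamp. split; [apply Rmax_l|].
  apply Rmax_lub; [exact H|apply Rmin_r].
Qed.

Lemma clamp_id s t x : s <= x <= t -> clamp s t x = x.
Proof. intros H. unfold clamp. rewrite Rmin_left, Rmax_right; lra. Qed.

Lemma clamp_Lipschitz s t x y : Rabs (clamp s t y - clamp s t x) <= Rabs (y - x).
Proof.
  unfold clamp, Rmax, Rmin.
  destruct (Rle_dec y t), (Rle_dec x t);
   repeat match goal with |- context [Rle_dec ?a ?b] => destruct (Rle_dec a b) end;
   unfold Rabs; repeat destruct Rcase_abs; lra.
Qed.

Lemma within_cont_clamp s t F x : s <= t -> s <= x <= t -> within_cont s t F x ->
  continuous (fun y => F (clamp s t y)) x.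
Proof.
  intros Hst Hx H. apply (ccont_real_lim (T := R_UniformSpace)). intros eps He.
  destruct (H eps He) as (d & Hd & K). apply locally_R. exists d. split; [exact Hd|].
  intros y Hy. rewrite (clamp_id s t x Hx). apply K; [now apply clamp_in|].
  rewrite <- (clamp_id s t x Hx) at 1. eapply Rle_lt_trans; [apply clamp_Lipschitz|exact Hy].
Qed.

Lemma const_of_derive0 s t F : s <= t ->
  (forall x, s < x < t -> is_derive F x 0) ->
  (forall x, s <= x <= t -> within_cont s t F x) -> F t = F s.
Proof.
  intros Hst HD HC.
  destruct (MVT_gen (fun y => F (clamp s t y)) s t (fun _ => 0)) as (c & _ & E).
  - rewrite Rmin_left, Rmax_right by exact Hst. intros x Hx.
    apply (is_derive_ext_loc F); [|now apply HD].
    apply locally_R. exists (Rmin (x - s) (t - x)). split; [apply Rmin_pos; lra|].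
    intros y Hy. symmetry. f_equal. apply clamp_id.
    generalize (Rmin_l (x - s) (t - x)) (Rmin_r (x - s) (t - x)). apply Rabs_def2 in Hy. lra.
  - rewrite Rmin_left, Rmax_right by exact Hst. intros x Hx.
    apply continuity_pt_filterlim. now apply within_cont_clamp; auto.
  - rewrite !clamp_id in E by lra. lra.
Qed.

(** Only points of the open interval constrain F. At an end of a piece the path may have a corner,
    and the two-sided derivative inside [velocity] may then be a default value. *)
Definition extends_cont (s t : R) (F : R -> C) (x : R) : Prop :=
  exists W : R -> C, ccont W x /\ locally x (fun y => s < y < t -> F y = W y).

Lemma extends_cont_extend s t F : s < t -> (forall x, s <= x <= t -> extends_cont s t F x) ->
  exists g : R -> C, (forall x, ccont g x) /\ (forall x, s < x < t -> g x = F x).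
Proof.
  intros Hst H.
  destruct (H s ltac:(lra)) as (Ws & Cs & Ls). destruct (H t ltac:(lra)) as (Wt & Ct & Lt).
  exists (fun x => if Rle_dec x s then Ws s else if Rle_dec t x then Wt t else F x).
  split.
  2: { intros x Hx. destruct (Rle_dec x s); [lra|]. destruct (Rle_dec t x); [lra|reflexivity]. }
  intros x.
  destruct (Rlt_dec x s) as [H1|H1]; [|destruct (Rlt_dec t x) as [H2|H2]].
  - apply (ccont_ext_loc (fun _ => Ws s)); [|apply ccont_const].
    apply locally_R. exists (s - x). split; [lra|]. intros y Hy. apply Rabs_def2 in Hy.
    destruct (Rle_dec y s); [reflexivity|lra].
  - apply (ccont_ext_loc (fun _ => Wt t)); [|apply ccont_const].
    apply locally_R. exists (x - t). split; [lra|]. intros y Hy. apply Rabs_def2 in Hy.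
    destruct (Rle_dec y s); [lra|]. destruct (Rle_dec t y); [reflexivity|lra].
  - apply ccont_of_eps. intros eps He.
    destruct (Req_dec x s) as [->|Ns]; [|destruct (Req_dec x t) as [->|Nt]].
    + destruct (proj1 (locally_R _ _) Ls) as (d & Hd & K).
      destruct (proj1 (locally_R _ _) (ccont_eps _ _ Cs eps He)) as (d' & Hd' & K').
      apply locally_R. exists (Rmin (t - s) (Rmin d d')). split; [repeat apply Rmin_pos; lra|].
      intros y Hy. destruct (Rle_dec s s); [|lra].
      generalize (Rmin_l (t - s) (Rmin d d')) (Rmin_r (t - s) (Rmin d d')) (Rmin_l d d') (Rmin_r d d').
      intros. destruct (Rle_dec y s).
      * replace (Ws s - Ws s)%C with (RtoC 0) by ring. rewrite Cmod_0. exact He.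
      * assert (Hy' := Rabs_def2 _ _ Hy). destruct (Rle_dec t y); [lra|].
        rewrite (K y); [|lra|lra]. apply K'. lra.
    + destruct (proj1 (locally_R _ _) Lt) as (d & Hd & K).
      destruct (proj1 (locally_R _ _) (ccont_eps _ _ Ct eps He)) as (d' & Hd' & K').
      apply locally_R. exists (Rmin (t - s) (Rmin d d')). split; [repeat apply Rmin_pos; lra|].
      intros y Hy. destruct (Rle_dec t s); [lra|]. destruct (Rle_dec t t); [|lra].
      generalize (Rmin_l (t - s) (Rmin d d')) (Rmin_r (t - s) (Rmin d d')) (Rmin_l d d') (Rmin_r d d').
      intros. assert (Hy' := Rabs_def2 _ _ Hy). destruct (Rle_dec y s); [lra|].
      destruct (Rle_dec t y).
      * replace (Wt t - Wt t)%C with (RtoC 0) by ring. rewrite Cmod_0. exact He.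
      * rewrite (K y); [|lra|lra]. apply K'. lra.
    + destruct (H x ltac:(lra)) as (W & CW & LW).
      destruct (proj1 (locally_R _ _) LW) as (d & Hd & K).
      destruct (proj1 (locally_R _ _) (ccont_eps _ _ CW eps He)) as (d' & Hd' & K').
      apply locally_R. exists (Rmin (Rmin (x - s) (t - x)) (Rmin d d')).
      split; [repeat apply Rmin_pos; lra|]. intros y Hy.
      generalize (Rmin_l (Rmin (x - s) (t - x)) (Rmin d d')) (Rmin_r (Rmin (x - s) (t - x)) (Rmin d d'))
        (Rmin_l d d') (Rmin_r d d') (Rmin_l (x - s) (t - x)) (Rmin_r (x - s) (t - x)).
      intros. assert (Hy' := Rabs_def2 _ _ Hy).
      destruct (Rle_dec y s); [lra|]. destruct (Rle_dec t y); [lra|].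
      destruct (Rle_dec x s); [lra|]. destruct (Rle_dec t x); [lra|].
      rewrite (K y), (K x); [|rewrite Rminus_diag, Rabs_R0; lra|lra|lra|lra].
      apply K'. lra.
Qed.

Lemma extends_cont_primitive s t F : s < t -> (forall x, s <= x <= t -> extends_cont s t F x) ->
  exists G : R -> C, (forall x, ccont G x) /\ (forall x, s < x < t -> cder G x (F x)) /\
    G s = RtoC 0 /\ is_RInt (V := C_R_NormedModule) F s t (G t).
Proof.
  intros Hst H. destruct (extends_cont_extend s t F Hst H) as (g & Cg & Eg).
  assert (X1 : forall a b, ex_RInt (fun x => Re (g x)) a b)
    by (intros; apply (ex_RInt_continuous (V := R_CompleteNormedModule)); intros; apply Cg).
  assert (X2 : forall a b, ex_RInt (fun x => Im (g x)) a b)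
    by (intros; apply (ex_RInt_continuous (V := R_CompleteNormedModule)); intros; apply Cg).
  assert (D : forall x, cder (fun y => (RInt (fun x => Re (g x)) s y, RInt (fun x => Im (g x)) s y)) x (g x)).
  { intros x. split.
    - apply (is_derive_RInt (fun x => Re (g x)) (fun y => RInt (fun x => Re (g x)) s y) s x).
      + apply filter_forall. intros y. apply (RInt_correct (V := R_CompleteNormedModule)), X1.
      + apply Cg.
    - apply (is_derive_RInt (fun x => Im (g x)) (fun y => RInt (fun x => Im (g x)) s y) s x).
      + apply filter_forall. intros y. apply (RInt_correct (V := R_CompleteNormedModule)), X2.
      + apply Cg. }
  exists (fun y => (RInt (fun x => Re (g x)) s y, RInt (fun x => Im (g x)) s y)).
  split; [intros x; exact (cder_cont _ _ _ (D x))|].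
  split; [intros x Hx; rewrite <- Eg by exact Hx; apply D|].
  split; [rewrite !RInt_point; reflexivity|].
  apply (is_RInt_ext (V := C_R_NormedModule) g).
  - rewrite Rmin_left, Rmax_right by lra. exact Eg.
  - apply (is_RInt_fct_extend_pair (U := R_NormedModule) (V := R_NormedModule) g).
    + apply (RInt_correct (V := R_CompleteNormedModule)), X1.
    + apply (RInt_correct (V := R_CompleteNormedModule)), X2.
Qed.

(** * Pulled-back forms in the charts of the surface *)

Definition C1c (g : R -> C) (t : R) : Prop :=
  exists g' : R -> C, locally t (fun s => cder g s (g' s)) /\ ccont g' t.

Lemma is_derive_C_cder (f : R -> C) s (l : C) :
  is_derive (V := C_R_NormedModule) f s l -> cder f s l.
Proof.
  intros H. split.
  - exact (filterdiff_ext_lin _ _ _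
      (filterdiff_comp' f (fun z : C_R_NormedModule => fst z) s _ _ H
        (filterdiff_linear _ (is_linear_fst (U := R_NormedModule) (V := R_NormedModule))))
      (fun y => eq_refl)).
  - exact (filterdiff_ext_lin _ _ _
      (filterdiff_comp' f (fun z : C_R_NormedModule => snd z) s _ _ H
        (filterdiff_linear _ (is_linear_snd (U := R_NormedModule) (V := R_NormedModule))))
      (fun y => eq_refl)).
Qed.

Lemma C1_at_C1c f t : C1_at f t -> C1c f t.
Proof.
  intros (f' & H & Hc). exists f'. split.
  - refine (filter_imp _ _ _ H). intros s. apply is_derive_C_cder.
  - split.
    + refine (continuous_comp f' fst t Hc _). destruct (f' t) as [p q]. apply continuous_fst.
    + refine (continuous_comp f' snd t Hc _). destruct (f' t) as [p q]. apply continuous_snd.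
Qed.

Lemma C1c_cont g t : C1c g t -> ccont g t.
Proof. intros (g' & H & _). exact (cder_cont _ _ _ (locally_singleton _ _ H)). Qed.

Lemma C1c_ext_loc f g t : locally t (fun s => f s = g s) -> C1c f t -> C1c g t.
Proof.
  intros HL (f' & H & Hc). exists f'. split; [|exact Hc].
  generalize (filter_and _ _ (locally_locally _ _ HL) H). apply filter_imp.
  intros s [H1 H2]. exact (cder_ext_loc _ _ _ _ H1 H2).
Qed.

Lemma C1c_inv g t : C1c g t -> g t <> RtoC 0 -> C1c (fun s => (/ g s)%C) t.
Proof.
  intros Hg H0. assert (Cg := C1c_cont _ _ Hg). destruct Hg as (g' & H & Hc).
  exists (fun s => - g' s / (g s * g s))%C. split.
  - generalize (filter_and _ _ H (ccont_neq0 g t Cg H0)). apply filter_imp.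
    intros s [H1 H2]. now apply cder_inv.
  - apply ccont_div; [now apply ccont_opp|now apply ccont_mult|now apply Cmult_neq_0].
Qed.

Lemma C1_neq_0 : RtoC 1 <> RtoC 0.
Proof. intros E. apply RtoC_inj in E. lra. Qed.

Lemma Cinv_neq0 z : z <> RtoC 0 -> (/ z)%C <> RtoC 0.
Proof.
  intros H E. apply C1_neq_0. transitivity (z * / z)%C; [field; auto|]. rewrite E. ring.
Qed.

Lemma recip_recip p : recip (recip p) = p.
Proof.
  destruct p as [z|]; simpl.
  - destruct (Ceq_dec z (RtoC 0)) as [->|H]; simpl.
    + destruct (Ceq_dec (RtoC 0) (RtoC 0)); [reflexivity|congruence].
    + destruct (Ceq_dec (/ z)%C (RtoC 0)) as [E|E].
      * exfalso. exact (Cinv_neq0 z H E).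
      * f_equal. field. auto.
  - destruct (Ceq_dec (RtoC 0) (RtoC 0)); [reflexivity|congruence].
Qed.

Lemma affine_recip p : p <> Infty -> p <> Fin (RtoC 0) -> affine (recip p) = (/ affine p)%C.
Proof.
  intros H1 H2. destruct p as [z|]; [|congruence]. simpl.
  destruct (Ceq_dec z (RtoC 0)) as [->|]; [congruence|reflexivity].
Qed.

Lemma recip_Infty p : recip p = Infty <-> p = Fin (RtoC 0).
Proof.
  split.
  - intros H. rewrite <- (recip_recip p), H. reflexivity.
  - intros ->. simpl. destruct (Ceq_dec (RtoC 0) (RtoC 0)); [reflexivity|congruence].
Qed.

Lemma affine_neq0 p : p <> Infty -> p <> Fin (RtoC 0) -> affine p <> RtoC 0.
Proof. destruct p; simpl; congruence. Qed.

(** A path that is C^1 in the chart at infinity is reread in the affine chart by inversion; its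
    coordinate 1/z stays away from 0 near t because [f t] is finite. *)
Lemma finite_chart f t : sphere_C1_at f t -> f t <> Infty ->
  locally t (fun s => f s <> Infty) /\ C1c (fun s => affine (f s)) t.
Proof.
  intros [[H1 H2]|[H1 H2]] Ht; [split; [exact H1|now apply C1_at_C1c]|].
  apply C1_at_C1c in H2.
  assert (H0 : f t <> Fin (RtoC 0)) by exact (locally_singleton _ _ H1).
  assert (Hn : affine (recip (f t)) <> RtoC 0).
  { apply affine_neq0.
    - intros E. apply H0. now apply recip_Infty.
    - intros E. apply Ht. rewrite <- (recip_recip (f t)), E. apply recip_Infty. reflexivity. }
  assert (L := ccont_neq0 _ _ (C1c_cont _ _ H2) Hn). cbv beta in L.
  assert (L' : locally t (fun s => f s <> Infty)).
  { refine (filter_imp _ _ _ L). intros s Hs E. apply Hs. now rewrite E. }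
  split; [exact L'|].
  refine (C1c_ext_loc _ _ _ _ (C1c_inv _ _ H2 Hn)).
  generalize (filter_and _ _ L' H1). apply filter_imp. intros s [S1 S2]. cbv beta.
  rewrite affine_recip by assumption.
  assert (affine (f s) <> RtoC 0) by now apply affine_neq0. field. auto.
Qed.

Lemma infinite_chart f t : sphere_C1_at f t -> f t <> Fin (RtoC 0) ->
  locally t (fun s => f s <> Fin (RtoC 0)) /\ C1c (fun s => affine (recip (f s))) t.
Proof.
  intros [[H1 H2]|[H1 H2]] Ht; [|split; [exact H1|now apply C1_at_C1c]].
  apply C1_at_C1c in H2.
  assert (H0 : f t <> Infty) by exact (locally_singleton _ _ H1).
  assert (Hn : affine (f t) <> RtoC 0) by now apply affine_neq0.
  assert (L := ccont_neq0 _ _ (C1c_cont _ _ H2) Hn). cbv beta in L.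
  assert (L' : locally t (fun s => f s <> Fin (RtoC 0))).
  { refine (filter_imp _ _ _ L). intros s Hs E. apply Hs. now rewrite E. }
  split; [exact L'|].
  refine (C1c_ext_loc _ _ _ _ (C1c_inv _ _ H2 Hn)).
  generalize (filter_and _ _ L' H1). apply filter_imp. intros s [S1 S2]. cbv beta.
  now rewrite affine_recip.
Qed.

Lemma recip_sphere_C1 f t : sphere_C1_at f t -> sphere_C1_at (fun s => recip (f s)) t.
Proof.
  intros [[H1 H2]|[H1 H2]]; [right|left].
  - split.
    + refine (filter_imp _ _ _ H1). intros s Hs E. apply Hs.
      rewrite <- (recip_recip (f s)), E. now apply recip_Infty.
    + destruct H2 as (f' & K & Kc). exists f'. split; [|exact Kc].
      refine (filter_imp _ _ _ K). intros s.
      apply is_derive_ext. intros x. now rewrite recip_recip.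
  - split; [|exact H2].
    refine (filter_imp _ _ _ H1). intros s Hs E. apply Hs. now apply recip_Infty.
Qed.

Lemma cder_velocity f t l : cder f t l -> velocity f t = l.
Proof.
  intros [H1 H2]. unfold velocity. destruct l as [l1 l2]. f_equal.
  - now apply is_derive_unique.
  - now apply is_derive_unique.
Qed.

Lemma velocity_ext f g t : (forall s, f s = g s) -> velocity f t = velocity g t.
Proof.
  intros H. unfold velocity. f_equal; apply Derive_ext; intros s; now rewrite H.
Qed.

Definition pbz (a : R) (zf : R -> sphere) (t : R) : C :=
  match zf t with
  | Fin z => (velocity (fun s => affine (zf s)) t / (z * z - RtoC a * RtoC a))%C
  | Infty => (- velocity (fun s => affine (recip (zf s))) t)%C
  end.

(* [w dz / (z^2 - a^2)] on the curve [B(z) w^2 = A(z)]. *)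
Definition pbw (A B : C -> C) (a : R) (zf wf : R -> sphere) (t : R) : C :=
  match zf t, wf t with
  | Fin z, Infty =>
      (2 * A z / C_derive B z * velocity (fun s => affine (recip (wf s))) t
       / (z * z - RtoC a * RtoC a))%C
  | _, w => (affine w * pbz a zf t)%C
  end.

Definition curve_pt (A B : C -> C) (z w : sphere) : Prop :=
  match z, w with
  | Fin z, Fin w => (B z * (w * w) = A z)%C
  | Fin z, Infty => B z = RtoC 0
  | Infty, Fin w => (w * w)%C = RtoC 1
  | Infty, Infty => False
  end.

(** The exchange of A with B and of w with 1/w makes dh / G an instance of the same statements as G
    dh. *)
Lemma curve_pt_recip A B z w : curve_pt A B z w -> curve_pt B A z (recip w).
Proof.
  destruct z as [z|], w as [w|]; simpl; try tauto.
  - intros H. destruct (Ceq_dec w (RtoC 0)) as [->|N]; simpl.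
    + rewrite <- H. ring.
    + rewrite <- H. field. auto.
  - intros ->. ring.
  - intros H. destruct (Ceq_dec w (RtoC 0)) as [->|N]; simpl.
    + assert (E := f_equal Re H). unfold Re in E; simpl in E. lra.
    + transitivity (/ (w * w))%C; [field; auto|]. rewrite H. field.
Qed.

Section PathOnCurve.
Context (A B dA dB : C -> C) (a : R).
Context (HA : forall z, cdiff A z (dA z)) (HB : forall z, cdiff B z (dB z)).
Context (CdA : forall z, ccont (T := R2) dA z) (CdB : forall z, ccont (T := R2) dB z).
Context (HdB : forall z, C_derive B z = dB z).
Context (Hsimple : forall z, B z = RtoC 0 -> A z <> RtoC 0 /\ dB z <> RtoC 0).

(** zf and wf are the coordinates of the path, zd and wd those of its C^1 extension. They agree on
    [s, t], so velocities agree on the open interval. *)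
Context (zf wf zd wd : R -> sphere) (s t : R).
Context (Hon : forall y, s <= y <= t -> curve_pt A B (zf y) (wf y)).
Context (Hend : forall y z, s <= y <= t -> zf y = Fin z -> (z * z - RtoC a * RtoC a)%C <> RtoC 0).
Context (Ez : forall y, s <= y <= t -> zd y = zf y) (Ew : forall y, s <= y <= t -> wd y = wf y).

Lemma locally_segment y : s < y < t -> locally y (fun x => s <= x <= t).
Proof.
  intros H. apply locally_R. exists (Rmin (y - s) (t - y)). split; [apply Rmin_pos; lra|].
  intros x Hx. generalize (Rmin_l (y - s) (t - y)) (Rmin_r (y - s) (t - y)).
  apply Rabs_def2 in Hx. lra.
Qed.

Lemma velocity_agree (F : sphere -> C) (f g : R -> sphere) y l :
  (forall y, s <= y <= t -> f y = g y) ->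
  s < y < t -> cder (fun x => F (f x)) y l -> cder (fun x => F (g x)) y l.
Proof.
  intros E Hy H. refine (cder_ext_loc _ _ _ _ _ H).
  refine (filter_imp _ _ _ (locally_segment y Hy)). intros x Hx. now rewrite E.
Qed.

Lemma C1c_velocity (F : sphere -> C) (f g : R -> sphere) x :
  (forall y, s <= y <= t -> f y = g y) ->
  C1c (fun y => F (f y)) x ->
  exists W, ccont W x /\
    locally x (fun y => s < y < t -> cder (fun x => F (g x)) y (W y)).
Proof.
  intros E (W & H & Hc). exists W. split; [exact Hc|].
  refine (filter_imp _ _ _ H). intros y K Hy. exact (velocity_agree F f g y _ E Hy K).
Qed.

(** With v = 1/z the form is - dv / (1 - a^2 v^2). This one expression is continuous and covers both
    values of [zf] near z = oo, even if the path enters and leaves that point infinitely often. *)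
Lemma pbz_ext x : s <= x <= t -> sphere_C1_at zd x -> extends_cont s t (pbz a zf) x.
Proof.
  intros Hx Hz.
  destruct (zf x) as [z|] eqn:Ezx.
  - assert (Hd : zd x <> Infty) by (rewrite (Ez x Hx), Ezx; discriminate).
    destruct (finite_chart _ _ Hz Hd) as [L1 C1].
    destruct (C1c_velocity affine zd zf x Ez C1) as (W & CW & LW).
    exists (fun y => W y / (affine (zd y) * affine (zd y) - RtoC a * RtoC a))%C. split.
    + assert (Cz := C1c_cont _ _ C1).
      apply ccont_div; [exact CW| |].
      * apply ccont_minus; [apply ccont_mult; exact Cz|apply ccont_const].
      * rewrite (Ez x Hx), Ezx. simpl. now apply (Hend x z).
    + generalize (filter_and _ _ L1 LW). apply filter_imp. intros y [Y1 Y2] Hy.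
      assert (Hy' : s <= y <= t) by lra.
      unfold pbz. rewrite (Ez y Hy') in Y1 |- *.
      destruct (zf y) as [zy|] eqn:Ey; [|congruence].
      rewrite (cder_velocity _ _ _ (Y2 Hy)). reflexivity.
  - assert (Hd : zd x <> Fin (RtoC 0)) by (rewrite (Ez x Hx), Ezx; discriminate).
    destruct (infinite_chart _ _ Hz Hd) as [L1 C1].
    destruct (C1c_velocity (fun p => affine (recip p)) zd zf x Ez C1) as (W & CW & LW).
    assert (Cz := C1c_cont _ _ C1).
    assert (N0 : (1 - RtoC a * RtoC a * (affine (recip (zd x)) * affine (recip (zd x))))%C <> RtoC 0).
    { rewrite (Ez x Hx), Ezx. simpl. intros E. apply (f_equal Re) in E. unfold Re in E; simpl in E. lra. }
    assert (CN : ccont (fun y => (1 - RtoC a * RtoC a * (affine (recip (zd y)) * affine (recip (zd y))))%C) x).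
    { apply ccont_minus; [apply ccont_const|]. apply ccont_mult; [apply ccont_const|].
      apply ccont_mult; exact Cz. }
    exists (fun y => - W y / (1 - RtoC a * RtoC a * (affine (recip (zd y)) * affine (recip (zd y)))))%C.
    split.
    + apply ccont_div; [now apply ccont_opp|exact CN|exact N0].
    + generalize (filter_and _ _ (filter_and _ _ L1 LW) (ccont_neq0 _ _ CN N0)).
      apply filter_imp. intros y [[Y1 Y2] Y3] Hy.
      assert (Hy' : s <= y <= t) by lra. specialize (Y2 Hy).
      unfold pbz. rewrite (Ez y Hy') in Y1, Y3 |- *.
      destruct (zf y) as [zy|] eqn:Ey.
      * assert (Hzy : zy <> RtoC 0) by (intros ->; now apply Y1).
        assert (Er : affine (recip (zf y)) = (/ zy)%C)
          by (rewrite Ey; apply (affine_recip (Fin zy)); congruence).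
        rewrite <- Ey, Er in Y3 |- *.
        assert (Hn : affine (recip (zf y)) <> RtoC 0)
          by (rewrite Er; now apply Cinv_neq0).
        assert (Ln := ccont_neq0 _ _ (cder_cont _ _ _ Y2) Hn). cbv beta in Ln.
        assert (K : cder (fun x => affine (zf x)) y (- W y / (/ zy * / zy))%C).
        { rewrite <- Er.
          refine (cder_ext_loc _ _ _ _ _ (cder_inv _ _ _ Y2 Hn)).
          refine (filter_imp _ _ _ Ln). intros x' Hx'.
          destruct (zf x') as [z'|] eqn:E'; [|now contradiction Hx'].
          simpl in Hx' |- *. destruct (Ceq_dec z' (RtoC 0)) as [->|N]; simpl in *; [congruence|].
          field. auto. }
        rewrite (cder_velocity _ _ _ K).
        assert (Hn2 := Hend y zy Hy' Ey).
        field. split; [exact Hzy|exact Hn2].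
      * rewrite (cder_velocity _ _ _ Y2). simpl. field.
Qed.

(** Near w = oo the path may alternate between finite and infinite w. Both cases are values of 2 A
    dv / ((B' - v^2 A') (z^2 - a^2)) with v = 1/w, whose denominator is nonzero because the roots of
    B are simple. *)
Lemma pbw_ext x : s <= x <= t -> sphere_C1_at zd x -> sphere_C1_at wd x ->
  extends_cont s t (pbw A B a zf wf) x.
Proof.
  intros Hx Hz Hw.
  destruct (wf x) as [w|] eqn:Ewx.
  - assert (Hd : wd x <> Infty) by (rewrite (Ew x Hx), Ewx; discriminate).
    destruct (finite_chart _ _ Hw Hd) as [L1 C1].
    destruct (pbz_ext x Hx Hz) as (W & CW & LW).
    exists (fun y => affine (wd y) * W y)%C. split.
    + apply ccont_mult; [exact (C1c_cont _ _ C1)|exact CW].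
    + generalize (filter_and _ _ L1 LW). apply filter_imp. intros y [Y1 Y2] Hy.
      assert (Hy' : s <= y <= t) by lra.
      rewrite (Ew y Hy') in Y1 |- *. rewrite <- (Y2 Hy). unfold pbw.
      destruct (zf y), (wf y); try reflexivity. congruence.
  - assert (Hd : wd x <> Fin (RtoC 0)) by (rewrite (Ew x Hx), Ewx; discriminate).
    destruct (infinite_chart _ _ Hw Hd) as [L1 C1].
    assert (Hc := Hon x Hx). rewrite Ewx in Hc.
    destruct (zf x) as [z|] eqn:Ezx; [|contradiction]. simpl in Hc.
    assert (Hdz : zd x <> Infty) by (rewrite (Ez x Hx), Ezx; discriminate).
    destruct (finite_chart _ _ Hz Hdz) as [L2 C2].
    destruct (C1c_velocity affine zd zf x Ez C2) as (W & CW & LW).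
    destruct (C1c_velocity (fun p => affine (recip p)) wd wf x Ew C1) as (V & CV & LV).
    assert (Cz := C1c_cont _ _ C2). assert (Cv := C1c_cont _ _ C1).
    set (zz := fun y => affine (zd y)) in *. set (vv := fun y => affine (recip (wd y))) in *.
    assert (Ezz : zz x = z) by (unfold zz; now rewrite (Ez x Hx), Ezx).
    assert (Evv : vv x = RtoC 0) by (unfold vv; now rewrite (Ew x Hx), Ewx).
    set (den := fun y => (dB (zz y) - vv y * vv y * dA (zz y))%C).
    assert (Cden : ccont den x).
    { apply ccont_minus; [apply ccont_comp; [apply CdB|exact Cz]|].
      apply ccont_mult; [now apply ccont_mult|]. apply ccont_comp; [apply CdA|exact Cz]. }
    assert (Nden : den x <> RtoC 0).
    { unfold den. rewrite Ezz, Evv. replace (dB z - RtoC 0 * RtoC 0 * dA z)%C with (dB z) by ring.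
      now apply Hsimple. }
    assert (Cq : ccont (fun y => (zz y * zz y - RtoC a * RtoC a)%C) x).
    { apply ccont_minus; [now apply ccont_mult|apply ccont_const]. }
    assert (Nq : (zz x * zz x - RtoC a * RtoC a)%C <> RtoC 0) by (rewrite Ezz; now apply (Hend x z)).
    exists (fun y => 2 * A (zz y) / den y * V y / (zz y * zz y - RtoC a * RtoC a))%C. split.
    + apply ccont_div; [|exact Cq|exact Nq].
      apply ccont_mult; [|exact CV]. apply ccont_div; [|exact Cden|exact Nden].
      apply ccont_mult; [apply ccont_const|].
      apply ccont_comp; [|exact Cz]. exact (cdiff_cont _ _ _ (HA _)).
    + generalize (filter_and _ _ (filter_and _ _ (locally_locally _ _ L1) (locally_locally _ _ L2)) (filter_and _ _ (filter_and _ _ LW LV) (ccont_neq0 _ _ Cden Nden))).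
      apply filter_imp. intros y [[Y1' Y2'] [[Y3 Y4] Y5]] Hy.
      assert (Y1 := locally_singleton _ _ Y1'). assert (Y2 := locally_singleton _ _ Y2').
      cbv beta in Y1, Y2.
      assert (Hy' : s <= y <= t) by lra. specialize (Y3 Hy). specialize (Y4 Hy).
      unfold den, zz, vv in Y5 |- *. cbv beta in Y5 |- *.
      rewrite (Ez y Hy') in Y2, Y5 |- *. rewrite (Ew y Hy') in Y1, Y5 |- *.
      assert (Hq := Hend y).
      destruct (zf y) as [zy|] eqn:Ezy; [|congruence]. specialize (Hq zy Hy' eq_refl).
      (* differentiate [B z = A z v^2] *)
      assert (Hrel : (dB zy * W y = dA zy * W y * (affine (recip (wf y)) * affine (recip (wf y)))
                 + 2 * A zy * affine (recip (wf y)) * V y)%C).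
      { assert (K1 : cder (fun x => B (affine (zf x))) y (dB zy * W y)%C).
        { refine (cdiff_cder B (fun x => affine (zf x)) y _ _ _ Y3). rewrite Ezy. apply HB. }
        assert (K2 : cder (fun x => A (affine (zf x)) * (affine (recip (wf x)) * affine (recip (wf x))))%C y
            (dA zy * W y * (affine (recip (wf y)) * affine (recip (wf y)))
                 + 2 * A zy * affine (recip (wf y)) * V y)%C).
        { assert (K0 : cder (fun x => A (affine (zf x))) y (dA zy * W y)%C).
          { refine (cdiff_cder A (fun x => affine (zf x)) y _ _ _ Y3). rewrite Ezy. apply HA. }
          refine (cder_eq _ _ _ _ (cder_mult _ _ _ _ _ K0 (cder_mult _ _ _ _ _ Y4 Y4)) _).
          rewrite Ezy. simpl. ring. }
        refine (cder_unique _ _ _ _ K1 (cder_ext_loc _ _ _ _ _ K2)).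
        generalize (filter_and _ _ (filter_and _ _ Y1' Y2') (locally_segment y Hy)).
        apply filter_imp. intros x' [[X1 X2] X3]. rewrite (Ew x' X3) in X1. rewrite (Ez x' X3) in X2.
        assert (Hx' := Hon x' X3).
        destruct (zf x') as [z'|]; [|congruence].
        destruct (wf x') as [w'|]; simpl in Hx' |- *.
        - destruct (Ceq_dec w' (RtoC 0)) as [->|N]; [congruence|]. simpl.
          rewrite <- Hx'. field. auto.
        - rewrite Hx'. ring. }
      unfold pbw, pbz. rewrite Ezy, (cder_velocity _ _ _ Y3).
      destruct (wf y) as [wy|] eqn:Ewy.
      * assert (Nw : wy <> RtoC 0) by (intros ->; congruence).
        assert (Er : affine (recip (Fin wy)) = (/ wy)%C)
          by (apply (affine_recip (Fin wy)); congruence).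
        rewrite Er in Hrel, Y5 |- *. simpl affine in *.
        assert (E1 : (W y * (dB zy - / wy * / wy * dA zy))%C = (2 * A zy * / wy * V y)%C).
        { transitivity (dB zy * W y - dA zy * W y * (/ wy * / wy))%C; [ring|]. rewrite Hrel. ring. }
        set (dn := (dB zy - / wy * / wy * dA zy)%C) in *.
        set (q := (zy * zy - RtoC a * RtoC a)%C) in *.
        transitivity (wy * (W y * dn / dn) / q)%C; [field; auto|].
        rewrite E1. field. auto.
      * rewrite (cder_velocity _ _ _ Y4), HdB. simpl.
        f_equal. f_equal. f_equal. ring.
Qed.

End PathOnCurve.

(** * Complex derivatives of the polynomials g1 and g2 *)

Lemma ccont_filterlim (phi : C -> C) z : ccont (T := R2) phi z ->
  filterlim phi (locally (T := C_UniformSpace) z) (locally (T := C_UniformSpace) (phi z)).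
Proof.
  intros H. apply filterlim_locally. intros eps.
  destruct (ccont_C_eps phi z H eps (cond_pos eps)) as (d & Hd & K).
  apply (locally_C_intro z _ d Hd). intros v Hv. specialize (K v Hv).
  split; simpl; unfold ball; simpl; unfold AbsRing_ball, abs, minus, plus, opp; simpl.
  - eapply Rle_lt_trans; [apply (re_le_Cmod (phi v - phi z)%C)|exact K].
  - eapply Rle_lt_trans; [apply (im_le_Cmod (phi v - phi z)%C)|exact K].
Qed.

Lemma cdiff_C_derive f z l : cdiff f z l -> C_derive f z = l.
Proof.
  intros (phi & H1 & H2 & H3). apply is_C_lim_unique. rewrite <- H2.
  refine (filterlim_ext_loc (F := locally' (T := C_UniformSpace) z) phi _ _ _).
  - destruct (locally_C_elim _ _ H3) as (d & Hd & K).
    apply (locally_C_intro z _ d Hd). intros v Hv Hne. rewrite (K v Hv).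
    assert (Hq : forall v : C, v <> z -> phi v = ((f z + phi v * (v - z) - f z) / (v - z))%C).
    { intros v' N. field. intros E. apply N. rewrite <- (Cplus_0_r z), <- E. ring. }
    exact (Hq v Hne).
  - refine (filterlim_filter_le_1 _ _ (ccont_filterlim phi z H1)).
    intros P HP. unfold locally', within.
    exact (filter_imp P (fun v => v <> z -> P v) (fun v Hv _ => Hv) HP).
Qed.

Lemma cdiff_Qp ps z : cdiff (Qp ps) z (Qd ps z).
Proof.
  induction ps as [|p l IH]; [apply cdiff_const|].
  refine (cdiff_eq _ _ _ _ (cdiff_mult (fun z : C => (z - RtoC p)%C) (Qp l) z (RtoC 1) _ _ IH) _).
  - refine (cdiff_eq _ _ _ _ (cdiff_plus _ _ z _ _ (cdiff_id z) (cdiff_const (- RtoC p)%C z)) _). ring.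
  - simpl. ring.
Qed.

Lemma Qd_cont ps z : ccont (T := R2) (Qd ps) z.
Proof.
  induction ps as [|p l IH]; [apply ccont_const|].
  apply ccont_plus; [exact (cdiff_cont _ _ _ (cdiff_Qp l z))|].
  apply ccont_mult; [apply ccont_minus; [apply ccont_id|apply ccont_const]|exact IH].
Qed.

Lemma cdiff_ext (f g : C -> C) z l : (forall v, f v = g v) -> cdiff f z l -> cdiff g z l.
Proof.
  intros E (phi & H1 & H2 & H3). exists phi. split; [exact H1|]. split; [exact H2|].
  refine (locally_C_imp _ _ _ _ H3). intros v. now rewrite !E.
Qed.

Lemma cdiff_comp (f g : C -> C) z lf lg :
  cdiff f (g z) lf -> cdiff g z lg -> cdiff (fun v => f (g v)) z (lf * lg)%C.
Proof.
  intros (p & P1 & P2 & P3) Hg. assert (Cg := cdiff_cont _ _ _ Hg).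
  destruct Hg as (q & Q1 & Q2 & Q3).
  exists (fun v => p (g v) * q v)%C. split; [|split].
  - apply (ccont_mult (T := R2)); [|exact Q1]. exact (ccont_comp (T := R2) p g z P1 Cg).
  - now rewrite P2, Q2.
  - destruct (locally_C_elim _ _ P3) as (d & Hd & K).
    destruct (ccont_C_eps g z Cg d Hd) as (d' & Hd' & K').
    refine (locally_C_imp2 _ _ _ _ _ Q3 (locally_C_intro z (fun v => Cmod (v - z)%C < d') d' Hd' (fun v H => H))).
    intros v E Hv. rewrite (K (g v) (K' v Hv)) at 1. rewrite E at 2. ring.
Qed.

Lemma cdiff_unique f g z lf lg :
  locally (T := R2) z (fun v : C => f v = g v) -> cdiff f z lf -> cdiff g z lg -> lf = lg.
Proof.
  intros HL Hf (q & Q1 & Q2 & Q3).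
  rewrite <- (cdiff_C_derive _ _ _ Hf). apply cdiff_C_derive.
  exists q. split; [exact Q1|]. split; [exact Q2|].
  assert (E0 : f z = g z) by exact (locally_singleton (T := R2) z _ HL).
  refine (locally_C_imp2 _ _ _ _ _ HL Q3). intros v -> E. now rewrite E0.
Qed.

Definition rts1 (l l1 l2 : R) := l :: -1 :: l1 :: - l2 :: nil.
Definition rts2 (l l1 l2 : R) := - l :: 1 :: - l1 :: l2 :: nil.

Lemma g1_Qp l l1 l2 z : g1 l l1 l2 z = Qp (rts1 l l1 l2) z.
Proof. unfold g1; simpl. rewrite !RtoC_opp. ring. Qed.

Lemma g2_Qp l l1 l2 z : g2 l l1 l2 z = Qp (rts2 l l1 l2) z.
Proof. unfold g2; simpl. rewrite !RtoC_opp. ring. Qed.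

Lemma cdiff_g1 l l1 l2 z : cdiff (g1 l l1 l2) z (Qd (rts1 l l1 l2) z).
Proof. apply (cdiff_ext (Qp (rts1 l l1 l2))); [intros; now rewrite g1_Qp|apply cdiff_Qp]. Qed.

Lemma cdiff_g2 l l1 l2 z : cdiff (g2 l l1 l2) z (Qd (rts2 l l1 l2) z).
Proof. apply (cdiff_ext (Qp (rts2 l l1 l2))); [intros; now rewrite g2_Qp|apply cdiff_Qp]. Qed.

(** * The surface in the coordinate [u = (z^2 + a^2) / (z^2 - a^2)] *)

Section Surface.
Context (l l1 l2 a : R).
Context (Hl : 0 < l) (Hla : l < a) (Ha1 : a < 1) (Hl1 : 1 < l1) (Hl2 : l1 < l2).
Context (Hrel : (a - l) * (a + 1) * (a - l1) * (a + l2) + (a + l) * (a - 1) * (a + l1) * (a - l2) = 0).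

Definition pq (q : R) : R := (q ^ 2 + a ^ 2) / (q ^ 2 - a ^ 2).
Definition ps4 : list R := pq l :: pq l2 :: pq l1 :: pq 1 :: nil.
Definition ps6 : list R := -1 :: 1 :: ps4.
Definition cc : R := (pq l + pq l2 + pq l1 + pq 1) / 2.
(** g2 - g1 is odd in z, hence of the form 2 z (P z^2 + S). Rewriting P z^2 + S in terms of z^2 +
    a^2 and z^2 - a^2, the coefficient of z^2 + a^2 is (P + S / a^2) / 2, which is [Kc]. *)
Definition Kc : R := ((l - 1 + l1 - l2) + (l * l2 - l * l1 - l * l1 * l2 + l1 * l2) / a ^ 2) / 2.
Definition bsq : R := l * l1 * l2 / a ^ 2.
Definition beta : R := (bsq + a ^ 2) / (bsq - a ^ 2).
Definition pr4 : R := (a ^ 2 - l ^ 2) * (1 - a ^ 2) * (l1 ^ 2 - a ^ 2) * (l2 ^ 2 - a ^ 2).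
(** The scale of Y for which the quartic with roots [ps4] is monic: each u - pq q contributes a
    constant 2 a^2 / (q^2 - a^2), and their product is - 16 a^8 / pr4. *)
Definition kap : R := 4 * a ^ 4 / sqrt pr4.
Definition mu1 : R := - kap * Kc / (4 * a ^ 2).
Definition mu2 : R := kap * (bsq - a ^ 2) / (4 * a ^ 3).

Lemma pr4_pos : 0 < pr4.
Proof. unfold pr4. repeat apply Rmult_lt_0_compat; nra. Qed.

Lemma kap_pos : 0 < kap.
Proof.
  unfold kap. apply Rdiv_lt_0_compat; [|apply sqrt_lt_R0, pr4_pos].
  assert (0 < a ^ 4) by (apply pow_lt; lra). lra.
Qed.

Lemma kap_sqr : kap * kap * pr4 = 16 * a ^ 8.
Proof.
  assert (H := pr4_pos). unfold kap.
  assert (Hs : 0 < sqrt pr4) by now apply sqrt_lt_R0.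
  rewrite <- (sqrt_sqrt pr4) at 3 by lra. field. lra.
Qed.

(** Since g2(z) = g1(-z), the left side is half of g1 + g2 as a polynomial in z2 = z^2. [Hrel] makes
    a^2 a root, and the product l l1 l2 of the roots gives the other one, [bsq]. *)
Lemma quartic_factor z2 :
  z2 ^ 2 - (l + l1 - l2 - l * l1 + l * l2 + l1 * l2) * z2 + l * l1 * l2 = (z2 - a ^ 2) * (z2 - bsq).
Proof.
  unfold bsq.
  assert (E : a ^ 4 - (l + l1 - l2 - l * l1 + l * l2 + l1 * l2) * a ^ 2 + l * l1 * l2 = 0) by nra.
  assert (Ea : l + l1 - l2 - l * l1 + l * l2 + l1 * l2 = a ^ 2 + l * l1 * l2 / a ^ 2).
  { apply Rmult_eq_reg_r with (a ^ 2); [|nra]. field_simplify; [|lra]. nra. }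
  rewrite Ea. field. lra.
Qed.

(** At z2 = 1 the quadratic equals (1 - l)(1 - l1)(1 + l2) < 0, so 1 separates its roots a^2 and
    [bsq]. *)
Lemma bsq_gt : 1 < bsq.
Proof.
  assert (H := quartic_factor 1).
  assert (H1 : 0 < (1 - l) * (l1 - 1) * (1 + l2)) by (repeat apply Rmult_lt_0_compat; lra).
  assert (H2 : 0 < 1 - a ^ 2) by nra.
  assert (H3 : (1 - a ^ 2) * (1 - bsq) < 0) by nra.
  nra.
Qed.

(** This says that g2 - g1 vanishes at u = cc, half the sum of the branch values. The reason is 4 g1
    g2 = (g1 + g2)^2 - (g2 - g1)^2: after division by (z^2 - a^2)^4 the first square is the square
    of a polynomial of degree one in u, and the second is a multiple of (u^2 - 1)(u - c)^2, where c
    is the zero. The coefficients of u^4 and u^3 then show that the four roots have sum 2 c. The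
    proof verifies the identity directly. *)
Lemma cc_identity : (l * l2 - l * l1 - l * l1 * l2 + l1 * l2) / a ^ 2 - (l - 1 + l1 - l2) = 2 * Kc * cc.
Proof.
  assert (N1 : 0 < a ^ 2 - l ^ 2) by nra. assert (N2 : 0 < 1 - a ^ 2) by nra.
  assert (N3 : 0 < l1 ^ 2 - a ^ 2) by nra. assert (N4 : 0 < l2 ^ 2 - a ^ 2) by nra.
  set (A1 := (a + 1) * (a - l1) * (a + l2)).
  set (A2 := (a - 1) * (a + l1) * (a - l2)).
  assert (E : l * (A1 - A2) = a * (A1 + A2)) by (unfold A1, A2; lra).
  assert (ND : A1 - A2 <> 0).
  { intros Z. rewrite Z, Rmult_0_r in E.
    assert (A1 + A2 = 0) by (destruct (Rmult_integral a (A1 + A2)); lra).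
    assert (A1 = 0) by lra. unfold A1 in *.
    assert ((a + 1) * (a - l1) * (a + l2) < 0).
    { replace ((a + 1) * (a - l1) * (a + l2)) with (- ((a + 1) * (l1 - a) * (a + l2))) by ring.
      assert (0 < (a + 1) * (l1 - a) * (a + l2)) by (repeat apply Rmult_lt_0_compat; lra). lra. }
    lra. }
  (* [Hrel] is linear in l; eliminating l leaves an identity between rational functions of a, l1,
     l2. *)
  assert (El : l = a * (A1 + A2) / (A1 - A2)) by (apply Rmult_eq_reg_r with (A1 - A2); [rewrite E; field|]; assumption).
  unfold Kc, cc, pq. unfold A1, A2 in *.
  assert (Nl : (a * ((a + 1) * (a - l1) * (a + l2) + (a - 1) * (a + l1) * (a - l2))) ^ 2 -
    (a * ((a + 1) * (a - l1) * (a + l2) - (a - 1) * (a + l1) * (a - l2))) ^ 2 <> 0).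
  { rewrite <- E, !Rpow_mult_distr. intros Z.
    assert (Z' : (l ^ 2 - a ^ 2) * ((a + 1) * (a - l1) * (a + l2) - (a - 1) * (a + l1) * (a - l2)) ^ 2 = 0) by lra.
    destruct (Rmult_integral _ _ Z') as [Z1|Z1]; [lra|]. now apply (pow_nonzero _ 2 ND). }
  revert N1. rewrite El. intros N1.
  field.
  repeat split; try lra.
Qed.

Lemma pq_order : pq l < -1 /\ 1 < pq l2 /\ pq l2 < pq l1 /\ pq l1 < pq 1.
Proof.
  assert (N1 : 0 < a ^ 2 - l ^ 2) by nra. assert (N2 : 0 < 1 - a ^ 2) by nra.
  assert (N3 : 0 < l1 ^ 2 - a ^ 2) by nra. assert (N4 : 0 < l2 ^ 2 - a ^ 2) by nra.
  assert (Ha2 : 0 < a ^ 2) by nra.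
  assert (E : forall q, q ^ 2 - a ^ 2 <> 0 -> pq q = 1 + 2 * a ^ 2 * / (q ^ 2 - a ^ 2))
    by (intros q Hq; unfold pq; field; exact Hq).
  assert (El : pq l = -1 - 2 * l ^ 2 * / (a ^ 2 - l ^ 2)) by (unfold pq; field; lra).
  assert (P1 : 0 < / (a ^ 2 - l ^ 2)) by now apply Rinv_0_lt_compat.
  assert (P4 : 0 < / (l2 ^ 2 - a ^ 2)) by now apply Rinv_0_lt_compat.
  assert (I1 : / (l2 ^ 2 - a ^ 2) < / (l1 ^ 2 - a ^ 2)) by (apply Rinv_lt_contravar; nra).
  assert (I2 : / (l1 ^ 2 - a ^ 2) < / (1 ^ 2 - a ^ 2)) by (apply Rinv_lt_contravar; nra).
  rewrite El, !E by nra.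
  assert (0 < l ^ 2) by nra.
  repeat split; nra.
Qed.

Lemma NoDup_ps6 : NoDup ps6.
Proof.
  destruct pq_order as (H1 & H2 & H3 & H4).
  unfold ps6, ps4. repeat constructor; simpl; intuition lra.
Qed.

Lemma NoDup_ps4 : NoDup ps4.
Proof. assert (H := NoDup_ps6). inversion H as [|? ? _ H']. now inversion H'. Qed.

Lemma real_z2a2 q : q ^ 2 - a ^ 2 <> 0 -> (RtoC q * RtoC q - RtoC a * RtoC a)%C <> RtoC 0.
Proof.
  intros H E. apply H. apply RtoC_inj. rewrite <- E, RtoC_minus, !RtoC_pow. simpl. ring.
Qed.

Lemma pq_C q : q ^ 2 - a ^ 2 <> 0 ->
  RtoC (pq q) = ((RtoC q * RtoC q + RtoC a * RtoC a) / (RtoC q * RtoC q - RtoC a * RtoC a))%C.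
Proof.
  intros H. unfold pq. rewrite RtoC_div, RtoC_minus, RtoC_plus, !RtoC_pow by exact H.
  simpl. rewrite !Cmult_1_r. reflexivity.
Qed.

Definition bigq (z : C) : C := (z * z - RtoC a * RtoC a)%C.
Definition uz (z : C) : C := ((z * z + RtoC a * RtoC a) / bigq z)%C.

Lemma uz_minus_pq z q : bigq z <> RtoC 0 -> q ^ 2 - a ^ 2 <> 0 ->
  (uz z - RtoC (pq q))%C =
  (2 * (RtoC a * RtoC a) * (RtoC q * RtoC q - z * z) / ((RtoC q * RtoC q - RtoC a * RtoC a) * bigq z))%C.
Proof.
  intros Hz Hq. rewrite pq_C by exact Hq. unfold uz, bigq in *.
  field. split; [exact Hz|now apply real_z2a2].
Qed.

Lemma q2_neq : l ^ 2 - a ^ 2 <> 0 /\ 1 ^ 2 - a ^ 2 <> 0 /\ l1 ^ 2 - a ^ 2 <> 0 /\ l2 ^ 2 - a ^ 2 <> 0.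
Proof. repeat split; nra. Qed.

Lemma kap_sqr_C : (RtoC kap * RtoC kap *
  ((RtoC l * RtoC l - RtoC a * RtoC a) * (1 - RtoC a * RtoC a) *
   (RtoC l1 * RtoC l1 - RtoC a * RtoC a) * (RtoC l2 * RtoC l2 - RtoC a * RtoC a)))%C
  = (- (16 * (RtoC a * RtoC a * RtoC a * RtoC a * RtoC a * RtoC a * RtoC a * RtoC a)))%C.
Proof.
  assert (H := kap_sqr). unfold pr4 in H.
  rewrite <- !RtoC_mult, <- !RtoC_minus, <- !RtoC_mult, <- RtoC_opp. f_equal.
  lra.
Qed.

(** Each u(z) - pq q is a constant times (q^2 - z^2) / (z^2 - a^2), and g1 g2 is the product of z^2
    - q^2 over q = l, 1, l1, l2. *)
Lemma Qp_ps4 z : bigq z <> RtoC 0 ->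
  Qp ps4 (uz z) = (- (RtoC kap * RtoC kap) * (g1 l l1 l2 z * g2 l l1 l2 z)
                   / (bigq z * bigq z * bigq z * bigq z))%C.
Proof.
  intros Hz. destruct q2_neq as (N1 & N2 & N3 & N4). assert (K := kap_sqr_C).
  assert (M1 := real_z2a2 _ N1). assert (M2 := real_z2a2 _ N2).
  assert (M3 := real_z2a2 _ N3). assert (M4 := real_z2a2 _ N4).
  unfold ps4; simpl Qp. rewrite !uz_minus_pq by assumption. unfold g1, g2.
  set (D := ((RtoC l * RtoC l - RtoC a * RtoC a) * (1 - RtoC a * RtoC a) *
   (RtoC l1 * RtoC l1 - RtoC a * RtoC a) * (RtoC l2 * RtoC l2 - RtoC a * RtoC a))%C) in *.
  assert (ND : D <> RtoC 0).
  { unfold D. repeat apply Cmult_neq_0; try assumption.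
    intros E. apply M2. rewrite <- E. ring. }
  assert (EK : (RtoC kap * RtoC kap)%C
    = (- (16 * (RtoC a * RtoC a * RtoC a * RtoC a * RtoC a * RtoC a * RtoC a * RtoC a)) / D)%C).
  { rewrite <- K. field. exact ND. }
  rewrite EK. unfold D. clear EK K.
  assert (M2' : (1 - RtoC a * RtoC a)%C <> RtoC 0) by (intros E; apply M2; rewrite <- E; ring).
  field. repeat split; auto.
Qed.

(* [d/dz] of [Qp_ps4] at a root of [g1 g2], where [du/dz = - 4 a^2 z / (z^2 - a^2)^2]. *)
Lemma Qd_ps4 z : bigq z <> RtoC 0 -> (g1 l l1 l2 z * g2 l l1 l2 z)%C = RtoC 0 ->
  (Qd ps4 (uz z) * (4 * (RtoC a * RtoC a) * z) * (bigq z * bigq z))%C =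
  (RtoC kap * RtoC kap * (Qd (rts1 l l1 l2) z * g2 l l1 l2 z + g1 l l1 l2 z * Qd (rts2 l l1 l2) z))%C.
Proof.
  intros Hz H0.
  assert (Cz : cdiff uz z (- (4 * (RtoC a * RtoC a) * z) / (bigq z * bigq z))%C).
  { assert (Dq : forall s, cdiff (fun z : C => (z * z + s)%C) z (z + z)%C).
    { intros s. refine (cdiff_eq _ _ _ _ (cdiff_plus _ _ z _ _
        (cdiff_mult _ _ z _ _ (cdiff_id z) (cdiff_id z)) (cdiff_const s z)) _). ring. }
    refine (cdiff_eq _ _ _ _ (cdiff_mult _ _ z _ _ (Dq (RtoC a * RtoC a)%C)
      (cdiff_inv bigq z _ (Dq (- (RtoC a * RtoC a))%C) Hz)) _).
    unfold bigq in *. field. exact Hz. }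
  assert (Cb : cdiff bigq z (z + z)%C).
  { refine (cdiff_eq _ _ _ _ (cdiff_plus _ _ z _ _
        (cdiff_mult _ _ z _ _ (cdiff_id z) (cdiff_id z)) (cdiff_const (- (RtoC a * RtoC a))%C z)) _). ring. }
  set (b2 := fun z => (bigq z * bigq z)%C).
  assert (Cb2 := cdiff_mult _ _ z _ _ Cb Cb). fold b2 in Cb2.
  assert (Cb4 := cdiff_mult _ _ z _ _ Cb2 Cb2).
  assert (CL := cdiff_mult _ _ z _ _ (cdiff_comp _ _ z _ _ (cdiff_Qp ps4 (uz z)) Cz) Cb4).
  assert (CR := cdiff_mult _ _ z _ _ (cdiff_const (- (RtoC kap * RtoC kap))%C z)
     (cdiff_mult _ _ z _ _ (cdiff_g1 l l1 l2 z) (cdiff_g2 l l1 l2 z))).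
  assert (HL : locally (T := R2) z (fun v : C => (Qp ps4 (uz v) * (b2 v * b2 v))%C =
     (- (RtoC kap * RtoC kap) * (g1 l l1 l2 v * g2 l l1 l2 v))%C)).
  { refine (locally_C_imp _ _ _ _ (ccont_neq0 (T := R2) bigq z (cdiff_cont _ _ _ Cb) Hz)).
    intros v Hv. rewrite Qp_ps4 by exact Hv. unfold b2. field. exact Hv. }
  assert (E := cdiff_unique _ _ _ _ _ HL CL CR). cbv beta in E.
  rewrite Qp_ps4 in E by exact Hz. rewrite H0 in E. unfold b2 in E.
  transitivity (- (Qd ps4 (uz z) * (- (4 * (RtoC a * RtoC a) * z) / (bigq z * bigq z))
      * (bigq z * bigq z * (bigq z * bigq z))))%C; [field; exact Hz|].
  match type of E with (?A + ?B)%C = _ => assert (EB : B = RtoC 0) end.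
  { field. exact Hz. }
  rewrite EB, Cplus_0_r in E. rewrite E. ring.
Qed.

End Surface.

(** * The forms in terms of [u] *)

Section SurfacePaths.
Context (l l1 l2 a : R).
Context (Hl : 0 < l) (Hla : l < a) (Ha1 : a < 1) (Hl1 : 1 < l1) (Hl2 : l1 < l2).
Context (Hrel : (a - l) * (a + 1) * (a - l1) * (a + l2) + (a + l) * (a - 1) * (a + l1) * (a - l2) = 0).

Notation G1 := (g1 l l1 l2).
Notation G2 := (g2 l l1 l2).
Notation q := (bigq a).
Notation u_z := (uz a).
Notation kp := (RtoC (kap l l1 l2 a)).
Notation K1 := (RtoC (Kc l l1 l2 a)).
Notation c1 := (RtoC (cc l l1 l2 a)).
Notation bt := (RtoC (beta l l1 l2 a)).
Notation b2 := (RtoC (bsq l l1 l2 a)).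
Notation m1 := (RtoC (mu1 l l1 l2 a)).
Notation m2 := (RtoC (mu2 l l1 l2 a)).
Notation Q4 := (ps4 l l1 l2 a).
Notation Q6 := (ps6 l l1 l2 a).
Notation A := (RtoC a).

(* [uS], [VS], [YS], [Y6] are the functions u, V, Y and Y6 = - i V Y on the surface. *)
Definition uS (p : sphere * sphere) : C :=
  match fst p with Fin z => u_z z | Infty => RtoC 1 end.

Definition VS (p : sphere * sphere) : C :=
  match fst p with Fin z => (2 * A * z / q z)%C | Infty => RtoC 0 end.

(** The values at infinity are the continuous extensions: g2 / (z^2 - a^2)^2 tends to 1 at z = oo,
    and at w = oo one has g2 w = g1 / w, which tends to 0. *)
Definition YS (p : sphere * sphere) : C :=
  match p with
  | (Fin z, Fin w) => (kp * (G2 z * w) / (q z * q z))%C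
  | (Infty, Fin w) => (kp * w)%C
  | _ => RtoC 0
  end.

Definition Y6 (p : sphere * sphere) : C := (- Ci * (VS p * YS p))%C.

Definition on_surf (p : sphere * sphere) : Prop :=
  curve_pt G1 G2 (fst p) (snd p) /\ forall z, fst p = Fin z -> q z <> RtoC 0.

Lemma NA : A <> RtoC 0.
Proof. intros E. apply RtoC_inj in E. lra. Qed.

Lemma bsq_C : (b2 * (A * A))%C = (RtoC l * RtoC l1 * RtoC l2)%C.
Proof.
  rewrite <- !RtoC_mult. f_equal. unfold bsq. field. lra.
Qed.

Lemma b2_neq : (b2 - A * A)%C <> RtoC 0.
Proof.
  intros E. assert (H := bsq_gt l l1 l2 a Hl Hla Ha1 Hl1 Hl2 Hrel).
  rewrite <- RtoC_mult, <- RtoC_minus in E. apply RtoC_inj in E. nra.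
Qed.

Lemma beta_C : bt = ((b2 + A * A) / (b2 - A * A))%C.
Proof.
  assert (H := bsq_gt l l1 l2 a Hl Hla Ha1 Hl1 Hl2 Hrel).
  unfold beta. rewrite RtoC_div, RtoC_minus, RtoC_plus, !RtoC_pow by nra.
  simpl. rewrite !Cmult_1_r. reflexivity.
Qed.

Lemma mu1_C : m1 = (- kp * K1 / (4 * (A * A)))%C.
Proof.
  assert (Hd : 4 * a ^ 2 <> 0) by (intros E; assert (0 < a * a) by (apply Rmult_lt_0_compat; lra); simpl in E; lra).
  unfold mu1. rewrite RtoC_div, !RtoC_mult, RtoC_opp, RtoC_pow by exact Hd.
  simpl. rewrite !Cmult_1_r. reflexivity.
Qed.

Lemma mu2_C : m2 = (kp * (b2 - A * A) / (4 * (A * A * A)))%C.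
Proof.
  assert (H := NA).
  assert (Hd : 4 * a ^ 3 <> 0) by (intros E; assert (0 < a * a * a) by (repeat apply Rmult_lt_0_compat; lra); simpl in E; lra).
  unfold mu2. rewrite RtoC_div, !RtoC_mult, RtoC_minus, !RtoC_pow by exact Hd.
  simpl. field. exact H.
Qed.

Lemma RtoC_m1 : RtoC (-1) = (- RtoC 1)%C.
Proof. rewrite <- RtoC_opp. apply f_equal. lra. Qed.

Lemma kp_neq0 : kp <> RtoC 0.
Proof.
  intros E. apply RtoC_inj in E.
  assert (H := kap_pos l l1 l2 a Hl Hla Ha1 Hl1 Hl2). lra.
Qed.

Lemma g_sum z : (G1 z + G2 z)%C = (2 * q z * (z * z - b2))%C.
Proof.
  assert (NAA := NA).
  assert (E : forall x, x ^ 2 - (l + l1 - l2 - l * l1 + l * l2 + l1 * l2) * x + l * l1 * l2 = (x - a ^ 2) * (x - bsq l l1 l2 a)).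
  { intros x. exact (quartic_factor l l1 l2 a Hl Hla Hrel x). }
  assert (E0 := E 0). assert (E1 := E 1). assert (Em := E (-1)).
  assert (ES : a ^ 2 + bsq l l1 l2 a = l + l1 - l2 - l * l1 + l * l2 + l1 * l2) by lra.
  assert (EP : a ^ 2 * bsq l l1 l2 a = l * l1 * l2) by lra.
  assert (ES' : (A * A + b2)%C = (RtoC l + RtoC l1 - RtoC l2 - RtoC l * RtoC l1 + RtoC l * RtoC l2 + RtoC l1 * RtoC l2)%C).
  { rewrite <- !RtoC_mult, <- ?RtoC_plus, <- ?RtoC_minus, <- ?RtoC_plus. f_equal. lra. }
  assert (EP' := bsq_C).
  unfold g1, g2, bigq.
  transitivity (2 * (z * z * z * z - (RtoC l + RtoC l1 - RtoC l2 - RtoC l * RtoC l1 + RtoC l * RtoC l2 + RtoC l1 * RtoC l2) * (z * z) + RtoC l * RtoC l1 * RtoC l2))%C; [ring|].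
  rewrite <- ES', <- EP'. ring.
Qed.

Lemma g_diff z : (G2 z - G1 z)%C = (2 * z * K1 * ((z * z + A * A) - c1 * q z))%C.
Proof.
  assert (Ha0 : a <> 0) by lra.
  assert (E := cc_identity l l1 l2 a Hl Hla Ha1 Hl1 Hl2 Hrel).
  set (k := Kc l l1 l2 a) in *. set (c := cc l l1 l2 a) in *.
  assert (E1 : k * (1 - c) = l - 1 + l1 - l2).
  { unfold k, Kc in *. lra. }
  assert (E2 : k * (1 + c) * (a * a) = l * l2 - l * l1 - l * l1 * l2 + l1 * l2).
  { replace (k * (1 + c)) with ((l * l2 - l * l1 - l * l1 * l2 + l1 * l2) / a ^ 2).
    - field. exact Ha0.
    - unfold k, Kc in *. lra. }
  assert (E1' : (RtoC k * (1 - RtoC c))%C = (RtoC l - 1 + RtoC l1 - RtoC l2)%C).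
  { rewrite <- !RtoC_minus, <- RtoC_plus, <- RtoC_minus, <- RtoC_mult. now f_equal. }
  assert (E2' : (RtoC k * (1 + RtoC c) * (A * A))%C =
    (RtoC l * RtoC l2 - RtoC l * RtoC l1 - RtoC l * RtoC l1 * RtoC l2 + RtoC l1 * RtoC l2)%C).
  { rewrite <- !RtoC_plus, <- !RtoC_mult, <- !RtoC_minus, <- RtoC_plus. now f_equal. }
  unfold g1, g2, bigq.
  transitivity (2 * z * ((RtoC l - 1 + RtoC l1 - RtoC l2) * (z * z) +
     (RtoC l * RtoC l2 - RtoC l * RtoC l1 - RtoC l * RtoC l1 * RtoC l2 + RtoC l1 * RtoC l2)))%C; [ring|].
  rewrite <- E1', <- E2'. ring.
Qed.

Lemma Gsimple1 z : G1 z = RtoC 0 -> G2 z <> RtoC 0 /\ Qd (rts1 l l1 l2) z <> RtoC 0.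
Proof.
  rewrite g1_Qp, g2_Qp. intros H. split.
  - intros H'. destruct (Qp_root _ _ H) as (p & Hp & ->). destruct (Qp_root _ _ H') as (p' & Hp' & E).
    apply RtoC_inj in E. subst p'. unfold rts1, rts2 in *. simpl in *. intuition lra.
  - apply Qd_neq0; [|exact H]. unfold rts1. repeat constructor; simpl; intuition lra.
Qed.

Lemma Gsimple2 z : G2 z = RtoC 0 -> G1 z <> RtoC 0 /\ Qd (rts2 l l1 l2) z <> RtoC 0.
Proof.
  rewrite g1_Qp, g2_Qp. intros H. split.
  - intros H'. destruct (Qp_root _ _ H) as (p & Hp & ->). destruct (Qp_root _ _ H') as (p' & Hp' & E).
    apply RtoC_inj in E. subst p'. unfold rts1, rts2 in *. simpl in *. intuition lra.
  - apply Qd_neq0; [|exact H]. unfold rts2. repeat constructor; simpl; intuition lra.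
Qed.

Lemma G_root_neq0 z : (G1 z * G2 z)%C = RtoC 0 -> z <> RtoC 0.
Proof.
  intros H ->.
  assert (E : (G1 (RtoC 0) * G2 (RtoC 0))%C = RtoC ((l * l1 * l2) * (l * l1 * l2))).
  { unfold g1, g2. rewrite !RtoC_mult. ring. }
  rewrite E in H. apply RtoC_inj in H.
  assert (0 < l * l1 * l2) by (repeat apply Rmult_lt_0_compat; lra). nra.
Qed.

Lemma VS_sqr p : on_surf p -> (VS p * VS p)%C = (uS p * uS p - 1)%C.
Proof.
  intros [_ H]. unfold VS, uS, uz. destruct (fst p) as [z|].
  - specialize (H z eq_refl). unfold bigq in *. field. exact H.
  - ring.
Qed.

Lemma YS_sqr p : on_surf p -> curve Q4 (-1) (uS p) (YS p).
Proof.
  intros [Hc H]. unfold curve. destruct p as [[z|] [w|]]; unfold YS, uS; cbn [fst snd] in *; cbv beta iota.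
  - specialize (H z eq_refl). rewrite Qp_ps4 by assumption. rewrite <- Hc.
    rewrite RtoC_m1. field. exact H.
  - specialize (H z eq_refl). rewrite Qp_ps4 by assumption. simpl in Hc. rewrite Hc.
    rewrite RtoC_m1. field. exact H.
  - simpl in Hc.
    transitivity (kp * kp * (w * w))%C; [ring|]. rewrite Hc.
    assert (K := kap_sqr_C l l1 l2 a Hl Hla Ha1 Hl1 Hl2).
    destruct (q2_neq l l1 l2 a Hl Hla Ha1 Hl1 Hl2) as (N1 & N2 & N3 & N4).
    assert (M1 := real_z2a2 a _ N1). assert (M2 := real_z2a2 a _ N2).
    assert (M3 := real_z2a2 a _ N3). assert (M4 := real_z2a2 a _ N4).
    assert (M2' : (1 - A * A)%C <> RtoC 0) by (intros E; apply M2; rewrite <- E; ring).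
    unfold ps4; simpl Qp. rewrite !pq_C by assumption.
    set (D := ((RtoC l * RtoC l - A * A) * (1 - A * A) *
      (RtoC l1 * RtoC l1 - A * A) * (RtoC l2 * RtoC l2 - A * A))%C) in *.
    assert (ND : D <> RtoC 0) by (unfold D; repeat apply Cmult_neq_0; assumption).
    transitivity (kp * kp * D / D)%C; [field; exact ND|]. rewrite K. unfold D.
    rewrite RtoC_m1. field. repeat split; auto.
  - contradiction.
Qed.

Lemma cdiff_sqr_plus s z : cdiff (fun z : C => (z * z + s)%C) z (z + z)%C.
Proof.
  refine (cdiff_eq _ _ _ _ (cdiff_plus _ _ z _ _
    (cdiff_mult _ _ z _ _ (cdiff_id z) (cdiff_id z)) (cdiff_const s z)) _). ring.
Qed.

Lemma cdiff_bigq z : cdiff q z (z + z)%C.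
Proof. exact (cdiff_sqr_plus (- (A * A))%C z). Qed.

Lemma cdiff_uz z : q z <> RtoC 0 -> cdiff u_z z (- (4 * (A * A) * z) / (q z * q z))%C.
Proof.
  intros Hz.
  refine (cdiff_eq _ _ _ _ (cdiff_mult _ _ z _ _ (cdiff_sqr_plus (A * A)%C z)
    (cdiff_inv q z _ (cdiff_bigq z) Hz)) _).
  unfold bigq in *. field. exact Hz.
Qed.

Lemma cdiff_vz z : q z <> RtoC 0 ->
  cdiff (fun z => 2 * A * z / q z)%C z (- (2 * A) * (z * z + A * A) / (q z * q z))%C.
Proof.
  intros Hz.
  refine (cdiff_eq _ _ _ _ (cdiff_mult _ _ z _ _ (cdiff_mult _ _ z _ _ (cdiff_const (2 * A)%C z) (cdiff_id z))
    (cdiff_inv q z _ (cdiff_bigq z) Hz)) _).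
  unfold bigq in *. field. exact Hz.
Qed.

Section OnePoint.
Context (zf wf : R -> sphere) (x : R).
Context (Hz : sphere_C1_at zf x) (Hw : sphere_C1_at wf x).
Context (Hon : locally x (fun y => on_surf (zf y, wf y))).

Notation Dx := (pbz a zf x).
Notation pt := (fun y => (zf y, wf y)).

Lemma C1c_here g : C1c g x -> cder g x (velocity g x).
Proof.
  intros (g' & H & _). apply locally_singleton in H. cbv beta in H.
  now rewrite (cder_velocity _ _ _ H).
Qed.

Lemma one_minus_neq0 z : z <> RtoC 0 -> q z <> RtoC 0 ->
  (1 - A * A * (/ z * / z))%C <> RtoC 0.
Proof.
  intros H1 H2 E. apply H2. unfold bigq.
  transitivity (z * z * (1 - A * A * (/ z * / z)))%C; [field; auto|]. rewrite E. ring.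
Qed.

(** That is, du = - 2 a V dh and dV = - 2 a u dh. Adding these, u + V = (z + a) / (z - a) satisfies
    d(u + V) = - 2 a (u + V) dh, the source of the height function. *)
Lemma uV_derivative :
  cder (fun y => uS (pt y)) x (- (2 * A) * VS (pt x) * Dx)%C /\
  cder (fun y => VS (pt y)) x (- (2 * A) * uS (pt x) * Dx)%C.
Proof.
  destruct (locally_singleton _ _ Hon) as [_ Hq]. cbn [fst snd] in Hq.
  destruct (zf x) as [z|] eqn:Ez.
  - destruct (finite_chart _ _ Hz) as [L C]; [rewrite Ez; discriminate|].
    apply C1c_here in C. set (W := velocity _ x) in C.
    assert (ED : Dx = (W / q z)%C) by (unfold pbz; now rewrite Ez).
    specialize (Hq z eq_refl).
    assert (Ea : affine (zf x) = z) by now rewrite Ez.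
    assert (EV : VS (Fin z, wf x) = (2 * A * z / q z)%C) by reflexivity.
    assert (EU : uS (Fin z, wf x) = u_z z) by reflexivity.
    cbv beta. rewrite ED, EV, EU. split.
    + refine (cder_ext_loc (fun y => u_z (affine (zf y))) _ _ _ _ _).
      { refine (filter_imp _ _ _ L). intros y Hy. unfold uS. cbn [fst]. destruct (zf y); [reflexivity|congruence]. }
      refine (cder_eq _ _ _ _ (cdiff_cder u_z _ x _ _ (cdiff_uz _ _) C) _); rewrite Ea; [exact Hq|].
      field. exact Hq.
    + refine (cder_ext_loc (fun y => 2 * A * affine (zf y) / q (affine (zf y)))%C _ _ _ _ _).
      { refine (filter_imp _ _ _ L). intros y Hy. unfold VS. cbn [fst]. destruct (zf y); [reflexivity|congruence]. }
      refine (cder_eq _ _ _ _ (cdiff_cder (fun z => 2 * A * z / q z)%C _ x _ _ (cdiff_vz _ _) C) _); rewrite Ea; [exact Hq|].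
      unfold uz. field. exact Hq.
  - destruct (infinite_chart _ _ Hz) as [L C]; [rewrite Ez; discriminate|].
    apply C1c_here in C. set (W := velocity _ x) in C.
    assert (ED : Dx = (- W)%C) by (unfold pbz; now rewrite Ez).
    assert (Ea : affine (recip (zf x)) = RtoC 0) by now rewrite Ez.
    assert (N1 : RtoC 1 <> RtoC 0) by exact C1_neq_0.
    set (om := fun y => affine (recip (zf y))) in *.
    assert (Cb : cder (fun y => 1 - A * A * (om y * om y))%C x (RtoC 0)).
    { refine (cder_eq _ _ _ _ (cder_minus _ _ _ _ _ (cder_const (RtoC 1) x)
        (cder_mult _ _ _ _ _ (cder_const (A * A)%C x) (cder_mult _ _ _ _ _ C C))) _).
      unfold om. rewrite Ea. ring. }
    assert (Cp : cder (fun y => 1 + A * A * (om y * om y))%C x (RtoC 0)).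
    { refine (cder_eq _ _ _ _ (cder_plus _ _ _ _ _ (cder_const (RtoC 1) x)
        (cder_mult _ _ _ _ _ (cder_const (A * A)%C x) (cder_mult _ _ _ _ _ C C))) _).
      unfold om. rewrite Ea. ring. }
    assert (Nb : (1 - A * A * (om x * om x))%C <> RtoC 0).
    { unfold om. rewrite Ea. intros E. apply N1. rewrite <- E. ring. }
    assert (Ci' := cder_inv _ _ _ Cb Nb).
    assert (LL := filter_and _ _ L Hon).
    assert (EV : VS (Infty, wf x) = RtoC 0) by reflexivity.
    assert (EU : uS (Infty, wf x) = RtoC 1) by reflexivity.
    cbv beta. rewrite ED, EV, EU. split.
    + refine (cder_ext_loc (fun y => (1 + A * A * (om y * om y)) * / (1 - A * A * (om y * om y)))%C _ _ _ _ _).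
      { refine (filter_imp _ _ _ LL). intros y [Hy [_ Hqy]]. cbn [fst] in Hqy. unfold om, uS. cbn [fst].
        destruct (zf y) as [zy|].
        - assert (Nz : zy <> RtoC 0) by congruence. specialize (Hqy zy eq_refl).
          rewrite (affine_recip (Fin zy)) by congruence. cbn [affine].
          assert (Nq := one_minus_neq0 zy Nz Hqy). unfold uz, bigq in *. field. repeat split; auto.
        - cbn. field. }
      refine (cder_eq _ _ _ _ (cder_mult _ _ _ _ _ Cp Ci') _).
      unfold om. rewrite Ea. field.
    + refine (cder_ext_loc (fun y => (2 * A * om y) * / (1 - A * A * (om y * om y)))%C _ _ _ _ _).
      { refine (filter_imp _ _ _ LL). intros y [Hy [_ Hqy]]. cbn [fst] in Hqy. unfold om, VS. cbn [fst].
        destruct (zf y) as [zy|].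
        - assert (Nz : zy <> RtoC 0) by congruence. specialize (Hqy zy eq_refl).
          rewrite (affine_recip (Fin zy)) by congruence. cbn [affine].
          assert (Nq := one_minus_neq0 zy Nz Hqy). unfold uz, bigq in *. field. repeat split; auto.
        - cbn. field. }
      refine (cder_eq _ _ _ _ (cder_mult _ _ _ _ _ (cder_mult _ _ _ _ _ (cder_const (2 * A)%C x) C) Ci') _).
      unfold om. rewrite Ea. field.
Qed.

Lemma cder_bigq_path g dg : cder g x dg -> cder (fun y => q (g y)) x ((g x + g x) * dg)%C.
Proof. exact (cdiff_cder q g x _ dg (cdiff_bigq (g x))). Qed.

(** At w = oo the expression g2 w is replaced by g1 v with v = 1/w. The derivative is made explicit
    at the zeros of Y, where w or 1/w is the coordinate in which the forms are given. *)
Lemma Y_derivative : exists dY, cder (fun y => YS (pt y)) x dY /\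
  (forall z, zf x = Fin z -> wf x = Fin (RtoC 0) ->
     dY = (kp * G2 z * velocity (fun y => affine (wf y)) x / (q z * q z))%C) /\
  (forall z, zf x = Fin z -> wf x = Infty ->
     dY = (kp * G1 z * velocity (fun y => affine (recip (wf y))) x / (q z * q z))%C).
Proof.
  destruct (locally_singleton _ _ Hon) as [Hcx Hq]. cbn [fst snd] in Hq, Hcx.
  destruct (wf x) as [w|] eqn:Ew.
  - destruct (finite_chart _ _ Hw) as [Lw Cw]; [rewrite Ew; discriminate|].
    apply C1c_here in Cw. set (W := velocity _ x) in *.
    assert (Eaw : affine (wf x) = w) by now rewrite Ew.
    destruct (zf x) as [z|] eqn:Ez.
    + destruct (finite_chart _ _ Hz) as [L C]; [rewrite Ez; discriminate|].
      apply C1c_here in C. set (Z := velocity _ x) in C.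
      assert (Ea : affine (zf x) = z) by now rewrite Ez.
      specialize (Hq z eq_refl).
      assert (Cq := cder_bigq_path _ _ C).
      assert (Nqq : (q (affine (zf x)) * q (affine (zf x)))%C <> RtoC 0)
        by (rewrite Ea; now apply Cmult_neq_0).
      assert (CG := cdiff_cder G2 _ x _ _ (cdiff_g2 l l1 l2 (affine (zf x))) C).
      assert (CY := cder_mult _ _ _ _ _ (cder_mult _ _ _ _ _ (cder_const kp x) (cder_mult _ _ _ _ _ CG Cw))
         (cder_inv _ _ _ (cder_mult _ _ _ _ _ Cq Cq) Nqq)).
      eexists. split; [|split].
      * refine (cder_ext_loc _ _ _ _ _ CY).
        generalize (filter_and _ _ L Lw). apply filter_imp. intros y [Y1 Y2].
        destruct (zf y); [|congruence]. destruct (wf y); [|congruence]. reflexivity.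
      * intros z' Ez' Ew'. injection Ez' as <-. injection Ew' as ->.
        cbv beta. rewrite Ea, Eaw. field. exact Hq.
      * discriminate.
    + destruct (infinite_chart _ _ Hz) as [L C]; [rewrite Ez; discriminate|].
      apply C1c_here in C. set (Z := velocity _ x) in C.
      set (om := fun y => affine (recip (zf y))) in *.
      assert (Ea : om x = RtoC 0) by (unfold om; now rewrite Ez).
      (* g2(z) / z^4 as a polynomial in o = 1/z. *)
      set (P := fun o : Complex.C => ((1 + RtoC l * o) * (1 + - (1) * o) * (1 + RtoC l1 * o) * (1 + - RtoC l2 * o))%C).
      assert (CP : exists dP, cder (fun y => P (om y)) x dP).
      { assert (Lin : forall k, cder (fun y => 1 + k * om y)%C x _)
          by exact (fun k => cder_plus _ _ _ _ _ (cder_const (RtoC 1) x) (cder_mult _ _ _ _ _ (cder_const k x) C)).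
        eexists. exact (cder_mult _ _ _ _ _ (cder_mult _ _ _ _ _ (cder_mult _ _ _ _ _ (Lin _) (Lin _)) (Lin _)) (Lin _)). }
      destruct CP as [dP CP].
      assert (Cb : cder (fun y => 1 - A * A * (om y * om y))%C x _)
        by exact (cder_minus _ _ _ _ _ (cder_const (RtoC 1) x)
          (cder_mult _ _ _ _ _ (cder_const (A * A)%C x) (cder_mult _ _ _ _ _ C C))).
      assert (Nb : ((1 - A * A * (om x * om x)) * (1 - A * A * (om x * om x)))%C <> RtoC 0).
      { rewrite Ea. intros E. apply C1_neq_0. rewrite <- E. ring. }
      assert (CY := cder_mult _ _ _ _ _ (cder_mult _ _ _ _ _ (cder_const kp x) (cder_mult _ _ _ _ _ CP Cw))
         (cder_inv _ _ _ (cder_mult _ _ _ _ _ Cb Cb) Nb)).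
      eexists. split; [|split; discriminate].
      refine (cder_ext_loc _ _ _ _ _ CY).
      generalize (filter_and _ _ (filter_and _ _ L Lw) Hon). apply filter_imp. intros y [[Y1 Y2] [_ Hqy]].
      cbn [fst] in Hqy. unfold om.
      destruct (wf y) as [wy|]; [|congruence]. cbn [affine].
      destruct (zf y) as [zy|].
      * assert (Nz : zy <> RtoC 0) by congruence. specialize (Hqy zy eq_refl).
        rewrite (affine_recip (Fin zy)) by congruence. cbn [affine].
        assert (Nq := one_minus_neq0 zy Nz Hqy). unfold YS, P, g2, bigq in *. field. repeat split; auto.
      * cbn. unfold P. field.
  - destruct (zf x) as [z|] eqn:Ez; [|contradiction].
    destruct (infinite_chart _ _ Hw) as [Lw Cw]; [rewrite Ew; discriminate|].
    apply C1c_here in Cw. set (W := velocity _ x) in *.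
    assert (Eaw : affine (recip (wf x)) = RtoC 0) by now rewrite Ew.
    destruct (finite_chart _ _ Hz) as [L C]; [rewrite Ez; discriminate|].
    apply C1c_here in C. set (Z := velocity _ x) in C.
    assert (Ea : affine (zf x) = z) by now rewrite Ez.
    specialize (Hq z eq_refl).
    assert (Cq := cder_bigq_path _ _ C).
    assert (Nqq : (q (affine (zf x)) * q (affine (zf x)))%C <> RtoC 0)
      by (rewrite Ea; now apply Cmult_neq_0).
    assert (CG := cdiff_cder G1 _ x _ _ (cdiff_g1 l l1 l2 (affine (zf x))) C).
    assert (CY := cder_mult _ _ _ _ _ (cder_mult _ _ _ _ _ (cder_const kp x) (cder_mult _ _ _ _ _ CG Cw))
       (cder_inv _ _ _ (cder_mult _ _ _ _ _ Cq Cq) Nqq)).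
    eexists. split; [|split].
    + refine (cder_ext_loc _ _ _ _ _ CY).
      generalize (filter_and _ _ (filter_and _ _ L Lw) Hon). apply filter_imp.
      intros y [[Y1 Y2] [Hcy _]]. cbn [fst snd] in Hcy.
      destruct (zf y) as [zy|]; [|congruence]. cbn [affine].
      destruct (wf y) as [wy|].
      * assert (Nw : wy <> RtoC 0) by congruence.
        rewrite (affine_recip (Fin wy)) by congruence. cbn [affine YS].
        simpl in Hcy. rewrite <- Hcy. unfold Cdiv. f_equal. field. exact Nw.
      * cbn. ring.
    + discriminate.
    + intros z' Ez' _. injection Ez' as <-.
      cbv beta. rewrite Ea, Eaw. field. exact Hq.
Qed.

Notation Gd := (pbw G1 G2 a zf wf x).
Notation Og := (pbw G2 G1 a zf (fun y => recip (wf y)) x).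
Definition f1 : C := (/ 2 * (Og - Gd))%C.
Definition f2 : C := (Ci / 2 * (Og + Gd))%C.

Lemma two_neq0 : RtoC 2 <> RtoC 0.
Proof. intros E. apply RtoC_inj in E. lra. Qed.

(** Multiplication by Y turns 1/w - w and 1/w + w into g2 - g1 and g2 + g1, because g2 w^2 = g1.
    These are the polynomials factored by [g_diff] and [g_sum]; together with du = - 2 a V dh this
    gives the two forms in terms of u. *)
Lemma forms_regular : YS (zf x, wf x) <> RtoC 0 ->
  (f1 * YS (zf x, wf x))%C = (kp * K1 / (2 * A) * (uS (zf x, wf x) - c1) * VS (zf x, wf x) * Dx)%C /\
  (f2 * YS (zf x, wf x))%C = (- Ci * (kp * (b2 - A * A) / (2 * (A * A))) * (uS (zf x, wf x) - bt) * Dx)%C.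
Proof.
  intros HY. assert (NA0 := NA). assert (Nb := b2_neq).
  destruct (locally_singleton _ _ Hon) as [Hc Hq]. cbn [fst snd] in Hq, Hc.
  rewrite beta_C. unfold f1, f2.
  destruct (wf x) as [w|] eqn:Ew; [|exfalso; apply HY; destruct (zf x); reflexivity].
  assert (Nw : w <> RtoC 0).
  { intros ->. apply HY. destruct (zf x); cbn; [unfold Cdiv|]; ring. }
  assert (EG : Gd = (w * Dx)%C) by (unfold pbw; rewrite Ew; destruct (zf x); reflexivity).
  assert (EO : Og = (/ w * Dx)%C).
  { unfold pbw. rewrite Ew. cbn [recip]. destruct (Ceq_dec w (RtoC 0)); [congruence|].
    destruct (zf x); reflexivity. }
  rewrite EG, EO. set (D := Dx). clearbody D.
  destruct (zf x) as [z|] eqn:Ez; cbn [curve_pt] in Hc.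
  - specialize (Hq z eq_refl).
    assert (Ed := g_diff z). assert (Es := g_sum z). unfold YS, uS, VS. cbn [fst]. split.
    + transitivity (kp / 2 * (G2 z - G2 z * (w * w)) * D / (q z * q z))%C; [field; auto|].
      rewrite Hc, Ed. unfold uz. field. auto.
    + transitivity (Ci / 2 * kp * (G2 z * (w * w) + G2 z) * D / (q z * q z))%C; [field; auto|].
      rewrite Hc, Es. unfold uz, bigq in *. field. repeat split; auto.
  - unfold YS, uS, VS. cbn [fst]. split.
    + transitivity (kp / 2 * (1 - w * w) * D)%C; [field; auto|]. rewrite Hc. field. exact NA0.
    + transitivity (Ci / 2 * kp * (1 + w * w) * D)%C; [field; auto|]. rewrite Hc. field. auto.
Qed.

(** Zeros of Y have z finite and w = 0 or w = oo. There one of 1/G and G contributes nothing, the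
    other form is read in the coordinate w or 1/w, and [Qd_ps4] converts the derivative of g1 or g2
    into that of the quartic. *)
Lemma forms_branch dY : YS (zf x, wf x) = RtoC 0 -> cder (fun y => YS (pt y)) x dY ->
  (f1 * (- (1) * Qd Q4 (uS (zf x, wf x))))%C = (2 * (m1 * (uS (zf x, wf x) - c1)) * dY)%C /\
  (f2 * (VS (zf x, wf x) * Qd Q4 (uS (zf x, wf x))))%C
    = (- Ci * (2 * (m2 * (uS (zf x, wf x) - bt)) * dY))%C /\ VS (zf x, wf x) <> RtoC 0.
Proof.
  intros HY HdY. assert (NA0 := NA). assert (Nb := b2_neq). assert (Nk := kp_neq0).
  destruct (locally_singleton _ _ Hon) as [Hc Hq]. cbn [fst snd] in Hq, Hc.
  destruct Y_derivative as (dY' & HdY' & D0 & Dinf).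
  assert (EdY := cder_unique _ _ _ _ HdY HdY'). subst dY'. clear HdY'.
  rewrite mu1_C, mu2_C, beta_C. unfold f1, f2.
  destruct (zf x) as [z|] eqn:Ez.
  2: { exfalso. destruct (wf x) as [w|]; [|contradiction]. cbn in Hc, HY.
       assert (Nw : w <> RtoC 0).
       { intros ->. apply C1_neq_0. rewrite <- Hc. ring. }
       exact (Cmult_neq_0 _ _ Nk Nw HY). }
  specialize (Hq z eq_refl).
  assert (Hnz : (G1 z * G2 z)%C = RtoC 0 -> VS (Fin z, wf x) <> RtoC 0).
  { intros H E. apply G_root_neq0 in H. unfold VS in E. cbn [fst] in E.
    apply (Cmult_neq_0 _ _ (Cmult_neq_0 _ _ two_neq0 NA0) H).
    transitivity (2 * A * z / q z * q z)%C; [field; exact Hq|]. rewrite E. ring. }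
  assert (EU : forall w, uS (Fin z, w) = u_z z) by reflexivity.
  assert (EV : forall w, VS (Fin z, w) = (2 * A * z / q z)%C) by reflexivity.
  assert (Ed := g_diff z). assert (Es := g_sum z).
  assert (EQ := Qd_ps4 l l1 l2 a Hl Hla Ha1 Hl1 Hl2 z Hq).
  destruct (wf x) as [w|] eqn:Ew; cbn [curve_pt] in Hc.
  - assert (Ew0 : w = RtoC 0).
    { destruct (Ceq_dec w (RtoC 0)) as [|N]; [assumption|]. exfalso.
      destruct (Ceq_dec (G2 z) (RtoC 0)) as [E|E].
      - destruct (Gsimple2 z E) as [N1 _]. apply N1. rewrite <- Hc, E. ring.
      - apply (Cmult_neq_0 _ _ (Cmult_neq_0 _ _ Nk E) N). cbn [YS] in HY.
        transitivity (kp * (G2 z * w) / (q z * q z) * (q z * q z))%C; [field; exact Hq|].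
        rewrite HY. ring. }
    subst w.
    assert (E1 : G1 z = RtoC 0) by (rewrite <- Hc; ring).
    destruct (Gsimple1 z E1) as [N2 Nd].
    assert (E12 : (G1 z * G2 z)%C = RtoC 0) by (rewrite E1; ring).
    specialize (EQ E12). assert (Nz := G_root_neq0 z E12).
    rewrite (D0 z eq_refl eq_refl).
    set (W := velocity (fun y => affine (wf y)) x).
    assert (EG : Gd = RtoC 0) by (unfold pbw; rewrite Ez, Ew; cbn [affine]; ring).
    assert (EO : Og = (2 * G2 z / Qd (rts1 l l1 l2) z * W / q z)%C).
    { unfold pbw. rewrite Ez, Ew. cbn [recip].
      destruct (Ceq_dec (RtoC 0) (RtoC 0)); [|congruence].
      rewrite (cdiff_C_derive _ _ _ (cdiff_g1 l l1 l2 z)). unfold W.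
      rewrite (velocity_ext (fun s => affine (recip (recip (wf s)))) (fun s => affine (wf s)));
        [reflexivity|]. intros s. now rewrite recip_recip. }
    rewrite EG, EO, EU, EV.
    set (Q' := Qd Q4 (u_z z)) in *. set (dg := Qd (rts1 l l1 l2) z) in *.
    rewrite E1 in Ed, Es, EQ.
    assert (Ec : (u_z z - c1)%C = ((z * z + A * A - c1 * q z) / q z)%C) by (unfold uz; field; exact Hq).
    assert (EQ' : Q' = (kp * kp * dg * G2 z / (4 * (A * A) * z * (q z * q z)))%C).
    { transitivity (Q' * (4 * (A * A) * z) * (q z * q z) / (4 * (A * A) * z * (q z * q z)))%C; [field; auto|].
      rewrite EQ. field. auto. }
    split; [|split].
    + rewrite EQ', Ec.
      transitivity (- (kp * kp * G2 z * G2 z * W / (4 * (A * A) * z * (q z * q z * q z))))%C; [field; auto|].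
      assert (Ed' : G2 z = (2 * z * K1 * (z * z + A * A - c1 * q z))%C) by (rewrite <- Ed; ring).
      rewrite Ed' at 1. field. auto.
    + rewrite EQ'.
      transitivity (Ci * kp * kp * G2 z * G2 z * W / (2 * A * (q z * q z * q z * q z)))%C; [field; auto|].
      assert (Es' : G2 z = (2 * q z * (z * z - b2))%C) by (rewrite <- Es; ring).
      rewrite Es' at 1. unfold uz, bigq in *. field. auto.
    + rewrite <- (EV (Fin (RtoC 0))). now apply Hnz.
  - destruct (Gsimple2 z Hc) as [N2 Nd].
    assert (E12 : (G1 z * G2 z)%C = RtoC 0) by (rewrite Hc; ring).
    specialize (EQ E12). assert (Nz := G_root_neq0 z E12).
    rewrite (Dinf z eq_refl eq_refl).
    set (W := velocity (fun y => affine (recip (wf y))) x).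
    assert (EO : Og = RtoC 0) by (unfold pbw; rewrite Ez, Ew; cbn [recip affine]; ring).
    assert (EG : Gd = (2 * G1 z / Qd (rts2 l l1 l2) z * W / q z)%C).
    { unfold pbw. rewrite Ez, Ew.
      rewrite (cdiff_C_derive _ _ _ (cdiff_g2 l l1 l2 z)). reflexivity. }
    rewrite EG, EO, EU, EV.
    set (Q' := Qd Q4 (u_z z)) in *. set (dg := Qd (rts2 l l1 l2) z) in *.
    rewrite Hc in Ed, Es, EQ.
    assert (Ec : (u_z z - c1)%C = ((z * z + A * A - c1 * q z) / q z)%C) by (unfold uz; field; exact Hq).
    assert (EQ' : Q' = (kp * kp * dg * G1 z / (4 * (A * A) * z * (q z * q z)))%C).
    { transitivity (Q' * (4 * (A * A) * z) * (q z * q z) / (4 * (A * A) * z * (q z * q z)))%C; [field; auto|].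
      rewrite EQ. field. auto. }
    split; [|split].
    + rewrite EQ', Ec.
      transitivity (kp * kp * G1 z * G1 z * W / (4 * (A * A) * z * (q z * q z * q z)))%C; [field; auto|].
      assert (Ed' : G1 z = (- (2 * z * K1 * (z * z + A * A - c1 * q z)))%C) by (rewrite <- Ed; ring).
      rewrite Ed' at 1. field. auto.
    + rewrite EQ'.
      transitivity (Ci * kp * kp * G1 z * G1 z * W / (2 * A * (q z * q z * q z * q z)))%C; [field; auto|].
      assert (Es' : G1 z = (2 * q z * (z * z - b2))%C) by (rewrite <- Es; ring).
      rewrite Es' at 1. unfold uz, bigq in *. field. auto.
    + rewrite <- (EV Infty). now apply Hnz.
Qed.

End OnePoint.
End SurfacePaths.

(** * Transport along paths *)

Definition wcontC (s t : R) (F : R -> C) (x : R) : Prop :=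
  forall eps, 0 < eps -> exists d, 0 < d /\
    forall y, s <= y <= t -> Rabs (y - x) < d -> Cmod (F y - F x)%C < eps.

Lemma wcontC_ext s t F W x : s <= x <= t ->
  ccont W x -> locally x (fun y => s <= y <= t -> F y = W y) -> wcontC s t F x.
Proof.
  intros Hx HW HL eps He.
  assert (E0 : F x = W x) by (apply (locally_singleton _ _ HL); exact Hx).
  destruct (proj1 (locally_R _ _) (filter_and _ _ HL (ccont_eps _ _ HW eps He))) as (d & Hd & K).
  exists d. split; [exact Hd|]. intros y Hy Hyd. destruct (K y Hyd) as [K1 K2].
  now rewrite K1, E0.
Qed.

Lemma ccont_wcontC s t F x : ccont F x -> wcontC s t F x.
Proof.
  intros H eps He. destruct (proj1 (locally_R _ _) (ccont_eps _ _ H eps He)) as (d & Hd & K).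
  exists d. split; [exact Hd|]. intros y _ Hy. now apply K.
Qed.

Lemma wcontC_mult s t F G x : s <= x <= t -> wcontC s t F x -> wcontC s t G x ->
  wcontC s t (fun y => (F y * G y)%C) x.
Proof.
  intros Hx HF HG eps He.
  set (a := Cmod (F x) + 1). set (b := Cmod (G x) + 1).
  assert (Ha : 0 < a) by (generalize (Cmod_ge_0 (F x)); unfold a; lra).
  assert (Hb : 0 < b) by (generalize (Cmod_ge_0 (G x)); unfold b; lra).
  assert (H1 : 0 < Rmin 1 (eps / (2 * b))) by (apply Rmin_pos; [lra|apply Rdiv_lt_0_compat; lra]).
  assert (H2 : 0 < eps / (2 * a)) by (apply Rdiv_lt_0_compat; lra).
  destruct (HF _ H1) as (d1 & Hd1 & K1). destruct (HG _ H2) as (d2 & Hd2 & K2).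
  exists (Rmin d1 d2). split; [now apply Rmin_pos|]. intros y Hy D.
  specialize (K1 y Hy (Rlt_le_trans _ _ _ D (Rmin_l _ _))).
  specialize (K2 y Hy (Rlt_le_trans _ _ _ D (Rmin_r _ _))).
  assert (K3 := Rlt_le_trans _ _ _ K1 (Rmin_l _ _)). assert (K4 := Rlt_le_trans _ _ _ K1 (Rmin_r _ _)).
  assert (HFy : Cmod (F y) <= a).
  { replace (F y) with ((F y - F x) + F x)%C by ring. eapply Rle_trans; [apply Cmod_triangle|]. unfold a; lra. }
  replace (F y * G y - F x * G x)%C with (F y * (G y - G x) + (F y - F x) * G x)%C by ring.
  eapply Rle_lt_trans; [apply Cmod_triangle|]. rewrite !Cmod_mult.
  assert (B1 : Cmod (F y) * Cmod (G y - G x)%C <= a * (eps / (2 * a)))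
    by (apply Rmult_le_compat; try apply Cmod_ge_0; lra).
  assert (B2 : Cmod (F y - F x)%C * Cmod (G x) <= eps / (2 * b) * Cmod (G x))
    by (apply Rmult_le_compat_r; [apply Cmod_ge_0|lra]).
  assert (B3 : eps / (2 * b) * Cmod (G x) < eps / (2 * b) * b)
    by (apply Rmult_lt_compat_l; [apply Rdiv_lt_0_compat; lra|unfold b; lra]).
  replace (a * (eps / (2 * a))) with (eps / 2) in B1 by (field; lra).
  replace (eps / (2 * b) * b) with (eps / 2) in B3 by (field; lra). lra.
Qed.

Lemma const_of_cder0 s t F : s <= t ->
  (forall x, s < x < t -> cder F x (RtoC 0)) ->
  (forall x, s <= x <= t -> wcontC s t F x) -> F t = F s.
Proof.
  intros Hst HD HC. apply Ceq_ext.
  - apply (const_of_derive0 s t (fun y => Re (F y)) Hst).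
    + intros x Hx. apply (HD x Hx).
    + intros x Hx eps He. destruct (HC x Hx eps He) as (d & Hd & K). exists d. split; [exact Hd|].
      intros y Hy D. eapply Rle_lt_trans; [apply (re_le_Cmod (F y - F x)%C)|now apply K].
  - apply (const_of_derive0 s t (fun y => Im (F y)) Hst).
    + intros x Hx. apply (HD x Hx).
    + intros x Hx eps He. destruct (HC x Hx eps He) as (d & Hd & K). exists d. split; [exact Hd|].
      intros y Hy D. eapply Rle_lt_trans; [apply (im_le_Cmod (F y - F x)%C)|now apply K].
Qed.

(* If [E' = i om Re(pb) E], then [E exp(-i om Re (int pb))] is constant. *)
Lemma circle_transport s t (E pb G : R -> C) om : s <= t ->
  (forall x, s < x < t -> cder E x (Ci * RtoC (om * Re (pb x)) * E x)%C) ->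
  (forall x, s <= x <= t -> wcontC s t E x) ->
  (forall x, s < x < t -> cder G x (pb x)) -> (forall x, ccont G x) -> G s = RtoC 0 ->
  E t = (E s * cis (om * Re (G t)))%C.
Proof.
  intros Hst HE CE HG CG G0.
  assert (K : (E t * cis (- (om * Re (G t))) = E s * cis (- (om * Re (G s))))%C).
  { apply (const_of_cder0 s t (fun x => E x * cis (- (om * Re (G x))))%C Hst).
    - intros x Hx.
      assert (D : is_derive (fun x => - (om * Re (G x))) x (- (om * Re (pb x)))).
      { apply is_derive_Ropp. apply (is_derive_eq _ _ (0 * Re (G x) + om * Re (pb x))); [|ring].
        apply is_derive_Rmult; [apply (is_derive_const (V := R_NormedModule))|apply (HG x Hx)]. }
      refine (cder_eq _ _ _ _ (cder_mult _ _ _ _ _ (HE x Hx) (cis_cder _ _ _ D)) _).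
      rewrite RtoC_opp. ring.
    - intros x Hx. apply wcontC_mult; [exact Hx|now apply CE|].
      apply ccont_wcontC. destruct (CG x) as [CR _].
      assert (CI : continuous (fun x => - (om * Re (G x))) x).
      { apply (continuous_Ropp (T := R_UniformSpace)).
        apply (continuous_Rmult (T := R_UniformSpace)); [apply continuous_const|exact CR]. }
      apply (ccont_pair (T := R_UniformSpace)).
      + apply (continuous_comp_R cos _ x); [apply continuous_cos|exact CI].
      + apply (continuous_comp_R sin _ x); [apply continuous_sin|exact CI]. }
  rewrite G0 in K. simpl in K. rewrite Rmult_0_r, Ropp_0, cis_0, Cmult_1_r in K.
  rewrite <- K, <- Cmult_assoc, (Cmult_comm (cis (- _))), cis_opp_inv. ring.
Qed.

Lemma cis_eq_1 x : cis x = RtoC 1 -> exists k : Z, x = 2 * IZR k * PI.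
Proof.
  intros H. apply (f_equal Re) in H. unfold cis, Re in H; simpl in H.
  assert (S : sin (x / 2) = 0).
  { assert (E : cos x = 1 - 2 * (sin (x / 2) * sin (x / 2))).
    { replace x with (2 * (x / 2)) at 1 by field. rewrite cos_2a_sin. ring. }
    rewrite H in E. assert (Z : sin (x / 2) * sin (x / 2) = 0) by lra.
    destruct (Rmult_integral _ _ Z); assumption. }
  apply sin_eq_0_0 in S. destruct S as [k Hk]. exists k. lra.
Qed.

Lemma extends_cont_lin s t F G x (c d : C) :
  extends_cont s t F x -> extends_cont s t G x ->
  extends_cont s t (fun y => (c * F y + d * G y)%C) x.
Proof.
  intros (W & CW & LW) (V & CV & LV).
  exists (fun y => c * W y + d * V y)%C. split.
  - apply ccont_plus; apply ccont_mult; auto using ccont_const.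
  - generalize (filter_and _ _ LW LV). apply filter_imp. intros y [Y1 Y2] Hy.
    now rewrite Y1, Y2.
Qed.

Lemma extends_cont_ext s t F G x : (forall y, F y = G y) -> extends_cont s t F x -> extends_cont s t G x.
Proof.
  intros E (W & CW & LW). exists W. split; [exact CW|].
  revert LW. apply filter_imp. intros y Hy Hst. rewrite <- E. now apply Hy.
Qed.

Lemma sphere_C1_at_ext f g x : locally x (fun y => f y = g y) ->
  sphere_C1_at f x -> sphere_C1_at g x.
Proof.
  intros HL [[H1 (f' & H2 & H3)]|[H1 (f' & H2 & H3)]]; [left|right]; (split;
    [generalize (filter_and _ _ HL H1); apply filter_imp; intros y [<- Hy]; exact Hy|]);
    exists f'; (split; [|exact H3]);
    generalize (filter_and _ _ (locally_locally _ _ HL) H2); apply filter_imp; intros y [Y1 Y2];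
    (eapply is_derive_ext_loc; [|exact Y2]); revert Y1; apply filter_imp; intros z ->; reflexivity.
Qed.

(** * Paths on the surface and the integrals along them *)

Section Transport.
Context (l l1 l2 : R).
Notation a := (a_end l l1 l2).
Context (Hl : 0 < l) (Hla : l < a) (Ha1 : a < 1) (Hl1 : 1 < l1) (Hl2 : l1 < l2).
Context (Hrel : (a - l) * (a + 1) * (a - l1) * (a + l2) + (a + l) * (a - 1) * (a + l1) * (a - l2) = 0).

Notation G1 := (g1 l l1 l2).
Notation G2 := (g2 l l1 l2).
Notation Q4 := (ps4 l l1 l2 a).
Notation Q6 := (ps6 l l1 l2 a).
Notation A := (RtoC a).
Notation U := (uS a).
Notation V := (VS a).
Notation Y := (YS l l1 l2 a).
Notation YY := (Y6 l l1 l2 a).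
Notation onS := (on_surf l l1 l2 a).

(** Over z = a and z = -a one has g1 + g2 = 0 with g2 nonzero, so w^2 = -1. The four removed points
    are therefore all the points of the curve with z^2 = a^2. *)
Lemma R_surf_on_surf p : R_surf l l1 l2 p -> onS p.
Proof.
  intros (Hc & N1 & N2 & N3 & N4). split.
  - destruct p as [[z|] [w|]]; exact Hc.
  - intros z Ez Eq.
    assert (Hz : z = A \/ z = (- A)%C).
    { apply Csqr_eq. unfold bigq in Eq. rewrite <- (Cplus_0_r (A * A)%C), <- Eq. ring. }
    assert (ES := g_sum l l1 l2 a Hl Hla Hrel z).
    rewrite Eq in ES. replace (2 * RtoC 0 * (z * z - RtoC (bsq l l1 l2 a)))%C with (RtoC 0) in ES by ring.
    assert (N : G2 z <> RtoC 0).
    { intros E. destruct (Gsimple2 l l1 l2 a Hl Hla Ha1 Hl1 Hl2 z E) as [N _].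
      apply N. rewrite <- ES, E. ring. }
    destruct p as [z' [w|]]; simpl in Ez; subst z'.
    + simpl in Hc.
      assert (Hw : w = Ci \/ w = (- Ci)%C).
      { apply Csqr_eq. transitivity (G2 z * (w * w) / G2 z)%C; [field; exact N|]. rewrite Hc.
        transitivity ((G1 z + G2 z) / G2 z - 1)%C; [field; exact N|]. rewrite ES.
        replace (Ci * Ci)%C with (- (1))%C; [field; exact N|].
        apply Ceq_ext; unfold Re, Im; simpl; ring. }
      destruct Hz as [-> | ->], Hw as [-> | ->]; congruence.
    + simpl in Hc. contradiction.
Qed.

Section Piece.
Context (gam : R -> sphere * sphere) (s t : R) (Hst : s < t).
Context (HR : forall y, s <= y <= t -> onS (gam y)).
Context (HC1 : C1_on gam s t).

Notation zf := (fun y => fst (gam y)).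
Notation wf := (fun y => snd (gam y)).

Lemma surf_cont x : s <= x <= t ->
  wcontC s t (fun y => U (gam y)) x /\ wcontC s t (fun y => V (gam y)) x /\
  wcontC s t (fun y => Y (gam y)) x.
Proof.
  intros Hx. destruct HC1 as (del & Hdel). destruct (Hdel x Hx) as (Ex & Hz & Hw).
  assert (Hdx := HR x Hx). rewrite <- Ex in Hdx.
  assert (CU : forall (W1 W2 W3 : R -> C), ccont W1 x -> ccont W2 x -> ccont W3 x ->
    locally x (fun y => onS (del y) -> U (del y) = W1 y /\ V (del y) = W2 y /\ Y (del y) = W3 y) ->
    wcontC s t (fun y => U (gam y)) x /\ wcontC s t (fun y => V (gam y)) x /\
    wcontC s t (fun y => Y (gam y)) x).
  { intros W1 W2 W3 C1 C2 C3 HL.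
    split; [|split]; (eapply wcontC_ext; [exact Hx| |]);
      [exact C1| |exact C2| |exact C3|]; revert HL; apply filter_imp; intros y Hy Hyst;
      destruct (Hdel y Hyst) as (Ey & _); rewrite Ey in Hy; now apply Hy, HR. }
  assert (NA0 : A <> RtoC 0) by (intros E; apply RtoC_inj in E; lra).
  destruct Hdx as [Hc Hq].
  set (zd := fun y => fst (del y)) in *. set (wd := fun y => snd (del y)) in *.
  assert (Edel : forall y, del y = (zd y, wd y)) by (intros; unfold zd, wd; now destruct (del y)).
  fold (zd x) in Hc, Hq. fold (wd x) in Hc.
  destruct (zd x) as [z|] eqn:Ezx.
  - destruct (finite_chart _ _ Hz) as [Lz Cz]; [rewrite Ezx; discriminate|]. apply C1c_cont in Cz.
    specialize (Hq z eq_refl).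
    set (ze := fun y => affine (zd y)) in *.
    assert (Eze : ze x = z) by (unfold ze; now rewrite Ezx).
    assert (Cq : ccont (fun y => bigq a (ze y)) x) by (apply (ccont_comp (bigq a) ze x); [exact (cdiff_cont _ _ _ (cdiff_bigq a _))|exact Cz]).
    assert (Nq : bigq a (ze x) <> RtoC 0) by now rewrite Eze.
    assert (CUU : ccont (fun y => uz a (ze y)) x).
    { apply (ccont_comp (uz a) ze x); [|exact Cz]. exact (cdiff_cont _ _ _ (cdiff_uz a _ Nq)). }
    assert (CVV : ccont (fun y => 2 * A * ze y / bigq a (ze y))%C x).
    { apply ccont_div; [apply ccont_mult; [apply ccont_const|exact Cz]|exact Cq|exact Nq]. }
    destruct (wd x) as [w|] eqn:Ewx.
    + destruct (finite_chart _ _ Hw) as [Lw Cw]; [rewrite Ewx; discriminate|]. apply C1c_cont in Cw.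
      apply (CU _ _ (fun y => RtoC (kap l l1 l2 a) * (G2 (ze y) * affine (wd y)) / (bigq a (ze y) * bigq a (ze y)))%C CUU CVV).
      * apply ccont_div; [|now apply ccont_mult|now apply Cmult_neq_0].
        apply ccont_mult; [apply ccont_const|]. apply ccont_mult; [|exact Cw].
        apply (ccont_comp G2 ze x); [exact (cdiff_cont _ _ _ (cdiff_g2 l l1 l2 _))|exact Cz].
      * generalize (filter_and _ _ Lz Lw). apply filter_imp. intros y [Y1 Y2] _.
        rewrite Edel. unfold ze. unfold uS, VS, YS. cbn [fst].
        destruct (zd y); [|congruence]. destruct (wd y); [|congruence]. auto.
    + destruct (infinite_chart _ _ Hw) as [Lw Cw]; [rewrite Ewx; discriminate|]. apply C1c_cont in Cw.
      apply (CU _ _ (fun y => RtoC (kap l l1 l2 a) * (G1 (ze y) * affine (recip (wd y))) / (bigq a (ze y) * bigq a (ze y)))%C CUU CVV).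
      * apply ccont_div; [|now apply ccont_mult|now apply Cmult_neq_0].
        apply ccont_mult; [apply ccont_const|]. apply ccont_mult; [|exact Cw].
        apply (ccont_comp G1 ze x); [exact (cdiff_cont _ _ _ (cdiff_g1 l l1 l2 _))|exact Cz].
      * generalize (filter_and _ _ Lz Lw). apply filter_imp. intros y [Y1 Y2] [Hcy _].
        rewrite Edel in Hcy |- *. unfold ze. unfold uS, VS, YS. cbn [fst snd] in *.
        destruct (zd y) as [zy|]; [|congruence]. split; [reflexivity|]. split; [reflexivity|].
        destruct (wd y) as [wy|]; cbn [affine].
        -- rewrite (affine_recip (Fin wy)) by congruence. cbn [affine].
           simpl in Hcy. rewrite <- Hcy. unfold Cdiv. f_equal. field. congruence.
        -- cbn [affine recip]. unfold Cdiv. ring.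
  - destruct (infinite_chart _ _ Hz) as [Lz Cz]; [rewrite Ezx; discriminate|]. apply C1c_cont in Cz.
    destruct (wd x) as [w|] eqn:Ewx; [|contradiction].
    destruct (finite_chart _ _ Hw) as [Lw Cw]; [rewrite Ewx; discriminate|]. apply C1c_cont in Cw.
    set (om := fun y => affine (recip (zd y))) in *.
    assert (Eom : om x = RtoC 0) by (unfold om; now rewrite Ezx).
    assert (Cb : ccont (fun y => 1 - A * A * (om y * om y))%C x).
    { apply ccont_minus; [apply ccont_const|]. apply ccont_mult; [apply ccont_const|now apply ccont_mult]. }
    assert (Nb : (1 - A * A * (om x * om x))%C <> RtoC 0).
    { rewrite Eom. intros E. apply C1_neq_0. rewrite <- E. ring. }
    apply (CU (fun y => (1 + A * A * (om y * om y)) / (1 - A * A * (om y * om y)))%C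
              (fun y => (2 * A * om y) / (1 - A * A * (om y * om y)))%C
              (fun y => RtoC (kap l l1 l2 a) * (((1 + RtoC l * om y) * (1 + - (1) * om y) * (1 + RtoC l1 * om y) * (1 + - RtoC l2 * om y)) * affine (wd y))
                 / ((1 - A * A * (om y * om y)) * (1 - A * A * (om y * om y))))%C).
    + apply ccont_div; [|exact Cb|exact Nb].
      apply ccont_plus; [apply ccont_const|]. apply ccont_mult; [apply ccont_const|now apply ccont_mult].
    + apply ccont_div; [|exact Cb|exact Nb]. apply ccont_mult; [apply ccont_const|exact Cz].
    + apply ccont_div; [|now apply ccont_mult|now apply Cmult_neq_0].
      apply ccont_mult; [apply ccont_const|]. apply ccont_mult; [|exact Cw].
      assert (Cl : forall k : C, ccont (fun y => 1 + k * om y)%C x)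
        by (intros; apply ccont_plus; [apply ccont_const|]; apply ccont_mult; [apply ccont_const|exact Cz]).
      exact (ccont_mult _ _ x (ccont_mult _ _ x (ccont_mult _ _ x (Cl (RtoC l)) (Cl (- (1))%C))
        (Cl (RtoC l1))) (Cl (- RtoC l2)%C)).
    + generalize (filter_and _ _ Lz Lw). apply filter_imp. intros y [Y1 Y2] [_ Hqy].
      rewrite Edel in Hqy |- *. unfold om. unfold uS, VS, YS. cbn [fst snd] in *.
      destruct (wd y) as [wy|]; [|congruence]. cbn [affine].
      destruct (zd y) as [zy|].
      * assert (Nz : zy <> RtoC 0) by congruence. specialize (Hqy zy eq_refl).
        rewrite (affine_recip (Fin zy)) by congruence. cbn [affine].
        assert (Nq := one_minus_neq0 a zy Nz Hqy). unfold uz, g2, bigq in *.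
        split; [|split]; field; repeat split; auto.
      * cbn. split; [|split]; field.
Qed.

Lemma interior_chart x : s < x < t ->
  sphere_C1_at zf x /\ sphere_C1_at wf x /\ locally x (fun y => onS (fst (gam y), snd (gam y))).
Proof.
  intros Hx. destruct HC1 as (del & Hdel). destruct (Hdel x ltac:(lra)) as (Ex & Hz & Hw).
  assert (HL := locally_segment s t x Hx).
  assert (HE : locally x (fun y => del y = gam y)).
  { revert HL. apply filter_imp. intros y Hy. now destruct (Hdel y Hy). }
  split; [|split].
  - refine (sphere_C1_at_ext _ _ _ _ Hz). revert HE. apply filter_imp. now intros y ->.
  - refine (sphere_C1_at_ext _ _ _ _ Hw). revert HE. apply filter_imp. now intros y ->.
  - revert HL. apply filter_imp. intros y Hy. rewrite <- surjective_pairing. now apply HR.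
Qed.

Lemma pb_Gdh_pbw y : pb_Gdh l l1 l2 gam y = pbw G1 G2 a zf wf y.
Proof.
  unfold pb_Gdh, pbw. destruct (gam y) as [[z|] [w|]]; reflexivity.
Qed.

Lemma pb_over_pbw y : pb_dh_over_G l l1 l2 gam y = pbw G2 G1 a zf (fun y => recip (wf y)) y.
Proof.
  unfold pb_dh_over_G, pbw. cbv beta.
  rewrite (velocity_ext (fun s => affine (recip (recip (snd (gam s))))) (fun s => affine (snd (gam s)))).
  2: { intros x. now rewrite recip_recip. }
  destruct (gam y) as [[z|] w]; cbn [fst snd]; destruct (recip w); reflexivity.
Qed.

Lemma piece_ext x : s <= x <= t ->
  extends_cont s t (pb_phi1 l l1 l2 gam) x /\ extends_cont s t (pb_phi2 l l1 l2 gam) x /\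
  extends_cont s t (pb_phi3 l l1 l2 gam) x.
Proof.
  intros Hx. destruct HC1 as (del & Hdel). destruct (Hdel x Hx) as (Ex & Hz & Hw).
  assert (Ez : forall y, s <= y <= t -> fst (del y) = zf y) by (intros y Hy; now destruct (Hdel y Hy) as (-> & _)).
  assert (Ew : forall y, s <= y <= t -> snd (del y) = wf y) by (intros y Hy; now destruct (Hdel y Hy) as (-> & _)).
  assert (Hend : forall y z, s <= y <= t -> zf y = Fin z -> (z * z - A * A)%C <> RtoC 0)
    by (intros y z Hy E; now apply (HR y Hy)).
  assert (Hon : forall y, s <= y <= t -> curve_pt G1 G2 (zf y) (wf y)) by (intros y Hy; apply (HR y Hy)).
  assert (X3 : extends_cont s t (pbz a zf) x).
  { exact (pbz_ext a zf (fun y => fst (del y)) s t Hend Ez x Hx Hz). }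
  assert (XG : extends_cont s t (pbw G1 G2 a zf wf) x).
  { refine (pbw_ext G1 G2 (Qd (rts1 l l1 l2)) (Qd (rts2 l l1 l2)) a _ _ _ _ _ _
      zf wf (fun y => fst (del y)) (fun y => snd (del y)) s t Hon Hend Ez Ew x Hx Hz Hw).
    - apply cdiff_g1.
    - apply cdiff_g2.
    - apply Qd_cont.
    - apply Qd_cont.
    - intros z. apply cdiff_C_derive, cdiff_g2.
    - exact (Gsimple2 l l1 l2 a Hl Hla Ha1 Hl1 Hl2). }
  assert (XO : extends_cont s t (pbw G2 G1 a zf (fun y => recip (wf y))) x).
  { refine (pbw_ext G2 G1 (Qd (rts2 l l1 l2)) (Qd (rts1 l l1 l2)) a _ _ _ _ _ _
      zf (fun y => recip (wf y)) (fun y => fst (del y)) (fun y => recip (snd (del y))) s t _ Hend Ez _ x Hx Hz _).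
    - apply cdiff_g2.
    - apply cdiff_g1.
    - apply Qd_cont.
    - apply Qd_cont.
    - intros z. apply cdiff_C_derive, cdiff_g1.
    - exact (Gsimple1 l l1 l2 a Hl Hla Ha1 Hl1 Hl2).
    - intros y Hy. apply curve_pt_recip. now apply Hon.
    - intros y Hy. now rewrite Ew.
    - exact (recip_sphere_C1 _ _ Hw). }
  split; [|split; [|exact X3]].
  - refine (extends_cont_ext _ _ _ _ _ _ (extends_cont_lin _ _ _ _ _ (/ 2)%C (- / 2)%C XO XG)).
    intros y. unfold pb_phi1. rewrite pb_Gdh_pbw, pb_over_pbw. ring.
  - refine (extends_cont_ext _ _ _ _ _ _ (extends_cont_lin _ _ _ _ _ (Ci / 2)%C (Ci / 2)%C XO XG)).
    intros y. unfold pb_phi2. rewrite pb_Gdh_pbw, pb_over_pbw. ring.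
Qed.

End Piece.

(** u + V is (z + a) / (z - a), so this is an explicit single-valued primitive of Re dh: the third
    coordinate has no periods. *)
Definition height (p : sphere * sphere) : R := - ln (Cmod (U p + V p)%C) / (2 * a).

Lemma height_derive (g : R -> C) x D : g x <> RtoC 0 ->
  cder g x (- (2 * A) * g x * D)%C ->
  is_derive (fun y => - ln (Cmod (g y)) / (2 * a)) x (Re D).
Proof.
  intros N [H1 H2].
  assert (Np : 0 < Re (g x) * Re (g x) + Im (g x) * Im (g x)).
  { rewrite <- Cmod_sqr. assert (0 < Cmod (g x)) by now apply Cmod_gt_0. now apply Rmult_lt_0_compat. }
  assert (Hsq : is_derive (fun y => Cmod (g y)) x
     ((2 * (Re (g x) * Re (- (2 * A) * g x * D)%C + Im (g x) * Im (- (2 * A) * g x * D)%C))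
       / (2 * sqrt (Re (g x) * Re (g x) + Im (g x) * Im (g x))))).
  { apply (is_derive_ext (fun y => sqrt (Re (g y) * Re (g y) + Im (g y) * Im (g y)))).
    { intros y. unfold Cmod, Re, Im; simpl. f_equal. ring. }
    refine (is_derive_sqrt (fun y => Re (g y) * Re (g y) + Im (g y) * Im (g y)) x _ _ Np).
    refine (is_derive_eq _ _ _ _ (is_derive_Rplus _ _ _ _ _ (is_derive_Rmult _ _ _ _ _ H1 H1)
      (is_derive_Rmult _ _ _ _ _ H2 H2)) _).
    ring. }
  assert (Eq : sqrt (Re (g x) * Re (g x) + Im (g x) * Im (g x)) = Cmod (g x))
    by (unfold Cmod, Re, Im; simpl; f_equal; ring).
  rewrite Eq in Hsq.
  assert (Nc : 0 < Cmod (g x)) by now apply Cmod_gt_0.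
  assert (HC := Cmod_sqr (g x)).
  set (dC := 2 * _ / _) in Hsq.
  assert (HL : is_derive (fun y => ln (Cmod (g y))) x (dC * / Cmod (g x))).
  { exact (is_derive_comp ln (fun y => Cmod (g y)) x _ _ (is_derive_ln _ Nc) Hsq). }
  apply (is_derive_eq _ _ (- (dC * / Cmod (g x)) * / (2 * a))).
  - refine (is_derive_eq _ _ _ _ (is_derive_Rmult _ (fun _ => / (2 * a)) _ _ 0 (is_derive_Ropp _ _ _ HL)
      (is_derive_const (V := R_NormedModule) _ _)) _).
    ring.
  - assert (E : Re (g x) * Re (- (2 * A) * g x * D)%C + Im (g x) * Im (- (2 * A) * g x * D)%C
       = - (2 * a) * Re D * (Cmod (g x) * Cmod (g x))).
    { rewrite HC. unfold Re, Im; simpl. ring. }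
    unfold dC. rewrite E. field. split; lra.
Qed.

Lemma within_cont_minus s t F G x : within_cont s t F x -> within_cont s t G x ->
  within_cont s t (fun y => F y - G y) x.
Proof.
  intros HF HG eps He. destruct (HF (eps / 2) ltac:(lra)) as (d1 & Hd1 & K1).
  destruct (HG (eps / 2) ltac:(lra)) as (d2 & Hd2 & K2).
  exists (Rmin d1 d2). split; [now apply Rmin_pos|]. intros y Hy D.
  specialize (K1 y Hy (Rlt_le_trans _ _ _ D (Rmin_l _ _))).
  specialize (K2 y Hy (Rlt_le_trans _ _ _ D (Rmin_r _ _))).
  replace (F y - G y - (F x - G x)) with ((F y - F x) + - (G y - G x)) by ring.
  eapply Rle_lt_trans; [apply Rabs_triang|]. rewrite Rabs_Ropp. lra.
Qed.

Lemma UV_neq0 p : onS p -> (U p + V p)%C <> RtoC 0.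
Proof.
  intros H E. apply C1_neq_0.
  transitivity ((U p * U p - V p * V p))%C.
  - rewrite (VS_sqr l l1 l2 a p H). ring.
  - transitivity ((U p + V p) * (U p - V p))%C; [ring|]. rewrite E. ring.
Qed.

Lemma height_within gam s t x : s <= x <= t -> (forall y, s <= y <= t -> onS (gam y)) ->
  wcontC s t (fun y => U (gam y)) x -> wcontC s t (fun y => V (gam y)) x ->
  within_cont s t (fun y => height (gam y)) x.
Proof.
  intros Hx HR HU HV eps He.
  set (m := Cmod (U (gam x) + V (gam x))%C).
  assert (Hm : 0 < m) by (apply Cmod_gt_0, UV_neq0, HR, Hx).
  assert (CL : continuous (fun r => - ln r / (2 * a)) m).
  { apply (continuous_Rmult (T := R_UniformSpace)); [|apply continuous_const].
    apply (continuous_Ropp (T := R_UniformSpace)).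
    apply (ex_derive_continuous (V := R_NormedModule)). eexists. now apply is_derive_ln. }
  destruct (proj1 (locally_R _ _) (proj1 (ccont_real_lim (T := R_UniformSpace) _ m) CL eps He)) as (d & Hd & K).
  destruct (HU (d / 2) ltac:(lra)) as (d1 & Hd1 & K1). destruct (HV (d / 2) ltac:(lra)) as (d2 & Hd2 & K2).
  exists (Rmin d1 d2). split; [now apply Rmin_pos|]. intros y Hy D.
  specialize (K1 y Hy (Rlt_le_trans _ _ _ D (Rmin_l _ _))).
  specialize (K2 y Hy (Rlt_le_trans _ _ _ D (Rmin_r _ _))).
  apply K. unfold m.
  set (p := (U (gam y) + V (gam y))%C). set (r := (U (gam x) + V (gam x))%C).
  assert (Hpr : Cmod (p - r)%C < d).
  { unfold p, r. replace (U (gam y) + V (gam y) - (U (gam x) + V (gam x)))%C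
      with ((U (gam y) - U (gam x)) + (V (gam y) - V (gam x)))%C by ring.
    eapply Rle_lt_trans; [apply Cmod_triangle|]. lra. }
  assert (T1 := Cmod_triangle r (p - r)%C). assert (T2 := Cmod_triangle p (- (p - r))%C).
  rewrite Cmod_opp in T2.
  replace (r + (p - r))%C with p in T1 by ring. replace (p + - (p - r))%C with r in T2 by ring.
  apply Rabs_def1; lra.
Qed.

Lemma Ci_sqr : (Ci * Ci)%C = RtoC (-1).
Proof. apply Ceq_ext; unfold Re, Im; simpl; ring. Qed.

Lemma Ci_neq0 : Ci <> RtoC 0.
Proof. intros E. apply (f_equal Im) in E. unfold Im in E; simpl in E. lra. Qed.

Lemma Y6_curve p : onS p -> curve Q6 1 (U p) (YY p).
Proof.
  intros H. assert (HY := YS_sqr l l1 l2 a Hl Hla Ha1 Hl1 Hl2 p H). assert (HV := VS_sqr l l1 l2 a p H).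
  unfold curve in *. unfold Y6, ps6. cbn [Qp]. rewrite RtoC_m1 in *.
  transitivity (- (V p * V p) * (Y p * Y p))%C.
  { transitivity ((Ci * Ci) * ((V p * V p) * (Y p * Y p)))%C; [ring|]. rewrite Ci_sqr, RtoC_m1. ring. }
  rewrite HY, HV. ring.
Qed.

Section WithPeriods.
Context (om1 x1 om2 x2 : R).
Context (Hper1 : forall x, -1 * Re (Qp Q4 (RtoC x)) <= 0 ->
  exists k : Z, om1 * (Xreal Ci Q4 (mu1 l l1 l2 a) (cc l l1 l2 a) x - x1) = IZR k * PI).
Context (Hper2 : forall x, 1 * Re (Qp Q6 (RtoC x)) <= 0 ->
  exists k : Z, om2 * (Xreal (RtoC 1) Q6 (mu2 l l1 l2 a) (beta l l1 l2 a) x - x2) = IZR k * PI).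

Definition E1 (p : sphere * sphere) : C := lift Ci Q4 (mu1 l l1 l2 a) (cc l l1 l2 a) om1 x1 (U p) (Y p).
Definition E2 (p : sphere * sphere) : C :=
  lift (RtoC 1) Q6 (mu2 l l1 l2 a) (beta l l1 l2 a) om2 x2 (U p) (YY p).

(** Existence of the three integrals is part of the statement, so that the [RInt] in [X_along] are
    genuine values and not defaults. *)
Definition transported (gam : R -> sphere * sphere) (s t : R) : Prop :=
  exists I1 I2 I3 : C,
    is_RInt (V := C_R_NormedModule) (pb_phi1 l l1 l2 gam) s t I1 /\
    is_RInt (V := C_R_NormedModule) (pb_phi2 l l1 l2 gam) s t I2 /\
    is_RInt (V := C_R_NormedModule) (pb_phi3 l l1 l2 gam) s t I3 /\
    E1 (gam t) = (E1 (gam s) * cis (om1 * Re I1))%C /\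
    E2 (gam t) = (E2 (gam s) * cis (om2 * Re I2))%C /\
    height (gam t) - height (gam s) = Re I3.

Lemma one_sqr : (RtoC 1 * RtoC 1)%C = RtoC 1.
Proof. ring. Qed.

Lemma wcontC_lift iota ps mu c eta om x0 (Hi : iota <> RtoC 0) (Hps : NoDup ps)
  (Heta : (iota * iota)%C = RtoC eta)
  (Hper : forall x, eta * Re (Qp ps (RtoC x)) <= 0 ->
     exists k : Z, om * (Xreal iota ps mu c x - x0) = IZR k * PI) s t u y x :
  s <= x <= t -> (forall z, s <= z <= t -> curve ps eta (u z) (y z)) ->
  wcontC s t u x -> wcontC s t y x ->
  wcontC s t (fun z => lift iota ps mu c om x0 (u z) (y z)) x.
Proof.
  intros Hx Hc Hu Hy eps He.
  destruct (lift_continuous iota Hi ps Hps mu c eta Heta om x0 Hper _ _ (Hc x Hx) eps He) as (d & Hd & K).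
  destruct (Hu d Hd) as (d1 & Hd1 & K1). destruct (Hy d Hd) as (d2 & Hd2 & K2).
  exists (Rmin d1 d2). split; [now apply Rmin_pos|]. intros z Hz D.
  apply K; [now apply Hc|apply K1|apply K2]; auto; eapply Rlt_le_trans; eauto using Rmin_l, Rmin_r.
Qed.

Lemma transported_piece gam s t : s < t -> (forall y, s <= y <= t -> onS (gam y)) ->
  C1_on gam s t -> transported gam s t.
Proof.
  intros Hst HR HC.
  assert (X := piece_ext gam s t HR HC).
  destruct (extends_cont_primitive s t _ Hst (fun x Hx => proj1 (X x Hx))) as (J1 & CJ1 & DJ1 & Z1 & R1).
  destruct (extends_cont_primitive s t _ Hst (fun x Hx => proj1 (proj2 (X x Hx)))) as (J2 & CJ2 & DJ2 & Z2 & R2').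
  destruct (extends_cont_primitive s t _ Hst (fun x Hx => proj2 (proj2 (X x Hx)))) as (J3 & CJ3 & DJ3 & Z3 & R3).
  assert (NA0 : A <> RtoC 0) by (intros E; apply RtoC_inj in E; lra).
  assert (SC := surf_cont gam s t HR HC).
  exists (J1 t), (J2 t), (J3 t). split; [exact R1|]. split; [exact R2'|]. split; [exact R3|].
  split; [|split].
  - refine (circle_transport s t (fun y => E1 (gam y)) _ J1 om1 (Rlt_le _ _ Hst) _ _ DJ1 CJ1 Z1).
    + intros x Hx. destruct (interior_chart gam s t HR HC x Hx) as (Hz & Hw & Hon).
      destruct (uV_derivative l l1 l2 a (fun y : R => fst (gam y)) (fun y : R => snd (gam y)) x Hz Hon) as [DU DV].
      destruct (Y_derivative l l1 l2 a (fun y : R => fst (gam y)) (fun y : R => snd (gam y)) x Hz Hw Hon) as (dY & DY & _).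
      assert (FR := forms_regular l l1 l2 a Hl Hla Ha1 Hl1 Hl2 Hrel (fun y : R => fst (gam y)) (fun y : R => snd (gam y)) x Hon).
      assert (FB := fun H => forms_branch l l1 l2 a Hl Hla Ha1 Hl1 Hl2 Hrel (fun y : R => fst (gam y)) (fun y : R => snd (gam y)) x Hz Hw Hon dY H DY).
      assert (Ef : pb_phi1 l l1 l2 gam x = f1 l l1 l2 a (fun y => fst (gam y)) (fun y => snd (gam y)) x)
        by (unfold pb_phi1, f1; now rewrite pb_Gdh_pbw, pb_over_pbw).
      rewrite Ef. cbv beta in *. rewrite <- (surjective_pairing (gam x)) in *.
      refine (lift_path Ci Ci_neq0 Q4 (NoDup_ps4 l l1 l2 a Hl Hla Ha1 Hl1 Hl2) _ _ (-1) Ci_sqr om1 x1 Hper1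
        (fun y => U (gam y)) (fun y => Y (gam y)) x _ dY _ _ _ _ _ _).
      * refine (cder_ext_loc _ _ _ _ _ DU). apply filter_forall. intros y. now rewrite <- surjective_pairing.
      * refine (cder_ext_loc _ _ _ _ _ DY). apply filter_forall. intros y. now rewrite <- surjective_pairing.
      * revert Hon. apply filter_imp. intros y Hy. rewrite <- surjective_pairing in Hy.
        exact (YS_sqr l l1 l2 a Hl Hla Ha1 Hl1 Hl2 _ Hy).
      * intros NY. destruct (FR NY) as [F _]. refine (eq_trans F _). unfold numer. rewrite mu1_C by assumption.
        field. exact NA0.
      * intros EY. destruct (FB EY) as [F _]. rewrite RtoC_m1. exact F.
    + intros x Hx. destruct (SC x Hx) as (C1 & C2 & C3).
      apply (wcontC_lift Ci Q4 _ _ (-1) om1 x1 Ci_neq0 (NoDup_ps4 l l1 l2 a Hl Hla Ha1 Hl1 Hl2) Ci_sqr Hper1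
        s t (fun y => U (gam y)) (fun y => Y (gam y)) x Hx); [|exact C1|exact C3].
      intros z Hz. exact (YS_sqr l l1 l2 a Hl Hla Ha1 Hl1 Hl2 _ (HR z Hz)).
  - refine (circle_transport s t (fun y => E2 (gam y)) _ J2 om2 (Rlt_le _ _ Hst) _ _ DJ2 CJ2 Z2).
    + intros x Hx. destruct (interior_chart gam s t HR HC x Hx) as (Hz & Hw & Hon).
      destruct (uV_derivative l l1 l2 a (fun y : R => fst (gam y)) (fun y : R => snd (gam y)) x Hz Hon) as [DU DV].
      destruct (Y_derivative l l1 l2 a (fun y : R => fst (gam y)) (fun y : R => snd (gam y)) x Hz Hw Hon) as (dY & DY & _).
      assert (FR := forms_regular l l1 l2 a Hl Hla Ha1 Hl1 Hl2 Hrel (fun y : R => fst (gam y)) (fun y : R => snd (gam y)) x Hon).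
      assert (FB := fun H => forms_branch l l1 l2 a Hl Hla Ha1 Hl1 Hl2 Hrel (fun y : R => fst (gam y)) (fun y : R => snd (gam y)) x Hz Hw Hon dY H DY).
      assert (Ef : pb_phi2 l l1 l2 gam x = f2 l l1 l2 a (fun y => fst (gam y)) (fun y => snd (gam y)) x)
        by (unfold pb_phi2, f2; now rewrite pb_Gdh_pbw, pb_over_pbw).
      assert (Hx' := HR x ltac:(lra)).
      assert (HYc := YS_sqr l l1 l2 a Hl Hla Ha1 Hl1 Hl2 _ Hx'). assert (HVc := VS_sqr l l1 l2 a _ Hx').
      rewrite Ef. cbv beta in *. rewrite <- (surjective_pairing (gam x)) in *.
      assert (D6 := cder_mult _ _ _ _ _ (cder_const (- Ci)%C x) (cder_mult _ _ _ _ _ DV DY)).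
      cbv beta in D6. rewrite <- (surjective_pairing (gam x)) in D6.
      assert (NB := b2_neq l l1 l2 a Hl Hla Ha1 Hl1 Hl2 Hrel).
      refine (lift_path (RtoC 1) C1_neq_0 Q6 (NoDup_ps6 l l1 l2 a Hl Hla Ha1 Hl1 Hl2) _ _ 1 one_sqr om2 x2 Hper2
        (fun y => U (gam y)) (fun y => YY (gam y)) x _ _ _ _ _ _ _ _).
      * refine (cder_ext_loc _ _ _ _ _ DU). apply filter_forall. intros y. now rewrite <- surjective_pairing.
      * refine (cder_ext_loc _ _ _ _ _ D6). apply filter_forall. intros y. rewrite <- surjective_pairing. reflexivity.
      * revert Hon. apply filter_imp. intros y Hy. rewrite <- surjective_pairing in Hy.
        exact (Y6_curve _ Hy).
      * intros N6. assert (NY : Y (gam x) <> RtoC 0) by (intros E; apply N6; unfold Y6; rewrite E; ring).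
        destruct (FR NY) as [_ F]. cbv beta. unfold Y6 at 1, numer.
        transitivity (- Ci * V (gam x) * (f2 l l1 l2 a (fun y => fst (gam y)) (fun y => snd (gam y)) x * Y (gam x)))%C; [ring|].
        rewrite F, mu2_C by assumption.
        transitivity ((Ci * Ci) * (V (gam x) * (RtoC (kap l l1 l2 a) * (RtoC (bsq l l1 l2 a) - A * A) / (2 * (A * A))
           * (U (gam x) - RtoC (beta l l1 l2 a)) * pbz a (fun y => fst (gam y)) x)))%C; [field; exact NA0|].
        rewrite Ci_sqr, RtoC_m1. field. exact NA0.
      * intros E6. cbv beta in E6 |- *. unfold ps6. cbn [Qd Qp]. unfold numer. unfold curve in HYc. rewrite RtoC_m1 in *.
        destruct (Ceq_dec (Y (gam x)) (RtoC 0)) as [EY|NY].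
        -- destruct (FB EY) as (_ & F & NV).
           assert (Q0 : Qp Q4 (U (gam x)) = RtoC 0).
           { transitivity (- (- RtoC 1 * Qp Q4 (U (gam x))))%C; [ring|]. rewrite <- HYc, EY. ring. }
           rewrite Q0, EY.
           transitivity (f2 l l1 l2 a (fun y => fst (gam y)) (fun y => snd (gam y)) x
              * (V (gam x) * Qd Q4 (U (gam x))) * V (gam x))%C.
           { transitivity (f2 l l1 l2 a (fun y => fst (gam y)) (fun y => snd (gam y)) x
              * Qd Q4 (U (gam x)) * (V (gam x) * V (gam x)))%C; [rewrite HVc|]; ring. }
           rewrite F. ring.
        (* The branch points of Y6 over u = 1 and u = -1: V vanishes and Y does not, so the relation
           follows from the regular formula for phi_2. *)
        -- destruct (FR NY) as (_ & F).
           assert (EV : V (gam x) = RtoC 0).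
           { destruct (Ceq_dec (V (gam x)) (RtoC 0)) as [|NV]; [assumption|]. exfalso.
             apply (Cmult_neq_0 (- Ci)%C (V (gam x) * Y (gam x))%C).
             - intros E. apply Ci_neq0. transitivity (- - Ci)%C; [ring|]. rewrite E. ring.
             - now apply Cmult_neq_0.
             - exact E6. }
           assert (EU : (U (gam x) * U (gam x) - 1)%C = RtoC 0) by (rewrite <- HVc, EV; ring).
           assert (EQ : Qp Q4 (U (gam x)) = (- (Y (gam x) * Y (gam x)))%C) by (rewrite HYc; ring).
           transitivity (f2 l l1 l2 a (fun y => fst (gam y)) (fun y => snd (gam y)) x
             * (2 * U (gam x) * Qp Q4 (U (gam x)) + (U (gam x) * U (gam x) - 1) * Qd Q4 (U (gam x))))%C; [ring|].
           rewrite EU, EQ, EV.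
           transitivity (- (2 * U (gam x) * Y (gam x)) * (f2 l l1 l2 a (fun y => fst (gam y)) (fun y => snd (gam y)) x * Y (gam x)))%C; [ring|].
           rewrite F, mu2_C by assumption. field. exact NA0.
    + intros x Hx. destruct (SC x Hx) as (C1 & C2 & C3).
      apply (wcontC_lift (RtoC 1) Q6 _ _ 1 om2 x2 C1_neq_0 (NoDup_ps6 l l1 l2 a Hl Hla Ha1 Hl1 Hl2) one_sqr Hper2
        s t (fun y => U (gam y)) (fun y => YY (gam y)) x Hx); [|exact C1|].
      * intros z Hz. exact (Y6_curve _ (HR z Hz)).
      * apply (wcontC_mult s t (fun _ => (- Ci)%C)); [exact Hx|apply ccont_wcontC, ccont_const|].
        now apply wcontC_mult.
  - assert (K : height (gam t) - Re (J3 t) = height (gam s) - Re (J3 s)).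
    { apply (const_of_derive0 s t (fun x => height (gam x) - Re (J3 x)) (Rlt_le _ _ Hst)).
      - intros x Hx. destruct (interior_chart gam s t HR HC x Hx) as (Hz & Hw & Hon).
        destruct (uV_derivative l l1 l2 a (fun y : R => fst (gam y)) (fun y : R => snd (gam y)) x Hz Hon) as [DU DV].
        assert (DS := cder_plus _ _ _ _ _ DU DV). cbv beta in DS. rewrite <- (surjective_pairing (gam x)) in DS.
        assert (DS' : cder (fun y => (U (gam y) + V (gam y))%C) x
            (- (2 * A) * (U (gam x) + V (gam x)) * pbz a (fun y : R => fst (gam y)) x)%C).
        { refine (cder_eq _ _ _ _ (cder_ext_loc _ _ _ _ _ DS) _); [|ring].
          apply filter_forall. intros y. now rewrite <- surjective_pairing. }
        assert (N := UV_neq0 _ (HR x ltac:(lra))).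
        apply (is_derive_eq _ _ (Re (pbz a (fun y : R => fst (gam y)) x) - Re (pbz a (fun y : R => fst (gam y)) x))); [|ring].
        apply is_derive_Rminus; [|exact (proj1 (DJ3 x Hx))].
        exact (height_derive _ _ _ N DS').
      - intros x Hx. destruct (SC x Hx) as (C1 & C2 & _).
        apply within_cont_minus.
        + exact (height_within gam s t x Hx HR C1 C2).
        + intros eps He. destruct (proj1 (ccont_real_lim (T := R_UniformSpace) _ x) (proj1 (CJ3 x)) eps He) as [d Hd].
          exists d. split; [apply cond_pos|]. intros y _ Hy. now apply Hd. }
    rewrite Z3 in K. simpl in K. lra.
Qed.

Lemma transported_path gam s t : (forall y, s <= y <= t -> onS (gam y)) ->
  piecewise_C1 gam s t -> s <= t /\ transported gam s t.
Proof.
  intros HR H. induction H as [s t Hst HC|s t u _ IH1 _ IH2].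
  - split; [exact Hst|]. destruct (Rle_lt_or_eq_dec _ _ Hst) as [Hlt|Heq].
    + now apply transported_piece.
    + subst t. exists (RtoC 0), (RtoC 0), (RtoC 0).
      repeat split; try exact (is_RInt_point (V := C_R_NormedModule) _ s);
        simpl; try rewrite Rmult_0_r, cis_0; try ring.
  (* [pwC1_concat] does not order its three points. If t < s, the hypothesis on [s, t] holds
     vacuously and the induction hypothesis itself returns s <= t. *)
  - assert (Hst : s <= t).
    { destruct (Rle_lt_dec s t) as [h|h]; [exact h|]. apply IH1. intros y Hy. lra. }
    assert (Htu : t <= u).
    { destruct (Rle_lt_dec t u) as [h|h]; [exact h|]. apply IH2. intros y Hy. lra. }
    split; [lra|].
    destruct (IH1 ltac:(intros; apply HR; lra)) as (_ & I1 & I2 & I3 & A1 & A2 & A3 & A4 & A5 & A6).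
    destruct (IH2 ltac:(intros; apply HR; lra)) as (_ & J1 & J2 & J3 & B1 & B2 & B3 & B4 & B5 & B6).
    exists (I1 + J1)%C, (I2 + J2)%C, (I3 + J3)%C.
    split; [exact (is_RInt_Chasles (V := C_R_NormedModule) _ _ _ _ _ _ A1 B1)|].
    split; [exact (is_RInt_Chasles (V := C_R_NormedModule) _ _ _ _ _ _ A2 B2)|].
    split; [exact (is_RInt_Chasles (V := C_R_NormedModule) _ _ _ _ _ _ A3 B3)|].
    split; [|split].
    + rewrite B4, A4, <- Cmult_assoc, <- cis_plus. do 2 f_equal. unfold Re; simpl; ring.
    + rewrite B5, A5, <- Cmult_assoc, <- cis_plus. do 2 f_equal. unfold Re; simpl; ring.
    + unfold Re in *; simpl. lra.
Qed.

Lemma CRInt_eq f s t I : is_RInt (V := C_R_NormedModule) f s t I -> CRInt f s t = I.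
Proof. intros H. unfold CRInt. exact (is_RInt_unique (V := C_R_CompleteNormedModule) f s t I H). Qed.

Lemma cis_ratio (e : C) a b : Cmod e = 1 -> (e * cis a)%C = (e * cis b)%C ->
  exists k : Z, a - b = 2 * IZR k * PI.
Proof.
  intros He H. apply cis_eq_1.
  assert (Ne : e <> RtoC 0) by (intros E; rewrite E, Cmod_0 in He; lra).
  assert (E : cis a = cis b).
  { transitivity (e * cis a / e)%C; [field; exact Ne|]. rewrite H. field. exact Ne. }
  unfold Rminus. rewrite cis_plus, E. apply cis_opp_inv.
Qed.

(** Two paths with the same ends multiply E1 by the same factor, so their first integrals differ by
    an integer multiple of 2 PI / om1; likewise for E2. This yields orthogonal generators along the
    two axes. *)
Lemma single_valued p0 : om1 <> 0 -> om2 <> 0 ->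
  X_single_valued l l1 l2
    (fun x => exists m n : Z, x = (IZR m * (2 * PI / om1) + IZR n * 0, IZR m * 0 + IZR n * (2 * PI / om2))) p0.
Proof.
  intros N1 N2 p gam del _ (Pg & Sg & g0 & g1) (Pd & Sd & d0 & d1).
  destruct (transported_path gam 0 1 (fun y Hy => R_surf_on_surf _ (Sg y Hy)) Pg)
    as (_ & I1 & I2 & I3 & A1 & A2 & A3 & A4 & A5 & A6).
  destruct (transported_path del 0 1 (fun y Hy => R_surf_on_surf _ (Sd y Hy)) Pd)
    as (_ & J1 & J2 & J3 & B1 & B2 & B3 & B4 & B5 & B6).
  rewrite g0, g1 in *. rewrite d0, d1 in *.
  unfold X_along, eq_mod.
  rewrite (CRInt_eq _ _ _ _ A1), (CRInt_eq _ _ _ _ A2), (CRInt_eq _ _ _ _ A3),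
    (CRInt_eq _ _ _ _ B1), (CRInt_eq _ _ _ _ B2), (CRInt_eq _ _ _ _ B3).
  split; [|lra].
  rewrite A4 in B4. rewrite A5 in B5.
  destruct (cis_ratio _ _ _ (Cmod_lift _ _ _ _ _ _ _ _) B4) as [k Hk].
  destruct (cis_ratio _ _ _ (Cmod_lift _ _ _ _ _ _ _ _) B5) as [j Hj].
  exists k, j. f_equal.
  - apply Rmult_eq_reg_l with om1; [|exact N1]. rewrite Rmult_minus_distr_l, Hk. field. exact N1.
  - apply Rmult_eq_reg_l with om2; [|exact N2]. rewrite Rmult_minus_distr_l, Hj. field. exact N2.
Qed.

End WithPeriods.
End Transport.

(** * Hyperbolic functions *)

Lemma sinh_add x y : sinh (x + y) = sinh x * cosh y + cosh x * sinh y.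
Proof.
  unfold sinh, cosh. rewrite Ropp_plus_distr, !exp_plus. field.
Qed.

Lemma cosh_add x y : cosh (x + y) = cosh x * cosh y + sinh x * sinh y.
Proof.
  unfold sinh, cosh. rewrite Ropp_plus_distr, !exp_plus. field.
Qed.

Lemma sinh_opp x : sinh (- x) = - sinh x.
Proof. unfold sinh. rewrite Ropp_involutive. field. Qed.

Lemma cosh_opp x : cosh (- x) = cosh x.
Proof. unfold cosh. rewrite Ropp_involutive. field. Qed.

Lemma sinh_sub x y : sinh (x - y) = sinh x * cosh y - cosh x * sinh y.
Proof. unfold Rminus at 1. rewrite sinh_add, sinh_opp, cosh_opp. ring. Qed.

Lemma cosh_sub x y : cosh (x - y) = cosh x * cosh y - sinh x * sinh y.
Proof. unfold Rminus at 1. rewrite cosh_add, sinh_opp, cosh_opp. ring. Qed.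

Lemma cosh_sqr x : cosh x * cosh x = 1 + sinh x * sinh x.
Proof.
  unfold sinh, cosh. assert (H : exp x * exp (- x) = 1) by (rewrite <- exp_plus, Rplus_opp_r; apply exp_0).
  nra.
Qed.

Lemma cosh_ge_1 x : 1 <= cosh x.
Proof.
  assert (H := cosh_sqr x). assert (0 < cosh x).
  { unfold cosh. generalize (exp_pos x) (exp_pos (- x)). lra. }
  nra.
Qed.

Lemma sinh_pos x : 0 < x -> 0 < sinh x.
Proof. intros H. rewrite <- sinh_0. now apply sinh_lt. Qed.

Lemma sinh_nonneg x : 0 <= x -> 0 <= sinh x.
Proof. intros [H| <-]; [left; now apply sinh_pos|rewrite sinh_0; lra]. Qed.

Lemma sinh_le x y : x <= y -> sinh x <= sinh y.
Proof. intros [H| ->]; [left; now apply sinh_lt|lra]. Qed.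

Lemma sinh_lt_inv x y : sinh x < sinh y -> x < y.
Proof. intros H. destruct (Rlt_le_dec x y) as [|K]; [assumption|]. apply sinh_le in K. lra. Qed.

Lemma cosh_lt x y : 0 <= x -> x < y -> cosh x < cosh y.
Proof.
  intros Hx H. assert (K := sinh_lt x y H). assert (K0 := sinh_nonneg x Hx).
  assert (H1 := cosh_sqr x). assert (H2 := cosh_sqr y).
  assert (H3 := cosh_ge_1 x). assert (H4 := cosh_ge_1 y). nra.
Qed.

Lemma cosh_le x y : 0 <= x -> x <= y -> cosh x <= cosh y.
Proof. intros Hx [H| ->]; [left; now apply cosh_lt|lra]. Qed.

Lemma cosh_lt_inv x y : 0 <= y -> cosh x < cosh y -> x < y.
Proof. intros Hy H. destruct (Rlt_le_dec x y) as [|K]; [assumption|]. apply cosh_le in K; lra. Qed.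

Section ContinuityRules.
Context {T : UniformSpace}.
Implicit Types (f : T -> R) (x : T).

Lemma continuous_sinh_comp f x : continuous f x -> continuous (fun t => sinh (f t)) x.
Proof.
  intros H. apply (continuous_comp_R sinh f x); [|exact H].
  apply (ex_derive_continuous (V := R_NormedModule)). exists (cosh (f x)).
  apply is_derive_Reals, derivable_pt_lim_sinh.
Qed.

Lemma continuous_cosh_comp f x : continuous f x -> continuous (fun t => cosh (f t)) x.
Proof.
  intros H. apply (continuous_comp_R cosh f x); [|exact H].
  apply (ex_derive_continuous (V := R_NormedModule)). exists (sinh (f x)).
  apply is_derive_Reals, derivable_pt_lim_cosh.
Qed.

Lemma continuous_arcsinh_comp f x : continuous f x -> continuous (fun t => arcsinh (f t)) x.
Proof.
  intros H. apply (continuous_comp_R arcsinh f x); [|exact H].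
  apply (ex_derive_continuous (V := R_NormedModule)). eexists.
  apply is_derive_Reals, derivable_pt_lim_arcsinh.
Qed.

Lemma continuous_sin_comp f x : continuous f x -> continuous (fun t => sin (f t)) x.
Proof. intros H. apply (continuous_comp_R sin f x); [apply continuous_sin|exact H]. Qed.
End ContinuityRules.

Ltac cts :=
  lazymatch goal with
  | |- continuous (fun _ => ?c) _ => exact (continuous_const _ _)
  | |- continuous (fun t => @?f t + @?g t) ?x => refine (continuous_Rplus f g x _ _); cbv beta; cts
  | |- continuous (fun t => @?f t - @?g t) ?x => refine (continuous_Rminus f g x _ _); cbv beta; cts
  | |- continuous (fun t => @?f t * @?g t) ?x => refine (continuous_Rmult f g x _ _); cbv beta; cts
  | |- continuous (fun t => - @?f t) ?x => refine (continuous_Ropp f x _); cbv beta; cts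
  | |- continuous (fun t => @?f t / @?g t) ?x =>
      refine (continuous_Rdiv f g x _ _ _); cbv beta; [cts|cts|try lra]
  | |- continuous (fun t => sqrt (@?f t)) ?x => refine (continuous_Rsqrt f x _); cbv beta; cts
  | |- continuous (fun t => sinh (@?f t)) ?x => refine (continuous_sinh_comp f x _); cbv beta; cts
  | |- continuous (fun t => cosh (@?f t)) ?x => refine (continuous_cosh_comp f x _); cbv beta; cts
  | |- continuous (fun t => arcsinh (@?f t)) ?x => refine (continuous_arcsinh_comp f x _); cbv beta; cts
  | |- continuous (fun t => sin (@?f t)) ?x => refine (continuous_sin_comp f x _); cbv beta; cts
  | |- continuous (fun t => t) ?x => exact (continuous_id x)
  | |- _ => try assumption
  end.

Lemma continuity_2d_of_continuous (F : R -> R -> R) x y :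
  continuous (T := R2) (fun p : R * R => F (fst p) (snd p)) (x, y) -> continuity_2d_pt F x y.
Proof. intros H. apply continuity_2d_pt_filterlim. exact H. Qed.

(** Uniform continuity of F near the compact segment over t0 makes the difference of the two
    integrands uniformly small. *)
Lemma RInt_param_continuous (F : R -> R -> R) a b t0 : a < b ->
  locally t0 (fun t => forall th, a <= th <= b ->
    continuous (T := R2) (fun p : R * R => F (fst p) (snd p)) (t, th)) ->
  continuous (fun t => RInt (F t) a b) t0.
Proof.
  intros Hab HL.
  assert (H0 := locally_singleton _ _ HL). cbv beta in H0.
  assert (HI : locally t0 (fun t => ex_RInt (F t) a b)).
  { revert HL. apply filter_imp. intros t Ht.
    apply (ex_RInt_continuous (V := R_CompleteNormedModule)).
    rewrite Rmin_left, Rmax_right by lra. intros th Hth.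
    refine (continuous_comp (fun s : R => (t, s) : R2) (fun p : R * R => F (fst p) (snd p)) th _ (Ht th Hth)).
    apply (continuous_comp_2 (fun _ : R => t) (fun s : R => s) (fun u v => (u, v) : R2));
      [apply continuous_const|apply continuous_id|].
    apply (continuous_ext (fun p => p)); [now intros []|]. apply continuous_id. }
  apply (ccont_real_lim (T := R_UniformSpace)). intros eps He.
  assert (He' : 0 < eps / (2 * (b - a))) by (apply Rdiv_lt_0_compat; lra).
  destruct (uniform_continuity_2d_1d' F a b t0
    (fun th Hth => continuity_2d_of_continuous F t0 th (H0 th Hth)) (mkposreal _ He')) as [d Hd].
  simpl in Hd.
  destruct (proj1 (locally_R _ _) HI) as (d' & Hd' & K).
  apply locally_R. exists (Rmin d d'). split; [apply Rmin_pos; [apply cond_pos|exact Hd']|].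
  intros t Ht.
  assert (It := K t (Rlt_le_trans _ _ _ Ht (Rmin_r _ _))).
  assert (I0 : ex_RInt (F t0) a b) by (apply K; rewrite Rminus_diag, Rabs_R0; exact Hd').
  assert (Htd := Rlt_le_trans _ _ _ Ht (Rmin_l _ _)). apply Rabs_def2 in Htd.
  assert (E : RInt (F t) a b - RInt (F t0) a b = RInt (fun th => F t th - F t0 th) a b).
  { symmetry. apply (RInt_minus (V := R_CompleteNormedModule)); assumption. }
  rewrite E.
  apply Rle_lt_trans with ((b - a) * (eps / (2 * (b - a)))).
  - apply (abs_RInt_le_const (fun th => F t th - F t0 th)); [lra| |].
    + apply (ex_RInt_minus (V := R_NormedModule)); assumption.
    + intros th Hth. left. assert (Hp := cond_pos d). apply (Hd th t0 th t); try lra.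
      rewrite Rminus_diag, Rabs_R0. exact Hp.
  - replace ((b - a) * (eps / (2 * (b - a)))) with (eps / 2) by (field; lra). lra.
Qed.

(** * The period condition of the second form *)

(* [u = cosh (n + xi h th)] runs from [cosh (n - h)] to [cosh (n + h)] when [th] runs over
   [-PI/2, PI/2], and it pulls phi_2 back to a multiple of [jJ m h n th d th]. *)
Definition xi (h th : R) : R := 2 * arcsinh (sinh (h / 2) * sin th).

(** With u = cosh (n + x), the product 4 num_v den_v sinh((h + x)/2) sinh((h - x)/2) is the quartic
    at u, and num_v sinh((h + x)/2) - den_v sinh((h - x)/2) is a positive multiple of u - beta.
    Hence the integrand splits into two terms that depend on n only through sqrt (num_v / den_v) and
    its inverse, which makes monotonicity in n visible. *)
Definition num_v (m h n x : R) : R := (sinh m - sinh (n + x - h)) * sinh (n + (h + x) / 2).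
Definition den_v (m h n x : R) : R := (sinh m + sinh (n + x + h)) * sinh (n - (h - x) / 2).

Definition jJ (m h n th : R) : R :=
  (sqrt (num_v m h n (xi h th)) / sqrt (den_v m h n (xi h th)) * sinh ((h + xi h th) / 2)
   - sqrt (den_v m h n (xi h th)) / sqrt (num_v m h n (xi h th)) * sinh ((h - xi h th) / 2))
  / cosh (xi h th / 2).

Definition J (m h n : R) : R := RInt (jJ m h n) (- (PI / 2)) (PI / 2).

Lemma half_PI_pos : 0 < PI / 2.
Proof. generalize PI_RGT_0. lra. Qed.

Lemma sin_bounds th : -1 <= sin th <= 1.
Proof. apply SIN_bound. Qed.

Lemma xi_bounds h th : 0 < h -> - h <= xi h th <= h.
Proof.
  intros Hh. assert (Hs : 0 < sinh (h / 2)) by (apply sinh_pos; lra).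
  destruct (sin_bounds th) as [H1 H2]. unfold xi.
  assert (E1 : arcsinh (sinh (h / 2) * sin th) <= h / 2).
  { rewrite <- (arcsinh_sinh (h / 2)) at 2. apply arcsinh_le. nra. }
  assert (E2 : - (h / 2) <= arcsinh (sinh (h / 2) * sin th)).
  { rewrite <- (arcsinh_sinh (- (h / 2))). apply arcsinh_le. rewrite sinh_opp. nra. }
  lra.
Qed.

Lemma arcsinh_opp x : arcsinh (- x) = - arcsinh x.
Proof.
  rewrite <- (arcsinh_sinh (- arcsinh x)). f_equal. now rewrite sinh_opp, sinh_arcsinh.
Qed.

Lemma xi_odd h th : xi h (- th) = - xi h th.
Proof. unfold xi. rewrite sin_neg, Ropp_mult_distr_r_reverse, arcsinh_opp. ring. Qed.

Section Domain.
Context (m h n : R) (Hh : 0 < h) (Hn : h < n) (Hm : n < m).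

Lemma num_v_pos x : - h <= x <= h -> 0 < num_v m h n x.
Proof.
  intros Hx. apply Rmult_lt_0_compat; [|apply sinh_pos; lra].
  assert (sinh (n + x - h) < sinh m) by (apply sinh_lt; lra). lra.
Qed.

Lemma den_v_pos x : - h <= x <= h -> 0 < den_v m h n x.
Proof.
  intros Hx. apply Rmult_lt_0_compat; [|apply sinh_pos; lra].
  assert (0 < sinh m) by (apply sinh_pos; lra). assert (0 < sinh (n + x + h)) by (apply sinh_pos; lra). lra.
Qed.
End Domain.

Lemma continuous_xi {T : UniformSpace} (fh ft : T -> R) t :
  continuous fh t -> continuous ft t -> continuous (fun s => xi (fh s) (ft s)) t.
Proof. intros. unfold xi. cts. Qed.

Lemma continuous_jJ {T : UniformSpace} (fm fh fn ft : T -> R) t :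
  0 < fh t -> fh t < fn t -> fn t < fm t ->
  continuous fm t -> continuous fh t -> continuous fn t -> continuous ft t ->
  continuous (fun s => jJ (fm s) (fh s) (fn s) (ft s)) t.
Proof.
  intros H1 H2 H3 Cm Ch Cn Ct.
  assert (Cx := continuous_xi fh ft t Ch Ct).
  assert (Hx := xi_bounds (fh t) (ft t) H1).
  assert (P1 := num_v_pos _ _ _ H1 H2 H3 _ Hx). assert (P2 := den_v_pos _ _ _ H1 H2 H3 _ Hx).
  assert (Cn1 : continuous (fun s => num_v (fm s) (fh s) (fn s) (xi (fh s) (ft s))) t)
    by (unfold num_v; cts).
  assert (Cd1 : continuous (fun s => den_v (fm s) (fh s) (fn s) (xi (fh s) (ft s))) t)
    by (unfold den_v; cts).
  apply sqrt_lt_R0 in P1. apply sqrt_lt_R0 in P2.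
  assert (Hc := cosh_ge_1 (xi (fh t) (ft t) / 2)).
  unfold jJ. cts.
Qed.

Lemma continuous_fst_R2 (p : R2) : continuous (T := R2) (fun q : R * R => fst q) p.
Proof. destruct p. apply continuous_fst. Qed.

Lemma continuous_snd_R2 (p : R2) : continuous (T := R2) (fun q : R * R => snd q) p.
Proof. destruct p. apply continuous_snd. Qed.

Lemma continuous_comp_fst (f : R -> R) (p : R2) : continuous f (fst p) ->
  continuous (T := R2) (fun q : R * R => f (fst q)) p.
Proof. intros H. apply (continuous_comp_R (T := R2) f fst p H). apply continuous_fst_R2. Qed.

Lemma J_continuous (mf hf nf : R -> R) t0 :
  locally t0 (fun t => continuous mf t /\ continuous hf t /\ continuous nf t /\
    0 < hf t /\ hf t < nf t /\ nf t < mf t) ->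
  continuous (fun t => J (mf t) (hf t) (nf t)) t0.
Proof.
  intros HL. apply (RInt_param_continuous (fun t th => jJ (mf t) (hf t) (nf t) th)).
  - generalize half_PI_pos. lra.
  - revert HL. apply filter_imp. intros t (C1 & C2 & C3 & P1 & P2 & P3) th _.
    apply (continuous_jJ (T := R2) (fun q => mf (fst q)) (fun q => hf (fst q)) (fun q => nf (fst q)) snd);
      try assumption; try (now apply continuous_comp_fst). apply continuous_snd_R2.
Qed.

Lemma jJ_continuous_th m h n th : 0 < h -> h < n -> n < m -> continuous (jJ m h n) th.
Proof.
  intros. apply (continuous_jJ (T := R_UniformSpace) (fun _ => m) (fun _ => h) (fun _ => n) (fun s => s));
    auto using continuous_const, continuous_id.
Qed.

Lemma ex_RInt_jJ m h n : 0 < h -> h < n -> n < m -> ex_RInt (jJ m h n) (- (PI / 2)) (PI / 2).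
Proof.
  intros. apply (ex_RInt_continuous (V := R_CompleteNormedModule)). intros th _.
  now apply jJ_continuous_th.
Qed.

(** The quotient num_v / den_v has two decreasing factors. One is evident; for sinh(n + s) / sinh(n
    - t) the cross difference collapses to - sinh(s + t) sinh(n2 - n1) by the addition formulas. *)
Lemma ratio_decreasing m h n1 n2 x : 0 < h -> h < n1 -> n1 < n2 -> n2 < m -> - h <= x <= h ->
  num_v m h n2 x * den_v m h n1 x < num_v m h n1 x * den_v m h n2 x.
Proof.
  intros Hh H1 H12 H2 Hx. unfold num_v, den_v.
  set (s := (h + x) / 2). set (t := (h - x) / 2).
  assert (Es : n2 + s = n2 + (h + x) / 2) by reflexivity.
  assert (F2 : 0 < sinh m - sinh (n2 + x - h)) by (assert (sinh (n2 + x - h) < sinh m) by (apply sinh_lt; lra); lra).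
  assert (F12 : sinh (n1 + x - h) < sinh (n2 + x - h)) by (apply sinh_lt; lra).
  assert (G1 : 0 < sinh m + sinh (n1 + x + h)).
  { assert (0 < sinh m) by (apply sinh_pos; lra). assert (0 < sinh (n1 + x + h)) by (apply sinh_pos; lra). lra. }
  assert (G12 : sinh (n1 + x + h) < sinh (n2 + x + h)) by (apply sinh_lt; lra).
  assert (S1 : 0 < sinh (n1 + s)) by (apply sinh_pos; unfold s; lra).
  assert (S2 : 0 < sinh (n2 + s)) by (apply sinh_pos; unfold s; lra).
  assert (T1 : 0 < sinh (n1 - t)) by (apply sinh_pos; unfold t; lra).
  assert (T2 : 0 < sinh (n2 - t)) by (apply sinh_pos; unfold t; lra).
  assert (I : sinh (n2 + s) * sinh (n1 - t) - sinh (n1 + s) * sinh (n2 - t) = - (sinh (s + t) * sinh (n2 - n1))).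
  { rewrite !sinh_sub, !sinh_add. ring. }
  assert (P : 0 < sinh (s + t) * sinh (n2 - n1)).
  { apply Rmult_lt_0_compat; apply sinh_pos; [unfold s, t|]; lra. }
  assert (K : sinh (n2 + s) * sinh (n1 - t) < sinh (n1 + s) * sinh (n2 - t)) by lra.
  assert (Q : (sinh m - sinh (n2 + x - h)) * (sinh m + sinh (n1 + x + h)) <=
     (sinh m - sinh (n1 + x - h)) * (sinh m + sinh (n2 + x + h))) by (apply Rmult_le_compat; lra).
  assert (Q0 : 0 < (sinh m - sinh (n2 + x - h)) * (sinh m + sinh (n1 + x + h))) by now apply Rmult_lt_0_compat.
  assert (K0 : 0 < sinh (n2 + s) * sinh (n1 - t)) by now apply Rmult_lt_0_compat.
  replace ((sinh m - sinh (n2 + x - h)) * sinh (n2 + s) * ((sinh m + sinh (n1 + x + h)) * sinh (n1 - t)))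
    with (((sinh m - sinh (n2 + x - h)) * (sinh m + sinh (n1 + x + h))) * (sinh (n2 + s) * sinh (n1 - t))) by ring.
  replace ((sinh m - sinh (n1 + x - h)) * sinh (n1 + s) * ((sinh m + sinh (n2 + x + h)) * sinh (n2 - t)))
    with (((sinh m - sinh (n1 + x - h)) * (sinh m + sinh (n2 + x + h))) * (sinh (n1 + s) * sinh (n2 - t))) by ring.
  apply Rlt_le_trans with (((sinh m - sinh (n2 + x - h)) * (sinh m + sinh (n1 + x + h))) * (sinh (n1 + s) * sinh (n2 - t))).
  - now apply Rmult_lt_compat_l.
  - apply Rmult_le_compat_r; lra.
Qed.

Lemma sqrt_ratio_lt a b c d : 0 < a -> 0 < b -> 0 < c -> 0 < d -> a * d < c * b ->
  sqrt a / sqrt b < sqrt c / sqrt d.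
Proof.
  intros Ha Hb Hc Hd H.
  rewrite <- !sqrt_div by lra. apply sqrt_lt_1_alt. split.
  - apply Rlt_le, Rdiv_lt_0_compat; assumption.
  - apply Rmult_lt_reg_r with (b * d); [now apply Rmult_lt_0_compat|].
    replace (a / b * (b * d)) with (a * d) by (field; lra).
    replace (c / d * (b * d)) with (c * b) by (field; lra). exact H.
Qed.

Lemma half_sums h x : 0 < h -> - h <= x <= h ->
  0 <= sinh ((h + x) / 2) /\ 0 <= sinh ((h - x) / 2) /\ 0 < sinh ((h + x) / 2) + sinh ((h - x) / 2).
Proof.
  intros Hh Hx.
  assert (H1 : 0 <= sinh ((h + x) / 2)) by (apply sinh_nonneg; lra).
  assert (H2 : 0 <= sinh ((h - x) / 2)) by (apply sinh_nonneg; lra).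
  split; [exact H1|]. split; [exact H2|].
  destruct (Rle_lt_dec x 0).
  - assert (0 < sinh ((h - x) / 2)) by (apply sinh_pos; lra). lra.
  - assert (0 < sinh ((h + x) / 2)) by (apply sinh_pos; lra). lra.
Qed.

(** With r = sqrt (num_v / den_v) the integrand is (r S - S' / r) / cosh, where S and S' are
    nonnegative and not both zero: it increases with r. *)
Lemma jJ_decreasing m h n1 n2 th : 0 < h -> h < n1 -> n1 < n2 -> n2 < m ->
  jJ m h n2 th < jJ m h n1 th.
Proof.
  intros Hh H1 H12 H2. assert (Hx := xi_bounds h th Hh). unfold jJ. set (x := xi h th) in *.
  assert (Hc := cosh_ge_1 (x / 2)).
  assert (A1' := num_v_pos m h n1 Hh H1 ltac:(lra) x Hx).
  assert (A2' := num_v_pos m h n2 Hh ltac:(lra) ltac:(lra) x Hx).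
  assert (B1' := den_v_pos m h n1 Hh H1 ltac:(lra) x Hx).
  assert (B2' := den_v_pos m h n2 Hh ltac:(lra) ltac:(lra) x Hx).
  assert (Hr := ratio_decreasing m h n1 n2 x Hh H1 H12 H2 Hx).
  assert (K1 := sqrt_ratio_lt _ _ _ _ A2' B2' A1' B1' Hr).
  assert (K2 : sqrt (den_v m h n1 x) / sqrt (num_v m h n1 x) < sqrt (den_v m h n2 x) / sqrt (num_v m h n2 x)).
  { apply sqrt_ratio_lt; try assumption. lra. }
  destruct (half_sums h x Hh Hx) as (S1 & S2 & S12).
  apply Rmult_lt_compat_r; [apply Rinv_0_lt_compat; lra|].
  set (r1 := sqrt (num_v m h n1 x) / sqrt (den_v m h n1 x)) in *.
  set (r2 := sqrt (num_v m h n2 x) / sqrt (den_v m h n2 x)) in *.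
  set (q1 := sqrt (den_v m h n1 x) / sqrt (num_v m h n1 x)) in *.
  set (q2 := sqrt (den_v m h n2 x) / sqrt (num_v m h n2 x)) in *.
  clearbody r1 r2 q1 q2.
  assert (0 <= (q2 - q1) * sinh ((h - x) / 2)) by (apply Rmult_le_pos; lra).
  assert (0 <= (r1 - r2) * sinh ((h + x) / 2)) by (apply Rmult_le_pos; lra).
  destruct S1 as [S1|S1].
  - assert (0 < (r1 - r2) * sinh ((h + x) / 2)) by (apply Rmult_lt_0_compat; lra). lra.
  - assert (0 < (q2 - q1) * sinh ((h - x) / 2)) by (apply Rmult_lt_0_compat; lra). lra.
Qed.

Lemma J_decreasing m h n1 n2 : 0 < h -> h < n1 -> n1 < n2 -> n2 < m -> J m h n2 < J m h n1.
Proof.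
  intros Hh H1 H12 H2. apply RInt_lt.
  - generalize half_PI_pos. lra.
  - intros th _. apply jJ_continuous_th; lra.
  - intros th _. apply jJ_continuous_th; lra.
  - intros th _. now apply jJ_decreasing.
Qed.

Lemma RInt_odd (f : R -> R) a : 0 < a -> (forall x, - a <= x <= a -> continuous f x) ->
  (forall x, f (- x) = - f x) -> RInt f (- a) a = 0.
Proof.
  intros Ha Cf Hodd.
  assert (Hex : ex_RInt f (- a) a).
  { apply (ex_RInt_continuous (V := R_CompleteNormedModule)).
    rewrite Rmin_left, Rmax_right by lra. exact Cf. }
  assert (E := RInt_comp_lin (V := R_CompleteNormedModule) f (-1) 0 (- a) a).
  replace (-1 * - a + 0) with a in E by ring. replace (-1 * a + 0) with (- a) in E by ring.
  specialize (E (ex_RInt_swap f (- a) a Hex)).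
  rewrite (RInt_ext _ f) in E.
  2: { intros x _. unfold scal; simpl; unfold mult; simpl.
       replace (-1 * x + 0) with (- x) by ring. rewrite Hodd. ring. }
  rewrite <- (opp_RInt_swap (V := R_CompleteNormedModule)) in E |- * by exact (ex_RInt_swap _ _ _ Hex).
  unfold opp in E |- *; simpl in E |- *. lra.
Qed.

(** The integrand obtained when num_v = den_v. It is odd in th, so its integral 0 is the reference
    value for comparisons of J. *)
Definition j_one (h th : R) : R :=
  (sinh ((h + xi h th) / 2) - sinh ((h - xi h th) / 2)) / cosh (xi h th / 2).

Lemma continuous_j_one h th : continuous (j_one h) th.
Proof.
  assert (Cx := continuous_xi (T := R_UniformSpace) (fun _ => h) (fun s => s) th (continuous_const h th) (continuous_id th)).
  assert (Hc := cosh_ge_1 (xi h th / 2)).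
  unfold j_one. cts.
Qed.

Lemma RInt_j_one h : RInt (j_one h) (- (PI / 2)) (PI / 2) = 0.
Proof.
  apply RInt_odd; [apply half_PI_pos|intros; apply continuous_j_one|].
  intros th. unfold j_one. rewrite xi_odd.
  replace (h - - xi h th) with (h + xi h th) by ring.
  replace (- xi h th / 2) with (- (xi h th / 2)) by field. rewrite cosh_opp.
  replace (h + - xi h th) with (h - xi h th) by ring.
  unfold Rdiv. ring.
Qed.

Lemma ex_RInt_j_one h : ex_RInt (j_one h) (- (PI / 2)) (PI / 2).
Proof.
  apply (ex_RInt_continuous (V := R_CompleteNormedModule)). intros th _. apply continuous_j_one.
Qed.

Lemma J_nonneg m h n : 0 < h -> h < n -> n < m ->
  (forall x, - h <= x <= h -> den_v m h n x <= num_v m h n x) -> 0 <= J m h n.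
Proof.
  intros Hh Hn Hm H. rewrite <- (RInt_j_one h). apply RInt_le.
  - generalize half_PI_pos. lra.
  - apply ex_RInt_j_one.
  - now apply ex_RInt_jJ.
  - intros th _. assert (Hx := xi_bounds h th Hh). unfold jJ, j_one. set (x := xi h th) in *.
    assert (Hc := cosh_ge_1 (x / 2)). destruct (half_sums h x Hh Hx) as (S1 & S2 & _).
    assert (A := num_v_pos m h n Hh Hn Hm x Hx). assert (B := den_v_pos m h n Hh Hn Hm x Hx).
    specialize (H x Hx). apply sqrt_le_1_alt in H. apply sqrt_lt_R0 in A, B.
    apply Rmult_le_compat_r; [left; apply Rinv_0_lt_compat; lra|].
    assert (K1 : 1 <= sqrt (num_v m h n x) / sqrt (den_v m h n x)).
    { apply Rmult_le_reg_r with (sqrt (den_v m h n x)); [exact B|]. unfold Rdiv.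
      rewrite Rmult_assoc, Rinv_l by lra. lra. }
    assert (K2 : sqrt (den_v m h n x) / sqrt (num_v m h n x) <= 1).
    { apply Rmult_le_reg_r with (sqrt (num_v m h n x)); [exact A|]. unfold Rdiv.
      rewrite Rmult_assoc, Rinv_l by lra. lra. }
    apply (Rmult_le_compat_r _ _ _ S1) in K1. apply (Rmult_le_compat_r _ _ _ S2) in K2. lra.
Qed.

Lemma J_nonpos m h n : 0 < h -> h < n -> n < m ->
  (forall x, - h <= x <= h -> num_v m h n x <= den_v m h n x) -> J m h n <= 0.
Proof.
  intros Hh Hn Hm H. rewrite <- (RInt_j_one h). apply RInt_le.
  - generalize half_PI_pos. lra.
  - now apply ex_RInt_jJ.
  - apply ex_RInt_j_one.
  - intros th _. assert (Hx := xi_bounds h th Hh). unfold jJ, j_one. set (x := xi h th) in *.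
    assert (Hc := cosh_ge_1 (x / 2)). destruct (half_sums h x Hh Hx) as (S1 & S2 & _).
    assert (A := num_v_pos m h n Hh Hn Hm x Hx). assert (B := den_v_pos m h n Hh Hn Hm x Hx).
    specialize (H x Hx). apply sqrt_le_1_alt in H. apply sqrt_lt_R0 in A, B.
    apply Rmult_le_compat_r; [left; apply Rinv_0_lt_compat; lra|].
    assert (K1 : sqrt (num_v m h n x) / sqrt (den_v m h n x) <= 1).
    { apply Rmult_le_reg_r with (sqrt (den_v m h n x)); [exact B|]. unfold Rdiv.
      rewrite Rmult_assoc, Rinv_l by lra. lra. }
    assert (K2 : 1 <= sqrt (den_v m h n x) / sqrt (num_v m h n x)).
    { apply Rmult_le_reg_r with (sqrt (num_v m h n x)); [exact A|]. unfold Rdiv.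
      rewrite Rmult_assoc, Rinv_l by lra. lra. }
    apply (Rmult_le_compat_r _ _ _ S1) in K1. apply (Rmult_le_compat_r _ _ _ S2) in K2. lra.
Qed.

(** Both s and d tend to 0 at one corner of the domain, where s / sqrt (s + d) is singular as a
    formula. The lower bound is continuous there, and is sharp at d = 0. *)
Lemma sqrt_quot_ge s d : 0 <= s -> 0 <= d -> 0 < s + d -> sqrt s - sqrt d <= s / sqrt (s + d).
Proof.
  intros Hs Hd Hsd.
  assert (P := sqrt_lt_R0 _ Hsd).
  apply Rmult_le_reg_r with (sqrt (s + d)); [exact P|].
  unfold Rdiv. rewrite Rmult_assoc, Rinv_l, Rmult_1_r by lra.
  assert (E1 := sqrt_sqrt s Hs). assert (E2 := sqrt_sqrt d Hd).
  assert (E3 := sqrt_sqrt (s + d) ltac:(lra)).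
  assert (P1 := sqrt_pos s). assert (P2 := sqrt_pos d).
  set (u := sqrt s) in *. set (v := sqrt d) in *. set (w := sqrt (s + d)) in *. clearbody u v w.
  assert (w <= u + v) by (assert (0 <= u * v) by (apply Rmult_le_pos; lra); nra).
  destruct (Rle_lt_dec u v); nra.
Qed.

Lemma RInt_positive_near (L : R -> R -> R) t0 d0 : 0 < d0 ->
  (forall t th, Rabs (t - t0) < d0 ->
     continuous (T := R2) (fun p : R * R => L (fst p) (snd p)) (t, th)) ->
  (forall th, - (PI / 2) < th < PI / 2 -> 0 < L t0 th) ->
  exists d, 0 < d /\ forall t, Rabs (t - t0) < d -> 0 < RInt (L t) (- (PI / 2)) (PI / 2).
Proof.
  intros Hd0 CL HL. assert (Hpi := half_PI_pos).
  assert (P0 : 0 < RInt (L t0) (- (PI / 2)) (PI / 2)).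
  { apply RInt_gt_0; [lra|exact HL|]. intros th _.
    refine (continuous_comp (fun s : R => (t0, s) : R2) (fun p : R * R => L (fst p) (snd p)) th _ _).
    - apply (continuous_comp_2 (fun _ : R => t0) (fun s : R => s) (fun u v => (u, v) : R2));
        [apply continuous_const|apply continuous_id|].
      apply (continuous_ext (fun p => p)); [now intros []|]. apply continuous_id.
    - apply CL. rewrite Rminus_diag, Rabs_R0. exact Hd0. }
  assert (C : continuous (fun t => RInt (L t) (- (PI / 2)) (PI / 2)) t0).
  { apply (RInt_param_continuous L); [lra|]. apply locally_R. exists d0. split; [exact Hd0|].
    intros t Ht th _. now apply CL. }
  assert (CC := proj1 (locally_R t0 _) (C (fun y : R => 0 < y) (open_gt 0 _ P0))).
  destruct CC as (d & Hd & K). now exists d.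
Qed.

Lemma continuous_fst_snd_xi h (p : R2) : continuous (T := R2) (fun q : R * R => xi h (snd q)) p.
Proof.
  apply (continuous_xi (T := R2) (fun _ => h) (fun q => snd q)); [apply continuous_const|apply continuous_snd_R2].
Qed.

(** * Signs of J at the two ends n = h and n = m *)

Section Ends.
Context (m h : R) (Hh : 0 < h) (Hm : h < m).

(* A lower bound of [jJ m h n] that stays continuous at [n = h]. *)
Definition low_h (n th : R) : R :=
  let x := xi h th in
  (sqrt (num_v m h n x) / sqrt (sinh m + sinh (n + x + h)) *
     (sqrt (sinh ((h + x) / 2)) - sqrt (sinh (n - (h - x) / 2) - sinh ((h + x) / 2)))
   - sinh ((h - x) / 2) * sqrt (sinh m + sinh (n + x + h)) * sqrt (sinh (n - (h - x) / 2))
     / sqrt (num_v m h n x))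
  / cosh (x / 2).

Lemma low_h_le n th : h < n -> n < m -> low_h n th <= jJ m h n th.
Proof.
  intros Hn Hnm. assert (Hx := xi_bounds h th Hh). unfold low_h, jJ. set (x := xi h th) in *. cbv zeta.
  assert (Hc := cosh_ge_1 (x / 2)).
  assert (PN := num_v_pos m h n Hh Hn Hnm x Hx). apply sqrt_lt_R0 in PN.
  destruct (half_sums h x Hh Hx) as (S1 & S2 & _).
  assert (PA : 0 < sinh m + sinh (n + x + h)).
  { assert (0 < sinh m) by (apply sinh_pos; lra). assert (0 < sinh (n + x + h)) by (apply sinh_pos; lra). lra. }
  assert (PS : 0 < sinh (n - (h - x) / 2)) by (apply sinh_pos; lra).
  assert (PD : sinh ((h + x) / 2) <= sinh (n - (h - x) / 2)) by (apply sinh_le; lra).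
  apply Rmult_le_compat_r; [left; apply Rinv_0_lt_compat; lra|].
  unfold den_v. rewrite sqrt_mult_alt by lra.
  assert (K := sqrt_quot_ge (sinh ((h + x) / 2)) (sinh (n - (h - x) / 2) - sinh ((h + x) / 2)) S1 ltac:(lra) ltac:(lra)).
  replace (sinh ((h + x) / 2) + (sinh (n - (h - x) / 2) - sinh ((h + x) / 2))) with (sinh (n - (h - x) / 2)) in K by ring.
  apply sqrt_lt_R0 in PA, PS.
  assert (Q : 0 < sqrt (num_v m h n x) / sqrt (sinh m + sinh (n + x + h))) by now apply Rdiv_lt_0_compat.
  apply (Rmult_le_compat_l _ _ _ (Rlt_le _ _ Q)) in K.
  apply Rplus_le_compat.
  - eapply Rle_trans; [exact K|]. right. field. lra.
  - right. field. lra.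
Qed.

(** Values n <= h are included, so that n = h has a two-sided neighbourhood: [sqrt] is 0 on negative
    numbers and continuous everywhere, and the denominators of [low_h] stay positive for n > h /
    2. *)
Lemma low_h_continuous n th : h / 2 < n -> n < m ->
  continuous (T := R2) (fun p : R * R => low_h (fst p) (snd p)) (n, th).
Proof.
  intros Hn Hnm. assert (Hx := xi_bounds h th Hh).
  assert (Cx := continuous_fst_snd_xi h (n, th)). assert (C1 := continuous_fst_R2 (n, th)).
  assert (PA : 0 < sinh m + sinh (n + xi h th + h)).
  { assert (0 < sinh m) by (apply sinh_pos; lra). assert (0 < sinh (n + xi h th + h)) by (apply sinh_pos; lra). lra. }
  assert (PN : 0 < num_v m h n (xi h th)).
  { apply Rmult_lt_0_compat; [|apply sinh_pos; lra].
    assert (sinh (n + xi h th - h) < sinh m) by (apply sinh_lt; lra). lra. }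
  assert (CN : continuous (T := R2) (fun p : R * R => num_v m h (fst p) (xi h (snd p))) (n, th))
    by (unfold num_v; cts).
  apply sqrt_lt_R0 in PA, PN. assert (Hc := cosh_ge_1 (xi h th / 2)).
  unfold low_h. cbv zeta. cts; simpl; lra.
Qed.

(** At n = h the sign is that of num_v - sinh((h - x)/2) (sinh m + sinh(2 h + x)), which factors as
    2 cosh h (sinh m - sinh h) sinh((h + x)/2). *)
Lemma low_h_pos th : - (PI / 2) < th < PI / 2 -> 0 < low_h h th.
Proof.
  intros Hth. assert (Hx := xi_bounds h th Hh). unfold low_h. cbv zeta.
  assert (Hx1 : - h < xi h th).
  { unfold xi. assert (- (h / 2) < arcsinh (sinh (h / 2) * sin th)); [|lra].
    rewrite <- (arcsinh_sinh (- (h / 2))). apply arcsinh_lt. rewrite sinh_opp.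
    assert (-1 < sin th).
    { replace (-1) with (sin (- (PI / 2))) by (rewrite sin_neg, sin_PI2; ring). apply sin_increasing_1; lra. }
    assert (0 < sinh (h / 2)) by (apply sinh_pos; lra). nra. }
  set (x := xi h th) in *.
  assert (Hc := cosh_ge_1 (x / 2)).
  apply Rmult_lt_0_compat; [|apply Rinv_0_lt_compat; lra].
  replace (h - (h - x) / 2) with ((h + x) / 2) by field. rewrite Rminus_diag, sqrt_0, Rminus_0_r.
  assert (PA : 0 < sinh m + sinh (h + x + h)).
  { assert (0 < sinh m) by (apply sinh_pos; lra). assert (0 < sinh (h + x + h)) by (apply sinh_pos; lra). lra. }
  assert (PN : 0 < num_v m h h x).
  { apply Rmult_lt_0_compat; [|apply sinh_pos; lra].
    assert (sinh (h + x - h) < sinh m) by (apply sinh_lt; lra). lra. }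
  assert (PS : 0 < sinh ((h + x) / 2)) by (apply sinh_pos; lra).
  assert (I : num_v m h h x - sinh ((h - x) / 2) * (sinh m + sinh (h + x + h)) =
    (sinh m - sinh h) * (2 * cosh h * sinh ((h + x) / 2))).
  { unfold num_v. set (s := (h + x) / 2). replace (h + x - h) with ((s + s) - h) by (unfold s; field).
    replace ((h - x) / 2) with (h - s) by (unfold s; field).
    replace (h + x + h) with ((s + s) + h) by (unfold s; field).
    rewrite !sinh_sub, !sinh_add, !cosh_add.
    set (S := sinh s). set (c := cosh s). set (H := sinh h). set (c' := cosh h).
    assert (E1 : c * c = 1 + S * S) by apply cosh_sqr.
    ring [E1]. }
  assert (I0 : 0 < (sinh m - sinh h) * (2 * cosh h * sinh ((h + x) / 2))).
  { assert (sinh h < sinh m) by now apply sinh_lt. assert (Hch := cosh_ge_1 h).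
    apply Rmult_lt_0_compat; [lra|]. apply Rmult_lt_0_compat; lra. }
  assert (EA := sqrt_sqrt _ (Rlt_le _ _ PA)). assert (EN := sqrt_sqrt _ (Rlt_le _ _ PN)).
  apply sqrt_lt_R0 in PA, PN, PS.
  set (N := sqrt (num_v m h h x)) in *. set (A := sqrt (sinh m + sinh (h + x + h))) in *.
  rewrite <- EA, <- EN in I.
  replace (N / A * sqrt (sinh ((h + x) / 2)) - sinh ((h - x) / 2) * A * sqrt (sinh ((h + x) / 2)) / N)
    with ((N * N - sinh ((h - x) / 2) * (A * A)) * sqrt (sinh ((h + x) / 2)) / (A * N)) by (field; lra).
  apply Rdiv_lt_0_compat; apply Rmult_lt_0_compat; lra.
Qed.

Lemma J_pos_near_h : exists n1, h < n1 < m /\ forall n, h < n -> n <= n1 -> 0 < J m h n.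
Proof.
  destruct (RInt_positive_near low_h h (Rmin (h / 2) (m - h))) as (d & Hd & K).
  - apply Rmin_pos; lra.
  - intros t th Ht. assert (A := Rlt_le_trans _ _ _ Ht (Rmin_l _ _)).
    assert (B := Rlt_le_trans _ _ _ Ht (Rmin_r _ _)). apply Rabs_def2 in A, B.
    apply low_h_continuous; lra.
  - apply low_h_pos.
  - assert (Hmin : 0 < Rmin d (m - h)) by (apply Rmin_pos; lra).
    assert (M1 := Rmin_l d (m - h)). assert (M2 := Rmin_r d (m - h)).
    exists (h + Rmin d (m - h) / 2). split; [lra|]. intros n Hn1 Hn2.
    apply Rlt_le_trans with (1 := K n ltac:(rewrite Rabs_pos_eq; lra)).
    apply RInt_le.
    + generalize half_PI_pos; lra.
    + apply (ex_RInt_continuous (V := R_CompleteNormedModule)). intros th _.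
      refine (continuous_comp (fun s : R => (n, s) : R2) (fun p : R * R => low_h (fst p) (snd p)) th _ _).
      * apply (continuous_comp_2 (fun _ : R => n) (fun s : R => s) (fun u v => (u, v) : R2));
          [apply continuous_const|apply continuous_id|].
        apply (continuous_ext (fun p => p)); [now intros []|]. apply continuous_id.
      * apply low_h_continuous; lra.
    + apply ex_RInt_jJ; lra.
    + intros th _. apply low_h_le; lra.
Qed.

(* The opposite of an upper bound of [jJ m h n] that stays continuous at [n = m]. *)
Definition low_m (n th : R) : R :=
  let x := xi h th in
  (sqrt (den_v m h n x) / sqrt (sinh (n + (h + x) / 2)) / (2 * cosh (n - (h - x) / 2)) *
     (sqrt (2 * cosh (n - (h - x) / 2) * sinh ((h - x) / 2)) - sqrt (sinh m - sinh n))
   - sqrt (sinh m - sinh (n + x - h)) * sqrt (sinh (n + (h + x) / 2)) / sqrt (den_v m h n x)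
     * sinh ((h + x) / 2))
  / cosh (x / 2).

Lemma low_m_le n th : h < n -> n < m -> low_m n th <= - jJ m h n th.
Proof.
  intros Hn Hnm. assert (Hx := xi_bounds h th Hh). unfold low_m, jJ. set (x := xi h th) in *. cbv zeta.
  assert (Hc := cosh_ge_1 (x / 2)). assert (Hc2 := cosh_ge_1 (n - (h - x) / 2)).
  assert (PD := den_v_pos m h n Hh Hn Hnm x Hx). apply sqrt_lt_R0 in PD.
  destruct (half_sums h x Hh Hx) as (S1 & S2 & _).
  assert (PA : 0 < sinh m - sinh (n + x - h)) by (assert (sinh (n + x - h) < sinh m) by (apply sinh_lt; lra); lra).
  assert (PS : 0 < sinh (n + (h + x) / 2)) by (apply sinh_pos; lra).
  assert (PM : sinh n < sinh m) by now apply sinh_lt.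
  match goal with |- _ <= - (?X / ?c) => replace (- (X / c)) with ((- X) / c) by (unfold Rdiv; ring) end.
  apply Rmult_le_compat_r; [left; apply Rinv_0_lt_compat; lra|].
  set (C := 2 * cosh (n - (h - x) / 2)) in *. assert (HC : 0 < C) by (unfold C; lra).
  assert (EC : sinh m - sinh (n + x - h) = C * sinh ((h - x) / 2) + (sinh m - sinh n)).
  { set (s := (h - x) / 2) in *. replace (n + x - h) with ((n - s) - s) by (unfold s; field).
    replace (sinh n) with (sinh ((n - s) + s)) by (f_equal; ring).
    rewrite (sinh_add (n - s) s), (sinh_sub (n - s) s). unfold C. ring. }
  assert (K := sqrt_quot_ge (C * sinh ((h - x) / 2)) (sinh m - sinh n)
     (Rmult_le_pos _ _ (Rlt_le _ _ HC) S2) ltac:(lra) ltac:(lra)).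
  rewrite <- EC in K.
  unfold num_v. rewrite (sqrt_mult_alt (sinh m - sinh (n + x - h))) by lra.
  apply sqrt_lt_R0 in PA, PS.
  assert (Q : 0 < sqrt (den_v m h n x) / sqrt (sinh (n + (h + x) / 2)) / C)
    by (repeat apply Rdiv_lt_0_compat; assumption).
  apply (Rmult_le_compat_l _ _ _ (Rlt_le _ _ Q)) in K.
  rewrite Ropp_minus_distr. apply Rplus_le_compat.
  - eapply Rle_trans; [exact K|]. right. field. lra.
  - right. field. lra.
Qed.

Lemma low_m_continuous n th : h < n ->
  continuous (T := R2) (fun p : R * R => low_m (fst p) (snd p)) (n, th).
Proof.
  intros Hn. assert (Hx := xi_bounds h th Hh).
  assert (Cx := continuous_fst_snd_xi h (n, th)). assert (C1 := continuous_fst_R2 (n, th)).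
  assert (PA : 0 < sinh (n + (h + xi h th) / 2)) by (apply sinh_pos; lra).
  assert (PD : 0 < den_v m h n (xi h th)).
  { apply Rmult_lt_0_compat; [|apply sinh_pos; lra].
    assert (0 < sinh m) by (apply sinh_pos; lra). assert (0 < sinh (n + xi h th + h)) by (apply sinh_pos; lra). lra. }
  assert (CD : continuous (T := R2) (fun p : R * R => den_v m h (fst p) (xi h (snd p))) (n, th))
    by (unfold den_v; cts).
  apply sqrt_lt_R0 in PA, PD. assert (Hc := cosh_ge_1 (xi h th / 2)).
  assert (Hc2 := cosh_ge_1 (n - (h - xi h th) / 2)).
  unfold low_m. cbv zeta. cts; simpl; lra.
Qed.

(** At n = m the factor sinh m - sinh(m + x - h) equals C sinh((h - x)/2), and the sign is that of
    den_v - C sinh((h + x)/2) sinh(m + (h + x)/2) = 2 sinh(m + (h + x)/2) sinh(m - h). *)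
Lemma low_m_pos th : - (PI / 2) < th < PI / 2 -> 0 < low_m m th.
Proof.
  intros Hth. assert (Hx := xi_bounds h th Hh). unfold low_m. cbv zeta.
  assert (Hx1 : xi h th < h).
  { unfold xi. assert (arcsinh (sinh (h / 2) * sin th) < h / 2); [|lra].
    rewrite <- (arcsinh_sinh (h / 2)) at 2. apply arcsinh_lt.
    assert (sin th < 1).
    { rewrite <- sin_PI2. apply sin_increasing_1; lra. }
    assert (0 < sinh (h / 2)) by (apply sinh_pos; lra). nra. }
  set (x := xi h th) in *.
  assert (Hc := cosh_ge_1 (x / 2)). assert (Hc2 := cosh_ge_1 (m - (h - x) / 2)).
  apply Rmult_lt_0_compat; [|apply Rinv_0_lt_compat; lra].
  rewrite Rminus_diag, sqrt_0, Rminus_0_r.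
  set (C := 2 * cosh (m - (h - x) / 2)) in *. assert (HC : 0 < C) by (unfold C; lra).
  assert (EC : sinh m - sinh (m + x - h) = C * sinh ((h - x) / 2)).
  { unfold C. set (s := (h - x) / 2) in *. replace (m + x - h) with ((m - s) - s) by (unfold s; field).
    replace (sinh m) with (sinh ((m - s) + s)) by (f_equal; ring).
    rewrite (sinh_add (m - s) s), (sinh_sub (m - s) s). ring. }
  rewrite EC.
  assert (PD : 0 < den_v m h m x).
  { apply Rmult_lt_0_compat; [|apply sinh_pos; lra].
    assert (0 < sinh m) by (apply sinh_pos; lra). assert (0 < sinh (m + x + h)) by (apply sinh_pos; lra). lra. }
  assert (PS : 0 < sinh (m + (h + x) / 2)) by (apply sinh_pos; lra).
  assert (P' : 0 < sinh ((h - x) / 2)) by (apply sinh_pos; lra).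
  assert (I : den_v m h m x - C * sinh ((h + x) / 2) * sinh (m + (h + x) / 2) =
     2 * sinh (m + (h + x) / 2) * sinh (m - h)).
  { unfold den_v, C. set (s := (h + x) / 2) in *. set (s' := (h - x) / 2) in *.
    replace (m + x + h) with ((m + s) + s) by (unfold s; field).
    replace (sinh m) with (sinh ((m + s) - s)) by (f_equal; ring).
    replace (m - h) with ((m - s') - s) by (unfold s, s'; field).
    rewrite (sinh_sub (m + s) s), (sinh_add (m + s) s), (sinh_sub (m - s') s). ring. }
  assert (I0 : 0 < 2 * sinh (m + (h + x) / 2) * sinh (m - h)).
  { apply Rmult_lt_0_compat; [lra|apply sinh_pos; lra]. }
  assert (P2 : 0 < C * sinh ((h - x) / 2)) by now apply Rmult_lt_0_compat.
  assert (ED := sqrt_sqrt _ (Rlt_le _ _ PD)). assert (ES := sqrt_sqrt _ (Rlt_le _ _ PS)).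
  apply sqrt_lt_R0 in PD, PS, P2.
  set (D := sqrt (den_v m h m x)) in *. set (S := sqrt (sinh (m + (h + x) / 2))) in *.
  set (W := sqrt (C * sinh ((h - x) / 2))) in *.
  rewrite <- ED, <- ES in I. rewrite <- ES in I0.
  replace (D / S / C * W - W * S / D * sinh ((h + x) / 2))
    with ((D * D - C * sinh ((h + x) / 2) * (S * S)) * W / (D * S * C)) by (field; lra).
  apply Rdiv_lt_0_compat; [apply Rmult_lt_0_compat; lra|].
  apply Rmult_lt_0_compat; [apply Rmult_lt_0_compat; lra|lra].
Qed.

Lemma J_neg_near_m : exists n1, h < n1 < m /\ forall n, n1 <= n -> n < m -> J m h n < 0.
Proof.
  destruct (RInt_positive_near low_m m (m - h)) as (d & Hd & K).
  - lra.
  - intros t th Ht. apply Rabs_def2 in Ht. apply low_m_continuous; lra.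
  - apply low_m_pos.
  - assert (Hmin : 0 < Rmin d (m - h)) by (apply Rmin_pos; lra).
    assert (M1 := Rmin_l d (m - h)). assert (M2 := Rmin_r d (m - h)).
    exists (m - Rmin d (m - h) / 2). split; [lra|]. intros n Hn1 Hn2.
    assert (Kn : 0 < RInt (low_m n) (- (PI / 2)) (PI / 2)).
    { apply K. rewrite Rabs_minus_sym, Rabs_pos_eq; lra. }
    assert (Ex := ex_RInt_jJ m h n Hh ltac:(lra) Hn2).
    assert (E : RInt (fun th => - jJ m h n th) (- (PI / 2)) (PI / 2) = - J m h n).
    { apply (RInt_opp (V := R_CompleteNormedModule)). exact Ex. }
    assert (Le : RInt (low_m n) (- (PI / 2)) (PI / 2) <= RInt (fun th => - jJ m h n th) (- (PI / 2)) (PI / 2)).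
    { apply RInt_le.
      + generalize half_PI_pos; lra.
      + apply (ex_RInt_continuous (V := R_CompleteNormedModule)). intros th _.
        refine (continuous_comp (fun s : R => (n, s) : R2) (fun p : R * R => low_m (fst p) (snd p)) th _ _).
        * apply (continuous_comp_2 (fun _ : R => n) (fun s : R => s) (fun u v => (u, v) : R2));
            [apply continuous_const|apply continuous_id|].
          apply (continuous_ext (fun p => p)); [now intros []|]. apply continuous_id.
        * apply low_m_continuous; lra.
      + exact (ex_RInt_opp (V := R_NormedModule) (jJ m h n) _ _ Ex).
      + intros th _. apply low_m_le; lra. }
    lra.
Qed.
End Ends.

(** * The periods of the first form *)

Definition half_sum (p0 p1 p2 p3 : R) : R := (p0 + p1 + p2 + p3) / 2.

(* [u = arc p q th] runs over [p, q] and [du / sqrt ((u - p) * (q - u)) = d th]. *)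
Definition arc (p q th : R) : R := (p + q) / 2 + (q - p) / 2 * sin th.

Definition upper_integrand (p0 p1 p2 p3 th : R) : R :=
  (half_sum p0 p1 p2 p3 - arc p2 p3 th) / sqrt ((arc p2 p3 th - p0) * (arc p2 p3 th - p1)).

Definition lower_integrand (p0 p1 p2 p3 th : R) : R :=
  (half_sum p0 p1 p2 p3 - arc p0 p1 th) / sqrt ((p3 - arc p0 p1 th) * (p2 - arc p0 p1 th)).

Definition upper_period (p0 p1 p2 p3 : R) : R :=
  RInt (upper_integrand p0 p1 p2 p3) (- (PI / 2)) (PI / 2).
Definition lower_period (p0 p1 p2 p3 : R) : R :=
  RInt (lower_integrand p0 p1 p2 p3) (- (PI / 2)) (PI / 2).

Lemma arc_bounds p q th : p <= q -> p <= arc p q th <= q.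
Proof. intros H. destruct (sin_bounds th). unfold arc. split; nra. Qed.

Lemma continuous_arc {T : UniformSpace} (fp fq ft : T -> R) t :
  continuous fp t -> continuous fq t -> continuous ft t ->
  continuous (fun s => arc (fp s) (fq s) (ft s)) t.
Proof. intros. unfold arc. cts. Qed.

Section Continuity.
Context {T : UniformSpace} (f0 f1 f2 f3 ft : T -> R) (t : T).
Context (H01 : f0 t < f1 t) (H12 : f1 t < f2 t) (H23 : f2 t < f3 t).
Context (C0 : continuous f0 t) (C1 : continuous f1 t) (C2 : continuous f2 t) (C3 : continuous f3 t)
  (Ct : continuous ft t).

Lemma continuous_upper_integrand :
  continuous (fun s => upper_integrand (f0 s) (f1 s) (f2 s) (f3 s) (ft s)) t.
Proof.
  assert (Ca := continuous_arc f2 f3 ft t C2 C3 Ct).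
  assert (B := arc_bounds (f2 t) (f3 t) (ft t) ltac:(lra)).
  assert (P : 0 < (arc (f2 t) (f3 t) (ft t) - f0 t) * (arc (f2 t) (f3 t) (ft t) - f1 t))
    by (apply Rmult_lt_0_compat; lra).
  apply sqrt_lt_R0 in P. unfold upper_integrand, half_sum. cts.
Qed.

Lemma continuous_lower_integrand :
  continuous (fun s => lower_integrand (f0 s) (f1 s) (f2 s) (f3 s) (ft s)) t.
Proof.
  assert (Ca := continuous_arc f0 f1 ft t C0 C1 Ct).
  assert (B := arc_bounds (f0 t) (f1 t) (ft t) ltac:(lra)).
  assert (P : 0 < (f3 t - arc (f0 t) (f1 t) (ft t)) * (f2 t - arc (f0 t) (f1 t) (ft t)))
    by (apply Rmult_lt_0_compat; lra).
  apply sqrt_lt_R0 in P. unfold lower_integrand, half_sum. cts.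
Qed.
End Continuity.

Lemma continuous_periods (f0 f1 f2 f3 : R -> R) t0 :
  locally t0 (fun t => f0 t < f1 t < f2 t /\ f2 t < f3 t /\
    continuous f0 t /\ continuous f1 t /\ continuous f2 t /\ continuous f3 t) ->
  continuous (fun t => upper_period (f0 t) (f1 t) (f2 t) (f3 t)) t0 /\
  continuous (fun t => lower_period (f0 t) (f1 t) (f2 t) (f3 t)) t0.
Proof.
  intros HL. split.
  - apply (RInt_param_continuous (fun t th => upper_integrand (f0 t) (f1 t) (f2 t) (f3 t) th));
      [generalize half_PI_pos; lra|].
    revert HL. apply filter_imp. intros t ((P1 & P2) & P3 & K0 & K1 & K2 & K3) th _.
    apply (continuous_upper_integrand (T := R2) (fun q => f0 (fst q)) (fun q => f1 (fst q))
      (fun q => f2 (fst q)) (fun q => f3 (fst q)) snd); try assumption;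
      try (now apply continuous_comp_fst). apply continuous_snd_R2.
  - apply (RInt_param_continuous (fun t th => lower_integrand (f0 t) (f1 t) (f2 t) (f3 t) th));
      [generalize half_PI_pos; lra|].
    revert HL. apply filter_imp. intros t ((P1 & P2) & P3 & K0 & K1 & K2 & K3) th _.
    apply (continuous_lower_integrand (T := R2) (fun q => f0 (fst q)) (fun q => f1 (fst q))
      (fun q => f2 (fst q)) (fun q => f3 (fst q)) snd); try assumption;
      try (now apply continuous_comp_fst). apply continuous_snd_R2.
Qed.

Lemma RInt_affine_sin A B :
  is_RInt (fun th => A + B * sin th) (- (PI / 2)) (PI / 2) (PI * A).
Proof.
  assert (C : forall th, continuous (fun th => A + B * sin th) th).
  { intros th. assert (Ci := continuous_id (U := R_UniformSpace) th). cts. }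
  assert (Cs : forall th, continuous (fun th => B * sin th) th).
  { intros th. cts. }
  assert (E0 : RInt (fun th => B * sin th) (- (PI / 2)) (PI / 2) = 0).
  { apply RInt_odd; [apply half_PI_pos|intros; apply Cs|]. intros th. rewrite sin_neg. ring. }
  assert (I0 : is_RInt (fun th => B * sin th) (- (PI / 2)) (PI / 2) 0).
  { rewrite <- E0. apply (RInt_correct (V := R_CompleteNormedModule)), (ex_RInt_continuous (V := R_CompleteNormedModule)).
    intros; apply Cs. }
  assert (I1 : is_RInt (fun _ => A) (- (PI / 2)) (PI / 2) (PI * A)).
  { replace (PI * A) with (scal (PI / 2 - - (PI / 2)) A) by (unfold scal; simpl; unfold mult; simpl; field).
    apply (is_RInt_const (V := R_NormedModule)). }
  replace (PI * A) with (plus (PI * A) 0) by (unfold plus; simpl; ring).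
  exact (is_RInt_plus (V := R_NormedModule) _ _ _ _ _ _ I1 I0).
Qed.

Section Bounds.
Context (p0 p1 p2 p3 : R) (H01 : p0 < p1) (H12 : p1 < p2) (H23 : p2 < p3).
Notation c := (half_sum p0 p1 p2 p3).
Notation g := (fun u => / sqrt ((u - p0) * (u - p1))).

Lemma g_decreasing u v : p1 < u -> u <= v -> g v <= g u.
Proof.
  intros Hu Huv. apply Rinv_le_contravar.
  - apply sqrt_lt_R0, Rmult_lt_0_compat; lra.
  - apply sqrt_le_1_alt, Rmult_le_compat; lra.
Qed.

Lemma ex_RInt_upper_integrand : ex_RInt (upper_integrand p0 p1 p2 p3) (- (PI / 2)) (PI / 2).
Proof.
  apply (ex_RInt_continuous (V := R_CompleteNormedModule)). intros th _.
  apply (continuous_upper_integrand (T := R_UniformSpace) (fun _ => p0) (fun _ => p1) (fun _ => p2) (fun _ => p3) (fun t => t));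
    auto using continuous_const, continuous_id.
Qed.

Lemma ex_RInt_lower_integrand : ex_RInt (lower_integrand p0 p1 p2 p3) (- (PI / 2)) (PI / 2).
Proof.
  apply (ex_RInt_continuous (V := R_CompleteNormedModule)). intros th _.
  apply (continuous_lower_integrand (T := R_UniformSpace) (fun _ => p0) (fun _ => p1) (fun _ => p2) (fun _ => p3) (fun t => t));
    auto using continuous_const, continuous_id.
Qed.

(** Let A be the midpoint. As g decreases, - sin th * g(u) >= - sin th * g(A) for either sign of sin
    th, and (c - A) g(u) >= (c - A) g(p2) since c <= A. What remains is affine in sin th, and its
    integral is PI times the constant term. *)
Lemma upper_period_ge : c <= (p2 + p3) / 2 -> PI * ((c - (p2 + p3) / 2) * g p2) <= upper_period p0 p1 p2 p3.
Proof.
  intros Hc. set (A := (p2 + p3) / 2).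
  assert (I := RInt_affine_sin ((c - A) * g p2) (- ((p3 - p2) / 2) * g A)).
  cbv beta in I |- *. rewrite <- (is_RInt_unique _ _ _ _ I).
  apply RInt_le; [generalize half_PI_pos; lra|eexists; exact I|apply ex_RInt_upper_integrand|].
  intros th _. unfold upper_integrand. set (u := arc p2 p3 th).
  assert (Hu : p2 <= u <= p3) by (apply arc_bounds; lra).
  assert (E : u = A + (p3 - p2) / 2 * sin th) by reflexivity.
  unfold Rdiv at 2. replace (c - u) with ((c - A) - (p3 - p2) / 2 * sin th) by lra.
  assert (G1 := g_decreasing p2 u ltac:(lra) ltac:(lra)). cbv beta in G1 |- *.
  assert (G2 : sin th * / sqrt ((u - p0) * (u - p1)) <= sin th * / sqrt ((A - p0) * (A - p1))).
  { destruct (Rle_lt_dec 0 (sin th)) as [S|S].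
    - apply Rmult_le_compat_l; [exact S|]. apply (g_decreasing A u); [unfold A; lra|]. nra.
    - assert (G2 := g_decreasing u A ltac:(lra) ltac:(nra)). cbv beta in G2. nra. }
  set (gu := / sqrt ((u - p0) * (u - p1))) in *. set (g2' := / sqrt ((p2 - p0) * (p2 - p1))) in *.
  set (gA := / sqrt ((A - p0) * (A - p1))) in *. clearbody gu g2' gA.
  assert (c - A <= 0) by (unfold A; lra). nra.
Qed.

Lemma upper_period_le : p2 <= c ->
  upper_period p0 p1 p2 p3 <= PI * ((c - p2) * g p2 - (p3 - p2) / 2 * g p3).
Proof.
  intros Hc.
  assert (I := RInt_affine_sin ((c - p2) * g p2 - (p3 - p2) / 2 * g p3) (- ((p3 - p2) / 2) * g p3)).
  cbv beta in I |- *. rewrite <- (is_RInt_unique _ _ _ _ I).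
  apply RInt_le; [generalize half_PI_pos; lra|apply ex_RInt_upper_integrand|eexists; exact I|].
  intros th _. unfold upper_integrand. set (u := arc p2 p3 th).
  assert (Hu : p2 <= u <= p3) by (apply arc_bounds; lra).
  assert (E : u - p2 = (p3 - p2) / 2 + (p3 - p2) / 2 * sin th) by (unfold u, arc; field).
  unfold Rdiv at 1. replace (c - u) with ((c - p2) - (u - p2)) by ring.
  assert (G1 := g_decreasing p2 u ltac:(lra) ltac:(lra)).
  assert (G2 := g_decreasing u p3 ltac:(lra) ltac:(lra)). cbv beta in G1, G2 |- *.
  apply (Rmult_le_compat_l (c - p2)) in G1; [|lra]. apply (Rmult_le_compat_l (u - p2)) in G2; [|lra].
  rewrite E in G2 at 1. lra.
Qed.

(** From c >= p2 the integrand is at least sqrt ((p2 - u) / (p3 - u)), which is smallest at u =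
    p1. *)
Lemma lower_period_ge : p2 <= c -> PI * sqrt ((p2 - p1) / (p3 - p1)) <= lower_period p0 p1 p2 p3.
Proof.
  intros Hc.
  assert (I := RInt_affine_sin (sqrt ((p2 - p1) / (p3 - p1))) 0).
  cbv beta in I |- *. rewrite <- (is_RInt_unique _ _ _ _ I).
  apply RInt_le; [generalize half_PI_pos; lra|eexists; exact I|apply ex_RInt_lower_integrand|].
  intros th _. unfold lower_integrand. set (u := arc p0 p1 th).
  assert (Hu : p0 <= u <= p1) by (apply arc_bounds; lra).
  rewrite Rmult_0_l, Rplus_0_r.
  apply Rle_trans with (sqrt ((p2 - u) / (p3 - u))).
  - apply sqrt_le_1_alt. apply Rmult_le_reg_r with ((p3 - p1) * (p3 - u)); [apply Rmult_lt_0_compat; lra|].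
    replace ((p2 - p1) / (p3 - p1) * ((p3 - p1) * (p3 - u))) with ((p2 - p1) * (p3 - u)) by (field; lra).
    replace ((p2 - u) / (p3 - u) * ((p3 - p1) * (p3 - u))) with ((p2 - u) * (p3 - p1)) by (field; lra).
    assert (0 <= (p1 - u) * (p3 - p2)) by (apply Rmult_le_pos; lra). lra.
  - rewrite sqrt_div by lra. rewrite sqrt_mult by lra.
    assert (S2 : 0 < sqrt (p2 - u)) by (apply sqrt_lt_R0; lra).
    assert (S3 : 0 < sqrt (p3 - u)) by (apply sqrt_lt_R0; lra).
    assert (E2 := sqrt_sqrt (p2 - u) ltac:(lra)).
    set (w2 := sqrt (p2 - u)) in *. set (w3 := sqrt (p3 - u)) in *. clearbody w2 w3.
    apply Rmult_le_reg_r with (w3 * w2); [now apply Rmult_lt_0_compat|].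
    replace (w2 / w3 * (w3 * w2)) with (p2 - u)
      by (rewrite <- E2; field; lra).
    replace ((c - u) / (w3 * w2) * (w3 * w2)) with (c - u)
      by (field; lra). lra.
Qed.
End Bounds.

(** * Boundary values on the real line *)

Lemma within_cont_of_continuous s t F x : continuous F x -> within_cont s t F x.
Proof.
  intros H eps He.
  assert (HL : locally (F x) (fun y : R => Rabs (y - F x) < eps)).
  { apply locally_R. exists eps. auto. }
  destruct (proj1 (locally_R x _) (H _ HL)) as (d & Hd & K).
  exists d. split; [exact Hd|]. intros y _. apply K.
Qed.

Lemma hsqrt_ge (x p : R) : p <= x -> hsqrt (RtoC x - RtoC p) = RtoC (sqrt (x - p)).
Proof. intros H. rewrite <- RtoC_minus. apply hsqrt_Rpos. lra. Qed.

Lemma hsqrt_le (x p : R) : x <= p -> hsqrt (RtoC x - RtoC p) = (Ci * RtoC (sqrt (p - x)))%C.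
Proof.
  intros H. rewrite <- RtoC_minus, hsqrt_Rneg by lra. do 3 f_equal. ring.
Qed.

Lemma Re_fU_real iota ps mu c x r : r <> 0 -> YU iota ps (RtoC x) = RtoC r ->
  Re (fU iota ps mu c (RtoC x)) = mu * (x - c) / r.
Proof.
  intros Hr E. unfold fU, numer. rewrite E, <- RtoC_minus, <- RtoC_mult, <- RtoC_div by exact Hr. reflexivity.
Qed.

Lemma Re_fU_imag iota ps mu c x r : r <> 0 -> YU iota ps (RtoC x) = (Ci * RtoC r)%C ->
  Re (fU iota ps mu c (RtoC x)) = 0.
Proof.
  intros Hr E. unfold fU, numer. rewrite E, <- RtoC_minus, <- RtoC_mult.
  assert (Hr' : RtoC r <> RtoC 0) by (intros Z; apply RtoC_inj in Z; contradiction).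
  assert (Hi := Ci_neq0).
  replace (RtoC (mu * (x - c)) / (Ci * RtoC r))%C with (Ci * (RtoC (mu * (x - c)) / (Ci * Ci * RtoC r)))%C
    by (field; auto).
  rewrite Ci_sqr, <- RtoC_mult, <- RtoC_div by lra. unfold Re; simpl. ring.
Qed.

Section RealLine.
Context (iota : C) (Hiota : iota <> RtoC 0) (ps : list R) (Hps : NoDup ps) (mu c : R).
Notation Xr := (Xreal iota ps mu c).

Lemma Xreal_const a b : a <= b ->
  (forall x, a < x < b -> ~ In x ps /\ Re (fU iota ps mu c (RtoC x)) = 0) -> Xr b = Xr a.
Proof.
  intros Hab H. apply const_of_derive0; [exact Hab| |].
  - intros x Hx. destruct (H x Hx) as (N & E). rewrite <- E.
    exact (Xreal_derive iota Hiota ps Hps mu c x N).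
  - intros x _. apply within_cont_of_continuous, Xreal_cont; assumption.
Qed.

(** The ends of the interval are typically branch points, where the form blows up and dw vanishes.
    The derivative is used in the open interval only, and continuity of [Xreal] and of the primitive
    of j closes the argument. *)
Lemma Xreal_RInt (w dw j : R -> R) a b : a <= b ->
  (forall t, a < t < b -> is_derive w t (dw t) /\ ~ In (w t) ps /\
     Re (fU iota ps mu c (RtoC (w t))) * dw t = j t) ->
  (forall t, continuous w t) -> (forall t, continuous j t) ->
  Xr (w b) - Xr (w a) = RInt j a b.
Proof.
  intros Hab H Cw Cj.
  assert (Ej : forall s t, ex_RInt j s t) by (intros; apply (ex_RInt_continuous (V := R_CompleteNormedModule)); auto).
  assert (Dj : forall t, is_derive (fun s => RInt j a s) t (j t)).
  { intros t. apply (is_derive_RInt (V := R_NormedModule) j _ a t); [|apply Cj].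
    apply filter_forall. intros s. apply (RInt_correct (V := R_CompleteNormedModule)), Ej. }
  assert (E : Xr (w b) - RInt j a b = Xr (w a) - RInt j a a).
  { apply (const_of_derive0 a b (fun t => Xr (w t) - RInt j a t) Hab).
    - intros t Ht. destruct (H t Ht) as (D & N & E).
      assert (D1 := is_derive_comp (V := R_NormedModule) Xr w t _ _ (Xreal_derive iota Hiota ps Hps mu c (w t) N) D).
      assert (D2 := is_derive_minus (V := R_NormedModule) _ _ t _ _ D1 (Dj t)).
      refine (is_derive_eq _ _ _ _ D2 _).
      change (dw t * Re (fU iota ps mu c (RtoC (w t))) - j t = 0). rewrite <- E. ring.
    - intros t _. apply within_cont_of_continuous. apply (continuous_Rminus (fun s => Xr (w s))).
      + apply (continuous_comp_R Xr w t); [apply Xreal_cont; assumption|apply Cw].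
      + apply (ex_derive_continuous (V := R_NormedModule)). eexists. apply Dj. }
  rewrite RInt_point in E. unfold zero in E; simpl in E. lra.
Qed.
End RealLine.

Lemma cos_open_pos th : - (PI / 2) < th < PI / 2 -> 0 < cos th.
Proof. intros H. apply cos_gt_0; lra. Qed.

Lemma arc_derive p q th : is_derive (arc p q) th ((q - p) / 2 * cos th).
Proof.
  unfold arc. auto_derive; [exact I|]. field.
Qed.

Lemma arc_ends p q : arc p q (- (PI / 2)) = p /\ arc p q (PI / 2) = q.
Proof. unfold arc. rewrite sin_neg, sin_PI2. split; field. Qed.

Lemma arc_open p q th : p < q -> - (PI / 2) < th < PI / 2 ->
  p < arc p q th < q /\
  sqrt (arc p q th - p) * sqrt (q - arc p q th) = (q - p) / 2 * cos th.
Proof.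
  intros Hpq Hth. assert (Hc := cos_open_pos th Hth).
  assert (E := sin2_cos2 th). unfold Rsqr in E.
  assert (S : -1 < sin th < 1) by (split; nra).
  assert (B : p < arc p q th < q) by (unfold arc; split; nra).
  split; [exact B|]. rewrite <- sqrt_mult by lra.
  rewrite <- (sqrt_square ((q - p) / 2 * cos th)) by (apply Rmult_le_pos; lra).
  f_equal. unfold arc.
  replace (((p + q) / 2 + (q - p) / 2 * sin th - p) * (q - ((p + q) / 2 + (q - p) / 2 * sin th)))
    with ((q - p) / 2 * ((q - p) / 2) * (1 - sin th * sin th)) by field.
  replace (1 - sin th * sin th) with (cos th * cos th) by lra. ring.
Qed.

Ltac split_roots x :=
  simpl YU;
  repeat match goal with
  | |- context [hsqrt (RtoC x - RtoC ?p)] =>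
      first [rewrite (hsqrt_ge x p) by lra | rewrite (hsqrt_le x p) by lra]
  end.

Lemma sqrt_diff_pos x y : x < y -> 0 < sqrt (y - x).
Proof. intros. apply sqrt_lt_R0. lra. Qed.

Section FirstForm.
Context (p0 p1 p2 p3 mu c : R) (H01 : p0 < p1) (H12 : p1 < p2) (H23 : p2 < p3).
Notation ps := (p0 :: p1 :: p2 :: p3 :: nil).
Context (Hps : NoDup ps).
Notation Xr := (Xreal Ci ps mu c).

Lemma not_in_ps x : x <> p0 -> x <> p1 -> x <> p2 -> x <> p3 -> ~ In x ps.
Proof. simpl. intuition. Qed.

Lemma Xreal1_below x : x <= p0 -> Xr x = Xr p0.
Proof.
  intros H. symmetry. apply (Xreal_const Ci Ci_neq0 ps Hps); [exact H|]. intros y Hy.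
  split; [apply not_in_ps; lra|].
  assert (S0 := sqrt_diff_pos y p0 ltac:(lra)). assert (S1 := sqrt_diff_pos y p1 ltac:(lra)).
  assert (S2 := sqrt_diff_pos y p2 ltac:(lra)). assert (S3 := sqrt_diff_pos y p3 ltac:(lra)).
  apply (Re_fU_imag _ _ _ _ _ (sqrt (p0 - y) * sqrt (p1 - y) * sqrt (p2 - y) * sqrt (p3 - y))).
  - apply Rgt_not_eq. repeat apply Rmult_lt_0_compat; assumption.
  - split_roots y. rewrite !RtoC_mult. assert (E := Ci_sqr). rewrite RtoC_m1 in E. ring [E].
Qed.

Lemma Xreal1_middle x : p1 <= x <= p2 -> Xr x = Xr p1.
Proof.
  intros H. apply (Xreal_const Ci Ci_neq0 ps Hps); [lra|]. intros y Hy.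
  split; [apply not_in_ps; lra|].
  assert (S0 := sqrt_diff_pos p0 y ltac:(lra)). assert (S1 := sqrt_diff_pos p1 y ltac:(lra)).
  assert (S2 := sqrt_diff_pos y p2 ltac:(lra)). assert (S3 := sqrt_diff_pos y p3 ltac:(lra)).
  apply (Re_fU_imag _ _ _ _ _ (- (sqrt (y - p0) * sqrt (y - p1) * sqrt (p2 - y) * sqrt (p3 - y)))).
  - apply Rlt_not_eq, Ropp_lt_gt_0_contravar. repeat apply Rmult_lt_0_compat; assumption.
  - split_roots y. rewrite RtoC_opp, !RtoC_mult. assert (E := Ci_sqr). rewrite RtoC_m1 in E. ring [E].
Qed.

Lemma Xreal1_above x : p3 <= x -> Xr x = Xr p3.
Proof.
  intros H. apply (Xreal_const Ci Ci_neq0 ps Hps); [lra|]. intros y Hy.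
  split; [apply not_in_ps; lra|].
  assert (S0 := sqrt_diff_pos p0 y ltac:(lra)). assert (S1 := sqrt_diff_pos p1 y ltac:(lra)).
  assert (S2 := sqrt_diff_pos p2 y ltac:(lra)). assert (S3 := sqrt_diff_pos p3 y ltac:(lra)).
  apply (Re_fU_imag _ _ _ _ _ (sqrt (y - p0) * sqrt (y - p1) * sqrt (y - p2) * sqrt (y - p3))).
  - apply Rgt_not_eq. repeat apply Rmult_lt_0_compat; assumption.
  - split_roots y. rewrite !RtoC_mult. ring.
Qed.

Lemma Xreal1_upper : c = half_sum p0 p1 p2 p3 -> Xr p3 - Xr p2 = mu * upper_period p0 p1 p2 p3.
Proof.
  intros Ec. destruct (arc_ends p2 p3) as (E1 & E2). assert (Hpi := half_PI_pos).
  assert (M : Xr (arc p2 p3 (PI / 2)) - Xr (arc p2 p3 (- (PI / 2))) =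
    RInt (fun th => mu * upper_integrand p0 p1 p2 p3 th) (- (PI / 2)) (PI / 2)); cycle 1.
  { rewrite E1, E2 in M. rewrite M.
    exact (RInt_scal (V := R_CompleteNormedModule) _ _ _ (mu) (ex_RInt_upper_integrand p0 p1 p2 p3 H01 H12 H23)). }
  apply (Xreal_RInt Ci Ci_neq0 ps Hps mu c (arc p2 p3) (fun th => (p3 - p2) / 2 * cos th)); [lra| | |].
  - intros th Hth. destruct (arc_open p2 p3 th H23 Hth) as (B & S). set (y := arc p2 p3 th) in *.
    assert (Hc := cos_open_pos th Hth).
    split; [apply arc_derive|]. split; [apply not_in_ps; lra|].
    assert (S0 := sqrt_diff_pos p0 y ltac:(lra)). assert (S1 := sqrt_diff_pos p1 y ltac:(lra)).
    assert (S2 := sqrt_diff_pos p2 y ltac:(lra)). assert (S3 := sqrt_diff_pos y p3 ltac:(lra)).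
    rewrite (Re_fU_real _ _ _ _ _ (- (sqrt (y - p0) * sqrt (y - p1) * (sqrt (y - p2) * sqrt (p3 - y))))).
    + rewrite S. unfold upper_integrand. fold y. rewrite sqrt_mult by lra. rewrite Ec.
      field. lra.
    + apply Rlt_not_eq, Ropp_lt_gt_0_contravar. repeat apply Rmult_lt_0_compat; assumption.
    + split_roots y. rewrite RtoC_opp, !RtoC_mult. assert (E := Ci_sqr). rewrite RtoC_m1 in E. ring [E].
  - intros th. apply (continuous_arc (T := R_UniformSpace) (fun _ => p2) (fun _ => p3) (fun t => t));
      auto using continuous_const, continuous_id.
  - intros th. apply (continuous_Rmult (fun _ => mu)); [apply continuous_const|].
    apply (continuous_upper_integrand (T := R_UniformSpace) (fun _ => p0) (fun _ => p1) (fun _ => p2) (fun _ => p3) (fun t => t));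
    auto using continuous_const, continuous_id.
Qed.

Lemma Xreal1_lower : c = half_sum p0 p1 p2 p3 -> Xr p1 - Xr p0 = - mu * lower_period p0 p1 p2 p3.
Proof.
  intros Ec. destruct (arc_ends p0 p1) as (E1 & E2). assert (Hpi := half_PI_pos).
  assert (M : Xr (arc p0 p1 (PI / 2)) - Xr (arc p0 p1 (- (PI / 2))) =
    RInt (fun th => - mu * lower_integrand p0 p1 p2 p3 th) (- (PI / 2)) (PI / 2)); cycle 1.
  { rewrite E1, E2 in M. rewrite M.
    exact (RInt_scal (V := R_CompleteNormedModule) _ _ _ (- mu) (ex_RInt_lower_integrand p0 p1 p2 p3 H01 H12 H23)). }
  apply (Xreal_RInt Ci Ci_neq0 ps Hps mu c (arc p0 p1) (fun th => (p1 - p0) / 2 * cos th)); [lra| | |].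
  - intros th Hth. destruct (arc_open p0 p1 th H01 Hth) as (B & S). set (y := arc p0 p1 th) in *.
    assert (Hc := cos_open_pos th Hth).
    split; [apply arc_derive|]. split; [apply not_in_ps; lra|].
    assert (S0 := sqrt_diff_pos p0 y ltac:(lra)). assert (S1 := sqrt_diff_pos y p1 ltac:(lra)).
    assert (S2 := sqrt_diff_pos y p2 ltac:(lra)). assert (S3 := sqrt_diff_pos y p3 ltac:(lra)).
    rewrite (Re_fU_real _ _ _ _ _ (sqrt (y - p0) * sqrt (p1 - y) * (sqrt (p2 - y) * sqrt (p3 - y)))).
    + rewrite S. unfold lower_integrand. fold y. rewrite sqrt_mult by lra. rewrite Ec.
      field. lra.
    + apply Rgt_not_eq. repeat apply Rmult_lt_0_compat; assumption.
    + split_roots y. rewrite !RtoC_mult. assert (E := Ci_sqr). rewrite RtoC_m1 in E. ring [E].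
  - intros th. apply (continuous_arc (T := R_UniformSpace) (fun _ => p0) (fun _ => p1) (fun t => t));
      auto using continuous_const, continuous_id.
  - intros th. apply (continuous_Rmult (fun _ => - mu)); [apply continuous_const|].
    apply (continuous_lower_integrand (T := R_UniformSpace) (fun _ => p0) (fun _ => p1) (fun _ => p2) (fun _ => p3) (fun t => t));
    auto using continuous_const, continuous_id.
Qed.
End FirstForm.

(** * Boundary values of the second form *)

Section SecondFormConst.
Context (p0 p1 p2 p3 mu c : R) (H0 : p0 < -1) (H1 : 1 < p1) (H12 : p1 < p2) (H23 : p2 < p3).
Notation ps := (-1 :: 1 :: p0 :: p1 :: p2 :: p3 :: nil).
Context (Hps : NoDup ps).
Notation Xr := (Xreal (RtoC 1) ps mu c).

Lemma not_in_ps6 x : x <> -1 -> x <> 1 -> x <> p0 -> x <> p1 -> x <> p2 -> x <> p3 -> ~ In x ps.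
Proof. simpl. intuition. Qed.

Lemma Xreal2_low x : p0 <= x <= -1 -> Xr x = Xr p0.
Proof.
  intros H. apply (Xreal_const _ C1_neq_0 ps Hps); [lra|]. intros y Hy.
  split; [apply not_in_ps6; lra|].
  assert (S0 := sqrt_diff_pos p0 y ltac:(lra)). assert (S1 := sqrt_diff_pos y p1 ltac:(lra)).
  assert (S2 := sqrt_diff_pos y p2 ltac:(lra)). assert (S3 := sqrt_diff_pos y p3 ltac:(lra)).
  assert (S4 := sqrt_diff_pos y (-1) ltac:(lra)). assert (S5 := sqrt_diff_pos y 1 ltac:(lra)).
  apply (Re_fU_imag _ _ _ _ _ (sqrt (-1 - y) * sqrt (1 - y) * sqrt (y - p0) * sqrt (p1 - y) * sqrt (p2 - y) * sqrt (p3 - y))).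
  - apply Rgt_not_eq. repeat apply Rmult_lt_0_compat; assumption.
  - split_roots y. rewrite !RtoC_mult. assert (E := Ci_sqr). rewrite RtoC_m1 in E. ring [E].
Qed.

Lemma Xreal2_mid x : 1 <= x <= p1 -> Xr x = Xr p1.
Proof.
  intros H. symmetry. apply (Xreal_const _ C1_neq_0 ps Hps); [lra|]. intros y Hy.
  split; [apply not_in_ps6; lra|].
  assert (S0 := sqrt_diff_pos p0 y ltac:(lra)). assert (S1 := sqrt_diff_pos y p1 ltac:(lra)).
  assert (S2 := sqrt_diff_pos y p2 ltac:(lra)). assert (S3 := sqrt_diff_pos y p3 ltac:(lra)).
  assert (S4 := sqrt_diff_pos (-1) y ltac:(lra)). assert (S5 := sqrt_diff_pos 1 y ltac:(lra)).
  apply (Re_fU_imag _ _ _ _ _ (- (sqrt (y - -1) * sqrt (y - 1) * sqrt (y - p0) * sqrt (p1 - y) * sqrt (p2 - y) * sqrt (p3 - y)))).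
  - apply Rlt_not_eq, Ropp_lt_gt_0_contravar. repeat apply Rmult_lt_0_compat; assumption.
  - split_roots y. rewrite RtoC_opp, !RtoC_mult. assert (E := Ci_sqr). rewrite RtoC_m1 in E. ring [E].
Qed.

Lemma Xreal2_high x : p2 <= x <= p3 -> Xr x = Xr p2.
Proof.
  intros H. apply (Xreal_const _ C1_neq_0 ps Hps); [lra|]. intros y Hy.
  split; [apply not_in_ps6; lra|].
  assert (S0 := sqrt_diff_pos p0 y ltac:(lra)). assert (S1 := sqrt_diff_pos p1 y ltac:(lra)).
  assert (S2 := sqrt_diff_pos p2 y ltac:(lra)). assert (S3 := sqrt_diff_pos y p3 ltac:(lra)).
  assert (S4 := sqrt_diff_pos (-1) y ltac:(lra)). assert (S5 := sqrt_diff_pos 1 y ltac:(lra)).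
  apply (Re_fU_imag _ _ _ _ _ (sqrt (y - -1) * sqrt (y - 1) * sqrt (y - p0) * sqrt (y - p1) * sqrt (y - p2) * sqrt (p3 - y))).
  - apply Rgt_not_eq. repeat apply Rmult_lt_0_compat; assumption.
  - split_roots y. rewrite !RtoC_mult. assert (E := Ci_sqr). rewrite RtoC_m1 in E. ring [E].
Qed.
End SecondFormConst.

Section SecondFormPeriod.
Context (m h n mu c : R) (Hh : 0 < h) (Hn : h < n) (Hm : n < m).
Let k0 := sinh m * cosh h - cosh n * sinh h.
Context (Hc : k0 * c = cosh n * sinh m - sinh h * cosh h).
Notation ps := (-1 :: 1 :: - cosh (m - h) :: cosh (n - h) :: cosh (n + h) :: cosh (m + h) :: nil).
Context (Hps : NoDup ps).
Notation Xr := (Xreal (RtoC 1) ps mu c).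

Lemma k0_pos : 0 < k0.
Proof.
  assert (E := sinh_sub m h). assert (P : 0 < sinh (m - h)) by (apply sinh_pos; lra).
  assert (L : cosh n < cosh m) by (apply cosh_lt; lra). assert (Ph := sinh_pos h Hh).
  unfold k0. nra.
Qed.

Lemma num_den_identity x :
  num_v m h n x * sinh ((h + x) / 2) - den_v m h n x * sinh ((h - x) / 2) = k0 * (cosh (n + x) - c).
Proof.
  rewrite Rmult_minus_distr_l, Hc. unfold num_v, den_v, k0.
  assert (E1 : 2 * (sinh (n + (h + x) / 2) * sinh ((h + x) / 2)) = cosh (n + x + h) - cosh n).
  { replace (n + x + h) with ((n + (h + x) / 2) + (h + x) / 2) by field.
    replace (cosh n) with (cosh ((n + (h + x) / 2) - (h + x) / 2)) by (f_equal; ring).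
    rewrite (cosh_add (n + (h + x) / 2)), (cosh_sub (n + (h + x) / 2)). ring. }
  assert (E2 : 2 * (sinh (n - (h - x) / 2) * sinh ((h - x) / 2)) = cosh n - cosh (n + x - h)).
  { replace (n + x - h) with ((n - (h - x) / 2) - (h - x) / 2) by field.
    replace (cosh n) with (cosh ((n - (h - x) / 2) + (h - x) / 2)) by (f_equal; ring).
    rewrite (cosh_add (n - (h - x) / 2)), (cosh_sub (n - (h - x) / 2)). ring. }
  apply Rmult_eq_reg_l with 2; [|lra].
  transitivity ((sinh m - sinh (n + x - h)) * (2 * (sinh (n + (h + x) / 2) * sinh ((h + x) / 2)))
    - (sinh m + sinh (n + x + h)) * (2 * (sinh (n - (h - x) / 2) * sinh ((h - x) / 2)))); [ring|].
  rewrite E1, E2. set (y := n + x).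
  rewrite (sinh_sub y h), (sinh_add y h), (cosh_sub y h), (cosh_add y h).
  assert (F := cosh_sqr y).
  set (S := sinh y) in *. set (C := cosh y) in *.
  transitivity (2 * (sinh m * C * cosh h - cosh n * (C * sinh h)) - 2 * (sinh m * cosh n)
    + 2 * (C * C - S * S) * (sinh h * cosh h)); [ring|].
  rewrite F. ring.
Qed.

Lemma product_identity x :
  (cosh (n + x) + cosh (m - h)) * (cosh (m + h) - cosh (n + x)) *
    ((cosh (n + x) - cosh (n - h)) * (cosh (n + h) - cosh (n + x))) =
  num_v m h n x * den_v m h n x * (4 * (sinh ((h + x) / 2) * sinh ((h - x) / 2))).
Proof.
  assert (E1 : cosh (n + x) - cosh (n - h) = 2 * (sinh (n - (h - x) / 2) * sinh ((h + x) / 2))).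
  { replace (n + x) with ((n - (h - x) / 2) + (h + x) / 2) by field.
    replace (cosh (n - h)) with (cosh ((n - (h - x) / 2) - (h + x) / 2)) by (f_equal; field).
    rewrite (cosh_add (n - (h - x) / 2)), (cosh_sub (n - (h - x) / 2)). ring. }
  assert (E2 : cosh (n + h) - cosh (n + x) = 2 * (sinh (n + (h + x) / 2) * sinh ((h - x) / 2))).
  { replace (n + h) with ((n + (h + x) / 2) + (h - x) / 2) by field.
    replace (cosh (n + x)) with (cosh ((n + (h + x) / 2) - (h - x) / 2)) by (f_equal; field).
    rewrite (cosh_add (n + (h + x) / 2)), (cosh_sub (n + (h + x) / 2)). ring. }
  assert (E3 : (cosh (n + x) + cosh (m - h)) * (cosh (m + h) - cosh (n + x)) =
     (sinh m - sinh (n + x - h)) * (sinh m + sinh (n + x + h))).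
  { set (y := n + x).
    rewrite (cosh_sub m h), (cosh_add m h), (sinh_sub y h), (sinh_add y h).
    assert (F1 := cosh_sqr m). assert (F2 := cosh_sqr y). assert (F3 := cosh_sqr h).
    ring [F1 F2 F3]. }
  rewrite E1, E2, E3. unfold num_v, den_v. ring.
Qed.

(** This is what the substitution [xi] is made for: from sinh(x / 2) = sinh(h / 2) sin th, the
    product vanishing at both ends becomes a perfect square, removing the endpoint singularities. *)
Lemma half_product th : sinh ((h + xi h th) / 2) * sinh ((h - xi h th) / 2) =
  sinh (h / 2) * cos th * (sinh (h / 2) * cos th).
Proof.
  set (x := xi h th).
  assert (Ex : sinh (x / 2) = sinh (h / 2) * sin th).
  { unfold x, xi. replace (2 * arcsinh (sinh (h / 2) * sin th) / 2) with (arcsinh (sinh (h / 2) * sin th)) by field.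
    apply sinh_arcsinh. }
  replace ((h + x) / 2) with (h / 2 + x / 2) by field. replace ((h - x) / 2) with (h / 2 - x / 2) by field.
  rewrite sinh_add, sinh_sub.
  assert (F1 := cosh_sqr (h / 2)). assert (F2 := cosh_sqr (x / 2)).
  transitivity (sinh (h / 2) * sinh (h / 2) * (cosh (x / 2) * cosh (x / 2))
    - cosh (h / 2) * cosh (h / 2) * (sinh (x / 2) * sinh (x / 2))); [ring|].
  rewrite F1, F2, Ex. assert (E := sin2_cos2 th). unfold Rsqr in E.
  assert (E' : cos th * cos th = 1 - sin th * sin th) by lra. ring [E'].
Qed.

Lemma xi_derive th : is_derive (xi h) th (2 * (sinh (h / 2) * cos th) / cosh (xi h th / 2)).
Proof.
  assert (D1 : is_derive (fun t => sinh (h / 2) * sin t) th (sinh (h / 2) * cos th)).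
  { auto_derive; [exact I|ring]. }
  assert (D2 := proj2 (is_derive_Reals arcsinh (sinh (h / 2) * sin th) _) (derivable_pt_lim_arcsinh _)).
  assert (D3 := is_derive_comp (V := R_NormedModule) arcsinh (fun t => sinh (h / 2) * sin t) th _ _ D2 D1).
  assert (D4 := is_derive_scal _ th 2 _ D3).
  refine (is_derive_eq _ _ _ _ D4 _).
  assert (E : cosh (xi h th / 2) = sqrt ((sinh (h / 2) * sin th) ^ 2 + 1)).
  { unfold xi. replace (2 * arcsinh (sinh (h / 2) * sin th) / 2) with (arcsinh (sinh (h / 2) * sin th)) by field.
    set (v := arcsinh (sinh (h / 2) * sin th)).
    rewrite <- (sqrt_square (cosh v)) by (generalize (cosh_ge_1 v); lra).
    rewrite cosh_sqr. unfold v. rewrite sinh_arcsinh. f_equal. ring. }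
  rewrite E. unfold scal; simpl; unfold mult; simpl. unfold Rdiv. ring.
Qed.

Lemma xi_ends : xi h (- (PI / 2)) = - h /\ xi h (PI / 2) = h.
Proof.
  unfold xi. rewrite sin_neg, sin_PI2. split.
  - replace (sinh (h / 2) * - (1)) with (sinh (- (h / 2))) by (rewrite sinh_opp; ring).
    rewrite arcsinh_sinh. field.
  - rewrite Rmult_1_r, arcsinh_sinh. field.
Qed.

Lemma xi_open th : - (PI / 2) < th < PI / 2 -> - h < xi h th < h.
Proof.
  intros Hth. assert (B := xi_bounds h th Hh). assert (P := half_product th).
  assert (0 < sinh (h / 2) * cos th).
  { apply Rmult_lt_0_compat; [apply sinh_pos; lra|now apply cos_open_pos]. }
  assert (P' : 0 < sinh ((h + xi h th) / 2) * sinh ((h - xi h th) / 2)) by (rewrite P; now apply Rmult_lt_0_compat).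
  split.
  - destruct (proj1 B) as [|E]; [assumption|]. rewrite <- E in P'.
    replace ((h + - h) / 2) with 0 in P' by field. rewrite sinh_0 in P'. lra.
  - destruct (proj2 B) as [|E]; [assumption|]. rewrite E in P'.
    replace ((h - h) / 2) with 0 in P' by field. rewrite sinh_0 in P'. lra.
Qed.

(** For u = cosh (n + x) the factor sinh(n + x) of du is sqrt (u^2 - 1) and cancels the same factor
    of Y6; the two algebraic identities then leave [jJ]. The constant k0 is positive, so J = 0 is
    the equality of the two boundary values. *)
Lemma Xreal2_period : k0 * (Xr (cosh (n + h)) - Xr (cosh (n - h))) = - mu * J m h n.
Proof.
  assert (K := k0_pos). assert (Hpi := half_PI_pos).
  destruct xi_ends as (E1 & E2).
  assert (M : Xr (cosh (n + xi h (PI / 2))) - Xr (cosh (n + xi h (- (PI / 2)))) =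
     RInt (fun th => - mu / k0 * jJ m h n th) (- (PI / 2)) (PI / 2)).
  { apply (Xreal_RInt _ C1_neq_0 ps Hps mu c (fun th => cosh (n + xi h th))
      (fun th => sinh (n + xi h th) * (2 * (sinh (h / 2) * cos th) / cosh (xi h th / 2)))); [lra| | |].
    - intros th Hth. assert (B := xi_open th Hth). assert (D := xi_derive th).
      assert (PS : 0 < sinh (h / 2) * cos th).
      { apply Rmult_lt_0_compat; [apply sinh_pos; lra|now apply cos_open_pos]. }
      assert (HP := half_product th). assert (I1 := product_identity (xi h th)).
      assert (I2 := num_den_identity (xi h th)). rewrite HP in I1.
      assert (PN := num_v_pos m h n Hh Hn Hm (xi h th) ltac:(lra)).
      assert (PD := den_v_pos m h n Hh Hn Hm (xi h th) ltac:(lra)).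
      assert (Hc2 := cosh_ge_1 (xi h th / 2)).
      set (x := xi h th) in *. set (sc := sinh (h / 2) * cos th) in *.
      assert (Py : 0 < sinh (n + x)) by (apply sinh_pos; lra).
      assert (Fy := cosh_sqr (n + x)).
      assert (O1 : cosh (n - h) < cosh (n + x)) by (apply cosh_lt; lra).
      assert (O2 : cosh (n + x) < cosh (n + h)) by (apply cosh_lt; lra).
      assert (O3 : cosh (n + h) < cosh (m + h)) by (apply cosh_lt; lra).
      assert (O4 := cosh_ge_1 (n - h)). assert (O5 := cosh_ge_1 (m - h)).
      split; [|split].
      + assert (D1 : is_derive (fun t => n + xi h t) th (2 * sc / cosh (x / 2))).
        { refine (is_derive_eq _ _ _ _ (is_derive_plus (V := R_NormedModule) _ _ th _ _
            (is_derive_const (V := R_NormedModule) n th) D) _). unfold plus, zero; simpl. ring. }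
        assert (D2 := proj2 (is_derive_Reals cosh (n + x) _) (derivable_pt_lim_cosh _)).
        refine (is_derive_eq _ _ _ _ (is_derive_comp (V := R_NormedModule) cosh (fun t => n + xi h t) th _ _ D2 D1) _).
        unfold scal; simpl; unfold mult; simpl. ring.
      + apply not_in_ps6; lra.
      + assert (S0 := sqrt_diff_pos (- cosh (m - h)) (cosh (n + x)) ltac:(lra)).
        assert (S1 := sqrt_diff_pos _ _ O1). assert (S2 := sqrt_diff_pos _ _ O2).
        assert (S3 := sqrt_diff_pos (cosh (n + x)) (cosh (m + h)) ltac:(lra)).
        assert (S4 := sqrt_diff_pos (-1) (cosh (n + x)) ltac:(lra)).
        assert (S5 := sqrt_diff_pos 1 (cosh (n + x)) ltac:(lra)).
        set (u := cosh (n + x)) in *.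
        assert (W1 : sqrt (u - -1) * sqrt (u - 1) = sinh (n + x)).
        { rewrite <- sqrt_mult by lra. rewrite <- (sqrt_square (sinh (n + x))) by lra. f_equal. lra. }
        assert (W2 : sqrt (u - - cosh (m - h)) * sqrt (u - cosh (n - h)) * (sqrt (cosh (n + h) - u) * sqrt (cosh (m + h) - u))
          = sqrt (num_v m h n x) * sqrt (den_v m h n x) * (2 * sc)).
        { assert (Q1 := Rmult_lt_0_compat _ _ PN PD).
          assert (Q2 : 0 <= (u - - cosh (m - h)) * (u - cosh (n - h))) by (apply Rmult_le_pos; lra).
          assert (Q3 : 0 <= 2 * sc * (2 * sc)) by (apply Rmult_le_pos; lra).
          rewrite <- (sqrt_square (2 * sc)) by lra.
          rewrite <- (sqrt_mult (num_v m h n x)), <- (sqrt_mult (num_v m h n x * _)) by lra.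
          rewrite <- (sqrt_mult (u - _)), <- (sqrt_mult (cosh (n + h) - u)), <- sqrt_mult
            by (first [lra | apply Rmult_le_pos; lra]).
          f_equal.
          transitivity ((u + cosh (m - h)) * (cosh (m + h) - u) * ((u - cosh (n - h)) * (cosh (n + h) - u))); [ring|].
          rewrite I1. ring. }
        assert (EN := sqrt_sqrt _ (Rlt_le _ _ PN)). assert (ED := sqrt_sqrt _ (Rlt_le _ _ PD)).
        apply sqrt_lt_R0 in PN, PD.
        rewrite (Re_fU_real _ _ _ _ _ (- ((sqrt (u - -1) * sqrt (u - 1)) *
          (sqrt (u - - cosh (m - h)) * sqrt (u - cosh (n - h)) * (sqrt (cosh (n + h) - u) * sqrt (cosh (m + h) - u)))))).
        * rewrite W1, W2. unfold jJ. fold x.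
          rewrite <- EN, <- ED in I2.
          set (N := sqrt (num_v m h n x)) in *. set (D' := sqrt (den_v m h n x)) in *.
          assert (Eu : u - c = (N * N * sinh ((h + x) / 2) - D' * D' * sinh ((h - x) / 2)) / k0).
          { rewrite I2. field. lra. }
          rewrite Eu. field. repeat split; lra.
        * apply Rlt_not_eq, Ropp_lt_gt_0_contravar. rewrite W1, W2.
          apply Rmult_lt_0_compat; [exact Py|]. apply Rmult_lt_0_compat; [now apply Rmult_lt_0_compat|lra].
        * split_roots u. rewrite RtoC_opp, !RtoC_mult. assert (E := Ci_sqr). rewrite RtoC_m1 in E. ring [E].
    - intros th. assert (Cx := continuous_xi (T := R_UniformSpace) (fun _ => h) (fun s => s) th
        (continuous_const h th) (continuous_id th)). cts.
    - intros th. apply (continuous_Rmult (fun _ => - mu / k0)); [apply continuous_const|].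
      now apply jJ_continuous_th. }
  rewrite E1, E2 in M.
  rewrite (RInt_scal (V := R_CompleteNormedModule) _ _ _ (- mu / k0) (ex_RInt_jJ m h n Hh Hn Hm)
    : RInt (fun th => - mu / k0 * jJ m h n th) _ _ = - mu / k0 * J m h n) in M.
  replace (n + - h) with (n - h) in M by ring. rewrite M. field. lra.
Qed.
End SecondFormPeriod.

(** * The zero of [J] as a function of [h] *)

Lemma IVT_decreasing_zero (f : R -> R) x y : x < y -> (forall t, x <= t <= y -> continuous f t) ->
  0 < f x -> f y < 0 -> exists z, x <= z <= y /\ f z = 0.
Proof.
  intros Hxy Cf Hx Hy.
  destruct (IVT_interv (fun t => - f t) x y) as (z & Hz & E); [|assumption|lra|lra|].
  - intros t Ht. apply continuity_pt_filterlim. apply (continuous_Ropp f). now apply Cf.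
  - exists z. split; [exact Hz|lra].
Qed.

Section FixedTheta.
Context (Th : R) (HTh : 2 < Th < 3).

(* Chosen so that [cosh (mm h) = Th * cosh h]. *)
Definition mm (h : R) : R := arcsinh (sqrt (Th * cosh h * (Th * cosh h) - 1)).

Lemma Th_cosh h : 2 < Th * cosh h.
Proof. assert (H := cosh_ge_1 h). nra. Qed.

Lemma sinh_mm h : sinh (mm h) = sqrt (Th * cosh h * (Th * cosh h) - 1).
Proof. apply sinh_arcsinh. Qed.

Lemma sinh_mm_sqr h : sinh (mm h) * sinh (mm h) = Th * cosh h * (Th * cosh h) - 1.
Proof. rewrite sinh_mm. apply sqrt_sqrt. assert (H := Th_cosh h). nra. Qed.

Lemma sinh_mm_pos h : 0 < sinh (mm h).
Proof. rewrite sinh_mm. apply sqrt_lt_R0. assert (H := Th_cosh h). nra. Qed.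

Lemma cosh_mm h : cosh (mm h) = Th * cosh h.
Proof.
  assert (E := cosh_sqr (mm h)). rewrite sinh_mm_sqr in E.
  assert (H1 := cosh_ge_1 (mm h)). assert (H2 := Th_cosh h). nra.
Qed.

Lemma mm_gt h : 0 < h -> h < mm h.
Proof.
  intros Hh. apply cosh_lt_inv.
  - left. apply sinh_lt_inv. rewrite sinh_0. apply sinh_mm_pos.
  - rewrite cosh_mm. assert (H := cosh_ge_1 h). nra.
Qed.

(** Since sinh (mm h) >= Th sinh h, the addition formula gives at most Th (cosh^2 h - sinh^2 h).
    Thus the lowest branch value stays bounded as h grows. *)
Lemma cosh_mm_sub h : 0 < h -> cosh (mm h - h) <= Th.
Proof.
  intros Hh. rewrite cosh_sub, cosh_mm.
  assert (Hs := sinh_pos h Hh). assert (Hc := cosh_ge_1 h). assert (E := cosh_sqr h).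
  assert (K : Th * sinh h <= sinh (mm h)).
  { assert (S := sinh_mm_sqr h). assert (P := sinh_mm_pos h).
    apply Rsqr_incr_0_var; [|lra]. unfold Rsqr. rewrite S. nra. }
  nra.
Qed.

Lemma mm_continuous h : continuous mm h.
Proof. unfold mm. assert (C := continuous_id (U := R_UniformSpace) h). cts. Qed.

Lemma J_zero_exists h : 0 < h -> exists n, (h < n < mm h) /\ J (mm h) h n = 0.
Proof.
  intros Hh. assert (Hm := mm_gt h Hh).
  destruct (J_pos_near_h _ _ Hh Hm) as (n1 & H1 & K1).
  destruct (J_neg_near_m _ _ Hh Hm) as (n2 & H2 & K2).
  assert (L : n1 < n2).
  { destruct (Rlt_le_dec n1 n2) as [|L]; [assumption|].
    assert (A := K1 n1 ltac:(lra) ltac:(lra)). assert (B := K2 n1 ltac:(lra) ltac:(lra)). lra. }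
  destruct (IVT_decreasing_zero (J (mm h) h) n1 n2 L) as (z & Hz & E).
  - intros t Ht. apply (J_continuous (fun _ => mm h) (fun _ => h) (fun s => s)).
    apply locally_R. exists (Rmin (t - h) (mm h - t)). split; [apply Rmin_pos; lra|].
    intros s Hs. assert (A := Rlt_le_trans _ _ _ Hs (Rmin_l _ _)).
    assert (B := Rlt_le_trans _ _ _ Hs (Rmin_r _ _)). apply Rabs_def2 in A, B.
    repeat split; try apply continuous_const; try apply continuous_id; lra.
  - apply K1; lra.
  - apply K2; lra.
  - exists z. split; [lra|exact E].
Qed.

(* The zero of [J (mm h) h] in the interval (h, mm h) for [0 < h], junk for [h <= 0]. *)
Definition psi (h : R) : R :=
  epsilon (inhabits 0) (fun n => (h < n < mm h) /\ J (mm h) h n = 0).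

Lemma psi_spec h : 0 < h -> (h < psi h < mm h) /\ J (mm h) h (psi h) = 0.
Proof. intros Hh. unfold psi. apply epsilon_spec. now apply J_zero_exists. Qed.

Lemma psi_gt h n : 0 < h -> h < n -> n < mm h -> 0 < J (mm h) h n -> n < psi h.
Proof.
  intros Hh Hn Hm HJ. destruct (psi_spec h Hh) as (B & E).
  destruct (Rlt_le_dec n (psi h)) as [|[L|L]]; [assumption| |rewrite L in E; lra].
  assert (K := J_decreasing (mm h) h (psi h) n Hh ltac:(lra) L Hm). lra.
Qed.

Lemma psi_lt h n : 0 < h -> h < n -> n < mm h -> J (mm h) h n < 0 -> psi h < n.
Proof.
  intros Hh Hn Hm HJ. destruct (psi_spec h Hh) as (B & E).
  destruct (Rlt_le_dec (psi h) n) as [|[L|L]]; [assumption| |rewrite <- L in E; lra].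
  assert (K := J_decreasing (mm h) h n (psi h) Hh Hn L ltac:(lra)). lra.
Qed.

Lemma psi_ge h n : 0 < h -> h < n -> n < mm h -> 0 <= J (mm h) h n -> n <= psi h.
Proof.
  intros Hh Hn Hm HJ. destruct (Rle_lt_dec n (psi h)) as [|L]; [assumption|].
  destruct (psi_spec h Hh) as (B & E).
  assert (K := J_decreasing (mm h) h (psi h) n Hh ltac:(lra) L Hm). lra.
Qed.

Lemma psi_le h n : 0 < h -> h < n -> n < mm h -> J (mm h) h n <= 0 -> psi h <= n.
Proof.
  intros Hh Hn Hm HJ. destruct (Rle_lt_dec (psi h) n) as [|L]; [assumption|].
  destruct (psi_spec h Hh) as (B & E).
  assert (K := J_decreasing (mm h) h n (psi h) Hh Hn L ltac:(lra)). lra.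
Qed.

Lemma locally_admissible h n : 0 < h -> h < n -> n < mm h ->
  locally h (fun t => 0 < t /\ t < n /\ n < mm t).
Proof.
  intros Hh Hn Hm.
  apply filter_and; [exact (open_gt 0 h Hh)|]. apply filter_and; [exact (open_lt n h Hn)|].
  exact (mm_continuous h (fun y : R => n < y) (open_gt n (mm h) Hm)).
Qed.

Lemma J_mm_continuous h n : 0 < h -> h < n -> n < mm h -> continuous (fun t => J (mm t) t n) h.
Proof.
  intros Hh Hn Hm. apply (J_continuous mm (fun s => s) (fun _ => n)).
  generalize (locally_admissible h n Hh Hn Hm). apply filter_imp. intros t (T1 & T2 & T3).
  repeat split; try apply continuous_const; try apply continuous_id; try apply mm_continuous; assumption.
Qed.

(** J is strictly positive at psi h - d and strictly negative at psi h + d. Both signs persist for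
    parameters t near h, and monotonicity in n traps psi t between the two points. *)
Lemma psi_continuous h : 0 < h -> continuous psi h.
Proof.
  intros Hh. destruct (psi_spec h Hh) as ((B1 & B2) & E).
  apply (ccont_real_lim (T := R_UniformSpace)). intros eps He.
  set (d := Rmin (eps / 2) (Rmin ((psi h - h) / 2) ((mm h - psi h) / 2))).
  assert (D1 : d <= eps / 2) by apply Rmin_l.
  assert (D2 : d <= (psi h - h) / 2) by (eapply Rle_trans; [apply Rmin_r|apply Rmin_l]).
  assert (D3 : d <= (mm h - psi h) / 2) by (eapply Rle_trans; [apply Rmin_r|apply Rmin_r]).
  assert (D0 : 0 < d) by (repeat apply Rmin_pos; lra).
  assert (K1 : 0 < J (mm h) h (psi h - d)).
  { rewrite <- E. apply J_decreasing; lra. }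
  assert (K2 : J (mm h) h (psi h + d) < 0).
  { rewrite <- E. apply J_decreasing; lra. }
  assert (L1 := locally_admissible h (psi h - d) Hh ltac:(lra) ltac:(lra)).
  assert (L2 := locally_admissible h (psi h + d) Hh ltac:(lra) ltac:(lra)).
  assert (L3 := J_mm_continuous h (psi h - d) Hh ltac:(lra) ltac:(lra) (fun y : R => 0 < y) (open_gt 0 _ K1)).
  assert (L4 := J_mm_continuous h (psi h + d) Hh ltac:(lra) ltac:(lra) (fun y : R => y < 0) (open_lt 0 _ K2)).
  unfold filtermap in L3, L4.
  generalize (filter_and _ _ (filter_and _ _ L1 L2) (filter_and _ _ L3 L4)). apply filter_imp. intros t (((T0 & T1 & T2) & (_ & T3 & T4)) & T5 & T6).
  assert (G := psi_gt t (psi h - d) T0 T1 T2 T5). assert (G' := psi_lt t (psi h + d) T0 T3 T4 T6).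
  apply Rabs_def1; lra.
Qed.

Definition q0 (h : R) : R := - cosh (mm h - h).
Definition q1 (h : R) : R := cosh (psi h - h).
Definition q2 (h : R) : R := cosh (psi h + h).
Definition q3 (h : R) : R := cosh (mm h + h).
Definition upP (h : R) : R := upper_period (q0 h) (q1 h) (q2 h) (q3 h).
Definition loP (h : R) : R := lower_period (q0 h) (q1 h) (q2 h) (q3 h).

Lemma q_order h : 0 < h -> q0 h < q1 h < q2 h /\ q2 h < q3 h.
Proof.
  intros Hh. destruct (psi_spec h Hh) as (B & _). unfold q0, q1, q2, q3.
  assert (H0 := cosh_ge_1 (mm h - h)). assert (H1 := cosh_ge_1 (psi h - h)).
  repeat split; [lra|apply cosh_lt; lra|apply cosh_lt; lra].
Qed.

Lemma periods_continuous h : 0 < h -> continuous upP h /\ continuous loP h.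
Proof.
  intros Hh. apply (continuous_periods q0 q1 q2 q3).
  generalize (open_gt 0 h Hh). apply filter_imp. intros t Ht.
  destruct (q_order t Ht) as (O1 & O2).
  assert (Cm := mm_continuous t). assert (Cp := psi_continuous t Ht).
  assert (Ci := continuous_id (U := R_UniformSpace) t).
  split; [exact O1|]. split; [exact O2|].
  unfold q0, q1, q2, q3. repeat split; cts.
Qed.

Lemma q2_lt_half_sum h : 0 < h ->
  half_sum (q0 h) (q1 h) (q2 h) (q3 h) - q2 h = sinh h * (sinh (mm h) - sinh (psi h)).
Proof.
  intros Hh. unfold half_sum, q0, q1, q2, q3. rewrite !cosh_sub, !cosh_add. field.
Qed.

Lemma half_sum_q h :
  half_sum (q0 h) (q1 h) (q2 h) (q3 h) - (q2 h + q3 h) / 2 = - (cosh (mm h - h) - cosh (psi h - h)) / 2.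
Proof. unfold half_sum, q0, q1, q2, q3. field. Qed.

Lemma q2_le_half_sum h : 0 < h -> q2 h <= half_sum (q0 h) (q1 h) (q2 h) (q3 h).
Proof.
  intros Hh. assert (E := q2_lt_half_sum h Hh). destruct (psi_spec h Hh) as (B & _).
  assert (0 < sinh h) by now apply sinh_pos.
  assert (sinh (psi h) < sinh (mm h)) by (apply sinh_lt; lra).
  assert (0 < sinh h * (sinh (mm h) - sinh (psi h))) by (apply Rmult_lt_0_compat; lra). lra.
Qed.

Lemma q2_sub_q1 h : q2 h - q1 h = 2 * sinh (psi h) * sinh h.
Proof. unfold q1, q2. rewrite cosh_sub, cosh_add. ring. Qed.

Lemma q3_sub_q0 h : q3 h - q0 h = 2 * Th * (cosh h * cosh h).
Proof. unfold q0, q3. rewrite cosh_sub, cosh_add, cosh_mm. ring. Qed.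

Lemma loP_pos h : 0 < h -> 0 < loP h.
Proof.
  intros Hh. destruct (q_order h Hh) as (O1 & O2).
  refine (Rlt_le_trans _ _ _ _ (lower_period_ge _ _ _ _ (proj1 O1) (proj2 O1) O2 (q2_le_half_sum h Hh))).
  apply Rmult_lt_0_compat; [apply PI_RGT_0|]. apply sqrt_lt_R0, Rdiv_lt_0_compat; lra.
Qed.

(** For sinh h = k + 2 the upper period is at least - PI / (2 (k + 2)^2): the centre c is within 1
    of the midpoint while the weight at q2 decays like 1 / sinh^2 h. The lower period stays above PI
    / 3, since (q2 - q1) / (q3 - q1) >= 1/9. *)
Lemma periods_large h k : 1 <= k -> sinh h = k + 2 -> 0 < h -> 0 < k * upP h + loP h.
Proof.
  intros Hk Es Hh. destruct (q_order h Hh) as (O1 & O2). destruct (psi_spec h Hh) as (B & _).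
  assert (C2 := q2_le_half_sum h Hh). assert (HS := half_sum_q h).
  assert (M := cosh_mm_sub h Hh). assert (N1 := cosh_ge_1 (psi h - h)).
  assert (S : sinh h < sinh (psi h)) by (apply sinh_lt; lra).
  assert (Ec := cosh_sqr h).
  assert (MN : cosh (psi h - h) < cosh (mm h - h)) by (apply cosh_lt; lra).
  assert (U := upper_period_ge _ _ _ _ (proj1 O1) (proj2 O1) O2 ltac:(lra)). cbv beta in U.
  fold (upP h) in U.
  assert (L := lower_period_ge _ _ _ _ (proj1 O1) (proj2 O1) O2 C2). fold (loP h) in L.
  assert (Hpi := PI_RGT_0).
  assert (E21 := q2_sub_q1 h). assert (E30 := q3_sub_q0 h).
  assert (D21 : 2 * (k + 2) * (k + 2) <= q2 h - q1 h) by nra.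
  assert (G : / sqrt ((q2 h - q0 h) * (q2 h - q1 h)) <= / (2 * (k + 2) * (k + 2))).
  { apply Rinv_le_contravar; [nra|].
    rewrite <- (sqrt_square (2 * (k + 2) * (k + 2))) by nra. apply sqrt_le_1_alt.
    apply Rmult_le_compat; nra. }
  assert (U' : - (PI / (2 * (k + 2) * (k + 2))) <= upP h).
  { eapply Rle_trans; [|exact U].
    replace (- (PI / (2 * (k + 2) * (k + 2)))) with (PI * (-1 * / (2 * (k + 2) * (k + 2)))) by (field; lra).
    apply Rmult_le_compat_l; [lra|].
    assert (G0 : 0 < / sqrt ((q2 h - q0 h) * (q2 h - q1 h))).
    { apply Rinv_0_lt_compat, sqrt_lt_R0, Rmult_lt_0_compat; lra. }
    (* By [half_sum_q] this is half the difference of two cosh that lie between 1 and Th, and Th <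
       3. *)
    assert (Hx : -1 <= half_sum (q0 h) (q1 h) (q2 h) (q3 h) - (q2 h + q3 h) / 2 <= 0) by lra.
    set (x := half_sum (q0 h) (q1 h) (q2 h) (q3 h) - (q2 h + q3 h) / 2) in *.
    set (g := / sqrt ((q2 h - q0 h) * (q2 h - q1 h))) in *.
    set (w := / (2 * (k + 2) * (k + 2))) in *. clearbody x g w. nra. }
  assert (L' : PI / 3 <= loP h).
  { eapply Rle_trans; [|exact L]. unfold Rdiv at 1. apply Rmult_le_compat_l; [lra|].
    rewrite <- (sqrt_square (/ 3)) by lra. apply sqrt_le_1_alt.
    assert (D31 : q3 h - q1 h <= 6 * (cosh h * cosh h)).
    { assert (q0 h <= 0) by (unfold q0; lra). assert (q1 h >= 0) by (unfold q1; lra).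
      assert (0 < cosh h * cosh h) by nra. nra. }
    apply Rmult_le_reg_r with (q3 h - q1 h); [lra|].
    replace ((q2 h - q1 h) / (q3 h - q1 h) * (q3 h - q1 h)) with (q2 h - q1 h) by (field; lra).
    rewrite Es in Ec. nra. }
  assert (W : k * (PI / (2 * (k + 2) * (k + 2))) <= PI / 4).
  { replace (k * (PI / (2 * (k + 2) * (k + 2)))) with (PI * (k / (2 * (k + 2) * (k + 2)))) by (field; lra).
    unfold Rdiv at 2. apply Rmult_le_compat_l; [lra|].
    apply Rmult_le_reg_r with (2 * (k + 2) * (k + 2)); [nra|].
    replace (k / (2 * (k + 2) * (k + 2)) * (2 * (k + 2) * (k + 2))) with k by (field; lra). nra. }
  nra.
Qed.
End FixedTheta.

(** * Negativity of the upper period for a tiny h *)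

(** For small h the first term is of order h and the two products are of order sinh^2 n, so the
    balance that determines [psi] sits at n of order sqrt h. Values well below and well above it
    bracket [psi]. *)
Lemma num_sub_den m h n x :
  num_v m h n x - den_v m h n x =
  sinh m * (2 * cosh (n + x / 2) * sinh (h / 2))
  - sinh (n + x - h) * sinh (n + (h + x) / 2) - sinh (n + x + h) * sinh (n - (h - x) / 2).
Proof.
  unfold num_v, den_v.
  replace (2 * cosh (n + x / 2) * sinh (h / 2)) with (sinh (n + (h + x) / 2) - sinh (n - (h - x) / 2)).
  - ring.
  - replace (n + (h + x) / 2) with ((n + x / 2) + h / 2) by field.
    replace (n - (h - x) / 2) with ((n + x / 2) - h / 2) by field.
    rewrite (sinh_add (n + x / 2)), (sinh_sub (n + x / 2)). ring.
Qed.

Section SmallParameter.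
Context (Th : R) (HTh : 2 < Th < 3).
(** The positive part of the bound on the upper period is (c - q2) g(q2), where c - q2 is O(s) and
    g(q2) is O((s sinh psi)^(-1/2)). With sinh psi >= 10^-6 this s makes it less than 0.016, against
    a negative part of at least 1/16. *)
Let s : R := / 10000000000.
Context (h : R) (Es : sinh h = s).

Lemma h_small_pos : 0 < h.
Proof. apply sinh_lt_inv. rewrite sinh_0, Es. unfold s. lra. Qed.

Lemma cosh_h_small : cosh h <= 1.001.
Proof. assert (E := cosh_sqr h). rewrite Es in E. unfold s in E. assert (H := cosh_ge_1 h). nra. Qed.

Lemma sinh_2h_small : 0 < sinh (2 * h) <= 4 * s.
Proof.
  assert (H1 := cosh_h_small). assert (H2 := cosh_ge_1 h).
  replace (2 * h) with (h + h) by ring. rewrite sinh_add, Es. unfold s. lra.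
Qed.

Lemma cosh_2h_small : 1 <= cosh (2 * h) <= 1.01.
Proof.
  split; [apply cosh_ge_1|]. replace (2 * h) with (h + h) by ring. rewrite cosh_add, Es.
  assert (H1 := cosh_h_small). assert (H2 := cosh_ge_1 h). unfold s. nra.
Qed.

Lemma sinh_half_h : s / 4 <= sinh (h / 2) <= s.
Proof.
  assert (Hh := h_small_pos). assert (H1 := cosh_h_small).
  assert (E := sinh_add (h / 2) (h / 2)). replace (h / 2 + h / 2) with h in E by field. rewrite Es in E.
  assert (H2 : cosh (h / 2) <= cosh h) by (apply cosh_le; lra).
  assert (H3 := cosh_ge_1 (h / 2)). assert (H4 : 0 < sinh (h / 2)) by (apply sinh_pos; lra).
  unfold s in *. split; nra.
Qed.

Lemma sinh_mm_small : 1.5 < sinh (mm Th h) <= 3.01.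
Proof.
  assert (E := sinh_mm_sqr Th HTh h). assert (P := sinh_mm_pos Th HTh h).
  assert (H1 := cosh_h_small). assert (H2 := cosh_ge_1 h).
  assert (2 < Th * cosh h <= 3.004) by nra. split; nra.
Qed.

Lemma psi_lower : / 1000000 <= sinh (psi Th h).
Proof.
  assert (Hh := h_small_pos). assert (M := sinh_mm_small).
  (* Below sqrt s = 10^-5: the two products in [num_sub_den] add up to at most 1.8 * 10^-11, while
     the first term is at least 7.5 * 10^-11. *)
  set (n := arcsinh (/ 1000000)). assert (En : sinh n = / 1000000) by apply sinh_arcsinh.
  rewrite <- En. apply sinh_le.
  assert (Hn : 2 * h < n).
  { apply sinh_lt_inv. rewrite En. assert (K := sinh_2h_small). unfold s in K. lra. }
  assert (Hm : n < mm Th h) by (apply sinh_lt_inv; lra).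
  apply (psi_ge Th HTh); [exact Hh|lra|exact Hm|].
  apply J_nonneg; [exact Hh|lra|exact Hm|]. intros x Hx.
  assert (I := num_sub_den (mm Th h) h n x).
  assert (T : sinh (n + 2 * h) <= 3 / 1000000).
  { rewrite sinh_add, En. assert (K1 := sinh_2h_small). assert (K2 := cosh_2h_small).
    assert (Ec := cosh_sqr n). rewrite En in Ec. assert (Hc := cosh_ge_1 n).
    assert (cosh n <= 2) by nra. unfold s in K1. nra. }
  assert (B1 : sinh (n + x - h) <= sinh (n + 2 * h)) by (apply sinh_le; lra).
  assert (B2 : sinh (n + (h + x) / 2) <= sinh (n + 2 * h)) by (apply sinh_le; lra).
  assert (B3 : sinh (n + x + h) <= sinh (n + 2 * h)) by (apply sinh_le; lra).
  assert (B4 : sinh (n - (h - x) / 2) <= sinh (n + 2 * h)) by (apply sinh_le; lra).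
  assert (P1 : 0 <= sinh (n + x - h)) by (apply sinh_nonneg; lra).
  assert (P2 : 0 <= sinh (n + (h + x) / 2)) by (apply sinh_nonneg; lra).
  assert (P3 : 0 <= sinh (n + x + h)) by (apply sinh_nonneg; lra).
  assert (P4 : 0 <= sinh (n - (h - x) / 2)) by (apply sinh_nonneg; lra).
  assert (Q1 := Rmult_le_compat _ _ _ _ P1 P2 B1 B2).
  assert (Q2 := Rmult_le_compat _ _ _ _ P3 P4 B3 B4).
  assert (Q3 : sinh (n + 2 * h) * sinh (n + 2 * h) <= 3 / 1000000 * (3 / 1000000)).
  { apply Rmult_le_compat; try lra; apply sinh_nonneg; lra. }
  assert (F := sinh_half_h). assert (Hc := cosh_ge_1 (n + x / 2)).
  assert (F1 : 2 * sinh (h / 2) <= 2 * cosh (n + x / 2) * sinh (h / 2)).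
  { unfold s in F. nra. }
  assert (F2 : 1.5 * (s / 2) <= sinh (mm Th h) * (2 * cosh (n + x / 2) * sinh (h / 2))).
  { apply Rmult_le_compat; unfold s in *; lra. }
  unfold s in F2. lra.
Qed.

Lemma psi_upper : sinh (psi Th h) <= 1.
Proof.
  assert (Hh := h_small_pos). assert (M := sinh_mm_small).
  set (n := arcsinh 1). assert (En : sinh n = 1) by apply sinh_arcsinh.
  rewrite <- En. apply sinh_le.
  assert (Hn : 2 * h < n).
  { apply sinh_lt_inv. rewrite En. assert (K := sinh_2h_small). unfold s in K. lra. }
  assert (Hm : n < mm Th h) by (apply sinh_lt_inv; lra).
  apply (psi_le Th HTh); [exact Hh|lra|exact Hm|].
  apply J_nonpos; [exact Hh|lra|exact Hm|]. intros x Hx.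
  assert (I := num_sub_den (mm Th h) h n x).
  assert (Ec := cosh_sqr n). rewrite En in Ec. assert (Hc := cosh_ge_1 n).
  assert (Hcn : cosh n <= 2) by nra.
  assert (K1 := sinh_2h_small). assert (K2 := cosh_2h_small).
  assert (T : / 2 <= sinh (n - 2 * h)).
  { rewrite sinh_sub, En. unfold s in K1. nra. }
  assert (B1 : sinh (n - 2 * h) <= sinh (n + x - h)) by (apply sinh_le; lra).
  assert (B2 : 1 <= sinh (n + (h + x) / 2)) by (rewrite <- En; apply sinh_le; lra).
  assert (P3 : 0 <= sinh (n + x + h)) by (apply sinh_nonneg; lra).
  assert (P4 : 0 <= sinh (n - (h - x) / 2)) by (apply sinh_nonneg; lra).
  assert (Q1 : / 2 * 1 <= sinh (n + x - h) * sinh (n + (h + x) / 2)) by (apply Rmult_le_compat; lra).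
  assert (Q2 := Rmult_le_pos _ _ P3 P4).
  assert (F := sinh_half_h).
  assert (G : cosh (n + x / 2) <= cosh (n + 2 * h)) by (apply cosh_le; lra).
  assert (G' : cosh (n + 2 * h) <= 4) by (rewrite cosh_add, En; unfold s in K1; nra).
  assert (G1 := cosh_ge_1 (n + x / 2)).
  assert (F1 : 2 * cosh (n + x / 2) * sinh (h / 2) <= 8 * s) by (apply Rmult_le_compat; unfold s in *; lra).
  assert (F2 : sinh (mm Th h) * (2 * cosh (n + x / 2) * sinh (h / 2)) <= 3.01 * (8 * s)).
  { apply Rmult_le_compat; try lra. apply Rmult_le_pos; unfold s in *; lra. }
  unfold s in F2. lra.
Qed.

Lemma upP_small : upP Th h < 0.
Proof.
  assert (Hh := h_small_pos). destruct (q_order Th HTh h Hh) as (O1 & O2).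
  destruct (psi_spec Th HTh h Hh) as (B & _).
  assert (C2 := q2_le_half_sum Th HTh h Hh). assert (D2 := q2_lt_half_sum Th h Hh).
  assert (U := upper_period_le _ _ _ _ (proj1 O1) (proj2 O1) O2 C2). cbv beta in U.
  fold (upP Th h) in U.
  eapply Rle_lt_trans; [exact U|].
  assert (PL := psi_lower). assert (PU := psi_upper). assert (M := sinh_mm_small).
  assert (E21 := q2_sub_q1 Th h). assert (E30 := q3_sub_q0 Th HTh h).
  assert (H1 := cosh_h_small). assert (H2 := cosh_ge_1 h).
  assert (N1 := cosh_ge_1 (psi Th h - h)). assert (N0 := cosh_ge_1 (mm Th h - h)).
  rewrite Es in E21, D2.
  assert (X1 : half_sum (q0 Th h) (q1 Th h) (q2 Th h) (q3 Th h) - q2 Th h <= 3.01 * s)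
    by (unfold s in *; lra).
  assert (N2 : 1 <= q2 Th h) by apply cosh_ge_1.
  (* q2 - q1 = 2 sinh psi sinh h is at least 2 * 10^-16 and q2 - q0 at least 2; the root of the
     product is at least 2 * 10^-8. *)
  assert (X2 : / sqrt ((q2 Th h - q0 Th h) * (q2 Th h - q1 Th h)) <= 50000000).
  { rewrite <- (Rinv_inv 50000000). apply Rinv_le_contravar; [lra|].
    rewrite <- (sqrt_square (/ 50000000)) by lra. apply sqrt_le_1_alt.
    apply Rle_trans with (2 * (2 / 10000000000000000)); [lra|].
    apply Rmult_le_compat; try lra; unfold q0, s in *; lra. }
  assert (Cp : cosh (psi Th h) <= 1.42).
  { assert (Ec := cosh_sqr (psi Th h)). assert (Hc := cosh_ge_1 (psi Th h)). nra. }
  assert (Y2 : q2 Th h <= 1.5).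
  { unfold q2. rewrite cosh_add, Es. unfold s.
    assert (cosh (psi Th h) * cosh h <= 1.42 * 1.001).
    { assert (Hc := cosh_ge_1 (psi Th h)). apply Rmult_le_compat; lra. } lra. }
  assert (Y3 : 2 <= q3 Th h <= 3.1).
  { unfold q3. rewrite cosh_add, Es, cosh_mm by exact HTh. unfold s. split; nra. }
  assert (X3 : / 4 <= / sqrt ((q3 Th h - q0 Th h) * (q3 Th h - q1 Th h))).
  { apply Rinv_le_contravar; [apply sqrt_lt_R0, Rmult_lt_0_compat; lra|].
    rewrite <- (sqrt_square 4) by lra. apply sqrt_le_1_alt.
    apply Rle_trans with (6.1 * 2.1); [|lra].
    apply Rmult_le_compat; try lra; [|unfold q1; lra]. rewrite E30. nra. }
  set (g2' := / sqrt ((q2 Th h - q0 Th h) * (q2 Th h - q1 Th h))) in *.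
  set (g3' := / sqrt ((q3 Th h - q0 Th h) * (q3 Th h - q1 Th h))) in *.
  assert (G2 : 0 < g2') by (apply Rinv_0_lt_compat, sqrt_lt_R0, Rmult_lt_0_compat; lra).
  assert (Z1 : (half_sum (q0 Th h) (q1 Th h) (q2 Th h) (q3 Th h) - q2 Th h) * g2' <= 3.01 * s * 50000000)
    by (apply Rmult_le_compat; lra).
  assert (Z2 : / 4 * / 4 <= (q3 Th h - q2 Th h) / 2 * g3') by (apply Rmult_le_compat; lra).
  unfold s in Z1. assert (Hpi := PI_RGT_0). nra.
Qed.
End SmallParameter.

Theorem period_parameters Th : 2 < Th < 3 ->
  exists h, 0 < h /\ exists k : Z, (1 <= k)%Z /\ IZR k * upP Th h + loP Th h = 0.
Proof.
  intros HTh. set (hs := arcsinh (/ 10000000000)).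
  assert (Es : sinh hs = / 10000000000) by apply sinh_arcsinh.
  assert (Ps : 0 < hs) by (apply sinh_lt_inv; rewrite sinh_0, Es; lra).
  assert (U := upP_small Th HTh hs Es). assert (L := loP_pos Th HTh hs Ps).
  (* k is fixed by the left end alone: it exceeds both 1 and loP / (- upP) there, so k upP + loP < 0
     at hs. The right end hl is then chosen in terms of k. *)
  set (k := Rdefinitions.up (1 + loP Th hs / - upP Th hs)).
  assert (Hk : 1 + loP Th hs / - upP Th hs < IZR k) by apply archimed.
  assert (Q : 0 < loP Th hs / - upP Th hs) by (apply Rdiv_lt_0_compat; lra).
  assert (N : IZR k * upP Th hs + loP Th hs < 0).
  { assert (loP Th hs / - upP Th hs * - upP Th hs = loP Th hs) by (field; lra). nra. }
  set (hl := arcsinh (IZR k + 2)). assert (El : sinh hl = IZR k + 2) by apply sinh_arcsinh.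
  assert (Lt : hs < hl) by (apply sinh_lt_inv; lra).
  assert (G := periods_large Th HTh hl (IZR k) ltac:(lra) El ltac:(lra)).
  destruct (IVT_interv (fun t => IZR k * upP Th t + loP Th t) hs hl) as (h & Hh & E).
  - intros t Ht. apply continuity_pt_filterlim.
    destruct (periods_continuous Th HTh t ltac:(lra)) as (C1 & C2).
    change (continuous (fun t => IZR k * upP Th t + loP Th t) t). cts.
  - exact Lt.
  - exact N.
  - exact G.
  - exists h. split; [lra|]. exists k. split; [|exact E]. apply le_IZR. lra.
Qed.

(** * From boundary values to single-valuedness *)

Lemma Qp_cons_R (p : R) (ps : list R) x r : Qp ps (RtoC x) = RtoC r ->
  Qp (p :: ps) (RtoC x) = RtoC ((x - p) * r).
Proof. intros E. simpl. now rewrite E, <- RtoC_minus, <- RtoC_mult. Qed.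

Section Periods.
Context (l l1 l2 a : R).
Context (Hl : 0 < l) (Hla : l < a) (Ha1 : a < 1) (Hl1 : 1 < l1) (Hl2 : l1 < l2).
Context (Hrel : (a - l) * (a + 1) * (a - l1) * (a + l2) + (a + l) * (a - 1) * (a + l1) * (a - l2) = 0).

(** a^2 and [bsq] are the roots of x^2 - alpha x + l l1 l2 and [bsq] is the larger, so the inner
    square root is bsq - a^2 and a is the end prescribed in the definition of the surface. *)
Lemma a_end_eq : a_end l l1 l2 = a.
Proof.
  assert (B := bsq_gt l l1 l2 a Hl Hla Ha1 Hl1 Hl2 Hrel).
  assert (Q0 := quartic_factor l l1 l2 a Hl Hla Hrel 0).
  assert (Q1 := quartic_factor l l1 l2 a Hl Hla Hrel 1).
  set (b := bsq l l1 l2 a) in *.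
  assert (Ea : alpha l l1 l2 = a ^ 2 + b) by (unfold alpha; lra).
  assert (Ep : l * l1 * l2 = a ^ 2 * b) by lra.
  unfold a_end. rewrite Ea.
  replace ((a ^ 2 + b) ^ 2 - 4 * l * l1 * l2) with ((b - a ^ 2) * (b - a ^ 2))
    by (replace (4 * l * l1 * l2) with (4 * (l * l1 * l2)) by ring; rewrite Ep; ring).
  rewrite sqrt_square by nra.
  replace ((a ^ 2 + b - (b - a ^ 2)) / 2) with (a * a) by field.
  apply sqrt_square. lra.
Qed.

(** If Kc vanished, [cc_identity] would make both the sum and the difference of the two coefficients
    in its definition zero, but the second coefficient is positive. *)
Lemma Kc_neq0 : Kc l l1 l2 a <> 0.
Proof.
  intros Z. assert (E := cc_identity l l1 l2 a Hl Hla Ha1 Hl1 Hl2 Hrel). rewrite Z in E.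
  unfold Kc in Z.
  assert (P : 0 < (l * l2 - l * l1 - l * l1 * l2 + l1 * l2) / a ^ 2).
  { apply Rdiv_lt_0_compat; [|apply pow_lt; lra].
    replace (l * l2 - l * l1 - l * l1 * l2 + l1 * l2) with (l * (l2 - l1) + (1 - l) * (l1 * l2)) by ring.
    assert (0 < l * (l2 - l1)) by (apply Rmult_lt_0_compat; lra).
    assert (0 < l1 * l2) by (apply Rmult_lt_0_compat; lra).
    assert (0 < (1 - l) * (l1 * l2)) by (apply Rmult_lt_0_compat; lra). lra. }
  lra.
Qed.

Lemma mu1_neq0 : mu1 l l1 l2 a <> 0.
Proof.
  assert (K := Kc_neq0). assert (P := kap_pos l l1 l2 a Hl Hla Ha1 Hl1 Hl2).
  unfold mu1. intros Z.
  assert (Z' : kap l l1 l2 a * Kc l l1 l2 a = 0).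
  { replace (kap l l1 l2 a * Kc l l1 l2 a) with (- (- kap l l1 l2 a * Kc l l1 l2 a / (4 * a ^ 2) * (4 * a ^ 2))) by (field; lra).
    rewrite Z. ring. }
  destruct (Rmult_integral _ _ Z'); [lra|contradiction].
Qed.

Notation p0 := (pq a l).
Notation p1 := (pq a l2).
Notation p2 := (pq a l1).
Notation p3 := (pq a 1).
Notation X1 := (Xreal Ci (ps4 l l1 l2 a) (mu1 l l1 l2 a) (cc l l1 l2 a)).
Notation X2 := (Xreal (RtoC 1) (ps6 l l1 l2 a) (mu2 l l1 l2 a) (beta l l1 l2 a)).

Lemma ps4_nonneg x : 0 <= (x - p0) * ((x - p1) * ((x - p2) * (x - p3))) ->
  x <= p0 \/ p1 <= x <= p2 \/ p3 <= x.
Proof.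
  destruct (pq_order l l1 l2 a Hl Hla Ha1 Hl1 Hl2) as (O0 & O1 & O2 & O3). intros H.
  destruct (Rle_lt_dec x p0) as [|A0]; [now left|]. right.
  destruct (Rle_lt_dec p3 x) as [|A3]; [now right|]. left.
  destruct (Rle_lt_dec p1 x) as [B1|B1]; [destruct (Rle_lt_dec x p2) as [|B2]; [now split|]|].
  - assert (0 < (x - p0) * ((x - p1) * ((x - p2) * (p3 - x)))) by (repeat apply Rmult_lt_0_compat; lra). lra.
  - assert (0 < (x - p0) * ((p1 - x) * ((p2 - x) * (p3 - x)))) by (repeat apply Rmult_lt_0_compat; lra). lra.
Qed.

Lemma ps6_nonpos x : (x - -1) * ((x - 1) * ((x - p0) * ((x - p1) * ((x - p2) * (x - p3))))) <= 0 ->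
  p0 <= x <= -1 \/ 1 <= x <= p1 \/ p2 <= x <= p3.
Proof.
  destruct (pq_order l l1 l2 a Hl Hla Ha1 Hl1 Hl2) as (O0 & O1 & O2 & O3). intros H.
  destruct (Rlt_le_dec x p0) as [A0|A0].
  { assert (0 < (-1 - x) * ((1 - x) * ((p0 - x) * ((p1 - x) * ((p2 - x) * (p3 - x))))))
      by (repeat apply Rmult_lt_0_compat; lra). lra. }
  destruct (Rle_lt_dec x (-1)) as [A1|A1]; [left; lra|].
  destruct (Rlt_le_dec x 1) as [A2|A2].
  { assert (0 < (x - -1) * ((1 - x) * ((x - p0) * ((p1 - x) * ((p2 - x) * (p3 - x))))))
      by (repeat apply Rmult_lt_0_compat; lra). lra. }
  destruct (Rle_lt_dec x p1) as [A3|A3]; [right; left; lra|].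
  destruct (Rlt_le_dec x p2) as [A4|A4].
  { assert (0 < (x - -1) * ((x - 1) * ((x - p0) * ((x - p1) * ((p2 - x) * (p3 - x))))))
      by (repeat apply Rmult_lt_0_compat; lra). lra. }
  destruct (Rle_lt_dec x p3) as [A5|A5]; [right; right; lra|].
  assert (0 < (x - -1) * ((x - 1) * ((x - p0) * ((x - p1) * ((x - p2) * (x - p3))))))
    by (repeat apply Rmult_lt_0_compat; lra). lra.
Qed.

Context (k : Z) (Hk : (1 <= k)%Z).
Context (HP : IZR k * upper_period p0 p1 p2 p3 + lower_period p0 p1 p2 p3 = 0).
Context (HP' : 0 < lower_period p0 p1 p2 p3).
Context (HB : X2 p2 = X2 p1).

(** With k P + P' = 0 this scale sends X1 - X1(p1) to k PI below p0, to 0 on [p1, p2] and to - PI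
    above p3. *)
Let om1 : R := IZR k * PI / (mu1 l l1 l2 a * lower_period p0 p1 p2 p3).

Lemma IZR_k_pos : 1 <= IZR k.
Proof. now apply IZR_le. Qed.

Lemma first_period x : -1 * Re (Qp (ps4 l l1 l2 a) (RtoC x)) <= 0 ->
  exists j : Z, om1 * (X1 x - X1 p1) = IZR j * PI.
Proof.
  destruct (pq_order l l1 l2 a Hl Hla Ha1 Hl1 Hl2) as (O0 & O1 & O2 & O3).
  assert (ND := NoDup_ps4 l l1 l2 a Hl Hla Ha1 Hl1 Hl2). assert (Kp := IZR_k_pos). assert (M := mu1_neq0).
  assert (Ec : cc l l1 l2 a = half_sum p0 p1 p2 p3) by (unfold cc, half_sum; reflexivity).
  assert (Eq : Qp (ps4 l l1 l2 a) (RtoC x) = RtoC ((x - p0) * ((x - p1) * ((x - p2) * (x - p3))))).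
  { repeat apply Qp_cons_R. rewrite <- (Rmult_1_r (x - p3)). now apply Qp_cons_R. }
  rewrite Eq. change (Re (RtoC ?r)) with r. intros H.
  destruct (ps4_nonneg x ltac:(lra)) as [C|[C|C]].
  - exists k. assert (E1 := Xreal1_below p0 p1 p2 p3 (mu1 l l1 l2 a) (cc l l1 l2 a) ltac:(lra) O2 O3 ND x C).
    assert (E2 := Xreal1_lower p0 p1 p2 p3 (mu1 l l1 l2 a) (cc l l1 l2 a) ltac:(lra) O2 O3 ND Ec).
    fold (ps4 l l1 l2 a) in E1, E2.
    replace (X1 x - X1 p1) with (mu1 l l1 l2 a * lower_period p0 p1 p2 p3) by lra.
    unfold om1. field. split; [lra|exact M].
  - exists 0%Z. assert (E1 := Xreal1_middle p0 p1 p2 p3 (mu1 l l1 l2 a) (cc l l1 l2 a) ltac:(lra) O3 ND x C).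
    fold (ps4 l l1 l2 a) in E1. rewrite E1. ring.
  - exists (-1)%Z. assert (E1 := Xreal1_above p0 p1 p2 p3 (mu1 l l1 l2 a) (cc l l1 l2 a) ltac:(lra) O2 O3 ND x C).
    assert (E2 := Xreal1_upper p0 p1 p2 p3 (mu1 l l1 l2 a) (cc l l1 l2 a) ltac:(lra) O2 O3 ND Ec).
    assert (E3 := Xreal1_middle p0 p1 p2 p3 (mu1 l l1 l2 a) (cc l l1 l2 a) ltac:(lra) O3 ND p2 ltac:(lra)).
    fold (ps4 l l1 l2 a) in E1, E2, E3.
    replace (X1 x - X1 p1) with (mu1 l l1 l2 a * upper_period p0 p1 p2 p3) by lra.
    replace (upper_period p0 p1 p2 p3) with (- (lower_period p0 p1 p2 p3) / IZR k).
    + unfold om1. field. repeat split; [lra|lra|exact M].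
    + apply Rmult_eq_reg_l with (IZR k); [|lra]. field_simplify; lra.
Qed.

(** Once X2 takes the same value at p1 and p2, only the difference with the value at p0 has to be
    scaled into PI Z; if this difference is 0 as well, om2 = 1 is taken. *)
Lemma second_period : exists om2, om2 <> 0 /\
  forall x, 1 * Re (Qp (ps6 l l1 l2 a) (RtoC x)) <= 0 ->
  exists j : Z, om2 * (X2 x - X2 p1) = IZR j * PI.
Proof.
  destruct (pq_order l l1 l2 a Hl Hla Ha1 Hl1 Hl2) as (O0 & O1 & O2 & O3).
  assert (ND := NoDup_ps6 l l1 l2 a Hl Hla Ha1 Hl1 Hl2). assert (Hpi := PI_RGT_0).
  assert (V : exists om2, om2 <> 0 /\ exists j : Z, om2 * (X2 p0 - X2 p1) = IZR j * PI).
  { destruct (Req_dec (X2 p0 - X2 p1) 0) as [Z|N].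
    - exists 1. split; [lra|]. exists 0%Z. rewrite Z. ring.
    - exists (PI / (X2 p0 - X2 p1)). split.
      + apply Rmult_integral_contrapositive_currified; [lra|now apply Rinv_neq_0_compat].
      + exists 1%Z. field. exact N. }
  destruct V as (om2 & N2 & j & Ej). exists om2. split; [exact N2|]. intros x.
  assert (Eq : Qp (ps6 l l1 l2 a) (RtoC x) =
    RtoC ((x - -1) * ((x - 1) * ((x - p0) * ((x - p1) * ((x - p2) * (x - p3))))))).
  { repeat apply Qp_cons_R. rewrite <- (Rmult_1_r (x - p3)). now apply Qp_cons_R. }
  rewrite Eq. change (Re (RtoC ?r)) with r. intros H.
  destruct (ps6_nonpos x ltac:(lra)) as [C|[C|C]].
  - exists j. rewrite <- Ej. do 2 f_equal.
    exact (Xreal2_low p0 p1 p2 p3 (mu2 l l1 l2 a) (beta l l1 l2 a) O1 O2 O3 ND x C).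
  - exists 0%Z.
    assert (E := Xreal2_mid p0 p1 p2 p3 (mu2 l l1 l2 a) (beta l l1 l2 a) O0 O2 O3 ND x C).
    fold (ps4 l l1 l2 a) (ps6 l l1 l2 a) in E. rewrite E. ring.
  - exists 0%Z.
    assert (E := Xreal2_high p0 p1 p2 p3 (mu2 l l1 l2 a) (beta l l1 l2 a) O0 O1 O2 ND x C).
    fold (ps4 l l1 l2 a) (ps6 l l1 l2 a) in E. rewrite E, HB. ring.
Qed.

Lemma single_valued_on_rectangular_torus :
  exists Lambda, rectangular_lattice Lambda /\ forall q, X_single_valued l l1 l2 Lambda q.
Proof.
  assert (Kp := IZR_k_pos). assert (M := mu1_neq0). assert (Hpi := PI_RGT_0).
  destruct second_period as (om2 & N2 & Per2). assert (Per1 := first_period).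
  assert (N1 : om1 <> 0).
  { unfold om1. apply Rmult_integral_contrapositive_currified.
    - apply Rmult_integral_contrapositive_currified; lra.
    - apply Rinv_neq_0_compat, Rmult_integral_contrapositive_currified; [exact M|lra]. }
  eexists. split; cycle 1.
  - intros q. assert (S := single_valued l l1 l2). rewrite a_end_eq in S.
    exact (S Hl Hla Ha1 Hl1 Hl2 Hrel om1 (X1 p1) om2 (X2 p1) Per1 Per2 q N1 N2).
  - assert (D : forall r, r <> 0 -> 2 * PI / r <> 0).
    { intros r Hr. apply Rmult_integral_contrapositive_currified; [lra|now apply Rinv_neq_0_compat]. }
    exists (2 * PI / om1, 0), (0, 2 * PI / om2). split; [|split; [|split]].
    + intros E. apply (f_equal fst) in E. now apply (D om1 N1).
    + intros E. apply (f_equal snd) in E. now apply (D om2 N2).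
    + simpl. ring.
    + intros x. simpl. reflexivity.
Qed.
End Periods.

(** * The parameters in exponential form *)

(* With [H = exp h], [N = exp n], [M = exp m]: a = tanh ((m + h) / 2), l = a tanh ((m - h) / 2),
   l1 = a coth ((n + h) / 2), l2 = a coth ((n - h) / 2). *)
Section Exponentials.
Context (H N M : R) (HH : 1 < H) (HN : H < N) (HM : N < M).

Let a := (M * H - 1) / (M * H + 1).
Let l := a * ((M - H) / (M + H)).
Let l1 := a * ((N * H + 1) / (N * H - 1)).
Let l2 := a * ((N + H) / (N - H)).

Lemma exp_positivity : 0 < M * H - 1 /\ 0 < N * H - 1 /\ 0 < M * H + 1 /\ 0 < N * H + 1.
Proof. repeat split; nra. Qed.

Lemma parameters_order : 0 < l /\ l < a /\ a < 1 /\ 1 < l1 /\ l1 < l2.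
Proof.
  destruct exp_positivity as (P1 & P2 & P3 & P4).
  assert (Pa : 0 < a) by (unfold a; apply Rdiv_lt_0_compat; lra).
  assert (Q1 : 0 < (M - H) / (M + H)) by (apply Rdiv_lt_0_compat; lra).
  assert (Q2 : (M - H) / (M + H) < 1).
  { apply Rmult_lt_reg_r with (M + H); [lra|]. unfold Rdiv. rewrite Rmult_assoc, Rinv_l by lra. lra. }
  split; [unfold l; now apply Rmult_lt_0_compat|].
  split; [unfold l; nra|]. split; [|split].
  - unfold a. apply Rmult_lt_reg_r with (M * H + 1); [lra|]. unfold Rdiv. rewrite Rmult_assoc, Rinv_l by lra. lra.
  - unfold l1, a. apply Rmult_lt_reg_r with ((M * H + 1) * (N * H - 1)); [now apply Rmult_lt_0_compat|].
    replace ((M * H - 1) / (M * H + 1) * ((N * H + 1) / (N * H - 1)) * ((M * H + 1) * (N * H - 1)))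
      with ((M * H - 1) * (N * H + 1)) by (field; lra).
    assert (0 < (M - N) * H) by (apply Rmult_lt_0_compat; lra). nra.
  - unfold l1, l2. apply Rmult_lt_compat_l; [exact Pa|].
    apply Rmult_lt_reg_r with ((N * H - 1) * (N - H)); [apply Rmult_lt_0_compat; lra|].
    replace ((N * H + 1) / (N * H - 1) * ((N * H - 1) * (N - H))) with ((N * H + 1) * (N - H)) by (field; lra).
    replace ((N + H) / (N - H) * ((N * H - 1) * (N - H))) with ((N + H) * (N * H - 1)) by (field; lra).
    assert (0 < N * (H * H - 1)) by (apply Rmult_lt_0_compat; nra). nra.
Qed.

(** From (a - l)/(a + l) = H / M, (l1 - a)/(l1 + a) = 1 / (N H), (1 - a)/(1 + a) = 1 / (M H) and (l2
    - a)/(l2 + a) = H / N, the relation reduces to (H / M) / (N H) = (H / N) / (M H), where both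
    sides are 1 / (M N). *)
Lemma parameters_relation :
  (a - l) * (a + 1) * (a - l1) * (a + l2) + (a + l) * (a - 1) * (a + l1) * (a - l2) = 0.
Proof.
  destruct exp_positivity as (P1 & P2 & P3 & P4).
  unfold l, l1, l2, a. field. lra.
Qed.

(** The map q -> (q^2 + a^2) / (q^2 - a^2) sends a tanh (t / 2) to - cosh t and a coth (t / 2) to
    cosh t; note that 1 = a coth ((m + h) / 2). *)
Lemma pq_values :
  pq a l = - ((M / H + H / M) / 2) /\ pq a l2 = (N / H + H / N) / 2 /\
  pq a l1 = (N * H + / (N * H)) / 2 /\ pq a 1 = (M * H + / (M * H)) / 2.
Proof.
  destruct exp_positivity as (P1 & P2 & P3 & P4).
  assert (Pa : 0 < a) by (unfold a; apply Rdiv_lt_0_compat; lra).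
  assert (E : forall t s, s * s - t * t <> 0 -> s <> 0 ->
    pq a (a * (t / s)) = (t * t + s * s) / (t * t - s * s)).
  { intros t s Hts Hs. unfold pq.
    assert (F : (a * t) ^ 2 - (a * s) ^ 2 <> 0).
    { replace ((a * t) ^ 2 - (a * s) ^ 2) with (- (a * a) * (s * s - t * t)) by ring.
      apply Rmult_integral_contrapositive_currified; nra. }
    field. repeat split; lra. }
  split; [|split; [|split]].
  - unfold l. rewrite E by nra. field. repeat split; nra.
  - unfold l2. rewrite E by nra. field. repeat split; nra.
  - unfold l1. rewrite E by nra. field. repeat split; nra.
  - unfold pq, a. field. repeat split; nra.
Qed.

(** In hyperbolic terms, k0 beta = cosh n sinh m - sinh h cosh h with k0 = sinh m cosh h - cosh n
    sinh h: the position of the zero of phi_2 that lets its numerator split in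
    [num_den_identity]. *)
Lemma beta_value :
  ((M - / M) / 2 * ((H + / H) / 2) - (N + / N) / 2 * ((H - / H) / 2)) * beta l l1 l2 a =
  (N + / N) / 2 * ((M - / M) / 2) - (H - / H) / 2 * ((H + / H) / 2).
Proof.
  destruct exp_positivity as (P1 & P2 & P3 & P4).
  destruct parameters_order as (O1 & O2 & O3 & O4 & O5).
  assert (B := bsq_gt l l1 l2 a O1 O2 O3 O4 O5 parameters_relation).
  assert (Pa : a <> 0) by lra.
  set (p := (M - H) * (N * H + 1) * (N + H) * (M * H + 1) - (M * H - 1) * (M + H) * (N * H - 1) * (N - H)).
  set (d := (M + H) * (N * H - 1) * (N - H) * (M * H + 1)).
  assert (Hd : d <> 0).
  { unfold d. repeat apply Rmult_integral_contrapositive_currified; lra. }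
  assert (E : bsq l l1 l2 a - a ^ 2 = a * (p / d)).
  { unfold bsq, l, l1, l2. unfold p, d.
    transitivity (a * ((M - H) / (M + H) * ((N * H + 1) / (N * H - 1)) * ((N + H) / (N - H)) - a)).
    - field. repeat split; lra.
    - f_equal. unfold a. field. repeat split; lra. }
  assert (E' : bsq l l1 l2 a + a ^ 2 = a * (((M - H) * (N * H + 1) * (N + H) * (M * H + 1) + (M * H - 1) * (M + H) * (N * H - 1) * (N - H)) / d)).
  { unfold bsq, l, l1, l2. unfold d.
    transitivity (a * ((M - H) / (M + H) * ((N * H + 1) / (N * H - 1)) * ((N + H) / (N - H)) + a)).
    - field. repeat split; lra.
    - f_equal. unfold a. field. repeat split; lra. }
  assert (Hp : p <> 0).
  { intros Z. rewrite Z in E. assert (a ^ 2 < 1) by nra. unfold Rdiv in E. lra. }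
  unfold beta. rewrite E, E'.
  transitivity (((M - / M) / 2 * ((H + / H) / 2) - (N + / N) / 2 * ((H - / H) / 2)) *
    (((M - H) * (N * H + 1) * (N + H) * (M * H + 1) + (M * H - 1) * (M + H) * (N * H - 1) * (N - H)) / p)).
  - field. repeat split; first [assumption|lra].
  - unfold p in *. field. repeat split; first [assumption|lra].
Qed.
End Exponentials.

Lemma sinh_exp x : sinh x = (exp x - / exp x) / 2.
Proof. unfold sinh. now rewrite exp_Ropp. Qed.

Lemma cosh_exp x : cosh x = (exp x + / exp x) / 2.
Proof. unfold cosh. now rewrite exp_Ropp. Qed.

Lemma cosh_sub_exp x y : cosh (x - y) = (exp x / exp y + exp y / exp x) / 2.
Proof.
  assert (P := exp_pos x). assert (Q := exp_pos y).
  rewrite cosh_exp. unfold Rminus at 1 2. rewrite exp_plus, exp_Ropp. field. lra.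
Qed.

Lemma cosh_add_exp x y : cosh (x + y) = (exp x * exp y + / (exp x * exp y)) / 2.
Proof. now rewrite cosh_exp, exp_plus. Qed.

Theorem proposition3p1 :
  exists a1 a2 : R,
    (0 <= a1 /\ a1 < a2 /\ a2 <= 1) /\
    forall l : R, a1 < l < a2 ->
      exists l1 l2 : R,
        1 < l1 /\ l1 < l2 /\
        exists Lambda : R * R -> Prop,
          rectangular_lattice Lambda /\
          forall p0 : sphere * sphere,
            R_surf l l1 l2 p0 ->
            X_single_valued l l1 l2 Lambda p0.
Proof.
  (* l in (1/3, 1/2) means Theta in (2, 3), the range for which the estimates at small and at large
     h are carried out. *)
  exists (/ 3), (/ 2). split; [lra|]. intros l Hl.
  set (Th := (1 + l) / (1 - l)).
  assert (HTh : 2 < Th < 3).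
  { assert (E : Th * (1 - l) = 1 + l) by (unfold Th; field; lra). split; nra. }
  destruct (period_parameters Th HTh) as (h & Hh & k & Hk & HP).
  destruct (psi_spec Th HTh h Hh) as ((B1 & B2) & HJ).
  assert (Cm := cosh_mm Th HTh h). assert (HP' := loP_pos Th HTh h Hh).
  unfold upP, loP, q0, q1, q2, q3 in HP, HP'.
  set (n := psi Th h) in *. set (m := mm Th h) in *.
  assert (XH : 1 < exp h) by (rewrite <- exp_0; now apply exp_increasing).
  assert (XN : exp h < exp n) by now apply exp_increasing.
  assert (XM : exp n < exp m) by now apply exp_increasing.
  rewrite !cosh_exp in Cm.
  assert (O := parameters_order _ _ _ XH XN XM).
  assert (Rel := parameters_relation _ _ _ XH XN XM).
  assert (V := pq_values _ _ _ XH XN XM). assert (Vb := beta_value _ _ _ XH XN XM).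
  cbv zeta in O, Rel, V, Vb.
  rewrite <- cosh_sub_exp, <- cosh_sub_exp, <- cosh_add_exp, <- cosh_add_exp in V.
  rewrite <- !sinh_exp, <- !cosh_exp in Vb.
  set (a := (exp m * exp h - 1) / (exp m * exp h + 1)) in *.
  (* tanh((m + h)/2) tanh((m - h)/2) = (cosh m - cosh h) / (cosh m + cosh h), so cosh m = Theta cosh
     h gives back the prescribed l for every h. *)
  assert (El : a * ((exp m - exp h) / (exp m + exp h)) = l).
  { unfold a. set (H := exp h) in *. set (M := exp m) in *.
    assert (E : (M + / M) * (1 - l) = (1 + l) * (H + / H)).
    { replace (M + / M) with (2 * (Th * ((H + / H) / 2))) by lra. unfold Th. field. lra. }
    assert (E' : (M * M + 1) * H * (1 - l) = (1 + l) * ((H * H + 1) * M)).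
    { replace ((M * M + 1) * H * (1 - l)) with ((M + / M) * (1 - l) * (M * H)) by (field; lra).
      rewrite E. field. lra. }
    apply Rmult_eq_reg_r with ((M * H + 1) * (M + H)).
    - replace ((M * H - 1) / (M * H + 1) * ((M - H) / (M + H)) * ((M * H + 1) * (M + H)))
        with ((M * H - 1) * (M - H)) by (field; split; nra).
      lra.
    - apply Rmult_integral_contrapositive_currified; nra. }
  rewrite El in O, Rel, V, Vb.
  set (l1 := a * ((exp n * exp h + 1) / (exp n * exp h - 1))) in *.
  set (l2 := a * ((exp n + exp h) / (exp n - exp h))) in *.
  clearbody a l1 l2.
  destruct O as (O1 & O2 & O3 & O4 & O5). destruct V as (V0 & V1 & V2 & V3).
  exists l1, l2. split; [exact O4|]. split; [exact O5|].
  assert (ND := NoDup_ps6 l l1 l2 a O1 O2 O3 O4 O5). unfold ps6, ps4 in ND.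
  assert (HB := Xreal2_period m h n (mu2 l l1 l2 a) (beta l l1 l2 a) Hh B1 B2 Vb).
  rewrite V0, V1, V2, V3 in ND. specialize (HB ND). rewrite HJ in HB.
  assert (K0 := k0_pos m h n Hh B1 B2).
  rewrite <- V0, <- V1, <- V2, <- V3 in HB, HP, HP'.
  destruct (single_valued_on_rectangular_torus l l1 l2 a O1 O2 O3 O4 O5 Rel k Hk HP HP') as (Lambda & L1 & L2).
  (* J = 0 leaves k0 (X2 p2 - X2 p1) = 0, and k0 > 0. *)
  - fold (ps4 l l1 l2 a) (ps6 l l1 l2 a) in HB. nra.
  - exists Lambda. split; [exact L1|]. intros p0 _. apply L2.
Qed.
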